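(* Let $K$ and $L$ be distinct quadratic number fields such that $\zeta_K(1/2)\,\zeta_L(1/2) \neq 0$. Then $$\frac{\zeta_K'(1/2)}{\zeta_K(1/2)} \neq \frac{\zeta_L'(1/2)}{\zeta_L(1/2)}.$$
   Context: A number field is a finite extension of $\mathbb{Q}$ contained in $\mathbb{C}$; it is quadratic if its degree over $\mathbb{Q}$ is $2$. For a number field $K$, $\zeta_K(s)$ denotes the Dedekind zeta function of $K$, i.e. the meromorphic continuation to $\mathbb{C}$ (holomorphic except for a simple pole at $s=1$) of $\sum_{I \neq 0} N(I)^{-s}$, $\Re(s)>1$, the sum being over the nonzero ideals of the ring of integers of $K$. $\zeta_K'$ denotes its derivative in $s$. *)

(* Defs.v *)
(* The field of complex numbers is R[i] for R : realType. *)
From HB Require Import structures.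
From mathcomp Require Import all_boot all_order all_algebra all_field.
From mathcomp Require Import finmap complex.
From mathcomp Require Import all_classical all_reals all_analysis.
From mathcomp.analysis.showcase Require Import summability.

Set Implicit Arguments.
Unset Strict Implicit.
Unset Printing Implicit Defensive.

Import Order.TTheory GRing.Theory Num.Theory.
Import numFieldNormedType.Exports.

Local Open Scope classical_set_scope.
Local Open Scope ring_scope.
Local Open Scope complex_scope.

Section DedekindZeta.
Variable R : realType.
Local Notation C := R[i].

(* Number fields are sets of complex numbers, so that equality of fields is
   equality of subsets of C and not isomorphism. *)
Definition number_field_of_degree (n : nat) (K : set C) : Prop :=
  exists (F : fieldExtType rat) (f : {rmorphism F -> C}),
    range f = K /\ \dim {:F} = n.

Definition quadratic_number_field (K : set C) : Prop :=
  number_field_of_degree 2 K.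

Definition ring_of_integers (K : set C) : set C :=
  K `&` [set x | integralOver (intr : int -> C) x].

(* The ideals of ring_of_integers K, the unit ideal included: the library's
   idealr_closed is restricted to proper ideals. *)
Definition is_ideal (K I : set C) : Prop :=
  [/\ I `<=` ring_of_integers K,
      I 0,
      forall x y, I x -> I y -> I (x + y)
    & forall a x, ring_of_integers K a -> I x -> I (a * x)].

Definition nonzero_ideals (K : set C) : set (set C) :=
  [set I | is_ideal K I /\ I <> [set 0]].

(* The number of cosets of I; fset_set sends infinite sets to fset0, but
   nonzero ideals in number fields have finite index. *)
Definition ideal_norm (K I : set C) : nat :=
  #|` fset_set [set [set x + y | y in I] | x in ring_of_integers K] |.

Definition cexp (z : C) : C :=
  let: x +i* y := z in (expR x * cos y) +i* (expR x * sin y).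

(* n ^ s for n > 0 *)
Definition natpow (n : nat) (s : C) : C := cexp (s * (ln (n%:R : R))%:C).

(* C^o is C as a normed module over itself: derivable and derive1 are
   differentiability and derivative with respect to a complex variable. *)
Definition simple_pole (f : C^o -> C^o) (a : C^o) : Prop :=
  exists g : C^o -> C^o,
    [/\ \forall z \near a, derivable g z 1,
        g a != 0
      & \forall z \near a^', f z = g z / (z - a)].

(* The series is unordered: the partial sums over finite sets of nonzero ideals
   converge along the directed family of these finite sets. *)
Definition is_dedekind_zeta (K : set C) (f : C^o -> C^o) : Prop :=
  [/\ forall s, s != 1 -> derivable f s 1,
      simple_pole f 1
    & forall s, 1 < complex.Re s ->
        partial_sum (fun I : nonzero_ideals K =>
          natpow (ideal_norm K (val I)) (- s) : C^o) A @[A --> totally] --> f s].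

(* By the identity theorem is_dedekind_zeta determines f on C minus {1}, and by
   Hecke's theorem such an f exists for every number field K; the value at the
   pole 1 is arbitrary. *)
Definition dedekind_zeta (K : set C) : C^o -> C^o :=
  xget (fun=> 0) [set f | is_dedekind_zeta K f].

End DedekindZeta.

(* Main.v *)
(* Write K = Q(sqrt m) with m squarefree, let d be its discriminant and chi the real
   primitive character modulo q = |d|. Counting ideals gives
   zeta_K(s) = zeta(s) L(s, chi) for Re s > 1, and (1 - 2^(1-s)) zeta(s) is an
   alternating series converging for Re s > 0, so on (0, 1) the quotient of zeta_K
   by L(., chi) is a function of s alone, the same for every K.

   The functional equation reads L(1-s, chi) c(s) = tau kappa(s) L(s, chi), where
   kappa does not depend on chi, tau^2 = q, and c(s) is (2 pi / q)^(s-1) times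
   2 cos((1-s) pi/2) or 2 sin((1-s) pi/2) according to the parity of chi. It follows
   from evaluating the sums of chi(m) (1 - e^(2 pi i m / (q N)))^(s-1) over
   0 < m < q N in two ways as N tends to infinity.

   Hence zeta_K(1-s) zeta_L(s) c_K(s) tau_L is symmetric in K and L. If the
   logarithmic derivatives of zeta_K and zeta_L at 1/2 agree, then so do those of
   c_K and c_L, which are ln(2 pi / q) + pi/2 for even and ln(2 pi / q) - pi/2 for odd
   characters. So ln(q_L / q_K) is 0 or pi or -pi. By Gelfond's theorem, proved here
   with an auxiliary function vanishing at Gaussian integers, e^pi is irrational; thus
   q_K = q_L and the parities agree, so the discriminants and the fields are equal. *)

Require Import Defs.
From HB Require Import structures.
From mathcomp Require Import all_boot all_order all_algebra all_field.
From mathcomp Require Import finmap complex.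
From mathcomp Require Import all_classical all_reals all_analysis.
From mathcomp Require Import ring lra zify.

Set Implicit Arguments.
Unset Strict Implicit.
Unset Printing Implicit Defensive.

Import Order.TTheory GRing.Theory Num.Theory.
Import numFieldNormedType.Exports.
Import ComplexField.Normc.

Local Open Scope classical_set_scope.
Local Open Scope ring_scope.

(** * Complex differentiation and the maximum principle *)

(** The obstacle is to carry the factorization of zeta_K from Re s > 1 into the critical strip,
    where zeta_K is known only as a differentiable function. Hadamard's three circles around 3 do
    this: products of finite Dirichlet sums converge uniformly on the circle of radius 1, which lies
    in Re z >= 2, and stay bounded on the circle of radius 29/10, which lies in Re z >= 1/10; hence
    they converge at the points 3 - r in between. This is the origin of the constant 1/10. The
    maximum principle behind it comes from Goursat's theorem pulled back by the exponential, with
    primitives of real and imaginary parts in place of contour integrals.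

    The functional equation stays real and free of the Gamma function: kappa(s) appears as the
    growth constant of binomial coefficients. The point 1/2 matters because s and 1 - s meet there,
    so that the values of L'/L cancel and only elementary factors survive.

    For e^pi, interpolation is carried out on polynomials, with a weighted sum of coefficients as
    norm, and exponentials enter as limits of (1 + z/n)^n. *)

Section RealTools.
Variable R : realType.
Implicit Types f F : R -> R.

Lemma continuous_antiderivative f (a : R) : continuous f ->
  exists F, forall x, a < x -> is_derive x 1 F (f x).
Proof.
move=> cf.
exists (fun y => (\int[lebesgue_measure]_(t in `[a, y]) f t)%R) => x ax.
have xu : x < x + 1 by rewrite ltrDl.
have fi : (@lebesgue_measure R).-integrable `[a, x + 1] (EFin \o f).
  apply: continuous_compact_integrable; first exact: segment_compact.
  exact: continuous_subspaceT.
have [dF eF] := @continuous_FTC1_closed R f a x (x + 1) xu fi ax (cf x).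
by rewrite -eF derive1E; exact/derivableP.
Qed.

Lemma is_derive_continuous f F (a b : R) :
  (forall x, a <= x <= b -> is_derive x 1 F (f x)) ->
  {within `[a, b], continuous F}.
Proof.
move=> dF; apply: derivable_within_continuous => x.
by rewrite in_itv /= => /dF[].
Qed.

(** The mean value theorem applied to [F - G]. It takes the place of integral estimates: [F] and [G]
    act as primitives, and close integrands give close increments. *)
Lemma derive_dist_le F G f g (a b e : R) : a <= b ->
  (forall x, a <= x <= b -> is_derive x 1 F (f x)) ->
  (forall x, a <= x <= b -> is_derive x 1 G (g x)) ->
  (forall x, a <= x <= b -> `|f x - g x| <= e) ->
  `|(F b - F a) - (G b - G a)| <= e * (b - a).
Proof.
move=> ab dF dG fg.
have dH x : a <= x <= b -> is_derive x 1 (F - G) (f x - g x).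
  by move=> xab; have dFx := dF _ xab; have dGx := dG _ xab; exact: is_deriveB.
have [|c cab E] := @MVT_segment _ (F - G) (fun x => f x - g x) _ _ ab _ (is_derive_continuous dH).
  by move=> x; rewrite in_itv /= => /andP[? ?]; apply: dH; rewrite !ltW.
have -> : F b - F a - (G b - G a) = (F - G) b - (F - G) a.
  by rewrite !fctE opprD !opprK addrACA opprD opprK.
rewrite E normrM (@ger0_norm _ (b - a)) ?subr_ge0// ler_wpM2r ?subr_ge0//.
exact: fg.
Qed.

(** The relation depends on the stage, so the stage travels with the state in a dependent pair and a
    chosen successor is iterated. This drives the subdivision in Goursat's argument. *)
Lemma dependent_choice_nat (T : Type) (P : nat -> T -> Prop)
    (Q : nat -> T -> T -> Prop) (x0 : T) :
  P 0%N x0 -> (forall n x, P n x -> exists y, P n.+1 y /\ Q n x y) ->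
  exists u : nat -> T, [/\ u 0%N = x0, forall n, P n (u n)
    & forall n, Q n (u n) (u n.+1)].
Proof.
move=> P0 step.
pose S := {nx : nat * T | P nx.1 nx.2}.
have next (s : S) : {t : S | (sval t).1 = (sval s).1.+1 /\ Q (sval s).1 (sval s).2 (sval t).2}.
  case: s => -[n x] /= Px; apply: cid.
  have [y [Py Qy]] := step _ _ Px.
  by exists (exist _ (n.+1, y) Py).
pose s0 : S := exist _ (0%N, x0) P0.
pose s n := iter n (fun s => sval (next s)) s0.
have s1 n : (sval (s n)).1 = n.
  elim: n => // n IH; have [e _] := svalP (next (s n)).
  by rewrite [LHS]e IH.
exists (fun n => (sval (s n)).2); split => // n.
  by have := svalP (s n); rewrite s1.
have [_ q] := svalP (next (s n)); move: q.
by rewrite {1}s1.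
Qed.

(** Nested intervals: left ends increase, right ends decrease, and every left end lies below every
    right end, so the supremum of the left ends works. *)
Lemma bisection (w : R) (u : nat -> R) : 0 <= w ->
  (forall n, u n.+1 = u n \/ u n.+1 = u n + w / 2 ^+ n.+1) ->
  exists p, forall n, u n <= p <= u n + w / 2 ^+ n.
Proof.
move=> w0 hu.
have e2 n : w / 2 ^+ n = w / 2 ^+ n.+1 + w / 2 ^+ n.+1.
  have : (2 : R) ^+ n != 0 by rewrite expf_neq0.
  by move=> ?; rewrite exprS; field.
have p2 n : 0 <= w / 2 ^+ n by rewrite divr_ge0// exprn_ge0.
have nd : {homo u : m n / (m <= n)%N >-> m <= n}.
  apply: homo_leq => [x|? ? ?|n]; [exact: lexx|exact: le_trans|].
  by case: (hu n) => ->; rewrite ?lexx// lerDl.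
have ni : {homo (fun n => u n + w / 2 ^+ n) : m n / (m <= n)%N >-> n <= m}.
  apply: (@homo_leq _ _ (fun x y => y <= x)) => [x|y x z h1 h2|n].
  - exact: lexx.
  - exact: le_trans h2 h1.
  rewrite [in leRHS]e2 addrA; case: (hu n) => ->; last exact: lexx.
  by rewrite lerDl.
have ub m n : u m <= u n + w / 2 ^+ n.
  case: (leqP m n) => [mn|/ltnW nm].
    by apply: le_trans (nd _ _ mn) _; rewrite lerDl.
  by apply: le_trans (ni _ _ nm); rewrite lerDl.
have hs n : ubound (range u) (u n + w / 2 ^+ n) by move=> _ [m _ <-].
exists (sup (range u)) => n; apply/andP; split.
  by apply: ub_le_sup; [exists (u 0%N + w / 2 ^+ 0%N); exact: hs|exists n].
by apply: ge_sup; [exists (u 0%N); exists 0%N|exact: hs].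
Qed.

End RealTools.

Lemma derivable_littleo (K : numFieldType) (f : K^o -> K^o) (x : K) :
  derivable f x 1 -> forall e : K, 0 < e -> exists2 d : K, 0 < d &
    forall h : K, `|h| < d -> `|f (x + h) - f x - 'D_1 f x * h| <= e * `|h|.
Proof.
move=> df e e0.
have /cvgrPdist_le /(_ _ e0) : (fun h => h^-1 *: (f (h *: 1 + x) - f x)) @ 0^' --> 'D_1 f x.
  exact: df.
rewrite near_withinE near_nbhs => /nbhs_normP [d /= d0 hd].
exists d => // h hd'.
have [->|h0] := eqVneq h 0; first by rewrite addr0 subrr mulr0 subr0 normr0 mulr0.
have := hd h; rewrite /= sub0r normrN => /(_ hd' h0).
rewrite distrC => H.
rewrite [h *: 1]mulr1 [h + x]addrC in H.
have -> : f (x + h) - f x - 'D_1 f x * h = (h^-1 *: (f (x + h) - f x) - 'D_1 f x) * h.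
  by rewrite mulrBl [h^-1 *: _]mulrC divfK.
by rewrite normrM ler_wpM2r.
Qed.

Section ComplexTools.
Variable R : realType.
Local Notation C := R[i].
Implicit Types (z w h : C) (G H : C -> C).

Lemma normcE_norm z : `|z| = (normc z)%:C%C.
Proof. by case: z. Qed.

Lemma le_normcD z w : normc (z + w) <= normc z + normc w.
Proof. exact: complex.le_normcD. Qed.

Lemma normcN z : normc (- z) = normc z.
Proof. exact: complex.normcN. Qed.

Lemma normc_ge0 z : 0 <= normc z.
Proof. by case: z => a b; rewrite sqrtr_ge0. Qed.

Lemma normc_eq0 z : (normc z == 0) = (z == 0).
Proof.
apply/eqP/eqP => [|->]; [exact: eq0_normc|exact: normc0].
Qed.

Lemma normc_gt0 z : (0 < normc z) = (z != 0).
Proof. by rewrite lt_def normc_ge0 andbT normc_eq0. Qed.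

Lemma normcX z n : normc (z ^+ n) = normc z ^+ n.
Proof.
elim: n => [|n IH]; first by rewrite !expr0 normc1.
by rewrite !exprS normcM IH.
Qed.

Lemma normc_real (x : R) : normc x%:C%C = `|x|.
Proof. by rewrite /= expr0n /= addr0 sqrtr_sqr. Qed.

Lemma le_normc_Re z : `|complex.Re z| <= normc z.
Proof.
case: z => a b /=; rewrite -(sqrtr_sqr a) ler_wsqrtr// lerDl sqr_ge0//.
Qed.

Lemma le_normc_Im z : `|complex.Im z| <= normc z.
Proof.
case: z => a b /=; rewrite -(sqrtr_sqr b) ler_wsqrtr// lerDr sqr_ge0//.
Qed.

Lemma normc_le_ReIm z : normc z <= `|complex.Re z| + `|complex.Im z|.
Proof.
case: z => a b /=; rewrite -[leRHS]ger0_norm ?addr_ge0// -sqrtr_sqr ler_wsqrtr//.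
rewrite sqrrD !real_normK ?num_real// -addrA [_ *+ 2 + _]addrC addrA lerDl.
by rewrite mulrn_wge0// mulr_ge0.
Qed.

Lemma normc_sqr z : normc z ^+ 2 = complex.Re z ^+ 2 + complex.Im z ^+ 2.
Proof. by case: z => a b /=; rewrite sqr_sqrtr// addr_ge0// sqr_ge0. Qed.

Lemma normcBC z w : normc (z - w) = normc (w - z).
Proof. by rewrite -opprB normcN. Qed.

Lemma normc_distD z w h : normc (z - w) <= normc (z - h) + normc (h - w).
Proof. by apply: le_trans (le_normcD _ _); rewrite subrKA. Qed.

Lemma le_normcB z w : normc (z - w) <= normc z + normc w.
Proof. by apply: le_trans (le_normcD _ _) _; rewrite normcN. Qed.

Lemma normc_dist_ge z w : normc z - normc w <= normc (z - w).
Proof. by rewrite lerBlDr; apply: le_trans (le_normcD _ _); rewrite subrK. Qed.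

Lemma le_normc_sum I (r : seq I) (P : pred I) (F : I -> C) :
  normc (\sum_(i <- r | P i) F i) <= \sum_(i <- r | P i) normc (F i).
Proof.
elim/big_rec2: _ => [|i y x _ h]; first by rewrite normc0.
by apply: le_trans (le_normcD _ _) _; rewrite lerD2l.
Qed.

(** Complex differentiability through the real-valued modulus [normc], because the norm of [R[i]]
    takes its values in [R[i]], where the order is only partial. *)
Definition cdiff G z := exists d : C, forall e : R, 0 < e ->
  exists2 dl : R, 0 < dl & forall h, normc h < dl ->
    normc (G (z + h) - G z - d * h) <= e * normc h.

Lemma derivable_estimate (G : C^o -> C^o) (z : C) : derivable G z 1 -> forall e : R, 0 < e ->
  exists2 dl : R, 0 < dl & forall h : C, normc h < dl ->
    normc (G (z + h) - G z - 'D_1 G z * h) <= e * normc h.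
Proof.
move=> /derivable_littleo dG e e0.
have e0' : (0 : C) < e%:C%C by rewrite ltcR.
have [d d0 hd] := dG _ e0'.
move: d0 hd; rewrite ltcE; case: d => d1 d2 /= /andP[/eqP -> d1_gt0] hd.
exists d1 => // h hh.
have := hd h; rewrite !normcE_norm -rmorphM lecR => -> //.
by rewrite complexr0 ltcR.
Qed.

Lemma derivable_cdiff (G : C^o -> C^o) z : derivable G z 1 -> cdiff G z.
Proof. by move=> /derivable_estimate ?; exists ('D_1 G z). Qed.

Lemma cdiff_continuous G z : cdiff G z -> forall e : R, 0 < e ->
  exists2 dl : R, 0 < dl & forall h, normc h < dl -> normc (G (z + h) - G z) <= e.
Proof.
move=> [d hd] e e0; have [dl dl0 H] := hd 1 ltr01.
pose M := 1 + normc d.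
have M0 : 0 < M by rewrite ltr_pwDl// normc_ge0.
exists (Num.min dl (e / M)); first by rewrite lt_min dl0 divr_gt0.
move=> h; rewrite lt_min => /andP[/H h1 h2].
have -> : G (z + h) - G z = (G (z + h) - G z - d * h) + d * h by rewrite subrK.
apply: le_trans (le_normcD _ _) _.
apply: le_trans (lerD h1 (lexx _)) _.
by rewrite normcM -mulrDl mulrC -ler_pdivlMr// ltW.
Qed.

Lemma cdiff_cst (c : C) z : cdiff (fun=> c) z.
Proof.
exists 0 => e e0; exists 1 => // h _.
by rewrite mul0r subrr subr0 normc0 mulr_ge0 ?normc_ge0// ltW.
Qed.

Lemma cdiff_id z : cdiff id z.
Proof.
exists 1 => e e0; exists 1 => // h _.
have -> : id (z + h) - id z - 1 * h = 0 by rewrite /=; ring.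
by rewrite normc0 mulr_ge0 ?normc_ge0// ltW.
Qed.

Lemma cdiffD G H z : cdiff G z -> cdiff H z -> cdiff (fun x => G x + H x) z.
Proof.
move=> [d hd] [d' hd']; exists (d + d') => e e0.
have e20 : 0 < e / 2 by rewrite divr_gt0.
have [r r0 Hr] := hd _ e20; have [r' r0' Hr'] := hd' _ e20.
exists (Num.min r r'); first by rewrite lt_min r0.
move=> h; rewrite lt_min => /andP[/Hr h1 /Hr' h2].
have -> : G (z + h) + H (z + h) - (G z + H z) - (d + d') * h =
  (G (z + h) - G z - d * h) + (H (z + h) - H z - d' * h) by ring.
apply: le_trans (le_normcD _ _) _; apply: le_trans (lerD h1 h2) _.
by rewrite -mulrDl -splitr.
Qed.

Lemma cdiffM G H z : cdiff G z -> cdiff H z -> cdiff (fun x => G x * H x) z.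
Proof.
move=> cG; have := cG; move=> [d hd] [d' hd']; exists (d * H z + G z * d') => e e0.
pose M := normc (H z) + normc (G z) + 1 + normc d'.
have M0 : 0 < M.
  rewrite /M; move: (normc_ge0 (H z)) (normc_ge0 (G z)) (normc_ge0 d'); lra.
have eM : 0 < e / M by rewrite divr_gt0.
have m0 : 0 < Num.min 1 (e / M) by rewrite lt_min ltr01.
have [r r0 Hr] := hd _ eM; have [r' r0' Hr'] := hd' _ m0.
have [s s0 Hs] := cdiff_continuous cG eM.
exists (Num.min (Num.min r r') s); first by rewrite !lt_min r0 r0'.
move=> h; rewrite !lt_min => /andP[/andP[/Hr h1 /Hr' h2] /Hs h3].
have -> : G (z + h) * H (z + h) - G z * H z - (d * H z + G z * d') * h =
  (G (z + h) - G z - d * h) * H z + G z * (H (z + h) - H z - d' * h)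
  + (G (z + h) - G z) * ((H (z + h) - H z - d' * h) + d' * h) by ring.
have n0 := normc_ge0.
have h2a : normc (H (z + h) - H z - d' * h) <= (e / M) * normc h.
  by apply: le_trans h2 _; rewrite ler_wpM2r// ge_min lexx orbT.
have h2b : normc (H (z + h) - H z - d' * h) <= normc h.
  by apply: le_trans h2 _; rewrite -[leRHS]mul1r ler_wpM2r// ge_min lexx.
have h4 : normc (H (z + h) - H z - d' * h + d' * h) <= (1 + normc d') * normc h.
  by apply: le_trans (le_normcD _ _) _; rewrite normcM mulrDl mul1r lerD2r.
have -> : e * normc h = (e / M * normc h) * normc (H z)
  + normc (G z) * (e / M * normc h) + e / M * ((1 + normc d') * normc h).
  have : M != 0 by rewrite gt_eqF.
  rewrite /M => ?; by field.
apply: le_trans (le_normcD _ _) _; apply: lerD.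
  apply: le_trans (le_normcD _ _) _; rewrite !normcM; apply: lerD.
    by rewrite ler_wpM2r.
  by rewrite ler_wpM2l.
by rewrite normcM ler_pM.
Qed.

Lemma cdiff_comp G H z : cdiff G z -> cdiff H (G z) -> cdiff (fun x => H (G x)) z.
Proof.
move=> cG; have := cG; move=> [d hd] [d' hd']; exists (d' * d) => e e0.
have n0 := normc_ge0.
pose M := 1 + normc d.
have M0 : 0 < M by rewrite ltr_pwDl.
pose N := 1 + normc d'.
have N0 : 0 < N by rewrite ltr_pwDl.
have e1 : 0 < e / 2 / M by rewrite !divr_gt0.
have e2 : 0 < Num.min 1 (e / 2 / N) by rewrite lt_min ltr01 !divr_gt0.
have [r r0 Hr] := hd _ e2; have [r' r0' Hr'] := hd' _ e1.
have [s s0 Hs] := cdiff_continuous cG (divr_gt0 r0' (ltr0n _ 2)).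
exists (Num.min r s); first by rewrite !lt_min r0.
move=> h; rewrite !lt_min => /andP[/Hr h1 /Hs h2].
set k := G (z + h) - G z in h1 h2.
have kr : normc k < r' by apply: le_lt_trans h2 _; rewrite ltr_pdivrMr// mulr_natr mulr2n ltrDl.
have kh : normc k <= M * normc h.
  have -> : k = (k - d * h) + d * h by rewrite subrK.
  apply: le_trans (le_normcD _ _) _; rewrite normcM mulrDl lerD2r.
  by apply: le_trans h1 _; rewrite ler_wpM2r// ge_min lexx.
have ek : G z + k = G (z + h) by rewrite /k addrC subrK.
have h3 := Hr' _ kr; rewrite ek in h3.
have -> : H (G (z + h)) - H (G z) - d' * d * h =
  (H (G (z + h)) - H (G z) - d' * k) + d' * (k - d * h) by ring.
apply: le_trans (le_normcD _ _) _.
have -> : e * normc h = e / 2 / M * (M * normc h) + e / 2 * normc h.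
  have : M != 0 by rewrite gt_eqF.
  by move=> ?; field.
apply: lerD; first by apply: le_trans h3 _; rewrite ler_wpM2l// ltW.
rewrite normcM.
apply: le_trans (_ : N * (e / 2 / N * normc h) <= _); last first.
  have : N != 0 by rewrite gt_eqF.
  by move=> ?; rewrite le_eqVlt; apply/orP; left; apply/eqP; field.
apply: ler_pM => //; first by rewrite /N lerDr.
by apply: le_trans h1 _; rewrite ler_wpM2r// ge_min lexx orbT.
Qed.

Lemma cdiffN G z : cdiff G z -> cdiff (fun x => - G x) z.
Proof.
move=> cG; have := cdiffM (cdiff_cst (-1) z) cG.
by rewrite (_ : (fun x => -1 * G x) = fun x => - G x)//; apply/funext => x; rewrite mulN1r.
Qed.

Lemma cdiffB G H z : cdiff G z -> cdiff H z -> cdiff (fun x => G x - H x) z.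
Proof. by move=> cG cH; apply: cdiffD => //; exact: cdiffN. Qed.

Lemma cdiffX G z n : cdiff G z -> cdiff (fun x => G x ^+ n) z.
Proof.
move=> cG; elim: n => [|n IH]; first by under [fun=> _]eq_fun do rewrite expr0; exact: cdiff_cst.
by under [fun=> _]eq_fun do rewrite exprS; exact: cdiffM.
Qed.

Lemma cdiff_sum I (r : seq I) (F : I -> C -> C) z :
  (forall i, cdiff (F i) z) -> cdiff (fun x => \sum_(i <- r) F i x) z.
Proof.
move=> cF; elim: r => [|i r IH].
  by under [fun=> _]eq_fun do rewrite big_nil; exact: cdiff_cst.
by under [fun=> _]eq_fun do rewrite big_cons; exact: cdiffD.
Qed.

Lemma cexpD z w : cexp (z + w) = cexp z * cexp w.
Proof.
case: z w => a b [c d]; rewrite /cexp /=.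
by simpc; rewrite expRD cosD sinD; congr (_ +i* _)%C; ring.
Qed.

Lemma cexp0 : cexp (0 : C) = 1.
Proof. by rewrite /cexp /= expR0 cos0 sin0 mul1r mulr0. Qed.

Lemma normc_cexp z : normc (cexp z) = expR (complex.Re z).
Proof.
case: z => a b; rewrite /cexp /= !exprMn -mulrDr cos2Dsin2 mulr1 sqrtr_sqr.
by rewrite ger0_norm ?expR_ge0.
Qed.

Lemma cexp_littleo (e : R) : 0 < e ->
  exists2 dl : R, 0 < dl & forall h, normc h < dl ->
    normc (cexp h - 1 - h) <= e * normc h.
Proof.
move=> e0.
have real_approx (f : R -> R) (d : R) : is_derive (0 : R) 1 f d -> forall e1 : R, 0 < e1 ->
   exists2 dl : R, 0 < dl & forall h : R, `|h| < dl -> `|f h - f 0 - d * h| <= e1 * `|h|.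
  move=> [df <-] e1 e10; have [dl dl0 H] := derivable_littleo df e10.
  by exists dl => // h /H; rewrite add0r.
(* Real and imaginary part each cost at most 3 m |h|, so 6 m <= e suffices; [m <= 1] and |h| < m / 2
   keep [expR x] within [m] of 1. *)
pose m := Num.min 1 (e / 8).
have m0 : 0 < m by rewrite lt_min ltr01 divr_gt0.
have m1 : m <= 1 by rewrite ge_min lexx.
have me : m <= e / 8 by rewrite ge_min lexx orbT.
have dsin0 : is_derive (0 : R) 1 (@sin R) 1 by have := is_derive_sin (0 : R); rewrite cos0.
have dcos0 : is_derive (0 : R) 1 (@cos R) 0 by have := is_derive_cos (0 : R); rewrite sin0 oppr0.
have dexp0 : is_derive (0 : R) 1 (@expR R) 1 by have := is_derive_expR (0 : R); rewrite expR0.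
have [d1 d10 H1] := real_approx _ _ dexp0 _ m0.
have [d2 d20 H2] := real_approx _ _ dcos0 _ m0.
have [d3 d30 H3] := real_approx _ _ dsin0 _ m0.
exists (Num.min (Num.min d1 d2) (Num.min d3 (m / 2))).
  by rewrite !lt_min d10 d20 d30 divr_gt0.
move=> [x y]; rewrite !lt_min => /andP[/andP[n1 n2] /andP[n3 n4]].
have nx : `|x| <= normc (x +i* y)%C := le_normc_Re (x +i* y)%C.
have ny : `|y| <= normc (x +i* y)%C := le_normc_Im (x +i* y)%C.
set nh := normc _ in n1 n2 n3 n4 nx ny *.
have {}H1 := H1 x (le_lt_trans nx n1); have {}H2 := H2 y (le_lt_trans ny n2).
have {}H3 := H3 y (le_lt_trans ny n3).
rewrite expR0 mul1r in H1; rewrite cos0 mul0r subr0 in H2; rewrite sin0 mul1r subr0 in H3.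
apply: le_trans (normc_le_ReIm _) _; rewrite /=.
have ex1 : `|expR x - 1| <= m.
  have -> : expR x - 1 = (expR x - 1 - x) + x by rewrite subrK.
  apply: le_trans (ler_normD _ _) _; apply: le_trans (lerD H1 (lexx _)) _.
  have : m * `|x| <= `|x| by rewrite ler_piMl.
  by move: nx n4; lra.
have ex2 : `|expR x| <= 2.
  have -> : expR x = (expR x - 1) + 1 by rewrite subrK.
  by apply: le_trans (ler_normD _ _) _; rewrite normr1; lra.
have A : `|expR x * cos y - 1 - x| <= 3 * (m * nh).
  have -> : expR x * cos y - 1 - x = (expR x - 1 - x) + expR x * (cos y - 1) by ring.
  apply: le_trans (ler_normD _ _) _; rewrite normrM.
  have : `|expR x| * `|cos y - 1| <= 2 * (m * nh).
    by apply: ler_pM => //; apply: le_trans H2 _; rewrite ler_wpM2l// ltW.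
  have : m * `|x| <= m * nh by rewrite ler_wpM2l// ltW.
  by move: H1; lra.
have B : `|expR x * sin y - 0 - y| <= 3 * (m * nh).
  have -> : expR x * sin y - 0 - y = expR x * (sin y - y) + (expR x - 1) * y by ring.
  apply: le_trans (ler_normD _ _) _; rewrite !normrM.
  have : `|expR x| * `|sin y - y| <= 2 * (m * nh).
    by apply: ler_pM => //; apply: le_trans H3 _; rewrite ler_wpM2l// ltW.
  have : `|expR x - 1| * `|y| <= m * nh by rewrite ler_pM.
  by lra.
have : m * nh <= e / 8 * nh by rewrite ler_wpM2r// normc_ge0.
have : 0 <= e * nh by rewrite mulr_ge0 ?normc_ge0// ltW.
by move: A B; rewrite subr0; lra.
Qed.

Lemma cdiff_cexp z : cdiff (@cexp R) z.
Proof.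
suff [d1 Hd1] : cdiff (@cexp R) 0 /\ forall e : R, 0 < e ->
  exists2 dl : R, 0 < dl & forall h, normc h < dl ->
    normc (cexp h - 1 - h) <= e * normc h.
  exists (cexp z) => e e0.
  have e1 : 0 < e / normc (cexp z) by rewrite divr_gt0// normc_cexp expR_gt0.
  have [dl dl0 H] := Hd1 _ e1.
  exists dl => // h /H h1; rewrite cexpD.
  have -> : cexp z * cexp h - cexp z - cexp z * h = cexp z * (cexp h - 1 - h) by ring.
  rewrite normcM -ler_pdivlMl ?normc_cexp ?expR_gt0//.
  by apply: le_trans h1 _; rewrite normc_cexp mulrA [_ ^-1 * _]mulrC.
split; last exact: cexp_littleo.
by exists 1 => e /cexp_littleo[dl dl0 H]; exists dl => // h /H; rewrite add0r cexp0 mul1r.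
Qed.

End ComplexTools.

(** * Cauchy's theorem on rectangles by repeated quartering *)

Section Goursat.
Variable R : realType.
Local Notation C := R[i].
Variables (G : C -> C) (lx ly : R) (U V : R -> R -> R).
Hypothesis cG : forall z, cdiff G z.
Hypothesis dU : forall b y, ly < y -> is_derive y 1 (U b) (complex.Re (G (b +i* y)%C)).
Hypothesis dV : forall c x, lx < x -> is_derive x 1 (V c) (complex.Im (G (x +i* c)%C)).

(** The imaginary part of the integral of G dz around the rectangle with opposite corners (a, c) and
    (b, d): [U b] is a primitive of Re G on the vertical line at [b], [V c] one of Im G on the
    horizontal line at [c]. *)
Let Phi a b c d := (U b d - U b c) - (U a d - U a c) + (V c b - V c a) - (V d b - V d a).

Let is_derive_quad (k l q y : R) :
  is_derive y 1 (fun y => k * y + l * ((y - q) ^+ 2 / 2)) (k + l * (y - q)).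
Proof.
have -> : (fun y => k * y + l * ((y - q) ^+ 2 / 2)) =
   cst k * id + cst (l / 2) * ((id - cst q) * (id - cst q)).
  apply/funext => t.
  rewrite -[RHS]/(k * t + l / 2 * ((t - q) * (t - q))).
  by rewrite expr2 (mulrC _ 2^-1) (mulrA l).
have dz := is_deriveB (is_derive_id y 1) (is_derive_cst q y 1).
apply: is_derive_eq (is_deriveD (is_deriveM (is_derive_cst k y 1) (is_derive_id y 1))
  (is_deriveM (is_derive_cst (l / 2) y 1) (is_deriveM dz dz))) _.
rewrite /GRing.scale /= !(mulr0, add0r, addr0, mulr1, subr0, oppr0).
rewrite -[(id - cst q) y]/(y - q).
by move: (y - q) => z; field.
Qed.

(** The affine approximation of [G] at p + iq has exact primitives [U0], [V0] and contributes 0;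
    what remains is at most e (s + t) along a perimeter of length 2 (s + t). *)
Let Phi_small (p q e : R) : 0 < e -> exists2 d : R, 0 < d &
  forall a c s t, lx < a -> ly < c -> 0 <= s -> 0 <= t ->
    a <= p <= a + s -> c <= q <= c + t -> s + t < d ->
    `|Phi a (a + s) c (c + t)| <= 2 * e * (s + t) ^+ 2.
Proof.
move=> e0; have [D HD] := cG (p +i* q)%C.
have [d d0 Hd] := HD _ e0; exists d => // a c s t xa yc s0 t0 ap cq st.
set g := G (p +i* q)%C in Hd.
pose al := complex.Re D; pose be := complex.Im D.
pose U0 (b y : R) := (complex.Re g + al * (b - p)) * y + (- be) * ((y - q) ^+ 2 / 2).
pose V0 (c x : R) := (complex.Im g + al * (c - q)) * x + be * ((x - p) ^+ 2 / 2).
have est x y : a <= x <= a + s -> c <= y <= c + t ->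
    normc (G (x +i* y)%C - g - D * ((x - p) +i* (y - q))%C) <= e * (s + t).
  move=> /andP[ax xs] /andP[cy yt].
  have nn : normc ((x - p) +i* (y - q))%C <= s + t.
    apply: le_trans (normc_le_ReIm _) _ => /=.
    move: ap cq => /andP[? ?] /andP[? ?].
    by apply: lerD; rewrite ler_norml; apply/andP; split; lra.
  have := Hd _ (le_lt_trans nn st).
  have -> : (p +i* q)%C + ((x - p) +i* (y - q))%C = (x +i* y)%C.
    by simpc; rewrite [p + _]addrC [q + _]addrC !subrK.
  by move=> /le_trans; apply; rewrite ler_wpM2l// ltW.
have eU b y : `|complex.Re (G (b +i* y)%C) - (complex.Re g + al * (b - p) + (- be) * (y - q))|
     <= normc (G (b +i* y)%C - g - D * ((b - p) +i* (y - q))%C).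
  apply: le_trans (le_normc_Re _).
  rewrite /al /be; case: (G _) => ? ?; case: (D) => ? ?; case: (g) => ? ?; simpc => /=.
  by rewrite le_eqVlt; apply/orP; left; apply/eqP; congr (`|_|); ring.
have eV c' x : `|complex.Im (G (x +i* c')%C) - (complex.Im g + al * (c' - q) + be * (x - p))|
     <= normc (G (x +i* c')%C - g - D * ((x - p) +i* (c' - q))%C).
  apply: le_trans (le_normc_Im _).
  rewrite /al /be; case: (G _) => ? ?; case: (D) => ? ?; case: (g) => ? ?; simpc => /=.
  by rewrite le_eqVlt; apply/orP; left; apply/eqP; congr (`|_|); ring.
have as_ : a <= a + s by rewrite lerDl.
have ct_ : c <= c + t by rewrite lerDl.
have TU b : a <= b <= a + s -> `|(U b (c + t) - U b c) - (U0 b (c + t) - U0 b c)| <= e * (s + t) * t.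
  move=> hb; rewrite [X in _ <= _ * X](_ : t = c + t - c); last by ring.
  apply: (@derive_dist_le _ _ _ (fun y => complex.Re (G (b +i* y)%C))
    (fun y => complex.Re g + al * (b - p) + (- be) * (y - q))) => // y hy.
  - by apply: dU; case/andP: hy => h _; exact: lt_le_trans h.
  - exact: is_derive_quad.
  - exact: le_trans (eU _ _) (est _ _ hb hy).
have TV c' : c <= c' <= c + t -> `|(V c' (a + s) - V c' a) - (V0 c' (a + s) - V0 c' a)| <= e * (s + t) * s.
  move=> hc; rewrite [X in _ <= _ * X](_ : s = a + s - a); last by ring.
  apply: (@derive_dist_le _ _ _ (fun x => complex.Im (G (x +i* c')%C))
    (fun x => complex.Im g + al * (c' - q) + be * (x - p))) => // x hx.
  - by apply: dV; case/andP: hx => h _; exact: lt_le_trans h.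
  - exact: is_derive_quad.
  - exact: le_trans (eV _ _) (est _ _ hx hc).
have h1 := TU a; rewrite lexx as_ in h1; have {}h1 := h1 isT.
have h2 := TU (a + s); rewrite lexx as_ in h2; have {}h2 := h2 isT.
have h3 := TV c; rewrite lexx ct_ in h3; have {}h3 := h3 isT.
have h4 := TV (c + t); rewrite lexx ct_ in h4; have {}h4 := h4 isT.
have z : (U0 (a + s) (c + t) - U0 (a + s) c) - (U0 a (c + t) - U0 a c)
  + (V0 c (a + s) - V0 c a) - (V0 (c + t) (a + s) - V0 (c + t) a) = 0.
  by rewrite /U0 /V0; field.
rewrite -[X in `|X|]subr0 -z /Phi.
move: h1 h2 h3 h4; rewrite !ler_norml.
have -> : 2 * e * (s + t) ^+ 2 = e * (s + t) * t + e * (s + t) * t + e * (s + t) * s + e * (s + t) * s.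
  by ring.
move=> /andP[h1 h1'] /andP[h2 h2'] /andP[h3 h3'] /andP[h4 h4'].
by apply/andP; split; lra.
Qed.

Let archi2 (w d : R) : 0 <= w -> 0 < d -> exists n : nat, w / 2 ^+ n < d.
Proof.
move=> w0 d0; pose n := Num.bound (w / d); exists n.
rewrite ltr_pdivrMr ?exprn_gt0// mulrC -ltr_pdivrMr//.
apply: lt_le_trans (archi_boundP _) _; first by rewrite divr_ge0// ltW.
by rewrite -natrX ler_nat ltnW// ltn_expl.
Qed.

Lemma goursat (a0 c0 w h : R) : lx < a0 -> ly < c0 -> 0 <= w -> 0 <= h ->
  (U (a0 + w) (c0 + h) - U (a0 + w) c0) - (U a0 (c0 + h) - U a0 c0)
   + (V c0 (a0 + w) - V c0 a0) - (V (c0 + h) (a0 + w) - V (c0 + h) a0) = 0.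
Proof.
move=> xa0 yc0 w0 h0; rewrite -/(Phi a0 (a0 + w) c0 (c0 + h)).
apply/eqP; apply/negPn/negP; rewrite -normr_gt0; set K := `|_| => K0.
(* A state is the lower left corner of a rectangle of generation [n]. Among the four quarters of a
   rectangle one carries at least a quarter of |Phi|, so [K / 4 ^+ n] survives. *)
pose P n (x : R * R) := [/\ lx < x.1, ly < x.2 &
  K / 4 ^+ n <= `|Phi x.1 (x.1 + w / 2 ^+ n) x.2 (x.2 + h / 2 ^+ n)|].
pose Q n (x y : R * R) := (y.1 = x.1 \/ y.1 = x.1 + w / 2 ^+ n.+1) /\
                          (y.2 = x.2 \/ y.2 = x.2 + h / 2 ^+ n.+1).
have e2 (v : R) n : v / 2 ^+ n = v / 2 ^+ n.+1 + v / 2 ^+ n.+1.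
  have : (2 : R) ^+ n != 0 by rewrite expf_neq0.
  by move=> ?; rewrite exprS; field.
have wn n : 0 <= w / 2 ^+ n by rewrite divr_ge0// exprn_ge0.
have hn n : 0 <= h / 2 ^+ n by rewrite divr_ge0// exprn_ge0.
have [||u [u0 uP uQ]] := @dependent_choice_nat _ P Q (a0, c0).
- by split => //=; rewrite !expr0 !divr1.
- move=> n [a c] [/= xa yc HK].
  set s := w / 2 ^+ n.+1; set t := h / 2 ^+ n.+1.
  have s0 : 0 <= s by exact: wn.
  have t0 : 0 <= t by exact: hn.
  rewrite (e2 w) (e2 h) -/s -/t !addrA in HK.
  have split4 : Phi a (a + s + s) c (c + t + t) =
     Phi a (a + s) c (c + t) + Phi (a + s) (a + s + s) c (c + t)
     + Phi a (a + s) (c + t) (c + t + t) + Phi (a + s) (a + s + s) (c + t) (c + t + t).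
    by rewrite /Phi; ring.
  have K4 : K / 4 ^+ n = 4 * (K / 4 ^+ n.+1).
    have : (4 : R) ^+ n != 0 by rewrite expf_neq0.
    by move=> ?; rewrite exprS; field.
  rewrite split4 K4 in HK.
  have big : forall A B C D k : R, 4 * k <= `|A + B + C + D| ->
      [\/ k <= `|A|, k <= `|B|, k <= `|C| | k <= `|D|].
    move=> A B C' D k H.
    case: (lerP k `|A|) => hA; first by constructor 1.
    case: (lerP k `|B|) => hB; first by constructor 2.
    case: (lerP k `|C'|) => hC; first by constructor 3.
    case: (lerP k `|D|) => hD; first by constructor 4.
    have := le_trans H (le_trans (ler_normD _ _) (lerD (le_trans (ler_normD _ _) (lerD (ler_normD _ _) (lexx _))) (lexx _))).
    by lra.
  have [B|B|B|B] := big _ _ _ _ _ HK.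
  + by exists (a, c); split; [split|split; left].
  + exists (a + s, c); split; [split => //=|split; [right|left] => //].
    by rewrite (lt_le_trans xa)// lerDl.
  + exists (a, c + t); split; [split => //=|split; [left|right] => //].
    by rewrite (lt_le_trans yc)// lerDl.
  + exists (a + s, c + t); split; [split => //=|split; right => //].
      by rewrite (lt_le_trans xa)// lerDl.
    by rewrite (lt_le_trans yc)// lerDl.
have [p hp] := @bisection _ w (fun n => (u n).1) w0 (fun n => (uQ n).1).
have [q hq] := @bisection _ h (fun n => (u n).2) h0 (fun n => (uQ n).2).
(* The [+ 1] keeps [W] positive for a degenerate rectangle and makes the final comparison strict:
   for e = K / (4 W) the bound of [Phi_small] falls below [K / 4 ^+ n]. *)
pose W := (w + h) ^+ 2 + 1.
have W0 : 0 < W by rewrite ltr_wpDl// sqr_ge0.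
have e0 : 0 < K / (4 * W) by rewrite divr_gt0// mulr_gt0.
have [d d0 Hd] := Phi_small p q e0.
have wh0 : 0 <= w + h by rewrite addr_ge0.
have [n hn'] := archi2 wh0 d0.
have [xa yc HK] := uP n.
have := Hd _ _ _ _ xa yc (wn n) (hn n) (hp n) (hq n).
rewrite -mulrDl => /(_ hn').
move=> /(le_trans HK); rewrite leNgt => /negP; apply.
have -> : 2 * (K / (4 * W)) * ((w + h) / 2 ^+ n) ^+ 2 = (K / 4 ^+ n) * ((w + h) ^+ 2 / (2 * W)).
  have -> : (4 : R) ^+ n = (2 ^+ n) ^+ 2.
    by rewrite (_ : 4 = 2 ^+ 2) -?exprM 1?mulnC//; ring.
  have : (2 : R) ^+ n != 0 by rewrite expf_neq0.
  move: W0 => /lt0r_neq0; move: (W) (2 ^+ n) => W' t W'0 t0.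
  by field; rewrite W'0 t0.
rewrite gtr_pMr ?divr_gt0 ?exprn_gt0// ltr_pdivrMr ?mulr_gt0// mul1r.
by rewrite /W; move: (sqr_ge0 (w + h)); lra.
Qed.

End Goursat.

Section MeanValue.
Variable R : realType.
Local Notation C := R[i].

Lemma continuous_Re_line (G : C -> C) (b : R) : (forall z, cdiff G z) ->
  continuous (fun y : R => complex.Re (G (b +i* y)%C)).
Proof.
move=> cG y; apply/cvgrPdist_le => /= e e0.
have [d d0 Hd] := cdiff_continuous (cG (b +i* y)%C) e0.
near=> t.
have := Hd (0 +i* (t - y))%C.
have -> : (b +i* y)%C + (0 +i* (t - y))%C = (b +i* t)%C by simpc; rewrite [y + _]addrC subrK.
have -> : normc (0 +i* (t - y))%C = `|y - t|.
  by rewrite /= expr0n /= add0r sqrtr_sqr distrC.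
move=> H; rewrite distrC; apply: le_trans (H _); last first.
  by near: t; exact: (@cvgr_dist_lt _ _ _ _ _ id _ cvg_id).
by rewrite -raddfB; exact: le_normc_Re.
Unshelve. all: by end_near.
Qed.

Lemma continuous_Im_line (G : C -> C) (c : R) : (forall z, cdiff G z) ->
  continuous (fun x : R => complex.Im (G (x +i* c)%C)).
Proof.
move=> cG y; apply/cvgrPdist_le => /= e e0.
have [d d0 Hd] := cdiff_continuous (cG (y +i* c)%C) e0.
near=> t.
have := Hd ((t - y) +i* 0)%C.
have -> : (y +i* c)%C + ((t - y) +i* 0)%C = (t +i* c)%C by simpc; rewrite [y + _]addrC subrK.
have -> : normc ((t - y) +i* 0)%C = `|y - t|.
  by rewrite /= expr0n /= addr0 sqrtr_sqr distrC.
move=> H; rewrite distrC; apply: le_trans (H _); last first.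
  by near: t; exact: (@cvgr_dist_lt _ _ _ _ _ id _ cvg_id).
by rewrite -raddfB; exact: le_normc_Im.
Unshelve. all: by end_near.
Qed.

Lemma cexp_2ipi (x y : R) : cexp (x +i* (y + pi *+ 2))%C = cexp (x +i* y)%C.
Proof. by rewrite /cexp /= cosD2pi sinD2pi. Qed.

(** A one-sided mean value property. Pulled back by z -> w + e^z the function has period 2 pi i, so
    the horizontal sides cancel in Goursat's identity and the mean over a vertical period does not
    depend on the abscissa. Far to the left it is close to [H w = 0], whereas Re H <= - c on the
    circle would make it at most - c. *)
Lemma holomorphic_circle_gt (H : C -> C) (w : C) (r c : R) :
  (forall z, cdiff H z) -> H w = 0 -> 0 < r -> 0 < c ->
  exists z, normc (z - w) = r /\ - c < complex.Re (H z).
Proof.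
move=> cH Hw r0 c0; apply: contrapT => /forallNP nex.
have neg z : normc (z - w) = r -> complex.Re (H z) <= - c.
  by move=> zr; rewrite leNgt; apply/negP => h; apply: (nex z).
pose G z := H (w + cexp z).
have cG z : cdiff G z.
  apply: cdiff_comp (cH _); apply: cdiffD; [exact: cdiff_cst|exact: cdiff_cexp].
have Gper x y : G (x +i* (y + pi *+ 2))%C = G (x +i* y)%C by rewrite /G cexp_2ipi.
have c20 : 0 < c / 2 by rewrite divr_gt0.
have [d d0 Hd] := cdiff_continuous (cH w) c20.
(* The abscissa [a] satisfies e^a < [d], so on the corresponding small circle Re H is at least - c /
   2. *)
pose b := ln r; pose a := Num.min b (ln (d / 2)).
have ab : a <= b by rewrite ge_min lexx.
have ea : expR a < d.
  apply: le_lt_trans (_ : d / 2 < d); last by rewrite ltr_pdivrMr// mulr_natr mulr2n ltrDl.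
  by rewrite -[leRHS]lnK ?posrE ?divr_gt0// ler_expR ge_min lexx orbT.
have /choice[U dU] : forall b : R, exists F : R -> R, forall y : R, -1 < y -> is_derive y 1 F (complex.Re (G (b +i* y)%C)).
  by move=> b'; apply: continuous_antiderivative; exact: continuous_Re_line.
have /choice[V dV] : forall c : R, exists F : R -> R, forall y : R, a - 1 < y -> is_derive y 1 F (complex.Im (G (y +i* c)%C)).
  by move=> b'; apply: continuous_antiderivative; exact: continuous_Im_line.
have p0 : 0 <= pi *+ 2 :> R by rewrite mulrn_wge0// pi_ge0.
have pp : 0 < pi *+ 2 :> R by rewrite pmulrn_lgt0// pi_gt0.
have := goursat cG dU dV (a0 := a) (c0 := 0) (w := b - a) (h := pi *+ 2).
rewrite (addrC a (b - a)) subrK add0r => /(_ _ _ _ _)/wrap[].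
- by rewrite gtrDl oppr_lt0.
- by rewrite oppr_lt0.
- by rewrite subr_ge0.
- exact: p0.
have -> : V (pi *+ 2) b - V (pi *+ 2) a = V 0 b - V 0 a.
  apply/eqP; rewrite -subr_eq0 -normr_le0.
  rewrite [leRHS](_ : _ = 0 * (b - a)); last by rewrite mul0r.
  apply: derive_dist_le ab _ _ _ => x /andP[xa xb].
  - by apply: dV; rewrite (lt_le_trans _ xa)// gtrDl oppr_lt0.
  - by apply: dV; rewrite (lt_le_trans _ xa)// gtrDl oppr_lt0.
  - by rewrite /= -[pi *+ 2]add0r Gper subrr normr0.
rewrite addrK => /eqP; rewrite subr_eq0 => /eqP E.
(* The mean over a period is attained at some point, so the two means are compared through single
   values of Re G. *)
have mv b' : exists y, U b' (pi *+ 2) - U b' 0 = complex.Re (G (b' +i* y)%C) * (pi *+ 2).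
  have dd x : 0 <= x <= pi *+ 2 -> is_derive x 1 (U b') (complex.Re (G (b' +i* x)%C)).
    by move=> /andP[x0 _]; apply: dU; rewrite (lt_le_trans _ x0)// oppr_lt0.
  have [|y _ ->] := @MVT_segment _ (U b') (fun y => complex.Re (G (b' +i* y)%C)) _ _ p0 _ (is_derive_continuous dd).
    by move=> x; rewrite in_itv /= => /andP[x0 _]; apply: dU; rewrite (lt_trans _ x0)// oppr_lt0.
  by exists y; rewrite subr0.
have [y1 E1] := mv b; have [y2 E2] := mv a.
move: E; rewrite E1 E2 => /(mulIf (lt0r_neq0 pp)) E.
have hb : complex.Re (G (b +i* y1)%C) <= - c.
  by apply: neg; rewrite addrAC subrr add0r normc_cexp /= lnK.
have ha : - (c / 2) <= complex.Re (G (a +i* y2)%C).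
  have := Hd (cexp (a +i* y2)%C); rewrite normc_cexp /= => /(_ ea).
  rewrite Hw subr0 => /(le_trans (le_normc_Re _)).
  by rewrite ler_norml => /andP[].
by rewrite E in hb; move: ha hb c0; lra.
Qed.

End MeanValue.

Section MaximumPrinciple.
Variable R : realType.
Local Notation C := R[i].

Lemma periodic_reduce (T : Type) (f : R -> T) : (forall y, f (y + pi *+ 2) = f y) ->
  forall y, exists2 y', 0 <= y' <= pi *+ 2 & f y' = f y.
Proof.
move=> fper y.
have pp : 0 < pi *+ 2 :> R by rewrite pmulrn_lgt0// pi_gt0.
have pern n x : f (x + (pi *+ 2) *+ n) = f x.
  by elim: n => [|n IH]; rewrite ?mulr0n ?addr0// mulrSr addrA fper.
pose k := Num.floor (y / (pi *+ 2)).
have [kl ku] : k%:~R * (pi *+ 2) <= y /\ y < (k + 1)%:~R * (pi *+ 2).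
  by split; [rewrite -ler_pdivlMr// floor_le|rewrite -ltr_pdivrMr// floorD1_gt].
exists (y - k%:~R * (pi *+ 2)).
  rewrite subr_ge0 kl /= lerBlDr; apply/ltW; apply: lt_le_trans ku _.
  by rewrite intrD mulrDl mul1r addrC.
case: k {kl ku} => n.
  by rewrite -pmulrn -(pern n (y - _)) -(mulr_natl (pi *+ 2) n) subrK.
by rewrite NegzE mulrNz mulNr opprK mulr_natl pern.
Qed.

Lemma continuous_normc_sq (G : C -> C) (d : R) : (forall z, cdiff G z) ->
  continuous (fun p : R * R => normc (G (p.1 +i* p.2)%C) ^+ 2 + d * p.1 ^+ 2).
Proof.
move=> cG.
have cN : continuous (fun p : R * R => normc (G (p.1 +i* p.2)%C)).
  move=> [x y]; apply/cvgrPdist_le => /= e e0.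
  have [r r0 Hr] := cdiff_continuous (cG (x +i* y)%C) e0.
  near=> t.
  have := Hr ((t.1 - x) +i* (t.2 - y))%C.
  have -> : (x +i* y)%C + ((t.1 - x) +i* (t.2 - y))%C = (t.1 +i* t.2)%C.
    by simpc; rewrite [x + _]addrC [y + _]addrC !subrK.
  move=> H.
  have {H}/H : normc ((t.1 - x) +i* (t.2 - y))%C < r.
    apply: le_lt_trans (normc_le_ReIm _) _ => /=.
    rewrite (splitr r) ltrD//.
      rewrite distrC; near: t.
      by apply: (@cvgr_dist_lt _ _ _ _ _ (fst : R * R -> R) x); [exact: cvg_fst|rewrite divr_gt0].
    rewrite distrC; near: t.
    by apply: (@cvgr_dist_lt _ _ _ _ _ (snd : R * R -> R) y); [exact: cvg_snd|rewrite divr_gt0].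
  set u := G _; set v := G _ => uv.
  rewrite distrC ler_norml; apply/andP; split.
    by rewrite lerNl opprB; apply: le_trans (normc_dist_ge _ _) _; rewrite normcBC.
  exact: le_trans (normc_dist_ge _ _) _.
move=> p; apply: cvgD.
  by apply: (@continuous_comp _ _ _ _ (fun x : R => x ^+ 2) p); [exact: cN|exact: exprn_continuous].
apply: cvgM; first exact: cvg_cst.
by apply: (@continuous_comp _ _ _ (fst : R * R -> R) (fun x : R => x ^+ 2) p); [exact: cvg_fst|exact: exprn_continuous].
Unshelve. all: by end_near.
Qed.

(** Periodicity reduces the strip to a compact rectangle. At an interior maximum of |G|^2 + d x^2
    the strictly subharmonic term d x^2 contradicts [holomorphic_circle_gt], and [d] is small enough
    for the maximum to avoid the two sides. *)
Lemma strip_maximum (G : C -> C) (a b M : R) : (forall z, cdiff G z) ->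
  (forall x y, G (x +i* (y + pi *+ 2))%C = G (x +i* y)%C) ->
  (forall y, normc (G (a +i* y)%C) <= M) ->
  (forall y, normc (G (b +i* y)%C) <= M) ->
  forall x y, a <= x <= b -> normc (G (x +i* y)%C) <= M.
Proof.
move=> cG Gper Ha Hb x0 y0 /andP[ax0 x0b]; rewrite leNgt; apply/negP => HM.
have n0 := @normc_ge0 R.
have M0 : 0 <= M by apply: le_trans (Ha 0).
(* On both sides x^2 <= [B], and [d * B] will be half the supposed excess [D], so the sides stay at
   or below M^2 + D / 2 while the interior reaches M^2 + D. *)
pose B := a ^+ 2 + b ^+ 2 + 1.
have B0 : 0 < B by rewrite ltr_wpDl// addr_ge0// sqr_ge0.
pose D := normc (G (x0 +i* y0)%C) ^+ 2 - M ^+ 2.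
have D0 : 0 < D by rewrite subr_gt0 ltr_pXn2r// nnegrE.
pose d := D / (2 * B).
have d0 : 0 < d by rewrite divr_gt0// mulr_gt0.
have dB : d * B = D / 2 by rewrite /d; field; rewrite gt_eqF.
pose phi (p : R * R) := normc (G (p.1 +i* p.2)%C) ^+ 2 + d * p.1 ^+ 2.
pose K : set (R * R) := `[a, b]%classic `*` `[0, pi *+ 2]%classic.
have p20 : 0 <= pi *+ 2 :> R by rewrite mulrn_wge0// pi_ge0.
have K0 : K !=set0.
  by exists (x0, 0); split; rewrite /= in_itv /= ?ax0 ?lexx.
have cK : compact K by apply: compact_setX; exact: segment_compact.
have cphi : {within K, continuous phi}.
  by apply: continuous_subspaceT; exact: continuous_normc_sq.
have [[x1 y1] + Hmax] := compact_EVT_max K0 cK cphi.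
rewrite inE => -[/=]; rewrite !in_itv /= => /andP[ax1 x1b] /andP[y1l y1u].
have max x y : a <= x <= b -> phi (x, y) <= phi (x1, y1).
  move=> xab.
  have [y' y'i e] := @periodic_reduce _ (fun y => phi (x, y)) (fun y => congr1 (fun g => normc g ^+ 2 + d * x ^+ 2) (Gper x y)) y.
  by rewrite -e; apply: Hmax; rewrite inE; split; rewrite /= in_itv.
have x0m : phi (x0, y0) <= phi (x1, y1) by apply: max; rewrite ax0.
have low : M ^+ 2 + D / 2 < phi (x1, y1).
  apply: lt_le_trans x0m; rewrite /phi /=.
  have -> : normc (G (x0 +i* y0)%C) ^+ 2 = M ^+ 2 + D by rewrite /D addrC subrK.
  have : 0 <= d * x0 ^+ 2 by rewrite mulr_ge0 ?sqr_ge0// ltW.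
  by lra.
have bd x : (x = a) \/ (x = b) -> (forall y, phi (x, y) < M ^+ 2 + D / 2 + 1 * 0 \/ phi (x, y) <= M ^+ 2 + D / 2).
  move=> hx y; right; rewrite /phi /= -dB; apply: lerD.
    by rewrite ler_pXn2r ?nnegrE//; case: hx => ->.
  rewrite ler_pM2l// /B.
  by case: hx => ->; move: (sqr_ge0 a) (sqr_ge0 b); lra.
have ax1' : a < x1.
  rewrite lt_neqAle ax1 andbT; apply/eqP => e.
  by have [|] := bd x1 (or_introl (esym e)) y1; move: low; lra.
have x1b' : x1 < b.
  rewrite lt_neqAle x1b andbT; apply/eqP => e.
  by have [|] := bd x1 (or_intror e) y1; move: low; lra.
pose r := Num.min (x1 - a) (b - x1).
have r0 : 0 < r by rewrite lt_min !subr_gt0 ax1'.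
pose z1 := (x1 +i* y1)%C.
pose g1 := G z1.
(* On the circle |z - z1| = r, with X = Re (z - z1), one has X^2 = r^2 / 2 + Re (z - z1)^2 / 2.
   Hence [phi] grows from z1 to z by Re H + |G - g1|^2 + d r^2 / 2, and a point with Re H > - d r^2
   / 2 exceeds the maximum. *)
pose H z := (2%:C * conjc g1 * (G z - g1) + (2 * d * x1)%:C * (z - z1) + (d / 2)%:C * (z - z1) ^+ 2)%C.
have cH z : cdiff H z.
  have cz : cdiff (fun z => z - z1) z by apply: cdiffB; [exact: cdiff_id|exact: cdiff_cst].
  apply: cdiffD; first apply: cdiffD.
  - apply: cdiffM; first exact: cdiff_cst.
    by apply: cdiffB => //; exact: cdiff_cst.
  - by apply: cdiffM => //; exact: cdiff_cst.
  - by apply: cdiffM; [exact: cdiff_cst|exact: cdiffX].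
have H1 : H z1 = 0 by rewrite /H /g1 !subrr expr0n /= !mulr0 !addr0.
have c0 : 0 < d * r ^+ 2 / 2 by rewrite divr_gt0// mulr_gt0// exprn_gt0.
have [[x y] [nz Hz]] := holomorphic_circle_gt cH H1 r0 c0.
have : normc ((x +i* y)%C - z1) ^+ 2 = r ^+ 2 by rewrite nz.
rewrite normc_sqr /= => nsq.
have xr : `|x - x1| <= r by rewrite -nz; exact: le_trans (le_normc_Re _).
have xab : a <= x <= b.
  move: xr; rewrite ler_norml => /andP[h1 h2].
  have ra : r <= x1 - a by rewrite ge_min lexx.
  have rb : r <= b - x1 by rewrite ge_min lexx orbT.
  by apply/andP; split; lra.
have := max x y xab; rewrite /phi /= -/z1 -/g1 !normc_sqr.
move: Hz; rewrite /H /z1.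
case: (G (x +i* y)%C) => u v; case: (g1) => u1 v1; rewrite expr2; simpc => /=.
set X := x - x1 in nsq *; set Y := y - y1 in nsq *.
have -> : x = X + x1 by rewrite subrK.
move=> h1 h2.
have h3 : 0 <= (u - u1) ^+ 2 + (v - v1) ^+ 2 by rewrite addr_ge0 ?sqr_ge0.
have h4 : d * r ^+ 2 = d * (X ^+ 2 + Y ^+ 2) by rewrite nsq.
rewrite h4 in h1.
suff : 0 < 0 :> R by rewrite ltxx.
by apply: lt_le_trans (_ : _ <= 0); [rewrite -subr_gt0 in h1; exact: h1|nra].
Qed.

(** The maximum principle for u(c + e^z) e^(-n z), evaluated at ln r1 + i pi, which the exponential
    sends to - r1. An integer [n] preserves the period 2 pi i; it is left free instead of being
    optimized. *)
Lemma three_circles (u : C -> C) (c : C) (r0 r1 r2 A B : R) n :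
  (forall z, cdiff u z) -> 0 < r0 -> r0 <= r1 -> r1 <= r2 ->
  (forall z, normc (z - c) = r0 -> normc (u z) <= A) ->
  (forall y, normc (u (c + cexp (ln r2 +i* y)%C)) <= B) ->
  normc (u (c - r1%:C%C)) <= Num.max (A * (r1 / r0) ^+ n) (B * (r1 / r2) ^+ n).
Proof.
move=> cu r00 r01 r12 HA HB.
have r10 : 0 < r1 by exact: lt_le_trans r01.
have r20 : 0 < r2 by exact: lt_le_trans r12.
pose G z := u (c + cexp z) * (cexp (- z)) ^+ n.
have cG z : cdiff G z.
  apply: cdiffM.
    by apply: cdiff_comp (cu _); apply: cdiffD; [exact: cdiff_cst|exact: cdiff_cexp].
  apply: cdiffX; apply: cdiff_comp (cdiff_cexp _).
  by apply: cdiffN; exact: cdiff_id.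
have Gper x y : G (x +i* (y + pi *+ 2))%C = G (x +i* y)%C.
  have mm (s t : R) : - (s +i* t)%C = (- s +i* - t)%C by [].
  rewrite /G cexp_2ipi !mm; congr (_ * _ ^+ _).
  by rewrite -(cexp_2ipi (- x) (- (y + _))) opprD subrK.
have nG r y : 0 < r -> normc (G (ln r +i* y)%C) = normc (u (c + cexp (ln r +i* y)%C)) / r ^+ n.
  move=> r_gt0; rewrite /G normcM normcX normc_cexp /= expRN lnK// exprVn.
  by [].
pose M := Num.max (A / r0 ^+ n) (B / r2 ^+ n).
have hA y : normc (G (ln r0 +i* y)%C) <= M.
  rewrite nG// le_max; apply/orP; left.
  apply: ler_wpM2r; first by rewrite invr_ge0 exprn_ge0// ltW.
  apply: HA.
  by rewrite addrAC subrr add0r normc_cexp /= lnK.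
have hB y : normc (G (ln r2 +i* y)%C) <= M.
  rewrite nG// le_max; apply/orP; right.
  apply: ler_wpM2r; last exact: HB.
  by rewrite invr_ge0 exprn_ge0// ltW.
have := strip_maximum cG Gper hA hB (x := ln r1) pi.
rewrite !ler_ln ?posrE// r01 r12 => /(_ isT).
rewrite nG//.
have -> : cexp (ln r1 +i* pi)%C = - r1%:C%C.
  by rewrite /cexp lnK// cospi sinpi mulr0 mulrN1; simpc.
rewrite ler_pdivrMr ?exprn_gt0// => /le_trans; apply.
have e (t r : R) : t / r ^+ n * r1 ^+ n = t * (r1 / r) ^+ n.
  by rewrite expr_div_n mulrAC mulrA.
rewrite /M maxr_pMl; last by rewrite exprn_ge0// ltW.
rewrite !e.
by rewrite lexx.
Qed.

Lemma bounded_circle (h : C -> C) (c : C) (a : R) : (forall z, cdiff h z) ->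
  exists B, forall y, normc (h (c + cexp (a +i* y)%C)) <= B.
Proof.
move=> ch.
pose G z := h (c + cexp z).
have cG z : cdiff G z.
  by apply: cdiff_comp (ch _); apply: cdiffD; [exact: cdiff_cst|exact: cdiff_cexp].
pose f (y : R) := normc (G (a +i* y)%C) ^+ 2.
have cf : continuous f.
  move=> y; have := @continuous_normc_sq _ 0 cG (a, y).
  move=> /(@continuous_comp _ _ _ (fun y : R => (a, y)) _ y).
  rewrite /f => H.
  have -> : (fun y => normc (G (a +i* y)%C) ^+ 2) = (fun p : R * R => normc (G (p.1 +i* p.2)%C) ^+ 2 + 0 * p.1 ^+ 2) \o (fun y : R => (a, y)).
    by apply/funext => t /=; rewrite mul0r addr0.
  have HH : {for y, continuous (fun y : R => (a, y))}.
    by apply: (@cvg_pair _ _ _ (nbhs y) (nbhs a) (nbhs y) _ _ _ (fun=> a) id); [exact: cvg_cst|exact: cvg_id].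
  exact: H HH.
have p20 : 0 <= pi *+ 2 :> R by rewrite mulrn_wge0// pi_ge0.
have [y1 _ Hy] := EVT_max p20 (continuous_subspaceT cf (A := `[0, pi *+ 2]%classic)).
exists (normc (G (a +i* y1)%C)) => y.
have [|y' y'i e] := @periodic_reduce _ (fun y => normc (G (a +i* y)%C)) _ y.
  by move=> t; rewrite /G cexp_2ipi.
rewrite -/(G _) -e -(@ler_pXn2r _ 2) ?nnegrE ?normc_ge0//.
by apply: Hy; rewrite in_itv.
Qed.

(* Hadamard's three circles applied to (h - E N) z^-n: uniform convergence on the
   inner circle and boundedness on the outer one force convergence in between. *)
Lemma middle_circle_cvg (h : C -> C) (E : nat -> C -> C) (c : C) (r0 r1 r2 B : R) :
  (forall z, cdiff h z) -> (forall N z, cdiff (E N) z) ->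
  0 < r0 -> r0 < r1 -> r1 < r2 ->
  (forall N z, normc (z - c) = r2 -> normc (E N z) <= B) ->
  (forall e : R, 0 < e -> exists N0 : nat, forall N z, (N0 <= N)%N ->
     normc (z - c) = r0 -> normc (h z - E N z) <= e) ->
  forall e : R, 0 < e -> exists N0 : nat, forall N, (N0 <= N)%N ->
     normc (h (c - r1%:C%C) - E N (c - r1%:C%C)) <= e.
Proof.
move=> ch cE r00 r01 r12 HB Hu e e0.
have r10 : 0 < r1 by exact: lt_trans r01.
have r20 : 0 < r2 by exact: lt_trans r12.
have [B' HB'] := bounded_circle c (ln r2) ch.
have bu N y : normc (h (c + cexp (ln r2 +i* y)%C) - E N (c + cexp (ln r2 +i* y)%C)) <= B' + B.
  apply: le_trans (le_normcB _ _) _; apply: lerD; first exact: HB'.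
  by apply: HB; rewrite addrAC subrr add0r normc_cexp /= lnK.
have BB : 0 <= B' + B by apply: le_trans (bu 0%N 0); rewrite normc_ge0.
(* The exponent comes first: it makes the outer term small for all [N] at once. Only then is [N0]
   chosen against the now fixed factor [q] of the inner circle. *)
have [n Hn] : exists n, (B' + B) * (r1 / r2) ^+ n <= e.
  have q1 : `|r1 / r2| < 1 by rewrite ger0_norm ?divr_ge0 ?ltW// ltr_pdivrMr// mul1r.
  have := @cvg_geometric _ (B' + B) _ q1.
  move=> /cvgrPdist_le /(_ _ e0) [n _ /(_ n (leqnn n))].
  rewrite sub0r normrN => H; exists n; exact: le_trans (ler_norm _) H.
pose q := (r1 / r0) ^+ n.
have q0 : 0 < q by rewrite exprn_gt0// divr_gt0.
have [N0 HN] := Hu _ (divr_gt0 e0 q0).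
exists N0 => N NN.
have cu z : cdiff (fun z => h z - E N z) z by apply: cdiffB.
have := three_circles n cu r00 (ltW r01) (ltW r12) (HN N ^~ NN) (bu N).
by move=> /le_trans; apply; rewrite ge_max Hn andbT -/q divfK ?gt_eqF.
Qed.

End MaximumPrinciple.

(** * Real primitive characters *)

Section ResidueSums.

Lemma period_modn (T : Type) (f : nat -> T) (q : nat) :
  (forall n, f (n + q)%N = f n) -> forall n, f (n %% q)%N = f n.
Proof.
move=> fq n; rewrite [in RHS](divn_eq n q) addnC.
elim: (n %/ q)%N => [|k IH]; first by rewrite mul0n addn0.
by rewrite mulSn [(q + _)%N]addnC addnA fq.
Qed.

Lemma sum_residues_mul (V : nmodType) (f : nat -> V) (q m : nat) :
  (0 < q)%N -> coprime m q -> (forall n, f (n + q)%N = f n) ->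
  \sum_(r < q) f (r * m)%N = \sum_(r < q) f r.
Proof.
move=> q0 cmq fq.
pose h (r : 'I_q) := Ordinal (ltn_pmod (r * m) q0).
have hinj : injective h.
  move=> x y /(congr1 val) /= /eqP.
  wlog : x y / (x <= y)%N => [H|xy].
    case: (leqP x y) => [|/ltnW] xy; first exact: H.
    by rewrite eq_sym => /(H _ _ xy).
  rewrite eq_sym eqn_mod_dvd ?leq_mul2r ?xy ?orbT// -mulnBl Gauss_dvdl 1?coprime_sym//.
  move=> /dvdnP[k yx]; apply/val_inj => /=.
  have : (y - x < q)%N by rewrite (leq_ltn_trans (leq_subr _ _)).
  rewrite yx -{2}(mul1n q) ltn_mul2r q0 /= ltnS leqn0 => /eqP k0.
  by apply/eqP; rewrite eqn_leq xy -subn_eq0 yx k0.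
rewrite [RHS](reindex_inj hinj) /=; apply: eq_bigr => r _.
by rewrite (period_modn fq).
Qed.

Lemma sum_residues_crt (V : nmodType) (f : nat -> V) (q1 q2 : nat) :
  (0 < q1)%N -> (0 < q2)%N -> coprime q1 q2 ->
  (forall n, f (n + q1 * q2)%N = f n) ->
  \sum_(r < q1 * q2) f r = \sum_(r1 < q1) \sum_(r2 < q2) f (r1 * q2 + r2 * q1)%N.
Proof.
move=> q10 q20 cq fq.
have qq0 : (0 < q1 * q2)%N by rewrite muln_gt0 q10.
pose h (p : 'I_q1 * 'I_q2) := Ordinal (ltn_pmod (p.1 * q2 + p.2 * q1) qq0).
have inj1 (n k : nat) (x y : 'I_n) : coprime k n -> x * k = y * k %[mod n] -> x = y.
  wlog : x y / (x <= y)%N => [H|xy] ckn.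
    case: (leqP x y) => [|/ltnW] xy; first exact: H.
    by move=> e; apply/esym; apply: H.
  move=> /eqP; rewrite eq_sym eqn_mod_dvd ?leq_mul2r ?xy ?orbT// -mulnBl Gauss_dvdl 1?coprime_sym//.
  move=> /dvdnP[j yx]; apply/val_inj => /=.
  have n0 : (0 < n)%N by exact: leq_ltn_trans (ltn_ord x).
  have : (y - x < n)%N by rewrite (leq_ltn_trans (leq_subr _ _)).
  rewrite yx -{2}(mul1n n) ltn_mul2r n0 /= ltnS leqn0 => /eqP k0.
  by apply/eqP; rewrite eqn_leq xy -subn_eq0 yx k0.
have hinj : injective h.
  move=> [x1 x2] [y1 y2] /(congr1 val) /= E.
  congr pair.
    apply: (inj1 _ q2); first by rewrite coprime_sym.
    have := congr1 (modn^~ q1) E; rewrite /= !modn_dvdm ?dvdn_mulr//.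
    by rewrite ![(_ + _ * q1)%N]addnC !modnMDl.
  apply: (inj1 _ q1) => //.
  have := congr1 (modn^~ q2) E; rewrite /= !modn_dvdm ?dvdn_mull//.
  by rewrite !modnMDl.
have hbij : bijective h.
  by apply: inj_card_bij => //; rewrite card_prod !card_ord.
rewrite pair_big /= (reindex h) /=; last exact: onW_bij.
by apply: eq_bigr => -[x y] _ /=; rewrite (period_modn fq).
Qed.

End ResidueSums.

Lemma sum_prim_root (F : fieldType) (z : F) (q k : nat) : q.-primitive_root z ->
  \sum_(m < q) z ^+ (k * m) = if (q %| k)%N then q%:R else 0.
Proof.
move=> pz; under eq_bigr do rewrite exprM.
rewrite (prim_order_dvd pz); case: eqP => [->|/eqP zk].
  by under eq_bigr do rewrite expr1n; rewrite sumr_const card_ord.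
have := subrX1 (z ^+ k) q.
rewrite -exprM mulnC exprM (prim_expr_order pz) expr1n subrr => /esym/eqP.
by rewrite mulf_eq0 subr_eq0 (negbTE zk) => /eqP.
Qed.

(* Primitivity is used only through the last clause. *)
Definition gauss_char (q : nat) (chi : nat -> int) : Prop :=
  [/\ (0 < q)%N, forall n, chi (n + q)%N = chi n,
      forall m n, chi (m * n)%N = chi m * chi n,
      forall n, chi n ^+ 2 = (coprime n q)%:R
    & forall (F : fieldType) (z : F), q.-primitive_root z -> forall m,
      \sum_(r < q) (chi r)%:~R * z ^+ (r * m) =
      (chi m)%:~R * \sum_(r < q) (chi r)%:~R * z ^+ r].

Section GaussChar.

(** For [m] prime to [q] the substitution r -> r m already gives the Gauss sum relation, because
    chi(m)^2 = 1; what is left to check is the vanishing at the other [m]. *)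
Lemma gauss_char_intro (q : nat) (chi : nat -> int) :
  (0 < q)%N -> (forall n, chi (n + q)%N = chi n) ->
  (forall m n, chi (m * n)%N = chi m * chi n) ->
  (forall n, chi n ^+ 2 = (coprime n q)%:R) ->
  (forall (F : fieldType) (z : F), q.-primitive_root z -> forall m,
     ~~ coprime m q -> \sum_(r < q) (chi r)%:~R * z ^+ (r * m) = 0) ->
  gauss_char q chi.
Proof.
move=> q0 per mul sq zero; split => // F z pz m.
have [cm|ncm] := boolP (coprime m q); last first.
  rewrite zero//; have /eqP := sq m; rewrite (negbTE ncm) sqrf_eq0 => /eqP ->.
  by rewrite mul0r.
have m2 : (chi m)%:~R * (chi m)%:~R = 1 :> F.
  by rewrite -intrM -expr2 sq cm.
have fper n : (chi (n + q)%N)%:~R * z ^+ (n + q) = (chi n)%:~R * z ^+ n :> F.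
  by rewrite per exprD (prim_expr_order pz) mulr1.
rewrite -(@sum_residues_mul _ (fun n => (chi n)%:~R * z ^+ n) q m q0 cm fper).
rewrite mulr_sumr; apply: eq_bigr => r _.
by rewrite mul intrM mulrA mulrCA m2 mulr1.
Qed.

Variables (q : nat) (chi : nat -> int).
Hypothesis hchi : gauss_char q chi.

Lemma gauss_char_gt0 : (0 < q)%N. Proof. by case: hchi. Qed.

Lemma gauss_char_period n : chi (n + q)%N = chi n. Proof. by case: hchi. Qed.

Lemma gauss_charM m n : chi (m * n)%N = chi m * chi n. Proof. by case: hchi. Qed.

Lemma gauss_char_sqr n : chi n ^+ 2 = (coprime n q)%:R. Proof. by case: hchi. Qed.

Lemma gauss_char_mod n : chi (n %% q)%N = chi n.
Proof. exact/period_modn/gauss_char_period. Qed.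

Lemma gauss_char_addM n k : chi (n + k * q)%N = chi n.
Proof. by rewrite -gauss_char_mod addnC modnMDl gauss_char_mod. Qed.

Lemma gauss_char1 : chi 1%N = 1.
Proof.
have := gauss_charM 1 1; have := gauss_char_sqr 1.
rewrite coprime1n muln1 expr2 => -> //.
Qed.

Lemma gauss_char_norm n : `|chi n| <= 1.
Proof.
have := gauss_char_sqr n; case: coprime => /eqP; last by rewrite sqrf_eq0 => /eqP ->.
by rewrite sqrf_eq1 => /orP[] /eqP ->; rewrite ?normrN normr1.
Qed.

Lemma gauss_char_cases n : coprime n q -> chi n = 1 \/ chi n = -1.
Proof.
move=> cn; have /eqP := gauss_char_sqr n; rewrite cn sqrf_eq1.
by case/orP => /eqP; [left|right].
Qed.

Lemma gauss_char_eq0 n : ~~ coprime n q -> chi n = 0.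
Proof.
by move=> cn; have /eqP := gauss_char_sqr n; rewrite (negbTE cn) sqrf_eq0 => /eqP.
Qed.

(** [q.-1] stands for the residue -1, so this value is the parity of the character. *)
Lemma gauss_char_N1 : chi q.-1 = 1 \/ chi q.-1 = -1.
Proof.
apply: gauss_char_cases; have := gauss_char_gt0.
by case: (q) => // n _; rewrite coprime_sym coprimeSn.
Qed.

Lemma gauss_charN n k : (n + k)%N = q -> chi k = chi q.-1 * chi n.
Proof.
move=> nk; rewrite -gauss_charM -[RHS]gauss_char_mod -[LHS]gauss_char_mod.
congr chi; have q0 := gauss_char_gt0.
have e : (q.-1 * n + n = n * q)%N.
  by rewrite -[X in (_ + X)%N]mul1n -mulnDl addn1 prednK// mulnC.
have : (n + k) = (n + q.-1 * n) %[mod q] by rewrite nk [(n + q.-1 * n)%N]addnC e modnn modnMl.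
by move=> /eqP; rewrite eqn_modDl => /eqP.
Qed.

(** Stated over any field, since it is applied twice: in characteristic l it yields reciprocity,
    over the complex numbers it fixes the Gauss sum up to sign. *)
Lemma gauss_sum_sqr (F : fieldType) (z : F) : q.-primitive_root z ->
  (\sum_(r < q) (chi r)%:~R * z ^+ r) ^+ 2 = (chi q.-1)%:~R * q%:R.
Proof.
move=> pz; have q0 := gauss_char_gt0.
case: hchi => _ _ _ _ /(_ F z pz) gs.
set G := \sum_(r < q) _ in gs *.
(* Fourier inversion at the residue 1 *)
have e1 : \sum_(m < q) (\sum_(r < q) (chi r)%:~R * z ^+ (r * m)) * z ^+ (m * q.-1) = q%:R.
  under eq_bigr do rewrite mulr_suml.
  rewrite exchange_big /=.
  transitivity (\sum_(r < q) (chi r)%:~R * (if (q %| r + q.-1)%N then q%:R else 0) : F).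
    apply: eq_bigr => r _; rewrite -(sum_prim_root _ pz) mulr_sumr.
    by apply: eq_bigr => m _; rewrite -mulrA -exprD mulnDl [(m * _)%N]mulnC.
  have i1 : (1 %% q < q)%N by rewrite ltn_pmod.
  rewrite (bigD1 (Ordinal i1)) //= big1 ?addr0.
    rewrite gauss_char_mod gauss_char1 mul1r ifT// /dvdn modnDml.
    by rewrite add1n prednK// modnn.
  move=> r; rewrite -val_eqE /= => r1; rewrite ifF ?mulr0//.
  apply/negbTE; apply: contra r1 => qr.
  rewrite -[X in X == _](@modn_small _ q)//.
  rewrite -(eqn_modDr q.-1) add1n prednK// modnn; exact: qr.
have e2 : (chi q.-1)%:~R * G ^+ 2 = q%:R.
  rewrite -e1; under [RHS]eq_bigr do rewrite gs mulrAC.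
  by rewrite -mulr_suml gs expr2 mulrA.
rewrite -e2 mulrA -intrM -expr2.
by case: gauss_char_N1 => ->; rewrite ?sqrrN expr1n mulr1z mul1r.
Qed.

End GaussChar.

Section GaussCharProduct.

Lemma gauss_char_trivial : gauss_char 1 (fun=> 1).
Proof.
split => //; first by move=> n; rewrite coprimen1 expr1n.
move=> F z pz m; by rewrite !big_ord_recl !big_ord0 /= mulr1z !mul1r mul0n.
Qed.

(** Writing r = r1 q2 + r2 q1 splits the sum into the two Gauss sums, up to the sign chi1(q2)
    chi2(q1). *)
Lemma gauss_char_mul (q1 q2 : nat) (chi1 chi2 : nat -> int) :
  gauss_char q1 chi1 -> gauss_char q2 chi2 -> coprime q1 q2 ->
  gauss_char (q1 * q2) (fun n => chi1 n * chi2 n).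
Proof.
move=> h1 h2 cq.
have q10 := gauss_char_gt0 h1; have q20 := gauss_char_gt0 h2.
split.
- by rewrite muln_gt0 q10.
- by move=> n; rewrite (gauss_char_addM h2) mulnC (gauss_char_addM h1).
- by move=> m n; rewrite (gauss_charM h1) (gauss_charM h2); ring.
- move=> n; rewrite exprMn (gauss_char_sqr h1) (gauss_char_sqr h2) -natrM.
  by rewrite coprimeMr mulnb.
move=> F z pz.
pose S1 := \sum_(r < q1) (chi1 r)%:~R * (z ^+ q2) ^+ r.
pose S2 := \sum_(r < q2) (chi2 r)%:~R * (z ^+ q1) ^+ r.
(* The factor following [chi1 m * chi2 m] does not depend on [m]; the case [m = 1] identifies it as
   the Gauss sum of the product. *)
suff key m : \sum_(r < q1 * q2) (chi1 r * chi2 r)%:~R * z ^+ (r * m) =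
    (chi1 m * chi2 m)%:~R * ((chi1 q2 * chi2 q1)%:~R * (S1 * S2)).
  move=> m; rewrite key; congr (_ * _).
  have := key 1%N; rewrite (gauss_char1 h1) (gauss_char1 h2) mulr1 mul1r => <-.
  by apply: eq_bigr => r _; rewrite muln1.
have pz1 : q1.-primitive_root (z ^+ q2).
  by have := dvdn_prim_root pz (dvdn_mulr q2 (dvdnn q1)); rewrite mulKn.
have pz2 : q2.-primitive_root (z ^+ q1).
  by have := dvdn_prim_root pz (dvdn_mull q1 (dvdnn q2)); rewrite mulnK.
have [_ _ _ _ /(_ F _ pz1 m) g1] := h1.
have [_ _ _ _ /(_ F _ pz2 m) g2] := h2.
rewrite (@sum_residues_crt _ (fun r => (chi1 r * chi2 r)%:~R * z ^+ (r * m)))//; last first.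
  move=> n; rewrite (gauss_char_addM h2) mulnC (gauss_char_addM h1).
  by rewrite mulnDl exprD (exprM z (q2 * q1)%N) (mulnC q2) (prim_expr_order pz) expr1n mulr1.
transitivity ((chi1 q2 * chi2 q1)%:~R * ((\sum_(r < q1) (chi1 r)%:~R * (z ^+ q2) ^+ (r * m)) *
   (\sum_(r < q2) (chi2 r)%:~R * (z ^+ q1) ^+ (r * m)))).
  rewrite big_distrl mulr_sumr /=; apply: eq_bigr => r1 _.
  rewrite big_distrr mulr_sumr /=; apply: eq_bigr => r2 _.
  rewrite (gauss_char_addM h1) addnC (gauss_char_addM h2).
  rewrite (gauss_charM h1) (gauss_charM h2) -!exprM mulnDl exprD !intrM.
  rewrite (_ : (q2 * (r1 * m) = r1 * q2 * m)%N); last by ring.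
  rewrite (_ : (q1 * (r2 * m) = r2 * q1 * m)%N); last by ring.
  ring.
by rewrite g1 g2 -/S1 -/S2 !intrM; ring.
Qed.

Lemma gauss_char_mul_N1 (q1 q2 : nat) (chi1 chi2 : nat -> int) :
  gauss_char q1 chi1 -> gauss_char q2 chi2 ->
  chi1 (q1 * q2).-1 * chi2 (q1 * q2).-1 = chi1 q1.-1 * chi2 q2.-1.
Proof.
move=> h1 h2; have q10 := gauss_char_gt0 h1; have q20 := gauss_char_gt0 h2.
congr (_ * _).
  rewrite (_ : (q1 * q2).-1 = q1.-1 + q2.-1 * q1)%N ?(gauss_char_addM h1)//.
  by case: (q1) q10 (q2) q20 => // a _ [] // b _ /=; lia.
rewrite (_ : (q1 * q2).-1 = q2.-1 + q1.-1 * q2)%N ?(gauss_char_addM h2)//.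
by case: (q1) q10 (q2) q20 => // a _ [] // b _ /=; lia.
Qed.

End GaussCharProduct.

(* The Kronecker symbols (-4/n), (8/n) and (-8/n). *)
Definition chi4 (n : nat) : int := nth 0 [:: 0; 1; 0; -1] (n %% 4).
Definition chi8 (n : nat) : int := nth 0 [:: 0; 1; 0; -1; 0; -1; 0; 1] (n %% 8).
Definition chi8m (n : nat) : int := nth 0 [:: 0; 1; 0; 1; 0; -1; 0; -1] (n %% 8).

Section SmallConductors.

Lemma table_mul (q : nat) (f : nat -> int) : (0 < q)%N ->
  (forall m n, (m < q)%N -> (n < q)%N -> f ((m * n) %% q)%N = f m * f n) ->
  forall m n, f ((m * n) %% q)%N = f (m %% q)%N * f (n %% q)%N.
Proof. by move=> q0 H m n; rewrite -H ?ltn_pmod// modnMml modnMmr. Qed.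

(** For even m, z^(2m) = 1 and the terms at the residues 1 and 3 cancel. Conductor 8 works in the
    same way, with z^(4m) = 1 and the pairs r, r + 4. *)
Lemma gauss_char_chi4 : gauss_char 4 chi4.
Proof.
apply: gauss_char_intro => //.
- by move=> n; rewrite /chi4 modnDr.
- apply: (@table_mul 4 (fun n => nth 0 [:: 0; 1; 0; -1] n)) => // m n.
  by case: m => [|[|[|[|]]]] // _; case: n => [|[|[|[|]]]].
- move=> n; rewrite /chi4 -coprime_modl.
  have := @ltn_pmod n 4 isT; move: (n %% 4)%N => k.
  by case: k => [|[|[|[|]]]].
move=> F z pz m ncm.
have m2 : (4 %| m * 2)%N.
  rewrite (_ : 4 = 2 * 2)%N// dvdn_pmul2r//.
  by apply: contraR ncm; rewrite dvdn2 negbK -coprime2n coprime_sym => h; rewrite -[4%N]/(2 ^ 2)%N coprimeXr.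
move: m2; rewrite (prim_order_dvd pz) => /eqP m2.
rewrite !big_ord_recr big_ord0 /= /chi4 /= !mul0r !addr0 !add0r mul1n.
rewrite (_ : (3 * m = m + m * 2)%N); last by lia.
by rewrite exprD m2 mulr1; ring.
Qed.

Lemma gauss_char_chi8 : gauss_char 8 chi8.
Proof.
apply: gauss_char_intro => //.
- by move=> n; rewrite /chi8 modnDr.
- apply: (@table_mul 8 (fun n => nth 0 [:: 0; 1; 0; -1; 0; -1; 0; 1] n)) => // m n.
  by case: m => [|[|[|[|[|[|[|[|]]]]]]]] // _; case: n => [|[|[|[|[|[|[|[|]]]]]]]].
- move=> n; rewrite /chi8 -coprime_modl.
  have := @ltn_pmod n 8 isT; move: (n %% 8)%N => k.
  by case: k => [|[|[|[|[|[|[|[|]]]]]]]].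
move=> F z pz m ncm.
have m2 : (8 %| m * 4)%N.
  rewrite (_ : 8 = 2 * 4)%N// dvdn_pmul2r//.
  by apply: contraR ncm; rewrite dvdn2 negbK -coprime2n coprime_sym => h; rewrite -[8%N]/(2 ^ 3)%N coprimeXr.
move: m2; rewrite (prim_order_dvd pz) => /eqP m2.
rewrite !big_ord_recr big_ord0 /= /chi8 /= !mul0r !addr0 !add0r mul1n.
rewrite (_ : (5 * m = m + m * 4)%N); last by lia.
rewrite (_ : (7 * m = 3 * m + m * 4)%N); last by lia.
by rewrite !exprD m2 !mulr1; ring.
Qed.

Lemma gauss_char_chi8m : gauss_char 8 chi8m.
Proof.
apply: gauss_char_intro => //.
- by move=> n; rewrite /chi8m modnDr.
- apply: (@table_mul 8 (fun n => nth 0 [:: 0; 1; 0; 1; 0; -1; 0; -1] n)) => // m n.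
  by case: m => [|[|[|[|[|[|[|[|]]]]]]]] // _; case: n => [|[|[|[|[|[|[|[|]]]]]]]].
- move=> n; rewrite /chi8m -coprime_modl.
  have := @ltn_pmod n 8 isT; move: (n %% 8)%N => k.
  by case: k => [|[|[|[|[|[|[|[|]]]]]]]].
move=> F z pz m ncm.
have m2 : (8 %| m * 4)%N.
  rewrite (_ : 8 = 2 * 4)%N// dvdn_pmul2r//.
  by apply: contraR ncm; rewrite dvdn2 negbK -coprime2n coprime_sym => h; rewrite -[8%N]/(2 ^ 3)%N coprimeXr.
move: m2; rewrite (prim_order_dvd pz) => /eqP m2.
rewrite !big_ord_recr big_ord0 /= /chi8m /= !mul0r !addr0 !add0r mul1n.
rewrite (_ : (5 * m = m + m * 4)%N); last by lia.
rewrite (_ : (7 * m = 3 * m + m * 4)%N); last by lia.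
by rewrite !exprD m2 !mulr1; ring.
Qed.

End SmallConductors.

(** * Quadratic reciprocity from Gauss sums in characteristic l *)

Section Reciprocity.

(** In the field with l^totient(q) elements, Euler's theorem makes [q] divide the order of the
    cyclic multiplicative group. *)
Lemma prim_root_pchar (l q : nat) : prime l -> (0 < q)%N -> coprime l q ->
  exists F : fieldType, exists2 z : F, q.-primitive_root z & l \in [pchar F].
Proof.
move=> pl q0 clq.
have t0 : (0 < totient q)%N by rewrite totient_gt0.
have [F chF cF] := pPrimePowerField pl t0.
pose n := #|F|.-1.
have n1 : (1 < #|F|)%N by exact: finNzRing_gt1.
have n0 : (0 < n)%N by rewrite /n -ltnS prednK// (leq_trans _ n1).
have qn : (q %| n)%N.
  rewrite /n cF -subn1 -eqn_mod_dvd ?expn_gt0 ?prime_gt0//.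
  by apply/eqP; exact: cyclic.Euler_exp_totient.
have : has n.-primitive_root (enum [pred x : F | x != 0]).
  apply: cyclic.has_prim_root => //.
  - apply/allP => x; rewrite mem_enum inE => x0; apply/unity_rootP.
    apply: (mulfI x0); rewrite -exprS mulr1 /n prednK ?expf_card// (leq_trans _ n1)//.
  - exact: enum_uniq.
  - rewrite -cardE; have := cardC (pred1 (0 : F)); rewrite card1 => e.
    rewrite /n -e add1n /=; apply/subset_leq_card/fintype.subsetP => x.
    by [].
move=> /hasP[x _ px].
by exists F; exists (x ^+ (n %/ q)) => //; exact: dvdn_prim_root.
Qed.

(** Frobenius multiplies the Gauss sum G by chi(l), while G^2 = chi(-1) q; dividing G^l by G gives
    the claim. This is quadratic reciprocity, with chi(-1) q as the discriminant. *)
Lemma gauss_char_euler (q : nat) (chi : nat -> int) (l : nat) :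
  gauss_char q chi -> prime l -> odd l -> coprime l q ->
  ((chi q.-1 * q%:Z)%:~R : 'F_l) ^+ l.-1./2 = (chi l)%:~R.
Proof.
move=> h pl ol clq.
have q0 := gauss_char_gt0 h.
have [F [z pz chF]] := prim_root_pchar pl q0 clq.
have ld (k : int) (F' : fieldType) : l \in [pchar F'] -> ((l %| k)%Z) = (k%:~R == 0 :> F').
  by move=> h'; exact: dvdz_pcharf.
set d := chi q.-1 * q%:Z; set k := l.-1./2.
have lk : l = k.*2.+1.
  by rewrite /k; move: ol; lia.
(* Both sides are images of integers, so the equality may be checked in any field of characteristic
   [l], here the one containing the root of unity. *)
suff : (d ^+ k - chi l)%:~R == 0 :> F.
  rewrite -(ld _ _ chF) (ld _ _ (pchar_Fp pl)) intrB subr_eq0 => /eqP <-.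
  by rewrite rmorphXn.
have [_ _ _ _ /(_ F _ pz) gs] := h.
have G2 := gauss_sum_sqr h pz.
set G := \sum_(r < q) _ in G2 gs.
have G0 : G != 0.
  rewrite -sqrf_eq0 G2 mulf_eq0 negb_or -(dvdn_pcharf chF) -prime_coprime// clq andbT.
  by case: (gauss_char_N1 h) => ->; rewrite ?mulrNz ?oppr_eq0 mulr1z oner_eq0.
have Gl : G ^+ l = (chi l)%:~R * G.
  rewrite -(pFrobenius_autE chF) rmorph_sum /= -gs; apply: eq_bigr => r _.
  by rewrite rmorphM rmorph_int rmorphXn /= pFrobenius_autE -exprM mulnC.
apply/eqP/(mulIf G0); rewrite mul0r intrB mulrBl -Gl lk exprSr -mul2n exprM G2.
by rewrite /d rmorphXn /= intrM subrr.
Qed.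

End Reciprocity.

Section Legendre.
Variables (p : nat).
Hypotheses (pp : prime p) (op : odd p).

(** Euler's formula serves as the definition, which puts the link with [gauss_char_euler] and the
    multiplicativity within easy reach; actual square roots come back through [euler_criterion]. *)
Definition legendre (n : nat) : int :=
  let x := (n%:R : 'F_p) ^+ p.-1./2 in
  if x == 0 then 0 else if x == 1 then 1 else -1.

Let p2 : (2 < p)%N.
Proof. by case: (p) pp op => [|[|[|]]]. Qed.

Let pk : p = p.-1./2.*2.+1.
Proof. by move: op; lia. Qed.

Let k_gt0 : (0 < p.-1./2)%N.
Proof. by move: p2 op; lia. Qed.

Lemma natF_eq0 n : ((n%:R : 'F_p) == 0) = (p %| n)%N.
Proof. by rewrite (dvdn_pcharf (pchar_Fp pp)). Qed.

Let n2F : (1 : 'F_p) != -1.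
Proof. by rewrite -subr_eq0 opprK -[1 + 1]/(2%:R : 'F_p) natF_eq0 gtnNdvd. Qed.

Lemma fermat_F (x : 'F_p) : x != 0 -> x ^+ p.-1 = 1.
Proof.
move=> x0; apply: (mulfI x0); rewrite -exprS mulr1 prednK ?prime_gt0//.
by have := expf_card x; rewrite card_Fp.
Qed.

Let sqr_half (x : 'F_p) : x != 0 -> (x ^+ p.-1./2) ^+ 2 = 1.
Proof.
move=> x0; rewrite -exprM muln2 -[RHS](fermat_F x0); congr (_ ^+ _).
by rewrite [in RHS]pk.
Qed.

Lemma legendreE n : (legendre n)%:~R = (n%:R : 'F_p) ^+ p.-1./2.
Proof.
rewrite /legendre; case: eqP => [->//|/eqP]; rewrite expf_eq0 k_gt0 /= => n0.
case: eqP => [->//|/eqP x1].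
have /eqP := sqr_half n0; rewrite sqrf_eq1 (negbTE x1) /= => /eqP ->.
by rewrite mulrNz mulr1z.
Qed.

Lemma legendre_sqr n : legendre n ^+ 2 = (coprime n p)%:R.
Proof.
rewrite /legendre expf_eq0 k_gt0 /= natF_eq0 coprime_sym prime_coprime//.
case: (p %| n)%N => /=; first by rewrite expr0n.
by case: ifP => _; rewrite ?sqrrN expr1n.
Qed.

Lemma legendre_inj (a b : int) : a \in [:: 0; 1; -1] -> b \in [:: 0; 1; -1] ->
  (a%:~R : 'F_p) = b%:~R -> a = b.
Proof.
have h10 : ((1 : 'F_p) == 0) = false by rewrite oner_eq0.
have h01 : ((0 : 'F_p) == 1) = false by rewrite eq_sym oner_eq0.
have hN0 : ((-1 : 'F_p) == 0) = false by rewrite oppr_eq0 oner_eq0.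
have h0N : ((0 : 'F_p) == -1) = false by rewrite eq_sym oppr_eq0 oner_eq0.
have h1N := negbTE n2F.
have hN1 : ((-1 : 'F_p) == 1) = false by rewrite eq_sym.
have eN : ((-1 : int)%:~R : 'F_p) = -1 by rewrite mulrNz mulr1z.
rewrite !inE => /or3P[] /eqP -> /or3P[] /eqP -> //;
  by rewrite ?eN ?mulr1z ?mulr0z => /eqP; rewrite ?h10 ?h01 ?hN0 ?h0N ?h1N ?hN1.
Qed.

Lemma legendre_in n : legendre n \in [:: 0; 1; -1].
Proof. by rewrite /legendre; case: ifP => // _; case: ifP. Qed.

Lemma mem_mul_signs (a b : int) : a \in [:: 0; 1; -1] -> b \in [:: 0; 1; -1] ->
  a * b \in [:: 0; 1; -1].
Proof. by rewrite !inE => /or3P[] /eqP -> /or3P[] /eqP ->. Qed.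

Lemma legendreM m n : legendre (m * n) = legendre m * legendre n.
Proof.
apply: legendre_inj; [exact: legendre_in|exact: mem_mul_signs (legendre_in _) (legendre_in _)|].
by rewrite intrM !legendreE natrM exprMn.
Qed.

Lemma Fp_primitive_root : exists n : nat, p.-1.-primitive_root (n%:R : 'F_p).
Proof.
have n0 : (0 < p.-1)%N by move: p2; lia.
have : has p.-1.-primitive_root (enum [pred x : 'F_p | x != 0]).
  apply: cyclic.has_prim_root => //.
  - apply/allP => x; rewrite mem_enum inE => x0; apply/unity_rootP; exact: fermat_F.
  - exact: enum_uniq.
  - rewrite -cardE; have := cardC (pred1 (0 : 'F_p)); rewrite card1 card_Fp// => e.
    rewrite -[X in (X.-1 <= _)%N]e add1n /=.
    by apply/subset_leq_card/fintype.subsetP => x.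
move=> /hasP[x _ px]; exists (nat_of_ord x).
by rewrite natr_Zp.
Qed.

(** Writing [n] as a power of a primitive root modulo [p], the power with exponent (p - 1)/2 can be
    1 only when the exponent of the root is even. *)
Lemma euler_criterion n : legendre n = 1 -> exists x : nat, (x ^ 2 = n %[mod p])%N.
Proof.
move=> h; have := legendreE n; rewrite h mulr1z => /esym n1.
have [g pg] := Fp_primitive_root.
have n0 : (n%:R : 'F_p) != 0.
  by apply/eqP => e; move: n1; rewrite e expr0n eqn0Ngt k_gt0 => /eqP; rewrite eq_sym oner_eq0.
have [[i /= _] e] := prim_rootP pg (fermat_F n0).
have {}pk2 : p.-1 = (p.-1./2 * 2)%N by rewrite muln2 [in LHS]pk.
move: n1; rewrite e -exprM => /eqP; rewrite -(prim_order_dvd pg) [X in (X %| _)%N]pk2 mulnC.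
rewrite dvdn_pmul2r// => /dvdnP[j ij]; exists (g ^ j)%N.
have : (((g ^ j) ^ 2)%N%:R : 'F_p) = n%:R by rewrite e ij -expnM natrX.
by move=> /(congr1 val) /=; rewrite !val_Fp_nat.
Qed.

(** When [p] divides m all powers of z are 1 and the sum is that of all symbols; multiplication by a
    primitive root, whose symbol is -1, changes its sign. *)
Lemma gauss_char_legendre : gauss_char p legendre.
Proof.
have p0 := prime_gt0 pp.
have per n : legendre (n + p) = legendre n.
  by rewrite /legendre natrD pchar_Fp_0// addr0.
apply: gauss_char_intro => //; [exact: legendreM|exact: legendre_sqr|].
move=> K z pz m; rewrite coprime_sym prime_coprime// negbK => pm.
have zm r : z ^+ (r * m) = 1.
  by apply/eqP; rewrite -(prim_order_dvd pz) dvdn_mull.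
under eq_bigr do rewrite zm mulr1.
rewrite -rmorph_sum /=.
suff -> : \sum_(r < p) legendre r = 0 by [].
have [g pg] := Fp_primitive_root.
have g0 : (g%:R : 'F_p) != 0.
  by rewrite (prim_root_eq0 pg) -lt0n; move: p2; lia.
have cg : coprime g p by rewrite coprime_sym prime_coprime// -natF_eq0.
have lg : legendre g = -1.
  rewrite /legendre expf_eq0 (negbTE g0) andbF.
  rewrite -(prim_order_dvd pg) ifF//.
  by apply/negbTE/negP => /dvdn_leq; move: p2 op; lia.
have := @sum_residues_mul _ legendre p g p0 cg per.
under eq_bigr do rewrite legendreM lg mulrN1.
rewrite sumrN => /eqP; rewrite eq_sym -addr_eq0 -mulr2n mulrn_eq0 => /eqP.
by [].
Qed.

Lemma legendre_N1 : legendre p.-1 = chi4 p.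
Proof.
have c4 : chi4 p \in [:: 0; 1; -1].
  by rewrite /chi4; have := @ltn_pmod p 4 isT; case: (p %% 4)%N => [|[|[|[|]]]].
apply: legendre_inj; [exact: legendre_in|exact: c4|].
rewrite legendreE.
have -> : (p.-1%:R : 'F_p) = -1.
  by apply/eqP; rewrite -addr_eq0 natr1 prednK ?prime_gt0// pchar_Fp_0.
rewrite -signr_odd /chi4.
have -> : odd p.-1./2 = (p %% 4 == 3)%N by move: op; lia.
have : (p %% 4 = 1 \/ p %% 4 = 3)%N by move: op; lia.
by case=> -> /=; rewrite ?expr0 ?expr1 ?mulrNz mulr1z.
Qed.

(** [gauss_char_euler] for the character modulo 8 evaluates the Euler power of 8, and 8 = 2^3
    differs from 2 by a square. *)
Lemma legendre_2 : legendre 2 = chi8 p.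
Proof.
have c8 : chi8 p \in [:: 0; 1; -1].
  by rewrite /chi8; have := @ltn_pmod p 8 isT; case: (p %% 8)%N => [|[|[|[|[|[|[|[|]]]]]]]].
apply: legendre_inj; [exact: legendre_in|exact: c8|].
have cp8 : coprime p 8 by rewrite (_ : 8 = 2 ^ 3)%N// coprimeXr// coprime_sym coprime2n.
rewrite -(gauss_char_euler gauss_char_chi8 pp op cp8).
rewrite legendreE [chi8 8.-1]/(1 : int) mul1r.
have n2 : (2%:R : 'F_p) != 0 by rewrite natF_eq0 gtnNdvd.
have -> : ((8%:Z)%:~R : 'F_p) = 2%:R ^+ 3 by rewrite -natrX.
by rewrite -exprM mulnC exprM [in RHS]exprS sqr_half// mulr1.
Qed.

End Legendre.

Section Existence.

(** The product of the Legendre symbols of the primes dividing [q]. The formulas for the values at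
    -1 and 2 hold for each prime and pass to the product because [chi4] and [chi8] are
    multiplicative. *)
Lemma odd_conductor (q : nat) : odd q -> (forall p, prime p -> ~~ (p ^ 2 %| q)%N) ->
  exists chi, [/\ gauss_char q chi, chi q.-1 = chi4 q & chi 2%N = chi8 q].
Proof.
have [n] := ubnP q; elim: n q => // n IH q qn oq sf.
have q0 : (0 < q)%N by case: (q) oq.
have [q1|q1] := leqP q 1.
  have -> : q = 1%N by apply/eqP; rewrite eqn_leq q1.
  by exists (fun=> 1); split => //; exact: gauss_char_trivial.
pose p := pdiv q; have pp : prime p by exact: pdiv_prime.
have /dvdnP[q' qE] := pdiv_dvd q.
rewrite -/p in qE.
have op : odd p by move: oq; rewrite qE oddM => /andP[].
have oq' : odd q' by move: oq; rewrite qE oddM => /andP[].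
have cpq : coprime p q'.
  rewrite prime_coprime//; apply/negP => /dvdnP[k kE].
  by have := sf _ pp; rewrite qE kE -mulnA mulnn dvdn_mull.
have q'0 : (0 < q')%N by case: (q') oq'.
have [||chi [h1 h2 h3]] := IH q' _ oq'.
- have q'q : (q' < q)%N by rewrite qE -{1}(muln1 q') ltn_pmul2l// prime_gt1.
  by rewrite (leq_trans q'q)// -ltnS.
- by move=> r pr; apply: contra (sf _ pr) => rq'; rewrite qE dvdn_mulr.
exists (fun n => chi n * legendre p n); have hl := gauss_char_legendre pp op; split.
- by rewrite qE; apply: gauss_char_mul => //; rewrite coprime_sym.
- rewrite qE (gauss_char_mul_N1 h1 hl) h2 legendre_N1//.
  by rewrite (gauss_charM gauss_char_chi4).
- by rewrite h3 legendre_2// qE (gauss_charM gauss_char_chi8).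
Qed.

Definition squarefree (m : int) := forall p : nat, prime p -> ~~ (p ^ 2 %| `|m|)%N.

Definition disc (m : int) : int := if (m == 1 %[mod 4])%Z then m else 4 * m.

Lemma quadratic_char (m : int) : squarefree m ->
  exists q chi, [/\ gauss_char q chi, chi q.-1 * q%:Z = disc m
    & (odd q -> chi 2%N = chi8 q)].
Proof.
move=> sf; rewrite /disc.
have s4 : chi4 `|m| = (if (`|m| %% 4 == 1)%N then 1 else if (`|m| %% 4 == 3)%N then -1 else 0).
  by rewrite /chi4; have := @ltn_pmod `|m| 4 isT; case: (_ %% 4)%N => [|[|[|[|]]]].
have [om|em] := boolP (odd `|m|).
  have [chi [h1 h2 h3]] := odd_conductor om sf.
  have c4m : coprime `|m| 4 by rewrite (_ : 4 = 2 ^ 2)%N// coprimeXr// coprime_sym coprime2n.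
  have mm : `|m|%N%:Z = m \/ `|m|%N%:Z = - m by lia.
  (* For odd m, chi4(|m|) |m| is the one of m and - m that is congruent to 1 modulo 4. *)
  have [m1|m1] : (m == 1 %[mod 4])%Z /\ chi4 `|m| * `|m|%N%:Z = m \/
      (m == 1 %[mod 4])%Z = false /\ chi4 `|m| * `|m|%N%:Z = - m.
    have [m4|m4] : (`|m| %% 4 = 1 \/ `|m| %% 4 = 3)%N by move: om; lia.
      rewrite s4 m4 /= mul1r; case: mm => e; rewrite e.
        by left; split => //; lia.
      by right; split => //; lia.
    rewrite s4 m4 /= mulN1r; case: mm => e; rewrite e ?opprK.
      by right; split => //; lia.
    by left; split => //; lia.
  - case: m1 => -> e; exists `|m|%N, chi; split => //; by rewrite h2.
  case: m1 => -> e.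
  exists (`|m| * 4)%N, (fun n => chi n * chi4 n); split.
  - by apply: gauss_char_mul gauss_char_chi4 _.
  - rewrite (gauss_char_mul_N1 h1 gauss_char_chi4) h2 (_ : chi4 4.-1 = -1)// PoszM.
    rewrite (_ : 4 * m = - (4 * - m)); last by ring.
    by rewrite -e; ring.
  - by rewrite oddM andbF.
have /dvdnP[k kE] : (2 %| `|m|)%N by rewrite dvdn2.
have ok : odd k.
  apply/negPn/negP; rewrite -dvdn2 => /dvdnP[j jE].
  by have := sf 2%N isT; rewrite kE jE -mulnA dvdn_mull.
have sfk p : prime p -> ~~ (p ^ 2 %| k)%N.
  by move=> pr; apply: contra (sf _ pr) => pk; rewrite kE dvdn_mulr.
have [chi [h1 h2 h3]] := odd_conductor ok sfk.
have k4 : chi4 k = (if (k %% 4 == 1)%N then 1 else if (k %% 4 == 3)%N then -1 else 0).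
  by rewrite /chi4; have := @ltn_pmod k 4 isT; case: (_ %% 4)%N => [|[|[|[|]]]].
have ck8 : coprime k 8 by rewrite (_ : 8 = 2 ^ 3)%N// coprimeXr// coprime_sym coprime2n.
rewrite ifF; last by move: kE; lia.
have N1 : `|m|%N%:Z = m \/ `|m|%N%:Z = - m by lia.
have [e|e] : chi4 k * `|m|%N%:Z = m \/ chi4 k * `|m|%N%:Z = - m.
- have [k1|k1] : (k %% 4 = 1 \/ k %% 4 = 3)%N by move: ok; lia.
    by rewrite k4 k1 /= mul1r.
  by rewrite k4 k1 /= mulN1r; case: N1 => ->; rewrite ?opprK; [right|left].
- exists (k * 8)%N, (fun n => chi n * chi8 n); split.
  + exact: gauss_char_mul gauss_char_chi8 _.
  + rewrite (gauss_char_mul_N1 h1 gauss_char_chi8) h2 [chi8 8.-1]/(1 : int) mulr1.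
    by rewrite PoszM -e kE PoszM; ring.
  + by rewrite oddM andbF.
- exists (k * 8)%N, (fun n => chi n * chi8m n); split.
  + exact: gauss_char_mul gauss_char_chi8m _.
  + rewrite (gauss_char_mul_N1 h1 gauss_char_chi8m) h2 [chi8m 8.-1]/(-1 : int) mulrN1.
    by rewrite -[m]opprK -e PoszM kE PoszM; ring.
  + by rewrite oddM andbF.
Qed.

End Existence.

(** * The functional equation of L(s, chi) *)

Section TrigonometricGaussSums.
Variable R : realType.
Local Notation C := R[i].

Definition cis (t : R) : C := (cos t +i* sin t)%C.

Lemma cisD (a b : R) : cis (a + b) = cis a * cis b.
Proof. by rewrite /cis cosD sinD; simpc; congr (_ +i* _)%C; ring. Qed.

Lemma cis0 : cis 0 = 1.
Proof. by rewrite /cis cos0 sin0. Qed.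

Lemma cisX (t : R) n : cis t ^+ n = cis (t * n%:R).
Proof.
elim: n => [|n IH]; first by rewrite expr0 mulr0 cis0.
by rewrite exprSr IH -cisD -natr1 mulrDr mulr1.
Qed.

Lemma normc_cis (t : R) : normc (cis t) = 1.
Proof. by rewrite /= cos2Dsin2 sqrtr1. Qed.

Lemma cis_2pi : cis (2 * pi) = 1.
Proof. by rewrite /cis mulr_natl cos2pi sin2pi. Qed.

Lemma cis_neq1 (t : R) : 0 < t < 2 * pi -> cis t != 1.
Proof.
move=> /andP[t0 t2]; apply/eqP => -[c1 _].
have s0 : 0 < sin (t / 2).
  by apply: sin_gt0_pi; rewrite divr_gt0//= ltr_pdivrMr// mulrC.
move: c1; rewrite (_ : t = (t / 2) *+ 2); last by rewrite mulr2n -splitr.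
rewrite cos_mulr2n cos2sin2 => e.
have : 0 < sin (t / 2) ^+ 2 by rewrite exprn_gt0.
by move: e; set x := sin _ ^+ 2; lra.
Qed.

Lemma cis_primitive_root (n : nat) : (0 < n)%N ->
  n.-primitive_root (cis (2 * pi / n%:R)).
Proof.
move=> n0; have nR : (n%:R : R) != 0 by rewrite pnatr_eq0 -lt0n.
apply/andP; split => //; apply/forallP => i; apply/eqP.
rewrite unity_rootE cisX.
have [e|ne] := eqVneq i.+1 n; first by rewrite e divfK// cis_2pi eqxx.
apply/negbTE/cis_neq1.
have pp : 0 < 2 * pi :> R by rewrite mulr_gt0// pi_gt0.
have ni : (i.+1 < n)%N by rewrite ltn_neqAle ne ltn_ord.
apply/andP; split; first by rewrite mulr_gt0// divr_gt0// ltr0n.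
by rewrite -mulrA gtr_pMr// mulrC ltr_pdivrMr ?ltr0n// mul1r ltr_nat.
Qed.

Lemma sum_mul_ord (V : nmodType) (f : nat -> V) (q N : nat) :
  \sum_(m < q * N) f m = \sum_(j < N) \sum_(k < q) f (q * j + k)%N.
Proof.
elim: N => [|N IH]; first by rewrite muln0 !big_ord0.
rewrite mulnS addnC big_split_ord /= IH big_ord_recr /=; congr (_ + _).
Qed.

(** Writing m = q j + k, the sum over j detects whether [N] divides [n], and the sum over k is then
    the Gauss relation at n / N. *)
Lemma gauss_sum_multiple (q : nat) (chi : nat -> int) (F : fieldType) (w : F) (N n : nat) :
  gauss_char q chi -> (0 < N)%N -> (q * N).-primitive_root w ->
  \sum_(m < q * N) (chi m)%:~R * w ^+ (m * n) =
  if (N %| n)%N then N%:R * (chi (n %/ N)%N)%:~R * \sum_(k < q) (chi k)%:~R * (w ^+ N) ^+ k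
  else 0.
Proof.
move=> h N0 pw; have q0 := gauss_char_gt0 h.
have pN : N.-primitive_root (w ^+ q).
  by have := dvdn_prim_root pw (dvdn_mull q (dvdnn N)); rewrite mulnK.
have pq : q.-primitive_root (w ^+ N).
  by have := dvdn_prim_root pw (dvdn_mulr N (dvdnn q)); rewrite mulKn.
rewrite (sum_mul_ord (fun m => (chi m)%:~R * w ^+ (m * n))).
rewrite exchange_big /=.
transitivity (\sum_(k < q) (chi k)%:~R * w ^+ (k * n) * (if (N %| n)%N then N%:R else 0) : F).
  apply: eq_bigr => k _; rewrite -(sum_prim_root n pN) mulr_sumr.
  apply: eq_bigr => j _.
  rewrite addnC [(q * j)%N]mulnC (gauss_char_addM h) -mulrA -!exprM -exprD.
  by congr (_ * _ ^+ _); ring.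
rewrite -mulr_suml; case: ifP => [/dvdnP[l ->]|]; last by rewrite mulr0.
rewrite mulnK// mulrC -mulrA; congr (_ * _).
have [_ _ _ _ /(_ F _ pq l) <-] := h.
by apply: eq_bigr => k _; rewrite -exprM; congr (_ * _ ^+ _); ring.
Qed.

Definition trig (b : bool) : R -> R := if b then @sin R else @cos R.

(** The square of the Gauss sum is q or - q, so the sum is real for even and purely imaginary for
    odd characters; [tau] is its nonzero coordinate, with a sign left open. Taking that coordinate
    on both sides leaves cosines or sines. *)
Lemma gauss_trig (q : nat) (chi : nat -> int) : gauss_char q chi ->
  exists2 tau : R, tau ^+ 2 = q%:R & forall N n, (0 < N)%N ->
  \sum_(m < q * N) (chi m)%:~R * trig (chi q.-1 == -1) (2 * pi / (q * N)%:R * (m * n)%:R) =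
  if (N %| n)%N then N%:R * (chi (n %/ N)%N)%:~R * tau else 0.
Proof.
move=> h; have q0 := gauss_char_gt0 h.
have qR : 0 < q%:R :> R by rewrite ltr0n.
pose G : C := \sum_(k < q) (chi k)%:~R * (cis (2 * pi / q%:R)) ^+ k.
have G2 : G ^+ 2 = (chi q.-1)%:~R * q%:R by rewrite /G (gauss_sum_sqr h (cis_primitive_root q0)).
have GN N n : (0 < N)%N -> \sum_(m < q * N) (chi m)%:~R * cis (2 * pi / (q * N)%:R * (m * n)%:R) =
    if (N %| n)%N then N%:R * (chi (n %/ N)%N)%:~R * G else 0.
  move=> N0; have qN0 : (0 < q * N)%N by rewrite muln_gt0 q0.
  under eq_bigr do rewrite -cisX.
  have E := gauss_sum_multiple n h N0 (cis_primitive_root qN0).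
  refine (etrans E _) => {E}.
  have zN : cis (2 * pi / (q * N)%:R) ^+ N = cis (2 * pi / q%:R).
    by rewrite cisX natrM invfM mulrA -mulrA mulVf ?mulr1// pnatr_eq0 -lt0n.
  by rewrite zN.
have intC (k : int) : (k%:~R : C) = ((k%:~R : R) +i* 0)%C.
  by rewrite -[RHS]/((k%:~R : R)%:C)%C rmorph_int.
have natC (k : nat) : (k%:R : C) = ((k%:R : R) +i* 0)%C.
  by rewrite -[RHS]/((k%:R : R)%:C)%C rmorph_nat.
have ReS N (f : 'I_N -> C) : complex.Re (\sum_(m < N) f m) = \sum_(m < N) complex.Re (f m).
  by apply: (big_morph (@complex.Re R)) => // -[? ?] [].
have ImS N (f : 'I_N -> C) : complex.Im (\sum_(m < N) f m) = \sum_(m < N) complex.Im (f m).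
  by apply: (big_morph (@complex.Im R)) => // -[? ?] [].
move: G2 GN; case: G => a b; rewrite expr2 intC natC; simpc => -[e1 e2] GN.
have ab0 : a * b = 0.
  by move: e2; rewrite [b * a]mulrC => e2; move: e2; lra.
case: (gauss_char_N1 h) => hN; rewrite hN in e1 *.
  have -> : (1 == -1 :> int) = false by [].
  rewrite mulr1z mul1r in e1.
  have b0 : b = 0.
    move/eqP: ab0; rewrite mulf_eq0 => /orP[] /eqP // a0.
    by move: e1; rewrite a0 mul0r => e1; have := sqr_ge0 b; rewrite expr2; lra.
  exists a; first by rewrite expr2 -e1 b0; ring.
  move=> N n N0; have /(congr1 (@complex.Re R)) := GN N n N0.
  rewrite ReS => E.
  transitivity (\sum_(m < q * N) complex.Re ((chi m)%:~R * cis (2 * pi / (q * N)%:R * (m * n)%:R) : C)).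
    by apply: eq_bigr => m _; rewrite intC /cis; simpc.
  rewrite E; case: ifP => // _; rewrite intC natC; simpc => /=.
  by ring.
have -> : (-1 == -1 :> int) by [].
rewrite mulrNz mulr1z mulN1r in e1.
have a0 : a = 0.
  move/eqP: ab0; rewrite mulf_eq0 => /orP[] /eqP // b0.
  by move: e1; rewrite b0 mul0r => e1; have := sqr_ge0 a; rewrite expr2; lra.
exists b; first by move: e1; rewrite a0 expr2; lra.
move=> N n N0; have /(congr1 (@complex.Im R)) := GN N n N0.
rewrite ImS => E.
transitivity (\sum_(m < q * N) complex.Im ((chi m)%:~R * cis (2 * pi / (q * N)%:R * (m * n)%:R) : C)).
  by apply: eq_bigr => m _; rewrite intC /cis; simpc.
rewrite E; case: ifP => // _; rewrite intC natC; simpc => /=.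
by ring.
Qed.

End TrigonometricGaussSums.

Section PathDerivative.
Variable R : realType.
Local Notation C := R[i].

Definition path_diff (f : R -> C) (d : C) (t : R) : Prop :=
  is_derive t 1 (fun u => complex.Re (f u)) (complex.Re d) /\
  is_derive t 1 (fun u => complex.Im (f u)) (complex.Im d).

Lemma path_diff_cst (c : C) t : path_diff (fun=> c) 0 t.
Proof. by split; exact: is_derive_cst. Qed.

Lemma path_diffD f g d e t : path_diff f d t -> path_diff g e t ->
  path_diff (fun u => f u + g u) (d + e) t.
Proof.
move=> [f1 f2] [g1 g2]; split.
  have -> : (fun u => complex.Re (f u + g u)) = (fun u => complex.Re (f u)) + (fun u => complex.Re (g u)).
    by apply/funext => u; rewrite [RHS]/(complex.Re (f u) + complex.Re (g u)); case: (f u); case: (g u).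
  apply: is_derive_eq; by case: (d); case: (e).
have -> : (fun u => complex.Im (f u + g u)) = (fun u => complex.Im (f u)) + (fun u => complex.Im (g u)).
  by apply/funext => u; rewrite [RHS]/(complex.Im (f u) + complex.Im (g u)); case: (f u); case: (g u).
apply: is_derive_eq; by case: (d); case: (e).
Qed.

Lemma path_diffM f g d e t : path_diff f d t -> path_diff g e t ->
  path_diff (fun u => f u * g u) (d * g t + f t * e) t.
Proof.
move=> [f1 f2] [g1 g2]; split.
  have -> : (fun u => complex.Re (f u * g u)) =
      (fun u => complex.Re (f u)) * (fun u => complex.Re (g u))
      - (fun u => complex.Im (f u)) * (fun u => complex.Im (g u)).
    apply/funext => u.
    rewrite [RHS]/(complex.Re (f u) * complex.Re (g u) - complex.Im (f u) * complex.Im (g u)).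
    by case: (f u) => ? ?; case: (g u).
  apply: is_derive_eq; rewrite /GRing.scale /=.
  by case: (d) => ? ?; case: (e) => ? ?; case: (f t) => ? ?; case: (g t) => ? ?; simpc => /=; ring.
have -> : (fun u => complex.Im (f u * g u)) =
    (fun u => complex.Re (f u)) * (fun u => complex.Im (g u))
    + (fun u => complex.Im (f u)) * (fun u => complex.Re (g u)).
  apply/funext => u.
  transitivity (complex.Re (f u) * complex.Im (g u) + complex.Im (f u) * complex.Re (g u)).
    by case: (f u) => u1 u2; case: (g u) => v1 v2; simpc.
  by [].
apply: is_derive_eq (is_deriveD (is_deriveM f1 g2) (is_deriveM f2 g1)) _.
rewrite /GRing.scale /=.
by case: (d) => ? ?; case: (e) => ? ?; case: (f t) => ? ?; case: (g t) => ? ?; simpc => /=; ring.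
Qed.

Lemma path_diff_eq f d e t : path_diff f d t -> d = e -> path_diff f e t.
Proof. by move=> ? <-. Qed.

Lemma path_diffX f d t n : path_diff f d t ->
  path_diff (fun u => f u ^+ n) (n%:R * d * f t ^+ n.-1) t.
Proof.
move=> fd; elim: n => [|n IH].
  apply: path_diff_eq (_ : 0 = _); last by rewrite !mul0r.
  by under [fun=> _]eq_fun do rewrite expr0; exact: path_diff_cst.
under [fun=> _]eq_fun do rewrite exprS.
apply: path_diff_eq (path_diffM fd IH) _.
case: n {IH} => [|n]; first by rewrite !expr0; ring.
by rewrite /= exprS -[n.+2%:R]natr1; ring.
Qed.

Lemma path_diff_sum (f : nat -> R -> C) (d : nat -> C) t n :
  (forall i, path_diff (f i) (d i) t) ->
  path_diff (fun u => \sum_(i < n) f i u) (\sum_(i < n) d i) t.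
Proof.
move=> fd; elim: n => [|n IH].
  by under [fun=> _]eq_fun do rewrite big_ord0; rewrite big_ord0; exact: path_diff_cst.
by under [fun=> _]eq_fun do rewrite big_ord_recr; rewrite big_ord_recr; exact: path_diffD.
Qed.

Lemma path_diff_real t : path_diff (fun u => u%:C%C) 1 t.
Proof. by split => /=; [exact: is_derive_id|exact: is_derive_cst]. Qed.

Lemma path_diff_cexp (a b : R -> R) (a' b' t : R) :
  is_derive t 1 a a' -> is_derive t 1 b b' ->
  path_diff (fun u => cexp (a u +i* b u)%C) ((a' +i* b')%C * cexp (a t +i* b t)%C) t.
Proof.
move=> da db.
have de : is_derive t 1 (@expR R \o a) (expR (a t) * a') by exact: is_derive1_comp.
have dc : is_derive t 1 (@cos R \o b) (- sin (b t) * b') by exact: is_derive1_comp.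
have ds : is_derive t 1 (@sin R \o b) (cos (b t) * b') by exact: is_derive1_comp.
split.
  have -> : (fun u => complex.Re (cexp (a u +i* b u)%C)) = (@expR R \o a) * (@cos R \o b) by [].
  apply: is_derive_eq; rewrite /GRing.scale /= /cexp; ring.
have -> : (fun u => complex.Im (cexp (a u +i* b u)%C)) = (@expR R \o a) * (@sin R \o b) by [].
apply: is_derive_eq; rewrite /GRing.scale /= /cexp; ring.
Qed.

(** The factor 2 comes from applying the mean value theorem to the two coordinates separately. *)
Lemma path_dist_le (f : R -> C) (d : R -> C) (a b M : R) : a <= b ->
  (forall t, a <= t <= b -> path_diff f (d t) t) ->
  (forall t, a <= t <= b -> normc (d t) <= M) ->
  normc (f b - f a) <= 2 * M * (b - a).
Proof.
move=> ab fd dM.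
have cst0 (x : R) : is_derive x 1 (fun _ : R => 0 : R) 0 by exact: is_derive_cst.
have h1 : `|(complex.Re (f b) - complex.Re (f a)) - (0 - 0)| <= M * (b - a).
  apply: (@derive_dist_le R (fun u => complex.Re (f u)) (fun=> 0) (fun u => complex.Re (d u)) (fun=> 0) a b M ab) => x xab.
  - exact: (fd x xab).1.
  - by rewrite subr0; apply: le_trans (dM _ xab); exact: le_normc_Re.
have h2 : `|(complex.Im (f b) - complex.Im (f a)) - (0 - 0)| <= M * (b - a).
  apply: (@derive_dist_le R (fun u => complex.Im (f u)) (fun=> 0) (fun u => complex.Im (d u)) (fun=> 0) a b M ab) => x xab.
  - exact: (fd x xab).2.
  - by rewrite subr0; apply: le_trans (dM _ xab); exact: le_normc_Im.
apply: le_trans (normc_le_ReIm _) _.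
rewrite !subr0 in h1 h2.
rewrite -mulrA mulr2n mulrDl mul1r.
by apply: lerD; [move: h1|move: h2]; case: (f b) => ? ?; case: (f a).
Qed.

End PathDerivative.

(** * The binomial series of (1 - z)^(s - 1) along rays *)

Section BinomialSeries.
Variable R : realType.
Local Notation C := R[i].

(* The coefficient of z^n in (1 - z)^(s - 1). *)
Definition bcoef (s : R) (n : nat) : R := \prod_(k < n) (1 - s / k.+1%:R).

Lemma bcoefS s n : bcoef s n.+1 = bcoef s n * (1 - s / n.+1%:R).
Proof. by rewrite /bcoef big_ord_recr. Qed.

Lemma bcoef_rec s n : n.+1%:R * bcoef s n.+1 = (n.+1%:R - s) * bcoef s n.
Proof.
have n0 : n.+1%:R != 0 :> R by rewrite pnatr_eq0.
by rewrite bcoefS mulrCA mulrC mulrBr mulr1 (mulrC _ (s / _)) divfK.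
Qed.

Lemma bcoef_factor (s : R) n : 0 < s < 1 -> 0 < 1 - s / n.+1%:R <= 1.
Proof.
move=> /andP[s0 s1]; have n0 : 0 < n.+1%:R :> R by rewrite ltr0n.
rewrite subr_gt0 ltr_pdivrMr// mul1r gerBl divr_ge0 ?ltW// andbT.
by apply: lt_le_trans s1 _; rewrite ler1n.
Qed.

Lemma bcoef_gt0 (s : R) n : 0 < s < 1 -> 0 < bcoef s n.
Proof. by move=> hs; apply: prodr_gt0 => k _; case/andP: (bcoef_factor k hs). Qed.

Lemma bcoef_nincr (s : R) m n : 0 < s < 1 -> (m <= n)%N -> bcoef s n <= bcoef s m.
Proof.
move=> hs; elim: n => [|n IH]; first by rewrite leqn0 => /eqP ->.
rewrite leq_eqVlt => /predU1P[->//|]; rewrite ltnS => /IH h.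
apply: le_trans h; rewrite bcoefS ger_pMr ?bcoef_gt0//.
by case/andP: (bcoef_factor n hs).
Qed.

Lemma bcoef_le1 (s : R) n : 0 < s < 1 -> bcoef s n <= 1.
Proof. by move=> hs; have := bcoef_nincr hs (leq0n n); rewrite /bcoef [leRHS]big_ord0. Qed.

(** With q the square root of r, K q^K is at most 1 + q + ... + q^(K-1) <= 1 / (1 - q), and the
    remaining factor q^K tends to 0. *)
Lemma natr_expr_cvg0 (r : R) : 0 <= r < 1 -> forall e : R, 0 < e ->
  exists K0 : nat, forall K, (K0 <= K)%N -> K%:R * r ^+ K <= e.
Proof.
move=> /andP[r0 r1] e e0; pose q := Num.sqrt r.
have q0 : 0 <= q by rewrite sqrtr_ge0.
have q1 : q < 1 by rewrite -sqrtr1 ltr_sqrt.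
have qb K : K%:R * q ^+ K <= (1 - q)^-1.
  have d0 : 0 < 1 - q by rewrite subr_gt0.
  rewrite -[leRHS]mul1r ler_pdivlMr//.
  apply: le_trans (_ : 1 - q ^+ K <= 1); last by rewrite gerBl exprn_ge0.
  have -> : 1 - q ^+ K = (1 - q) * \sum_(i < K) q ^+ i.
    by rewrite -opprB subrX1 -mulNr opprB.
  rewrite mulrC ler_pM2l// mulr_natl -[X in _ *+ X](card_ord K) -sumr_const.
  by apply: ler_sum => i _; apply: ler_wiXn2l; [|exact: ltW|exact: ltnW].
have d0 : 0 < e * (1 - q) by rewrite mulr_gt0// subr_gt0.
have := @cvg_geometric R 1 q; rewrite ger0_norm// => /(_ q1).
move=> /cvgrPdist_le /(_ _ d0) [K0 _ HK0]; exists K0 => K KK.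
have := HK0 K KK; rewrite sub0r normrN /geometric /= mul1r ger0_norm ?exprn_ge0// => hq.
have -> : r ^+ K = q ^+ K * q ^+ K by rewrite -exprMn -expr2 sqr_sqrtr.
rewrite mulrA; apply: le_trans (ler_pM _ _ (qb K) hq) _.
- by rewrite mulr_ge0 ?exprn_ge0.
- by rewrite exprn_ge0.
- by rewrite mulrC mulfK// gt_eqF// subr_gt0.
Qed.

Section PolarCoordinates.
Variable th : R.

(* The logarithm of |1 - t e^(i th)| and the opposite of its argument (principal
   value), so that [ray_exp k t] below is (1 - t e^(i th))^k. *)
Definition lam (t : R) := ln (1 - 2 * cos th * t + t * t) / 2.
Definition alp (t : R) := atan (sin th * t / (1 - cos th * t)).

Lemma is_derive_lam t : 0 < 1 - 2 * cos th * t + t * t ->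
  is_derive t 1 lam ((t - cos th) / (1 - 2 * cos th * t + t * t)).
Proof.
move=> rh; pose P : R -> R := cst 1 - cst (2 * cos th) * id + id * id.
have dP : is_derive t 1 P (2 * (t - cos th)).
  apply: is_derive_eq (is_deriveD (is_deriveB (is_derive_cst _ _ _)
    (is_deriveM (is_derive_cst _ _ _) (is_derive_id _ _))) (is_deriveM (is_derive_id _ _) (is_derive_id _ _))) _.
  by rewrite /GRing.scale /=; ring.
have Pt : 0 < P t by exact: rh.
have dl : is_derive t 1 (@ln R \o P) ((P t)^-1 * (2 * (t - cos th))).
  exact: (@is_derive1_comp _ _ _ _ _ _ (is_derive1_ln Pt) dP).
have -> : lam = (@ln R \o P) * cst 2^-1 by [].
apply: is_derive_eq; rewrite /GRing.scale /= -[P t]/(1 - 2 * cos th * t + t * t).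
by rewrite mulr0 add0r (mulrCA _ 2) (mulrA 2^-1) mulVf// mul1r mulrC.
Qed.

Lemma is_derive_alp t : 0 < 1 - cos th * t -> 0 < 1 - 2 * cos th * t + t * t ->
  is_derive t 1 alp (sin th / (1 - 2 * cos th * t + t * t)).
Proof.
move=> dn rh; pose D : R -> R := cst 1 - cst (cos th) * id.
have D0 : D t != 0 by rewrite gt_eqF.
have dD : is_derive t 1 D (- cos th).
  apply: is_derive_eq; rewrite /GRing.scale /=; ring.
have dV := is_deriveV D0 dD.
pose N : R -> R := cst (sin th) * id.
have dN : is_derive t 1 N (sin th).
  apply: is_derive_eq; rewrite /GRing.scale /=; ring.
have dQ := is_deriveM dN dV.
have da : is_derive t 1 (@atan R \o (N * (fun y => (D y)^-1))) (sin th / (1 - 2 * cos th * t + t * t)).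
  apply: is_derive_eq (@is_derive1_comp _ _ _ _ _ _ (is_derive1_atan _) dQ) _.
  rewrite /GRing.scale /= -[(N * _) t]/(sin th * t / (1 - cos th * t)).
  rewrite -[N t]/(sin th * t) -[D t]/(1 - cos th * t).
  move: dn rh {D0 dD dV dQ dN}.
  have : sin th ^+ 2 = 1 - cos th ^+ 2 by exact: sin2cos2.
  move: (sin th) (cos th) => S c S2 dn rh.
  have S2' : S * S = 1 - c ^+ 2 by rewrite -S2 expr2.
  have d0 : 1 - c * t != 0 by rewrite gt_eqF.
  have e1 : 1 + (S * t / (1 - c * t)) ^+ 2 = (1 - 2 * c * t + t * t) / (1 - c * t) ^+ 2.
    rewrite expr_div_n exprMn expr2 S2'; field; exact: d0.
  rewrite e1; have r0' : 1 - 2 * c * t + t * t != 0 by rewrite gt_eqF.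
  by field; rewrite d0 r0'.
exact: da.
Qed.

End PolarCoordinates.

Section Ray.
Variables (s th r : R).
Hypotheses (hs : 0 < s < 1) (r0 : 0 <= r) (r1 : r < 1).

Let den_gt0 t : 0 <= t <= r -> 0 < 1 - cos th * t.
Proof.
move=> /andP[t0 tr]; rewrite subr_gt0.
have : cos th * t <= 1 * t by rewrite ler_wpM2r// cos_le1.
by move: r1; lra.
Qed.

Let rho_gt0 t : 0 <= t <= r -> 0 < 1 - 2 * cos th * t + t * t.
Proof.
move=> tr; have -> : 1 - 2 * cos th * t + t * t = (1 - cos th * t) ^+ 2 + (sin th * t) ^+ 2.
  by rewrite exprMn sin2cos2; ring.
by rewrite ltr_wpDr ?sqr_ge0// exprn_gt0// den_gt0.
Qed.

Let dlam t (tr : 0 <= t <= r) := is_derive_lam (rho_gt0 tr).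
Let dalp t (tr : 0 <= t <= r) := is_derive_alp (den_gt0 tr) (rho_gt0 tr).

Let c := cis th.

Let normc_den t : 0 <= t <= r -> 1 - r <= normc (1 - t%:C%C * c).
Proof.
move=> /andP[t0 tr]; apply: le_trans (normc_dist_ge _ _).
rewrite normc1 normcM normc_cis mulr1 normc_real ger0_norm//.
by rewrite lerD2l lerN2.
Qed.

Definition ray_exp (k t : R) : C := cexp (k * lam th t +i* (- (k * alp th t)))%C.

Let y K t : C := \sum_(n < K) (bcoef s n)%:C%C * (t%:C%C * c) ^+ n.

Let path_ray k t : 0 <= t <= r -> path_diff (ray_exp k) (- (k%:C%C * c / (1 - t%:C%C * c)) * ray_exp k t) t.
Proof.
move=> tr.
have da : is_derive t 1 (cst k * lam th) (k * ((t - cos th) / (1 - 2 * cos th * t + t * t))).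
  have d := dlam tr; apply: is_derive_eq; rewrite /GRing.scale /=; ring.
have db : is_derive t 1 (- (cst k * alp th)) (- (k * (sin th / (1 - 2 * cos th * t + t * t)))).
  have d := dalp tr; apply: is_derive_eq; rewrite /GRing.scale /=; ring.
apply: path_diff_eq (path_diff_cexp da db) _; congr (_ * _).
have rh := rho_gt0 tr.
have d0 : 1 - t%:C%C * c != 0.
  by rewrite -normc_gt0; apply: lt_le_trans (normc_den tr); rewrite subr_gt0.
suff E : (k * ((t - cos th) / (1 - 2 * cos th * t + t * t))
    +i* - (k * (sin th / (1 - 2 * cos th * t + t * t))))%C * (1 - t%:C%C * c) = - (k%:C%C * c).
  by rewrite -[LHS](mulfK d0) E mulNr.
rewrite /c /cis; have s2 : sin th * sin th = 1 - cos th * cos th by rewrite -!expr2 sin2cos2.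
have u1 : (1 - 2 * cos th * t + t * t)^-1 * (1 - 2 * cos th * t + t * t) = 1 by rewrite mulVf// gt_eqF.
clear da db rh d0.
set u := (1 - 2 * cos th * t + t * t)^-1 in u1 *; clearbody u.
move: (cos th) (sin th) s2 u1 => C0 S s2 u1.
have S0 : 1 - C0 * C0 - S * S = 0 by rewrite s2 subrr.
simpc; congr (_ +i* _)%C.
  transitivity (- (k * C0) * (u * (1 - 2 * C0 * t + t * t)) + k * u * t * (1 - C0 * C0 - S * S)).
    by ring.
  by rewrite u1 S0; ring.
transitivity (- (k * S) * (u * (1 - 2 * C0 * t + t * t))).
  by ring.
by rewrite u1; ring.
Qed.

Let path_y K t : path_diff (y K) (\sum_(n < K) (bcoef s n)%:C%C * (n%:R * c * (t%:C%C * c) ^+ n.-1)) t.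
Proof.
apply: (@path_diff_sum _ (fun n t => (bcoef s n)%:C%C * (t%:C%C * c) ^+ n)
  (fun n => (bcoef s n)%:C%C * (n%:R * c * (t%:C%C * c) ^+ n.-1)) t K) => n.
have h : path_diff (fun t => t%:C%C * c) c t.
  apply: path_diff_eq (path_diffM (path_diff_real t) (path_diff_cst c t)) _.
  by rewrite mul1r mulr0 addr0.
apply: path_diff_eq (path_diffM (path_diff_cst _ t) (path_diffX n h)) _.
by rewrite mul0r add0r.
Qed.

(* The binomial recursion makes the differential equation
   (1 - z) Y' = (1 - s) Y telescope up to one boundary term. *)
Let y_ode K t : (1 - t%:C%C * c) * (\sum_(n < K) (bcoef s n)%:C%C * (n%:R * c * (t%:C%C * c) ^+ n.-1)) =
  (1 - s)%:C%C * c * y K t - c * (K%:R * (bcoef s K)%:C%C * (t%:C%C * c) ^+ K.-1).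
Proof.
set z := t%:C%C * c; rewrite /y -/z.
elim: K => [|K IH]; first by rewrite !big_ord0 !mulr0 !mul0r mulr0 subrr.
rewrite !big_ord_recr /= mulrDr IH [in RHS]mulrDr.
have rec : K.+1%:R * (bcoef s K.+1)%:C%C = (K.+1%:R - s%:C%C) * (bcoef s K)%:C%C :> C.
  have := congr1 (real_complex R) (bcoef_rec s K).
  by rewrite !rmorphM rmorphB /= !rmorph_nat.
rewrite rec rmorphB rmorph1 -[K.+1%:R]natr1.
case: K {IH rec} => [|K]; first by rewrite !mul0r expr0; ring.
by rewrite /= exprS; ring.
Qed.

Lemma normc_ray_exp k t : normc (ray_exp k t) = expR (k * lam th t).
Proof. by rewrite normc_cexp. Qed.

(** Multiplied by (1 - z)^(1 - s), an exact solution of the differential equation would be constant;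
    here the derivative of the product is the single boundary term left by [y_ode]. The product
    starts at 1, and |1 - z| lies between 1 - r and 2 along the ray. *)
Lemma binomial_ray_bound K : (0 < K)%N ->
  normc (y K r * ray_exp (1 - s) r - 1) <= 4 * (K%:R * r ^+ K) / (1 - r).
Proof.
move=> K0; have r1' : 0 < 1 - r by rewrite subr_gt0.
have s01 : 0 <= 1 - s <= 1 by move: hs; lra.
pose d t := - (c * (K%:R * (bcoef s K)%:C%C * (t%:C%C * c) ^+ K.-1)) / (1 - t%:C%C * c) * ray_exp (1 - s) t.
have dd t : 0 <= t <= r -> path_diff (fun t => y K t * ray_exp (1 - s) t) (d t) t.
  move=> tr; apply: path_diff_eq (path_diffM (path_y K t) (path_ray (1 - s) tr)) _.
  have d0 : 1 - t%:C%C * c != 0.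
    by rewrite -normc_gt0; apply: lt_le_trans (normc_den tr).
  rewrite mulrA -mulrDl /d; congr (_ * _).
  apply: (canRL (mulfK d0)); rewrite mulrDl [X in X + _]mulrC y_ode mulrN mulNr (mulrA (y K t)) divfK//.
  by ring.
have dle t : 0 <= t <= r -> normc (d t) <= 2 * (K%:R * r ^+ K.-1) / (1 - r).
  move=> tr; have /andP[t0 tr'] := tr.
  rewrite /d !normcM normcN !normcM normcV normc_cis mul1r normcX normcM normc_cis mulr1 normc_real.
  rewrite -[K%:R](@rmorph_nat _ _ (real_complex R)) normc_real ger0_norm ?ler0n//.
  rewrite normc_real (ger0_norm (ltW (bcoef_gt0 K hs))) (ger0_norm t0) normc_ray_exp.
  have e2 : expR ((1 - s) * lam th t) <= 2.
    have l4 : lam th t <= ln 2.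
      rewrite /lam ler_pdivrMr// [leRHS](_ : _ = ln (2 * 2)); last first.
        by rewrite lnM ?posrE// mulr_natr mulr2n.
      rewrite ler_ln ?posrE ?mulr_gt0 ?rho_gt0//.
      have : `|cos th * t| <= 1 by rewrite normrM mulr_ile1// ?cos_max// ger0_norm// (le_trans tr')// ltW.
      rewrite ler_norml => /andP[h _].
      have : t * t <= 1 by rewrite mulr_ile1// (le_trans tr')// ltW.
      by rewrite -mulrA; lra.
    apply: le_trans (_ : expR (1 * ln 2) <= 2); last by rewrite mul1r lnK ?posrE.
    rewrite ler_expR.
    have l0 : 0 <= ln 2 :> R by rewrite ln_ge0// ler1n.
    apply: le_trans (_ : (1 - s) * ln 2 <= _); first by rewrite ler_wpM2l//; case/andP: s01.
    by rewrite ler_wpM2r//; case/andP: s01.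
  have b0 := ltW (bcoef_gt0 K hs).
  rewrite mulrC -[leRHS]mulrA.
  apply: ler_pM => //.
    by rewrite !mulr_ge0 ?invr_ge0 ?normc_ge0 ?ler0n ?exprn_ge0.
  apply: ler_pM; rewrite ?invr_ge0 ?normc_ge0//.
  - by rewrite !mulr_ge0 ?ler0n ?exprn_ge0.
  - apply: ler_pM; rewrite ?mulr_ge0 ?ler0n ?exprn_ge0//.
      by rewrite ger_pMr ?ltr0n// bcoef_le1.
    by apply: lerXn2r; rewrite ?nnegrE.
  - by rewrite lef_pV2 ?posrE// ?normc_den// (lt_le_trans r1' (normc_den tr)).
have := @path_dist_le _ (fun t => y K t * ray_exp (1 - s) t) d 0 r _ r0 dd dle.
cbv beta.
have y0 : y K 0 * ray_exp (1 - s) 0 = 1.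
  have -> : y K 0 = 1.
    rewrite /y; case: (K) K0 => // k _; rewrite big_ord_recl big1 ?addr0.
      by rewrite expr0 mulr1 /bcoef big_ord0.
    by move=> i _; rewrite mul0r expr0n mulr0.
  rewrite mul1r /ray_exp /lam /alp !mulr0 subr0 addr0 ln1 !mul0r atan0 mulr0 oppr0.
  by rewrite -cexp0.
rewrite [X in normc (_ - X)]y0 => /le_trans; apply; rewrite subr0.
have -> : r ^+ K = r * r ^+ K.-1 by rewrite -exprS prednK.
by rewrite le_eqVlt; apply/orP; left; apply/eqP; ring.
Qed.

(* Partial sums of the binomial series of (1 - z)^(s - 1) at z = r e^(i th) *)
Lemma binomial_ray (e : R) : 0 < e -> exists K0 : nat, forall K, (K0 <= K)%N ->
  normc (\sum_(n < K) ((bcoef s n * r ^+ n)%:C%C * cis (th * n%:R)) - ray_exp (s - 1) r) <= e.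
Proof.
move=> e0; have r1' : 0 < 1 - r by rewrite subr_gt0.
have w0 : ray_exp (1 - s) r != 0 by rewrite -normc_gt0 normc_ray_exp expR_gt0.
have wV : ray_exp (s - 1) r = (ray_exp (1 - s) r)^-1.
  apply: (mulIf w0); rewrite mulVf// /ray_exp -cexpD; simpc.
  rewrite -mulrDl -mulNr -mulNr -mulrDl.
  have -> : s - 1 + (1 - s) = 0 by ring.
  have -> : - (s - 1) + - (1 - s) = 0 by ring.
  by rewrite !mul0r -cexp0.
have W0 : 0 < normc (ray_exp (1 - s) r) by rewrite normc_gt0.
have d0 : 0 < e * normc (ray_exp (1 - s) r) * (1 - r) / 4 by rewrite divr_gt0// !mulr_gt0.
have rr : 0 <= r < 1 by rewrite r0.
have [K0 HK0] := natr_expr_cvg0 rr d0.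
exists K0.+1 => K KK.
have -> : \sum_(n < K) ((bcoef s n * r ^+ n)%:C%C * cis (th * n%:R)) = y K r.
  apply: eq_bigr => n _; rewrite exprMn -cisX mulrA rmorphM rmorphXn.
  by [].
have b := binomial_ray_bound (leq_ltn_trans (leq0n _) KK).
rewrite wV -[y K r](mulfK w0) -[X in _ - X]mul1r -mulrBl normcM normcV.
rewrite ler_pdivrMr//; apply: le_trans b _.
rewrite ler_pdivrMr// mulrC -ler_pdivlMr//.
by apply: HK0; exact: ltnW.
Qed.

End Ray.
End BinomialSeries.

Lemma sum_ord_tail (V : zmodType) (f : nat -> V) L J : (L <= J)%N ->
  \sum_(i < J) f i - \sum_(i < L) f i = \sum_(i < J - L) f (L + i)%N.
Proof.
by move=> LJ; rewrite -[X in \sum_(i < X) f i - _](subnKC LJ) big_split_ord /= addrAC subrr add0r.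
Qed.

Section RealSequences.
Variable R : realType.
Implicit Types (a v c : nat -> R) (C : R).

Lemma cvg_seqP (u : nat -> R) (l : R) : u @ \oo --> l <->
  forall e : R, 0 < e -> exists n0 : nat, forall n, (n0 <= n)%N -> `|u n - l| <= e.
Proof.
split=> [/cvgrPdist_le h e e0|h].
  by have [n0 _ H] := h e e0; exists n0 => n nn; rewrite distrC; exact: H.
apply/cvgrPdist_le => e e0; have [n0 H] := h e e0.
by exists n0 => // n /= nn; rewrite distrC; exact: H.
Qed.

Lemma le_cvg_seq (u : nat -> R) (l C : R) : u @ \oo --> l -> (forall n, u n <= C) -> l <= C.
Proof.
move=> /cvg_seqP h uC; apply/ler_addgt0Pr => e e0; have [n0 H] := h e e0.
have := H n0 (leqnn _); rewrite ler_norml => /andP[h1 h2].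
by have := uC n0; lra.
Qed.

(** Summation by parts. The induction sets the boundary term aside: the rest is bounded by the total
    decrease C (v 0 - v j), and the boundary term adds C v j back. *)
Lemma abel_le a v C k : (forall j, `|\sum_(i < j) a i| <= C) ->
  (forall i, (i < k)%N -> 0 <= v i) ->
  (forall i, (i.+1 < k)%N -> v i.+1 <= v i) -> (0 < k)%N ->
  `|\sum_(i < k) a i * v i| <= C * v 0%N.
Proof.
case: k => // k ha v0 vd _.
have key j : (j <= k)%N ->
    `|\sum_(i < j.+1) a i * v i - (\sum_(i < j.+1) a i) * v j| <= C * (v 0%N - v j).
  elim: j => [_|j IH jk].
    by rewrite !big_ord1 !subrr mulr0 normr0.
  have := IH (ltnW jk).
  set S := \sum_(i < j.+1) a i; set T := \sum_(i < j.+1) a i * v i => h.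
  rewrite big_ord_recr /= -/T big_ord_recr /= -/S.
  have -> : T + a j.+1 * v j.+1 - (S + a j.+1) * v j.+1 = (T - S * v j) + S * (v j - v j.+1) by ring.
  apply: le_trans (ler_normD _ _) _.
  have -> : C * (v 0%N - v j.+1) = C * (v 0%N - v j) + C * (v j - v j.+1) by ring.
  apply: lerD => //; rewrite normrM.
  have d0 : 0 <= v j - v j.+1 by rewrite subr_ge0 vd.
  by rewrite (ger0_norm d0) ler_wpM2r// ha.
have := key k (leqnn _); set T := \sum_(i < k.+1) a i * v i => h.
rewrite -[T](subrK ((\sum_(i < k.+1) a i) * v k)).
apply: le_trans (ler_normD _ _) _; apply: le_trans (lerD h (lexx _)) _.
rewrite normrM (ger0_norm (v0 k (leqnn _))).
have := ha k.+1; have := v0 k (leqnn _); set X := `|_| => vk XC.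
by have : X * v k <= C * v k; [rewrite ler_wpM2r|lra].
Qed.

(** Passing to the decreasing weights 1 - v costs one more partial sum, hence the factor 2. *)
Lemma abel_increasing_le a v C k : (forall j, `|\sum_(i < j) a i| <= C) ->
  (forall i, (i < k)%N -> 0 <= v i <= 1) ->
  (forall i, (i.+1 < k)%N -> v i <= v i.+1) ->
  `|\sum_(i < k) a i * v i| <= 2 * C.
Proof.
move=> ha v01 vi.
have C0 : 0 <= C by apply: le_trans (ha 0%N).
case: k v01 vi => [|k] v01 vi; first by rewrite big_ord0 normr0 mulr_ge0.
have -> : \sum_(i < k.+1) a i * v i = \sum_(i < k.+1) a i - \sum_(i < k.+1) a i * (1 - v i).
  by rewrite -sumrB; apply: eq_bigr => i _; rewrite mulrBr mulr1 opprB addrC subrK.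
apply: le_trans (ler_normB _ _) _; rewrite mulrDl mul1r.
apply: lerD; first exact: ha.
apply: le_trans (@abel_le a (fun i => 1 - v i) C k.+1 ha _ _ isT) _.
- by move=> i ik; rewrite subr_ge0; case/andP: (v01 i ik).
- by move=> i ik; rewrite lerD2l lerN2 vi.
- rewrite -[leRHS]mulr1 ler_wpM2l// gerBl.
  by case/andP: (v01 0%N isT).
Qed.

Lemma cvg_sum_ord (f : nat -> nat -> R) (phi : nat -> R) L :
  (forall i, (i < L)%N -> (fun n => f n i) @ \oo --> phi i) ->
  (fun n => \sum_(i < L) f n i) @ \oo --> \sum_(i < L) phi i.
Proof.
elim: L => [|L IH] h.
  by under [X in X @ _]eq_fun do rewrite big_ord0; rewrite big_ord0; exact: cvg_cst.
by under [X in X @ _]eq_fun do rewrite big_ord_recr; rewrite big_ord_recr; apply: cvgD; [by apply: IH => i /ltnW/h|exact: h].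
Qed.

(** An interchange of limits suited to conditionally convergent sums: what controls the remainder
    after [L] terms is [g L], uniformly in large [n], where Tannery's theorem would ask for a
    summable majorant. *)
Lemma tannery (x : nat -> R) (f : nat -> nat -> R) (phi g : nat -> R) (Phi : R) :
  (forall L, exists n0 : nat, forall n, (n0 <= n)%N -> `|x n - \sum_(i < L) f n i| <= g L) ->
  (forall i, (fun n => f n i) @ \oo --> phi i) ->
  g @ \oo --> (0 : R) -> (fun L => \sum_(i < L) phi i) @ \oo --> Phi ->
  x @ \oo --> Phi.
Proof.
move=> xf fphi /cvg_seqP g0 /cvg_seqP phiS; apply/cvg_seqP => e e0.
have e3 : 0 < e / 3 by rewrite divr_gt0.
have [L1 H1] := g0 _ e3; have [L2 H2] := phiS _ e3.
pose L := maxn L1 L2.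
have [n1 H3] := xf L.
have /cvg_seqP /(_ _ e3) [n2 H4] : (fun n => \sum_(i < L) f n i) @ \oo --> \sum_(i < L) phi i.
  by apply: cvg_sum_ord => i _; exact: fphi.
exists (maxn n1 n2) => n; rewrite geq_max => /andP[h1 h2].
have := H1 L (leq_maxl _ _); have := H2 L (leq_maxr _ _).
have := H3 n h1; have := H4 n h2; rewrite subr0 => a1 a2 a3 a4.
have -> : x n - Phi = (x n - \sum_(i < L) f n i) + (\sum_(i < L) f n i - \sum_(i < L) phi i)
   + (\sum_(i < L) phi i - Phi) by rewrite !subrKA.
apply: le_trans (ler_normD _ _) _; apply: le_trans (lerD (ler_normD _ _) (lexx _)) _.
have := ler_norm (g L); lra.
Qed.

Lemma dirichlet_cvg (x g : nat -> R) :
  (forall L J, (L <= J)%N -> `|x J - x L| <= g L) -> g @ \oo --> (0 : R) ->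
  cvgn x /\ forall L, `|limn x - x L| <= g L.
Proof.
move=> xg /cvg_seqP g0.
have cx : cvgn x.
  apply/cauchy_cvgP/cauchy_exP => e e0.
  have e2 : 0 < e / 2 by rewrite divr_gt0.
  have [n0 H] := g0 _ e2; exists (x n0); exists n0 => // n /= nn.
  rewrite /ball /= distrC; apply: le_lt_trans (xg _ _ nn) _.
  have := H n0 (leqnn _); rewrite subr0 => h; have := ler_norm (g n0).
  by lra.
split => // L; apply: (@le_cvg_seq (fun n => `|x (n + L)%N - x L|)).
  apply: cvg_norm; apply: cvgB; last exact: cvg_cst.
  by rewrite (cvg_shiftn L x).
by move=> n; apply: xg; rewrite leq_addl.
Qed.

End RealSequences.

Lemma powR_le_l (R : realType) (s x y : R) : 0 <= s -> 0 <= x -> x <= y -> x `^ s <= y `^ s.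
Proof.
move=> s0 x0 xy; apply: ge0_ler_powR => //; rewrite nnegrE//; exact: le_trans xy.
Qed.

Section DirichletSeries.
Variable R : realType.
Variables (q : nat) (chi : nat -> int).
Hypotheses (h : gauss_char q chi) (q1 : (1 < q)%N).

Let c (n : nat) : R := (chi n)%:~R.
Let q0 : (0 < q)%N := ltnW q1.

Lemma gauss_char_at0 : chi 0%N = 0.
Proof. by apply: (gauss_char_eq0 h); rewrite /coprime gcd0n; case: (q) q1 => [|[]]. Qed.

(** The Gauss relation at m = 0 equates the sum with chi(0) times the Gauss sum, and chi(0) = 0. *)
Lemma gauss_char_sum_period : \sum_(r < q) chi r = 0.
Proof.
have [_ _ _ _ /(_ R[i] _ (cis_primitive_root R q0) 0%N)] := h.
rewrite gauss_char_at0 mulr0z mul0r.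
under eq_bigr do rewrite muln0 expr0 mulr1.
by rewrite -rmorph_sum /= => /eqP; rewrite intr_eq0 => /eqP.
Qed.

Lemma gauss_char_partial_sum m k : `|\sum_(i < k) c (m + i)%N| <= q%:R.
Proof.
have c1 n : `|c n| <= 1.
  by rewrite /c -intr_norm -[1]/(1%:~R) ler_int (gauss_char_norm h).
have per j : \sum_(i < q) c (j + i)%N = 0.
  elim: j => [|j IH].
    by have := congr1 (fun z : int => z%:~R : R) gauss_char_sum_period; rewrite rmorph_sum /= mulr0z.
  move: IH; case: (q) q1 (gauss_char_period h) => // q' _ per.
  rewrite big_ord_recl /= addn0 => e; rewrite big_ord_recr /=.
  rewrite (_ : c (j.+1 + q') = c j); last by rewrite /c addSnnS per.
  rewrite addrC -[RHS]e; congr (_ + _).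
  by apply: eq_bigr => i _; rewrite /bump /= add1n addSnnS.
have [n] := ubnP k; elim: n k m => // n IH k m; rewrite ltnS => kn.
have [kq|qk] := leqP k q.
  apply: le_trans (ler_norm_sum _ _ _) _.
  apply: le_trans (_ : \sum_(i < k) 1 <= _); first by apply: ler_sum => i _.
  by rewrite sumr_const card_ord ler_nat.
rewrite -(subnKC (ltnW qk)) big_split_ord /= per add0r.
under eq_bigr do rewrite addnA.
apply: IH; apply: leq_trans kn; rewrite -subSn ?(ltnW qk)//.
by move: q1 qk; lia.
Qed.

Definition Lseries (s : R) (N : nat) : R := \sum_(i < N) c i.+1 * (i.+1%:R `^ (- s)).
Definition Lvalue (s : R) : R := limn (Lseries s).

Lemma powRN_nincr (s x y : R) : 0 <= s -> 0 < x -> x <= y -> y `^ (- s) <= x `^ (- s).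
Proof.
move=> s0 x0 xy; have y0 := lt_le_trans x0 xy.
by rewrite !powRN lef_pV2 ?posrE ?powR_gt0//; apply: ge0_ler_powR => //; rewrite nnegrE ltW.
Qed.

Lemma powRN_cvg0 (s C : R) : 0 < s -> (fun n : nat => C * n.+1%:R `^ (- s)) @ \oo --> (0 : R).
Proof.
move=> s0; rewrite -[X in _ --> X](mulr0 C); apply: cvgM; first exact: cvg_cst.
apply/cvg_seqP => e e0.
pose A := (e^-1) `^ (s^-1).
exists (Num.bound A) => n nA.
rewrite subr0 ger0_norm ?powR_ge0//.
have An : A <= n.+1%:R.
  apply: le_trans (ltW (archi_boundP (powR_ge0 _ _))) _.
  by rewrite ler_nat; exact: leqW.
rewrite powRN invf_ple ?posrE ?powR_gt0//.
apply: le_trans (_ : A `^ s <= _).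
  by rewrite /A -powRrM mulVf ?gt_eqF// powRr1// invr_ge0 ltW.
by apply: powR_le_l; rewrite ?powR_ge0// ltW.
Qed.

Lemma Lseries_tail (s : R) L J : 0 < s -> (L <= J)%N ->
  `|Lseries s J - Lseries s L| <= q%:R * L.+1%:R `^ (- s).
Proof.
move=> s0 LJ; rewrite /Lseries (sum_ord_tail (fun i => c i.+1 * (i.+1%:R `^ (- s))) LJ).
have [->|J0] := posnP (J - L)%N; first by rewrite big_ord0 normr0 mulr_ge0 ?powR_ge0.
have := @abel_le R (fun i => c (L + i).+1) (fun i => (L + i).+1%:R `^ (- s)) q%:R (J - L)%N.
rewrite /= addn0; apply => //.
  by move=> j; exact: (gauss_char_partial_sum L.+1 j).
by move=> i _; apply: powRN_nincr; [exact: ltW|rewrite ltr0n|rewrite ler_nat addnS].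
Qed.

Lemma Lseries_cvg (s : R) : 0 < s -> Lseries s @ \oo --> Lvalue s.
Proof.
move=> s0; have [cx _] := dirichlet_cvg (fun L J LJ => Lseries_tail s0 LJ) (powRN_cvg0 _ s0).
exact: cx.
Qed.

End DirichletSeries.

Section Kappa.
Variable R : realType.
Variable s : R.
Hypothesis hs : 0 < s < 1.

(* Growth constant of the binomial coefficients; its value 1/Gamma(1-s) is
   never needed, only that it does not depend on the character. *)
Definition kappa : R := limn (fun n : nat => n.+1%:R `^ s * bcoef s n.+1).

Let w (n : nat) := n.+1%:R `^ s * bcoef s n.+1.

(** Bernoulli's inequality for exponents in (0, 1), read off from Young's inequality with the
    conjugate exponents 1/s and 1/(1 - s). *)
Lemma powR_concave_le (t : R) : -1 < t -> (1 + t) `^ s <= 1 + s * t.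
Proof.
move=> t1; have /andP[s0 s1] := hs.
have t0 : 0 <= 1 + t by move: t1; lra.
have s1' : 0 < 1 - s by rewrite subr_gt0.
have := @conjugate_powR R ((1 + t) `^ s) 1 s^-1 (1 - s)^-1 (powR_ge0 _ _) ler01.
rewrite !invr_gt0 !invrK => /(_ s0 s1'); rewrite mulr1 powR1 -powRrM mulfV ?gt_eqF// powRr1//.
rewrite [s + _]addrC subrK => /(_ erefl); lra.
Qed.

Let w_step n : w n <= w n.+1.
Proof.
rewrite /w (bcoefS _ n.+1) mulrA mulrAC ler_wpM2r//; first by rewrite ltW// bcoef_gt0.
have n0 : 0 < n.+2%:R :> R by rewrite ltr0n.
have := @powR_concave_le (- n.+2%:R^-1).
rewrite ltrN2 invf_lt1// ltr1n => /(_ isT).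
rewrite mulrN => H.
have e : n.+1%:R = n.+2%:R * (1 + - n.+2%:R^-1) :> R.
  by rewrite mulrDr mulr1 mulrN mulfV ?gt_eqF// -[n.+2%:R]natr1 addrK.
rewrite [X in X `^ s <= _]e powRM ?ler0n//; last by rewrite subr_ge0 invf_le1// ler1n.
by rewrite ler_wpM2l ?powR_ge0.
Qed.

Let w' (n : nat) := n.+2%:R `^ s * bcoef s n.+1.

Let w'_step n : w' n.+1 <= w' n.
Proof.
rewrite /w' (bcoefS _ n.+1) mulrA mulrAC ler_wpM2r//; first by rewrite ltW// bcoef_gt0.
have n0 : 0 < n.+2%:R :> R by rewrite ltr0n.
have := @powR_concave_le (n.+2%:R^-1).
rewrite (lt_trans _ (_ : 0 < _)) ?invr_gt0// => /(_ isT) H.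
have e : n.+3%:R = n.+2%:R * (1 + n.+2%:R^-1) :> R.
  by rewrite mulrDr mulr1 mulfV ?gt_eqF// natr1.
rewrite e powRM ?ler0n//.
rewrite -mulrA -[leRHS]mulr1 ler_wpM2l ?powR_ge0//.
have /andP[f0 _] := bcoef_factor n.+1 hs.
apply: le_trans (ler_wpM2r (ltW f0) H) _.
have : 0 <= (s / n.+2%:R) ^+ 2 by exact: sqr_ge0.
by rewrite expr2; set x := s / _; lra.
Qed.

(** By Bernoulli's inequality at -1/(n+2) and at 1/(n+2), [w] increases while its shifted companion
    [w'] decreases; since w <= w', the sequence [w] is bounded. *)
Lemma kappa_cvg : w @ \oo --> kappa.
Proof.
have nd : {homo w : m n / (m <= n)%N >-> m <= n}.
  by apply: homo_leq => [x|? ? ?|n]; [exact: lexx|exact: le_trans|exact: w_step].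
apply: (nondecreasing_is_cvgn nd); exists (w' 0%N) => _ [n _ <-].
have : w' n <= w' 0%N by elim: n => // n; exact: le_trans (w'_step n).
apply: le_trans; rewrite /w /w' ler_wpM2r//; first by rewrite ltW// bcoef_gt0.
have /andP[s0 _] := hs.
by apply: powR_le_l; [exact: ltW|rewrite ler0n|rewrite ler_nat].
Qed.

Lemma kappa_gt0 : 0 < kappa.
Proof.
have nd : {homo w : m n / (m <= n)%N >-> m <= n}.
  by apply: homo_leq => [x|? ? ?|n]; [exact: lexx|exact: le_trans|exact: w_step].
apply: lt_le_trans (_ : w 0%N <= _); first by rewrite /w powR1 mul1r bcoef_gt0.
exact: (nondecreasing_cvgn_le nd (cvgP _ kappa_cvg)).
Qed.

Lemma bcoef_asymp (l : nat) :
  (fun j : nat => (2 * j.+1)%:R `^ s * bcoef s (l.+1 * (2 * j.+1))) @ \oo --> kappa * l.+1%:R `^ (- s).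
Proof.
have -> : (fun j : nat => (2 * j.+1)%:R `^ s * bcoef s (l.+1 * (2 * j.+1))) =
    (fun j => w (l.+1 * (2 * j.+1)).-1 * l.+1%:R `^ (- s)).
  apply/funext => j; rewrite /w prednK ?muln_gt0// (natrM _ l.+1) powRM ?ler0n// powRN.
  by rewrite -(mulrA (l.+1%:R `^ s)) [RHS]mulrC mulKf// gt_eqF// powR_gt0// ltr0n.
apply: cvgM; last exact: cvg_cst.
have /cvg_seqP hk := kappa_cvg.
apply/cvg_seqP => e /hk[n0 H]; exists n0 => n nn; apply: H.
by apply: leq_trans nn _; lia.
Qed.

End Kappa.

Section RayLimit.
Variable R : realType.
Local Notation C := R[i].

Definition trig_part (b : bool) (z : C) : R := if b then complex.Im z else complex.Re z.

Lemma trig_partB b (z w : C) : trig_part b (z - w) = trig_part b z - trig_part b w.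
Proof. by case: b; rewrite /= raddfB. Qed.

Lemma le_trig_part b (z : C) : `|trig_part b z| <= normc z.
Proof. by case: b; [exact: le_normc_Im|exact: le_normc_Re]. Qed.

Lemma trig_part_sum b n (f : 'I_n -> C) : trig_part b (\sum_(i < n) f i) = \sum_(i < n) trig_part b (f i).
Proof.
by case: b; [apply: (big_morph (@complex.Im R))|apply: (big_morph (@complex.Re R))] => // -[? ?] [].
Qed.

Lemma trig_part_cis b (x t : R) : trig_part b (x%:C%C * cis t) = x * trig b t.
Proof. by case: b; rewrite /cis /=; simpc. Qed.

Lemma trig_part_ray b (th k t : R) :
  trig_part b (ray_exp th k t) = expR (k * lam th t) * trig b (- (k * alp th t)).
Proof. by case: b. Qed.

Lemma continuous_trig b : continuous (@trig R b).
Proof. by case: b; [exact: continuous_sin|exact: continuous_cos]. Qed.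

(* A real or imaginary part of (1 - e^(i th))^(s - 1). *)
Definition boundary_term (b : bool) (s th : R) : R :=
  (2 * sin (th / 2)) `^ (s - 1) * trig b ((1 - s) * ((pi - th) / 2)).

Lemma sin_half_gt0 (th : R) : 0 < th < 2 * pi -> 0 < sin (th / 2).
Proof.
move=> /andP[t0 t1]; apply: sin_gt0_pi; rewrite divr_gt0//= ltr_pdivrMr// mulrC.
by [].
Qed.

Lemma half_angle (th : R) : cos th = 1 - 2 * sin (th / 2) ^+ 2 /\ sin th = 2 * (sin (th / 2) * cos (th / 2)).
Proof.
have e : th = (th / 2) *+ 2 by rewrite mulr2n -splitr.
split; first by rewrite [in LHS]e cos_mulr2n cos2sin2; ring.
by rewrite [in LHS]e sin_mulr2n; ring.
Qed.

(** The number 1 - e^(i th) has modulus 2 sin(th/2) and argument - (pi - th)/2. *)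
Lemma ray_boundary b (s th : R) : 0 < th < 2 * pi ->
  trig_part b (ray_exp th (s - 1) 1) = boundary_term b s th.
Proof.
move=> hth; have s0 := sin_half_gt0 hth; have [ec es] := half_angle th.
rewrite trig_part_ray /boundary_term; congr (_ * trig b _).
  rewrite /powR gt_eqF ?mulr_gt0// /lam; congr (expR (_ * _)).
  have -> : 1 - 2 * cos th * 1 + 1 * 1 = (2 * sin (th / 2)) ^+ 2 by rewrite ec; ring.
  by rewrite lnXn ?mulr_gt0// -[ln _ *+ 2]mulr_natr mulfK.
rewrite -mulNr opprB; congr (_ * _).
rewrite /alp !mulr1.
have -> : sin th / (1 - cos th) = tan (pi / 2 - th / 2).
  rewrite /tan sinB cosB sin_pihalf cos_pihalf !mul0r !mul1r subr0 add0r ec es.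
  have -> : 1 - (1 - 2 * sin (th / 2) ^+ 2) = 2 * (sin (th / 2) * sin (th / 2)) by ring.
  by rewrite -mulf_div divff// mul1r -mulf_div divff ?gt_eqF// mul1r.
rewrite tanK; first by rewrite mulrBl.
by rewrite in_itv /=; move: hth => /andP[? ?]; apply/andP; split; lra.
Qed.

Lemma ray_limit b (s th : R) : 0 < th < 2 * pi ->
  (fun j : nat => trig_part b (ray_exp th (s - 1) (1 - j.+1%:R^-1))) @ \oo --> boundary_term b s th.
Proof.
move=> hth; have s0 := sin_half_gt0 hth; have [ec es] := half_angle th.
rewrite -ray_boundary// trig_part_ray.
have r1 : (fun j : nat => 1 - j.+1%:R^-1 : R) @ \oo --> (1 : R).
  rewrite -[X in _ --> X]subr0; apply: cvgB; first exact: cvg_cst.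
  exact: cvg_harmonic.
have s2 : 0 < sin (th / 2) ^+ 2 by rewrite exprn_gt0.
have dn : 0 < 1 - cos th * 1 by rewrite ec; lra.
have rh : 0 < 1 - 2 * cos th * 1 + 1 * 1 by rewrite ec; lra.
have cl : {for 1, continuous (lam th)}.
  by apply/differentiable_continuous/derivable1_diffP; have [] := is_derive_lam rh.
have ca : {for 1, continuous (alp th)}.
  by apply/differentiable_continuous/derivable1_diffP; have [] := is_derive_alp dn rh.
under [X in X @ _]eq_fun do rewrite trig_part_ray.
have hl := @continuous_cvg _ _ _ _ _ _ (lam th) _ cl r1.
have ha := @continuous_cvg _ _ _ _ _ _ (alp th) _ ca r1.
apply: cvgM.
  apply: (@continuous_cvg _ _ _ _ _ _ (@expR R)); first exact: continuous_expR.
  by apply: cvgM; [exact: cvg_cst|exact: hl].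
apply: (@continuous_cvg _ _ _ _ _ _ (@trig R b)); first exact: continuous_trig.
by apply: cvgN; apply: cvgM; [exact: cvg_cst|exact: ha].
Qed.

(** In sin x = 2 sin(x/2) cos(x/2) the mean value theorem turns sin(x/2) into (x/2) cos z with z <=
    pi/4; two cosines of at least cos(pi/4) then give the factor 1/2. *)
Lemma sin_ge_half (x : R) : 0 <= x <= pi / 2 -> x / 2 <= sin x.
Proof.
move=> /andP[x0 xp]; have p0 := pi_gt0 R.
have k2 : cos (pi / 4 : R) ^+ 2 = 1 / 2.
  have := cos_mulr2n (pi / 4 : R); have -> : (pi / 4) *+ 2 = pi / 2 :> R by field.
  by rewrite cos_pihalf [_ *+ 2]mulr2n; lra.
have k0 : 0 < cos (pi / 4 : R) by apply: cos_gt0_pihalf; apply/andP; split; lra.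
have ck (y : R) : 0 <= y <= pi / 4 -> cos (pi / 4) <= cos y.
  move=> /andP[y0 yp]; rewrite leNgt ltr_cos ?in_itv /=; first by rewrite -leNgt.
    by apply/andP; split; lra.
  by apply/andP; split; lra.
have y0 : 0 <= x / 2 by rewrite divr_ge0.
have [z] := @MVT_segment R sin cos 0 (x / 2) y0 (fun t _ => is_derive_sin t)
  (continuous_subspaceT (@continuous_sin R)).
rewrite in_itv /= => /andP[z0 z1]; rewrite sin0 !subr0 => es.
have [_ ->] := half_angle x.
have cz : cos (pi / 4) <= cos z by apply: ck; apply/andP; split; lra.
have cx : cos (pi / 4) <= cos (x / 2) by apply: ck; apply/andP; split; lra.
have : cos (pi / 4) * cos (pi / 4) <= cos z * cos (x / 2) by apply: ler_pM => //; exact: ltW.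
rewrite es; move: k2; rewrite expr2; set u := cos z; set v := cos (x / 2); move=> -> uv.
have : 1 / 2 * x <= (u * v) * x by rewrite ler_wpM2r.
have -> : 2 * (u * (x / 2) * v) = u * v * x by field.
lra.
Qed.

Lemma sin_dist_le (x : R) : 0 <= x -> `|sin x - x| <= x * x.
Proof.
move=> x0.
have hc t : 0 <= t <= x -> `|cos t - 1| <= x.
  move=> /andP[t0 tx].
  have := @derive_dist_le R cos (fun=> 1) (fun u => - sin u) (fun=> 0) 0 t 1 t0.
  rewrite cos0 subrr !subr0 mul1r => /(_ _ _ _)/le_trans; apply => //.
  by move=> u _; rewrite subr0 normrN ler_norml sin_geN1 sin_le1.
have := @derive_dist_le R sin id cos (fun=> 1) 0 x x x0.
rewrite sin0 !subr0; apply => // t ht; exact: hc.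
Qed.

Lemma sin_scale_cvg (a : R) : 0 <= a ->
  (fun n : nat => n.+1%:R * sin (a / n.+1%:R)) @ \oo --> a.
Proof.
move=> a0; apply/cvg_seqP => e e0.
have /cvg_seqP/(_ _ (divr_gt0 e0 (_ : 0 < a * a + 1)))[|n0 H] := @cvg_harmonic R.
  by have := mulr_ge0 a0 a0; lra.
exists n0 => n /H; rewrite /harmonic /= subr0 ger0_norm ?invr_ge0// => h.
have n1 : 0 < n.+1%:R :> R by rewrite ltr0n.
have := @sin_dist_le (a / n.+1%:R); rewrite divr_ge0 ?ler0n// => /(_ isT) hs.
have -> : n.+1%:R * sin (a / n.+1%:R) - a = n.+1%:R * (sin (a / n.+1%:R) - a / n.+1%:R).
  by rewrite mulrBr [_ * (a / _)]mulrC divfK ?gt_eqF.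
rewrite normrM gtr0_norm//; apply: le_trans (ler_wpM2l (ltW n1) hs) _.
have -> : n.+1%:R * (a / n.+1%:R * (a / n.+1%:R)) = a * a * n.+1%:R^-1 by field; rewrite gt_eqF.
have aa := mulr_ge0 a0 a0.
have d0 : 0 < a * a + 1 by lra.
apply: le_trans (_ : (a * a + 1) * n.+1%:R^-1 <= _).
  by rewrite ler_wpM2r ?invr_ge0 ?ler0n// lerDl.
by rewrite mulrC -ler_pdivlMr.
Qed.

End RayLimit.

(** * Two evaluations of one finite trigonometric sum *)

Section FunctionalEquation.
Variable R : realType.
Local Notation C := R[i].
Variables (q : nat) (chi : nat -> int) (s tau : R).
Hypotheses (h : gauss_char q chi) (q1 : (1 < q)%N) (hs : 0 < s < 1).

Let c (n : nat) : R := (chi n)%:~R.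
Let b := chi q.-1 == -1.
Let q0 : (0 < q)%N := ltnW q1.
Let th (N m : nat) : R := 2 * pi / (q * N)%:R * m%:R.

Hypothesis htau : forall N n, (0 < N)%N ->
  \sum_(m < q * N) c m * trig b (2 * pi / (q * N)%:R * (m * n)%:R) =
  if (N %| n)%N then N%:R * c (n %/ N)%N * tau else 0.

Let c0 : c 0%N = 0.
Proof. by rewrite /c (gauss_char_at0 h q1). Qed.

Let c1 n : `|c n| <= 1.
Proof. by rewrite /c -intr_norm -[1]/(1%:~R) ler_int (gauss_char_norm h). Qed.

(* As N grows, the angles near 0 modulo 2 pi make N^(s - 1) A N converge to a
   multiple of L(1 - s), while the binomial series of (1 - e^(i th))^(s - 1) and
   the Gauss sums give tau * kappa * L(s). *)
Let A (N : nat) : R := \sum_(m < q * N) c m * boundary_term b s (th N m).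

(** [P] is [A] moved inside the unit disc, where the binomial series converges absolutely; [Q] is
    the truncated series once the Gauss sums have removed every exponent that is not a multiple of
    [N]. *)
Let P (N : nat) (r : R) := \sum_(m < q * N) c m * trig_part b (ray_exp (th N m) (s - 1) r).
Let Q (N L : nat) (r : R) := N%:R * tau * \sum_(i < L) c i.+1 * (bcoef s (i.+1 * N) * r ^+ (i.+1 * N)).

Let thE N m n : th N m * n%:R = 2 * pi / (q * N)%:R * (m * n)%:R.
Proof. by rewrite /th (natrM _ m n) mulrA. Qed.

Let th_bounds N (m : 'I_(q * N)) : m != 0%N :> nat -> 0 < th N m < 2 * pi.
Proof.
move=> m0; have m0' : (0 < m)%N by rewrite lt0n.
have qN : (0 < q * N)%N by exact: leq_ltn_trans (ltn_ord m).
have pp : 0 < 2 * pi :> R by rewrite mulr_gt0// pi_gt0.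
rewrite /th; apply/andP; split; first by rewrite mulr_gt0 ?divr_gt0 ?ltr0n.
by rewrite -mulrA gtr_pMr// mulrC ltr_pdivrMr ?ltr0n// mul1r ltr_nat.
Qed.

Let partial_identity N J (r : R) : (0 < N)%N ->
  \sum_(m < q * N) c m * trig_part b (\sum_(n < N * J.+1) ((bcoef s n * r ^+ n)%:C%C * cis (th N m * n%:R)))
  = Q N J r.
Proof.
move=> N0.
transitivity (\sum_(n < N * J.+1) bcoef s n * r ^+ n * \sum_(m < q * N) c m * trig b (2 * pi / (q * N)%:R * (m * n)%:R)).
  under eq_bigr do rewrite trig_part_sum mulr_sumr.
  rewrite exchange_big /=; apply: eq_bigr => n _; rewrite mulr_sumr.
  by apply: eq_bigr => m _; rewrite trig_part_cis thE mulrCA.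
under eq_bigr do rewrite (htau _ N0).
rewrite (sum_mul_ord (fun n => bcoef s n * r ^+ n * (if (N %| n)%N then N%:R * c (n %/ N)%N * tau else 0))).
transitivity (\sum_(j < J.+1) bcoef s (N * j) * r ^+ (N * j) * (N%:R * c j * tau)).
  apply: eq_bigr => j _; case: (N) N0 => // N' _.
  rewrite big_ord_recl big1 ?addr0 /=.
    by rewrite addn0 dvdn_mulr// mulKn.
  move=> i _; rewrite ifF ?mulr0// dvdn_addr ?dvdn_mulr//.
  by rewrite gtnNdvd// ltnS.
rewrite big_ord_recl /= c0 !(mulr0, mul0r) add0r /Q mulr_sumr.
by apply: eq_bigr => i _; rewrite /bump /= add1n [(N * _)%N]mulnC; ring.
Qed.

(** Abel summation against decreasing weights. The bound is uniform in [r], which makes the limit r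
    -> 1 possible. *)
Let Q_tail N L J (r : R) : (0 < N)%N -> 0 <= r <= 1 -> (L <= J)%N ->
  `|Q N J r - Q N L r| <= N%:R * `|tau| * (q%:R * bcoef s (L.+1 * N)).
Proof.
move=> N0 /andP[r0 r1] LJ.
rewrite /Q -mulrBr normrM normrM ger0_norm ?ler0n// ler_wpM2l ?mulr_ge0//.
rewrite (sum_ord_tail (fun i => c i.+1 * (bcoef s (i.+1 * N) * r ^+ (i.+1 * N))) LJ).
have b0 n : 0 <= bcoef s n by rewrite ltW// bcoef_gt0.
have [->|J0] := posnP (J - L)%N; first by rewrite big_ord0 normr0 mulr_ge0.
have := @abel_le R (fun i => c (L + i).+1) (fun i => bcoef s ((L + i).+1 * N) * r ^+ ((L + i).+1 * N)) q%:R (J - L)%N.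
move=> /(_ _ _ _ J0)/le_trans; apply.
- by move=> j; exact: (gauss_char_partial_sum R h q1 L.+1 j).
- by move=> i _; rewrite mulr_ge0 ?exprn_ge0.
- move=> i _; have le : ((L + i).+1 * N <= (L + i.+1).+1 * N)%N by rewrite leq_mul2r addnS leqnSn orbT.
  by apply: ler_pM; rewrite ?exprn_ge0 ?bcoef_nincr// ler_wiXn2l.
- by rewrite addn0 ler_wpM2l// ger_pMr ?bcoef_gt0// exprn_ile1.
Qed.

Let PQ N L (r : R) : (0 < N)%N -> 0 <= r < 1 ->
  `|P N r - Q N L r| <= N%:R * `|tau| * (q%:R * bcoef s (L.+1 * N)).
Proof.
move=> N0 /andP[r0 r1]; apply/ler_addgt0Pr => e e0.
have qN : 0 < (q * N)%:R :> R by rewrite ltr0n muln_gt0 q0.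
have e' : 0 < e / (q * N)%:R by rewrite divr_gt0.
have /choice[K hK] : forall m : 'I_(q * N), exists K0 : nat, forall K, (K0 <= K)%N ->
  normc (\sum_(n < K) ((bcoef s n * r ^+ n)%:C%C * cis (th N m * n%:R)) - ray_exp (th N m) (s - 1) r) <= e / (q * N)%:R.
  by move=> m; exact: binomial_ray.
pose J := maxn L (\max_m K m).
have KJ m : (K m <= N * J.+1)%N.
  apply: leq_trans (leq_bigmax m) _; apply: leq_trans (leq_maxr L _) _.
  by rewrite -/J mulnS; apply: leq_trans (leq_pmull J N0) (leq_addl _ _).
have LJ : (L <= J)%N by exact: leq_maxl.
have h1 : `|P N r - Q N J r| <= e.
  rewrite -partial_identity// /P -sumrB; apply: le_trans (ler_norm_sum _ _ _) _.
  apply: le_trans (_ : \sum_(m < q * N) e / (q * N)%:R <= _); last first.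
    by rewrite sumr_const card_ord -[_ *+ _]mulr_natr divfK// gt_eqF.
  apply: ler_sum => m _; rewrite -mulrBr normrM -trig_partB -[leRHS]mul1r.
  apply: ler_pM => //; apply: le_trans (le_trig_part _ _) _.
  by rewrite normcBC; apply: hK.
have h2 : `|Q N J r - Q N L r| <= N%:R * `|tau| * (q%:R * bcoef s (L.+1 * N)).
  by apply: Q_tail => //; rewrite r0 ltW.
rewrite -[P N r](subrK (Q N J r)) -addrA; apply: le_trans (ler_normD _ _) _.
by rewrite [leRHS]addrC; exact: lerD.
Qed.

(** The limit r -> 1 in [PQ] stands in for convergence on the unit circle itself. The singular angle
    0 has coefficient [c 0 = 0]. *)
Let AQ N L : (0 < N)%N ->
  `|A N - Q N L 1| <= N%:R * `|tau| * (q%:R * bcoef s (L.+1 * N)).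
Proof.
move=> N0.
have r1 : (fun j : nat => 1 - j.+1%:R^-1 : R) @ \oo --> (1 : R).
  rewrite -[X in _ --> X]subr0; apply: cvgB; first exact: cvg_cst.
  exact: cvg_harmonic.
have hP : (fun j : nat => P N (1 - j.+1%:R^-1)) @ \oo --> A N.
  apply: (@cvg_sum_ord R (fun j m => c m * trig_part b (ray_exp (th N m) (s - 1) (1 - j.+1%:R^-1)))
     (fun m => c m * boundary_term b s (th N m)) (q * N)%N) => m mN.
  have [m0|m0] := eqVneq (m : nat) 0%N.
    by rewrite m0 c0 mul0r; under [X in X @ _]eq_fun do rewrite mul0r; exact: cvg_cst.
  by apply: cvgM; [exact: cvg_cst|exact/ray_limit/(@th_bounds N (Ordinal mN))].
have hQ : (fun j : nat => Q N L (1 - j.+1%:R^-1)) @ \oo --> Q N L 1.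
  apply: cvgM; first exact: cvg_cst.
  apply: (@cvg_sum_ord R (fun j i => c i.+1 * (bcoef s (i.+1 * N) * (1 - j.+1%:R^-1) ^+ (i.+1 * N)))
     (fun i => c i.+1 * (bcoef s (i.+1 * N) * 1 ^+ (i.+1 * N))) L) => i _.
  apply: cvgM; first exact: cvg_cst.
  apply: cvgM; first exact: cvg_cst.
  apply: (@continuous_cvg _ _ _ _ _ _ (fun x : R => x ^+ (i.+1 * N))); last exact: r1.
  exact: exprn_continuous.
have hd : (fun j : nat => `|P N (1 - j.+1%:R^-1) - Q N L (1 - j.+1%:R^-1)|) @ \oo --> `|A N - Q N L 1|.
  by apply: cvg_norm; apply: cvgB.
apply: (le_cvg_seq hd) => j.
apply: PQ => //; rewrite subr_ge0 invf_le1 ?ltr0n// ler1n /=.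
by rewrite ltrBlDr ltrDl invr_gt0 ltr0n.
Qed.

Let bt (n i : nat) : R := boundary_term b s (pi * i.+1%:R / (q * n.+1)%:R).

Let c_period n k : c (n + k * q)%N = c n.
Proof. by rewrite /c (gauss_char_addM h). Qed.

Let chiN : chi q.-1 = if b then -1 else 1.
Proof. by rewrite /b; have [->|->] := gauss_char_N1 h. Qed.

Let trigN (x : R) : trig b (- x) = (chi q.-1)%:~R * trig b x.
Proof. by rewrite chiN; case: (b); rewrite /trig ?sinN ?cosN ?mul1r// mulrNz mulr1z mulN1r. Qed.

Let boundary_reflect (x : R) : boundary_term b s (2 * pi - x) = (chi q.-1)%:~R * boundary_term b s x.
Proof.
rewrite /boundary_term.
have -> : (2 * pi - x) / 2 = pi - x / 2 by field.
have -> : sin (pi - x / 2) = sin (x / 2).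
  by rewrite sinB sinpi cospi mul0r mulN1r sub0r opprK.
have -> : (1 - s) * ((pi - (2 * pi - x)) / 2) = - ((1 - s) * ((pi - x) / 2)) by field.
by rewrite trigN mulrCA.
Qed.

(** The reflection th -> 2 pi - th multiplies both the character and the boundary term by chi(-1),
    so the two halves agree. For even N the midpoint m = q N / 2 is a multiple of [q] and drops out
    together with m = 0. *)
Let A_even n : A (2 * n.+1) = 2 * \sum_(i < (q * n.+1).-1) c i.+1 * bt n i.
Proof.
pose T := (q * n.+1).-1; have eT : (q * n.+1 = T.+1)%N by rewrite /T prednK// muln_gt0 q0.
have q0R : 0 < q%:R :> R by rewrite ltr0n.
have n0R : 0 < n.+1%:R :> R by rewrite ltr0n.
have thi i : th (2 * n.+1) i = pi * i%:R / (q * n.+1)%:R.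
  rewrite /th !natrM; field.
  by rewrite !gt_eqF.
rewrite /A; have -> : (q * (2 * n.+1) = T.+1 + T.+1)%N by lia.
rewrite big_split_ord /= -/T !big_ord_recl /= c0 mul0r add0r.
have -> : c (T.+1 + 0)%N = 0.
  by rewrite addn0 -eT mulnC -[X in c X]add0n c_period c0.
rewrite mul0r add0r mulr_natl mulr2n; congr (_ + _).
  by apply: eq_bigr => i _; rewrite /bump /= add1n thi.
rewrite (reindex_inj rev_ord_inj) /=; apply: eq_bigr => i _.
have -> : (T.+1 + bump 0 (T - i.+1) = 2 * T.+1 - i.+1)%N by rewrite /bump /=; have := ltn_ord i; lia.
have le : (i.+1 <= 2 * T.+1)%N by have := ltn_ord i; lia.
have -> : c (2 * T.+1 - i.+1)%N = (chi q.-1)%:~R * c i.+1.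
  rewrite /c -intrM; congr (_%:~R).
  have qi : (i.+1 %% q <= q)%N by rewrite ltnW// ltn_mod.
  rewrite -(gauss_char_mod h i.+1) -(gauss_charN h (subnKC qi)) -[LHS](gauss_char_mod h) -[RHS](gauss_char_mod h).
  congr chi; apply/eqP; rewrite -(eqn_modDr i.+1) subnK// -eT.
  rewrite mulnA mulnAC modnMl -modnDmr addnC subnKC// ?modnn//.
rewrite thi natrB// eT.
have -> : pi * ((2 * T.+1)%:R - i.+1%:R) / T.+1%:R = 2 * pi - pi * i.+1%:R / T.+1%:R :> R.
  by rewrite natrM; field; rewrite gt_eqF ?ltr0n.
rewrite boundary_reflect mulrACA /bt eT.
have -> : (chi q.-1)%:~R * (chi q.-1)%:~R = 1 :> R.
  by rewrite -intrM; have [->|->] := gauss_char_N1 h.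
by rewrite mul1r.
Qed.

Let ang_bounds n i : (i.+1 < q * n.+1)%N -> 0 < (pi : R) * i.+1%:R / (q * n.+1)%:R < pi.
Proof.
move=> iq; have p0 := pi_gt0 R.
have d0 : 0 < (q * n.+1)%:R :> R by rewrite ltr0n muln_gt0 q0.
apply/andP; split; first by rewrite divr_gt0// mulr_gt0// ltr0n.
by rewrite ltr_pdivrMr// ltr_pM2l// ltr_nat.
Qed.

Let bt_scale n i : (i.+1 < q * n.+1)%N -> (2 * n.+1)%:R `^ (s - 1) * bt n i =
  (4 * (n.+1%:R * sin (pi * i.+1%:R / (2 * q%:R) / n.+1%:R))) `^ (s - 1)
    * trig b ((1 - s) * ((pi - pi * i.+1%:R / (q * n.+1)%:R) / 2)).
Proof.
move=> iq; have /andP[a0 a1] := ang_bounds iq.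
have q0R : 0 < q%:R :> R by rewrite ltr0n.
have n0R : 0 < n.+1%:R :> R by rewrite ltr0n.
have -> : pi * i.+1%:R / (2 * q%:R) / n.+1%:R = pi * i.+1%:R / (q * n.+1)%:R / 2 :> R.
  by rewrite natrM; field; rewrite !gt_eqF.
rewrite /bt /boundary_term mulrA; congr (_ * _).
have s2 : 0 < sin (pi * i.+1%:R / (q * n.+1)%:R / 2 : R).
  by apply: sin_half_gt0; rewrite a0 (lt_trans a1)// ltr_pMl ?pi_gt0 ?ltr1n.
rewrite -powRM ?ler0n ?mulr_ge0 ?(ltW s2)// natrM; congr (_ `^ _); ring.
Qed.

(** For fixed i the angle th tends to 0, and with N = 2 (n + 1) the base 2 N sin(th/2) of the power
    tends to 2 pi (i + 1) / q. *)
Let bt_cvg i : (fun n => (2 * n.+1)%:R `^ (s - 1) * bt n i) @ \oo -->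
  (2 * pi / q%:R) `^ (s - 1) * trig b ((1 - s) * (pi / 2)) * i.+1%:R `^ (- (1 - s)).
Proof.
have q0R : 0 < q%:R :> R by rewrite ltr0n.
have p0 := pi_gt0 R; have i0R : 0 < i.+1%:R :> R by rewrite ltr0n.
have inv : (fun n => pi * i.+1%:R / (q * n.+1)%:R : R) @ \oo --> (0 : R).
  rewrite -(mulr0 (pi * i.+1%:R / q%:R)).
  have -> : (fun n => pi * i.+1%:R / (q * n.+1)%:R : R) = (fun n => pi * i.+1%:R / q%:R * n.+1%:R^-1).
    by apply/funext => n; rewrite natrM invfM mulrA.
  by apply: cvgM; [exact: cvg_cst|exact: cvg_harmonic].
have H : (fun n => (4 * (n.+1%:R * sin (pi * i.+1%:R / (2 * q%:R) / n.+1%:R))) `^ (s - 1)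
    * trig b ((1 - s) * ((pi - pi * i.+1%:R / (q * n.+1)%:R) / 2))) @ \oo -->
    (4 * (pi * i.+1%:R / (2 * q%:R))) `^ (s - 1) * trig b ((1 - s) * ((pi - 0) / 2)).
  apply: cvgM; last first.
    apply: (@continuous_cvg _ _ _ _ _ _ (@trig R b)); first exact: continuous_trig.
    apply: cvgM; first exact: cvg_cst.
    apply: cvgM; last exact: cvg_cst.
    by apply: cvgB; [exact: cvg_cst|exact: inv].
  apply: (@continuous_cvg _ _ _ _ _ _ (fun x : R => x `^ (s - 1))).
    apply/differentiable_continuous/derivable1_diffP/derivable_powR.
    by rewrite in_itv /= andbT mulr_gt0// divr_gt0 ?mulr_gt0.
  apply: cvgM; first exact: cvg_cst.
  by apply: sin_scale_cvg; rewrite divr_ge0// mulr_ge0// ltW.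
have -> : (2 * pi / q%:R) `^ (s - 1) * trig b ((1 - s) * (pi / 2)) * i.+1%:R `^ (- (1 - s)) =
    (4 * (pi * i.+1%:R / (2 * q%:R))) `^ (s - 1) * trig b ((1 - s) * ((pi - 0) / 2)).
  rewrite subr0 opprB mulrAC -powRM ?ler0n// ?divr_ge0 ?mulr_ge0 ?(ltW p0)//.
  by congr (_ `^ _ * _); field; rewrite gt_eqF.
move/cvg_seqP in H; apply/cvg_seqP => e e0; have [n0 Hn] := H e e0.
exists (maxn n0 i.+1) => n; rewrite geq_max => /andP[n1 n2].
by rewrite bt_scale ?Hn//; nia.
Qed.

(** Abel summation twice. The trigonometric factor lies in [0, 1] and is monotone, decreasing for
    sines and increasing for cosines, so its partial sums against chi are at most 2 q. The power
    factor then decreases, and [sin_ge_half] bounds its first value independently of [n]. *)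
Let bt_tail n L :
  `|\sum_(i < (q * n.+1).-1 - L) c (L + i).+1 * ((2 * n.+1)%:R `^ (s - 1) * bt n (L + i))|
   <= 2 * q%:R * (pi / q%:R) `^ (s - 1) * L.+1%:R `^ (- (1 - s)).
Proof.
have p0 := pi_gt0 R; have /andP[s0 s1] := hs.
have q0R : 0 < q%:R :> R by rewrite ltr0n.
have n0R : 0 < n.+1%:R :> R by rewrite ltr0n.
set k := ((q * n.+1).-1 - L)%N.
have [->|k0] := posnP k; first by rewrite big_ord0 normr0 !mulr_ge0 ?powR_ge0// ltW.
pose x i : R := pi * (L + i).+1%:R / (q * n.+1)%:R.
have ik i : (i < k)%N -> ((L + i).+1 < q * n.+1)%N by rewrite /k; lia.
have xb i : (i < k)%N -> 0 < x i < pi by move=> /ik; exact: ang_bounds.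
have xS i : x i <= x i.+1.
  by rewrite /x ler_wpM2r ?invr_ge0 ?ler0n// ler_wpM2l ?(ltW p0)// ler_nat addnS.
pose v i := trig b ((1 - s) * ((pi - x i) / 2)).
pose u i := (4 * (n.+1%:R * sin (x i / 2))) `^ (s - 1).
have s2 i : (i < k)%N -> 0 < sin (x i / 2).
  by move=> /xb/andP[? ?]; apply: sin_half_gt0; apply/andP; split; lra.
have uS i : (i.+1 < k)%N -> u i.+1 <= u i.
  move=> i1; have := xb _ i1; have := xb _ (ltnW i1); have := xS i => ? /andP[? ?] /andP[? ?].
  rewrite /u -opprB; apply: powRN_nincr; first by lra.
    by rewrite !mulr_gt0 ?s2// ltnW.
  rewrite !ler_pM2l// le_eqVlt; have [<-|ne] := eqVneq (x i) (x i.+1); first by rewrite eqxx.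
  rewrite ltr_sin ?in_itv /=; last 2 first.
  - by apply/andP; split; lra.
  - by apply/andP; split; lra.
  by apply/orP; right; rewrite ltr_pM2r ?invr_gt0// lt_neqAle ne.
have yb i : (i < k)%N -> 0 <= (1 - s) * ((pi - x i) / 2) <= pi / 2.
  move=> /xb/andP[? ?]; rewrite mulr_ge0 /=; [|lra|lra].
  by rewrite -[leRHS]mul1r; apply: ler_pM; lra.
have yS i : (1 - s) * ((pi - x i.+1) / 2) <= (1 - s) * ((pi - x i) / 2).
  by rewrite ler_wpM2l//; have := xS i; lra.
have v01 i : (i < k)%N -> 0 <= v i <= 1.
  move=> /yb/andP[y0 y1]; rewrite /v /trig; case: (b).
    by rewrite sin_le1 andbT sin_ge0_pi//; apply/andP; split; lra.
  by rewrite cos_le1 andbT cos_ge0_pihalf//; apply/andP; split; lra.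
have av j : (j <= k)%N -> `|\sum_(i < j) c (L + i).+1 * v i| <= 2 * q%:R.
  move=> jk; case: (posnP j) => [->|j0]; first by rewrite big_ord0 normr0; lra.
  have cs j' : `|\sum_(i < j') c (L + i).+1| <= q%:R by exact: (gauss_char_partial_sum R h q1 L.+1 j').
  have [bT|bF] := boolP b.
    apply: le_trans (@abel_le R (fun i => c (L + i).+1) v q%:R j cs _ _ j0) _.
    - by move=> i ij; case/andP: (v01 i (leq_trans ij jk)).
    - move=> i ij; have ij' := leq_trans ij jk.
      have := yb _ ij'; have := yb _ (ltnW ij'); have := yS i => ? /andP[? ?] /andP[? ?].
      rewrite /v bT /= leNgt ltr_sin ?in_itv /= -?leNgt//; apply/andP; split; lra.
    - have /andP[_ v1] := v01 0%N k0.
      by rewrite [leRHS]mulrC ler_wpM2l// ?(ltW q0R)//; lra.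
  apply: (@abel_increasing_le R (fun i => c (L + i).+1) v q%:R j cs).
  - by move=> i ij; apply: v01; exact: leq_trans ij jk.
  - move=> i ij; have ij' := leq_trans ij jk.
    have := yb _ ij'; have := yb _ (ltnW ij'); have := yS i => ? /andP[? ?] /andP[? ?].
    rewrite /v (negbTE bF) /= leNgt ltr_cos ?in_itv /= -?leNgt//; apply/andP; split; lra.
(* [abel_le] asks for partial sums of every length, whereas monotonicity holds below [k]; the
   coefficients are therefore cut off there. *)
pose a i := if (i < k)%N then c (L + i).+1 * v i else 0.
have aj j : \sum_(i < j) a i = \sum_(i < minn j k) c (L + i).+1 * v i.
  rewrite (big_ord_widen_cond j xpredT (fun i => c (L + i).+1 * v i) (geq_minl j k)) [RHS]big_mkcond /=.
  by apply: eq_bigr => i _; rewrite /a leq_min ltn_ord.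
have -> : \sum_(i < k) c (L + i).+1 * ((2 * n.+1)%:R `^ (s - 1) * bt n (L + i)) = \sum_(i < k) a i * u i.
  apply: eq_bigr => i _; rewrite /a ltn_ord bt_scale ?ik// /u /v.
  have -> : pi * (L + i).+1%:R / (2 * q%:R) / n.+1%:R = x i / 2.
    by rewrite /x natrM; field; rewrite !gt_eqF.
  by rewrite mulrCA mulrC.
apply: le_trans (@abel_le R a u (2 * q%:R) k _ _ uS k0) _.
- by move=> j; rewrite aj av// geq_minr.
- by move=> i _; exact: powR_ge0.
rewrite -[leRHS]mulrA ler_wpM2l//.
rewrite opprB -powRM ?ler0n ?divr_ge0 ?(ltW p0) ?(ltW q0R)//.
rewrite /u -opprB; have /andP[x0 x1] := xb _ k0; apply: powRN_nincr; first by lra.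
  by rewrite mulr_gt0 ?divr_gt0// ltr0n.
have := @sin_ge_half R (x 0%N / 2); rewrite divr_ge0 ?(ltW x0)//= => /(_ _) h2.
have {}h2 : x 0%N / 2 / 2 <= sin (x 0%N / 2) by apply: h2; lra.
apply: le_trans (_ : 4 * (n.+1%:R * (x 0%N / 2 / 2)) <= _); last first.
  by rewrite ler_wpM2l// ler_wpM2l// ltW.
rewrite /x addn0 natrM le_eqVlt; apply/orP; left; apply/eqP; field.
by rewrite !gt_eqF.
Qed.

Theorem functional_equation :
  2 * trig b ((1 - s) * (pi / 2)) * (2 * pi / q%:R) `^ (s - 1) * (Lvalue chi (1 - s) : R)
  = tau * kappa s * Lvalue chi s.
Proof.
have /andP[s0 s1] := hs; have s1' : 0 < 1 - s by rewrite subr_gt0.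
have lhs : (fun n => (2 * n.+1)%:R `^ (s - 1) * A (2 * n.+1)) @ \oo -->
    2 * trig b ((1 - s) * (pi / 2)) * (2 * pi / q%:R) `^ (s - 1) * Lvalue chi (1 - s).
  pose g L := 2 * (2 * q%:R * (pi / q%:R) `^ (s - 1)) * L.+1%:R `^ (- (1 - s)) : R.
  pose phi i := 2 * (c i.+1 * ((2 * pi / q%:R) `^ (s - 1) * trig b ((1 - s) * (pi / 2)) * i.+1%:R `^ (- (1 - s)))).
  apply: (@tannery R _ (fun n i => 2 * (c i.+1 * ((2 * n.+1)%:R `^ (s - 1) * bt n i))) phi g).
  - move=> L; exists L => n Ln; rewrite A_even mulrCA -[X in _ - X]mulr_sumr -mulrBr normrM ger0_norm//.
    rewrite /g -mulrA ler_wpM2l// mulr_sumr.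
    have -> : \sum_(i < (q * n.+1).-1) (2 * n.+1)%:R `^ (s - 1) * (c i.+1 * bt n i) =
              \sum_(i < (q * n.+1).-1) c i.+1 * ((2 * n.+1)%:R `^ (s - 1) * bt n i).
      by apply: eq_bigr => i _; rewrite mulrCA.
    rewrite (sum_ord_tail (fun i => c i.+1 * ((2 * n.+1)%:R `^ (s - 1) * bt n i))).
      exact: bt_tail.
    by have := leq_pmulr n.+1 q0; nia.
  - move=> i; apply: cvgM; first exact: cvg_cst.
    by apply: cvgM; [exact: cvg_cst|exact: bt_cvg].
  - exact: powRN_cvg0.
  - rewrite /phi; under [X in X @ _]eq_fun => L.
      rewrite (eq_bigr (fun i : 'I_L => 2 * trig b ((1 - s) * (pi / 2)) * (2 * pi / q%:R) `^ (s - 1) *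
        (c i.+1 * i.+1%:R `^ (- (1 - s)))))//; last by move=> i _; ring.
      rewrite -mulr_sumr; over.
    by apply: cvgM; [exact: cvg_cst|exact: (Lseries_cvg h q1)].
have rhs : (fun n => (2 * n.+1)%:R `^ (s - 1) * A (2 * n.+1)) @ \oo --> tau * kappa s * Lvalue chi s.
  have Ns n : (2 * n.+1)%:R `^ (s - 1) * (2 * n.+1)%:R = (2 * n.+1)%:R `^ s :> R.
    by rewrite -{2}[(2 * n.+1)%:R]powRr1 ?ler0n// -powRD ?subrK// pnatr_eq0 implybT.
  pose g L := 2 * (`|tau| * q%:R * kappa s) * L.+1%:R `^ (- s) : R.
  pose phi i := tau * (c i.+1 * (kappa s * i.+1%:R `^ (- s))).
  apply: (@tannery R _ (fun n i => tau * (c i.+1 * ((2 * n.+1)%:R `^ s * bcoef s (i.+1 * (2 * n.+1))))) phi g).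
  - move=> L.
    (* The limit itself, being positive, serves as tolerance: eventually the weight is at most twice
       its limit, whence the 2 in [g]. *)
    have l0 : 0 < kappa s * L.+1%:R `^ (- s) by rewrite mulr_gt0 ?kappa_gt0// powR_gt0 ?ltr0n.
    have /cvg_seqP/(_ _ l0)[n0 H] := @bcoef_asymp R s hs L.
    exists n0 => n /H{}H.
    have {H}H : (2 * n.+1)%:R `^ s * bcoef s (L.+1 * (2 * n.+1)) <= 2 * (kappa s * L.+1%:R `^ (- s)).
      by have := ler_norm ((2 * n.+1)%:R `^ s * bcoef s (L.+1 * (2 * n.+1)) - kappa s * L.+1%:R `^ (- s)); lra.
    have -> : \sum_(i < L) tau * (c i.+1 * ((2 * n.+1)%:R `^ s * bcoef s (i.+1 * (2 * n.+1)))) =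
       (2 * n.+1)%:R `^ (s - 1) * Q (2 * n.+1) L 1.
      rewrite /Q mulr_sumr mulr_sumr; apply: eq_bigr => i _.
      by rewrite -Ns expr1n; ring.
    rewrite -mulrBr normrM ger0_norm ?powR_ge0//.
    apply: le_trans (ler_wpM2l (powR_ge0 _ _) (@AQ (2 * n.+1) L _)) _ => //.
    have -> : (2 * n.+1)%:R `^ (s - 1) * ((2 * n.+1)%:R * `|tau| * (q%:R * bcoef s (L.+1 * (2 * n.+1)))) =
      `|tau| * q%:R * ((2 * n.+1)%:R `^ s * bcoef s (L.+1 * (2 * n.+1))) by rewrite -Ns; ring.
    apply: le_trans (ler_wpM2l _ H) _; first by rewrite mulr_ge0.
    by rewrite /g le_eqVlt; apply/orP; left; apply/eqP; ring.
  - move=> i; apply: cvgM; first exact: cvg_cst.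
    by apply: cvgM; [exact: cvg_cst|exact: bcoef_asymp].
  - exact: powRN_cvg0.
  - rewrite /phi; under [X in X @ _]eq_fun => L.
      rewrite (eq_bigr (fun i : 'I_L => tau * kappa s * (c i.+1 * i.+1%:R `^ (- s))))//; last by move=> i _; ring.
      rewrite -mulr_sumr; over.
    by apply: cvgM; [exact: cvg_cst|exact: (Lseries_cvg h q1)].
exact: (cvg_unique _ lhs rhs).
Qed.

End FunctionalEquation.

(** * Irrationality of e^pi *)

Section PolynomialNorm.
Variable R : realType.
Local Notation C := R[i].
Implicit Types (f g : {poly C}) (r : R) (z w : C).

(** The weighted l1 norm of the coefficients. It dominates the values on the disc of radius [r], and
    division by a linear factor can be estimated coefficient by coefficient. *)
Definition pnorm r f : R := \sum_(i < size f) normc f`_i * r ^+ i.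

Lemma pnorm_widen r f n : (size f <= n)%N -> pnorm r f = \sum_(i < n) normc f`_i * r ^+ i.
Proof.
move=> fn; rewrite /pnorm (big_ord_widen n (fun i => normc f`_i * r ^+ i) fn) big_mkcond.
apply: eq_bigr => i _; case: ltnP => // fi.
by rewrite nth_default// normc0 mul0r.
Qed.

Lemma pnorm_ge0 r f : 0 <= r -> 0 <= pnorm r f.
Proof. by move=> r0; apply: sumr_ge0 => i _; rewrite mulr_ge0 ?normc_ge0 ?exprn_ge0. Qed.

Lemma pnormD r f g : 0 <= r -> pnorm r (f + g) <= pnorm r f + pnorm r g.
Proof.
move=> r0; pose n := maxn (size f) (size g).
rewrite (pnorm_widen r (size_polyD f g)) (pnorm_widen r (leq_maxl _ _ : (size f <= n)%N)).
rewrite (pnorm_widen r (leq_maxr _ _ : (size g <= n)%N)) -big_split /=.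
apply: ler_sum => i _; rewrite -mulrDl ler_wpM2r ?exprn_ge0// coefD; exact: le_normcD.
Qed.

Lemma pnorm0 r : pnorm r 0 = 0.
Proof. by rewrite /pnorm size_poly0 big_ord0. Qed.

Lemma pnorm1 r : pnorm r 1 = 1.
Proof. by rewrite /pnorm size_poly1 big_ord1 coef1 normc1 mul1r expr0. Qed.

Lemma pnorm_sum r I (s : seq I) (F : I -> {poly C}) : 0 <= r ->
  pnorm r (\sum_(i <- s) F i) <= \sum_(i <- s) pnorm r (F i).
Proof.
move=> r0; elim: s => [|i s IH]; first by rewrite !big_nil pnorm0.
by rewrite !big_cons; apply: le_trans (pnormD _ _ r0) _; rewrite lerD2l.
Qed.

Lemma pnormZ r c f : pnorm r (c *: f) = normc c * pnorm r f.
Proof.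
rewrite (pnorm_widen r (size_scale_leq c f)) mulr_sumr.
by apply: eq_bigr => i _; rewrite coefZ normcM mulrA.
Qed.

Lemma pnormMX r f : pnorm r (f * 'X) = r * pnorm r f.
Proof.
have sf : (size (f * 'X)%R <= (size f).+1)%N.
  by have [->|f0] := eqVneq f 0; [rewrite mul0r size_poly0|rewrite size_mulX].
have c0 : (f * 'X)`_0 = 0 by rewrite coefMX.
rewrite (pnorm_widen r sf) big_ord_recl [(f * 'X)`_ord0]c0 normc0 mul0r add0r mulr_sumr.
by apply: eq_bigr => i _; rewrite lift0 coefMX exprS mulrCA.
Qed.

Lemma pnorm_Xn r n f : pnorm r (f * 'X ^+ n) = r ^+ n * pnorm r f.
Proof.
elim: n => [|n IH]; first by rewrite !expr0 mulr1 mul1r.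
by rewrite exprSr mulrA pnormMX IH exprS mulrA.
Qed.

Lemma pnorm_affine_exp r c n : 0 <= r ->
  pnorm r ((1 + c *: 'X) ^+ n) <= (1 + normc c * r) ^+ n.
Proof.
move=> r0; elim: n => [|n IH]; first by rewrite !expr0 pnorm1.
rewrite !exprSr mulrDr mulr1 -scalerAr; apply: le_trans (pnormD _ _ r0) _.
rewrite pnormZ pnormMX mulrDr mulr1; apply: lerD => //.
by rewrite [leLHS]mulrA [leRHS]mulrC ler_wpM2l// mulr_ge0 ?normc_ge0.
Qed.

Lemma horner_le_pnorm r f w : normc w <= r -> normc f.[w] <= pnorm r f.
Proof.
move=> wr; have w0 := normc_ge0 w; rewrite horner_coef; apply: le_trans (le_normc_sum _ _ _) _.
apply: ler_sum => i _; rewrite normcM normcX ler_wpM2l ?normc_ge0// lerXn2r// nnegrE//.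
exact: le_trans wr.
Qed.

(** For the dividend f, comparing coefficients gives g_i = f_(i+1) + z g_(i+1); summed with weights
    r^(i+1) this reads r |g| <= |f| + |z| |g| in the norm [pnorm r]. *)
Lemma pnorm_divided r g z c : normc z < r ->
  pnorm r g <= pnorm r (g * ('X - z%:P) + c%:P) / (r - normc z).
Proof.
move=> zr; have z0 := normc_ge0 z; have r0 : 0 < r := le_lt_trans z0 zr.
rewrite ler_pdivlMr ?subr_gt0// mulrC mulrBl lerBlDr.
set f := g * _ + _; pose n := maxn (size f) (size g).+1.
have cf i : g`_i = f`_i.+1 + z * g`_i.+1.
  by rewrite /f coefD coefC addr0 mulrBr coefB coefMX coefMC /= mulrC subrK.
rewrite (pnorm_widen r (leq_maxl _ _ : (size f <= n)%N)).
have sg : (size g <= n)%N by rewrite (leq_trans (leqnSn _)) ?leq_maxr.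
rewrite {2}(pnorm_widen r sg).
have [m em] : exists m, n = m.+1 by exists n.-1; rewrite prednK// /n leq_max orbT.
have sm : (size g <= m)%N by rewrite -ltnS -em leq_maxr.
rewrite (pnorm_widen r sm) em !big_ord_recl mulr_sumr mulrDr mulr_sumr.
apply: le_trans (_ : \sum_(i < m) (normc f`_(lift ord0 i) * r ^+ lift ord0 i +
    normc z * (normc g`_(lift ord0 i) * r ^+ lift ord0 i)) <= _).
  apply: ler_sum => i _; rewrite lift0 exprS.
  have : normc g`_i <= normc f`_i.+1 + normc z * normc g`_i.+1.
    by rewrite cf -normcM; exact: le_normcD.
  have rr : 0 <= r * r ^+ i by rewrite mulr_ge0 ?exprn_ge0 ?ltW.
  move=> /(ler_wpM2r rr); rewrite mulrDl -!mulrA => hh; apply: le_trans hh.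
  by rewrite mulrCA.
rewrite big_split /= addrACA -[leLHS]add0r lerD//.
by have r0' := ltW r0; rewrite addr_ge0// !mulr_ge0 ?normc_ge0 ?exprn_ge0.
Qed.

(* Newton interpolation at the points zs. *)
Lemma interpolation_bound r w (zs : seq C) : uniq zs ->
  (forall z, z \in zs -> normc z < r) -> normc w <= r ->
  exists2 c : R, 0 <= c & forall f, normc f.[w] <=
    c * (\sum_(z <- zs) normc f.[z]) + pnorm r f * \prod_(z <- zs) (normc (w - z) / (r - normc z)).
Proof.
move=> + + wr; elim: zs => [_ _|z zs IH /=].
  by exists 0 => // f; rewrite !big_nil mul0r add0r mulr1; exact: horner_le_pnorm.
move=> /andP[zzs uz] zr; have r0 : 0 <= r by apply: le_trans wr; exact: normc_ge0.
have [|c c0 H] := IH uz; first by move=> y yz; apply: zr; rewrite inE yz orbT.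
have z1 : normc z < r by apply: zr; rewrite inE eqxx.
pose k := \sum_(y <- zs) (normc (y - z))^-1.
have k0 : 0 <= k by apply: sumr_ge0 => y _; rewrite invr_ge0 normc_ge0.
(* The constant depends on [w] and the points but not on [f], because it will serve a whole sequence
   of polynomials. *)
exists (1 + normc (w - z) * (c * k)); first by rewrite addr_ge0// !mulr_ge0 ?normc_ge0.
move=> f; rewrite !big_cons.
have /factor_theorem[g eg] : root (f - f.[z]%:P) z by rewrite rootE !hornerE subrr.
have ef : f = g * ('X - z%:P) + f.[z]%:P by rewrite -eg subrK.
have hf y : f.[y] = g.[y] * (y - z) + f.[z] by rewrite {1}ef !hornerE.
have S0 : 0 <= \sum_(y <- zs) normc f.[y] by apply: sumr_ge0 => y _; exact: normc_ge0.
have gz : \sum_(y <- zs) normc g.[y] <= k * (normc f.[z] + \sum_(y <- zs) normc f.[y]).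
  rewrite /k mulr_suml big_seq [leRHS]big_seq; apply: ler_sum => y yz.
  have yz0 : 0 < normc (y - z).
    by rewrite normc_gt0 subr_eq0; apply: contraNneq zzs => <-.
  rewrite mulrC ler_pdivlMr// -normcM -[g.[y] * _](addrK f.[z]) -hf.
  apply: le_trans (le_normcB _ _) _; rewrite addrC lerD2l.
  rewrite (big_rem y)//= lerDl; apply: sumr_ge0 => ? _; exact: normc_ge0.
rewrite hf; apply: le_trans (le_normcD _ _) _; rewrite normcM.
have pg := @pnorm_divided r g z f.[z] z1; rewrite -ef in pg.
set P := \prod_(y <- zs) _ in H *.
have P0 : 0 <= P.
  rewrite /P big_seq; apply: prodr_ge0 => y yz; rewrite divr_ge0 ?normc_ge0// subr_ge0 ltW//.
  by apply: zr; rewrite inE yz orbT.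
have {}H := H g; set S := \sum_(y <- zs) normc f.[y] in gz S0 *.
have h1 : normc g.[w] <= c * (k * (normc f.[z] + S)) + pnorm r f / (r - normc z) * P.
  apply: le_trans H _; apply: lerD; first exact: ler_wpM2l.
  exact: ler_wpM2r.
have h2 := ler_wpM2r (normc_ge0 (w - z)) h1.
apply: le_trans (lerD h2 (lexx _)) _.
have -> : (1 + normc (w - z) * (c * k)) * (normc f.[z] + S) +
  pnorm r f * (normc (w - z) / (r - normc z) * P) =
  (c * (k * (normc f.[z] + S)) + pnorm r f / (r - normc z) * P) * normc (w - z) + normc f.[z] + S.
  by ring.
by rewrite lerDl.
Qed.

End PolynomialNorm.

Section ExpPolynomials.
Variable R : realType.
Local Notation C := R[i].

(** With h = z/k, both 1 + h and e^h are at most e^|h| in modulus, so factoring x^k - y^k leaves at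
    most k e^|z| times |e^h - 1 - h|, which is o(1/k). *)
Lemma affine_exp_cvg (z : C) (e : R) : 0 < e ->
  exists n0 : nat, forall n, (n0 <= n)%N -> normc ((1 + z / n.+1%:R) ^+ n.+1 - cexp z) <= e.
Proof.
move=> e0; set M := expR (normc z).
have M0 : 0 < M by exact: expR_gt0.
have z0 := normc_ge0 z.
have d0 : 0 < e / (M * (normc z + 1)) by rewrite divr_gt0// mulr_gt0//; lra.
have [dl dl0 H] := cexp_littleo d0.
have [n0 Hn] : exists n0 : nat, forall n, (n0 <= n)%N -> normc z / n.+1%:R < dl.
  exists (Num.bound (normc z / dl)) => n nn; rewrite ltr_pdivrMr ?ltr0n// mulrC -ltr_pdivrMr//.
  apply: lt_le_trans (archi_boundP (divr_ge0 z0 (ltW dl0))) _.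
  by rewrite ler_nat (leq_trans nn).
exists n0 => n /Hn{}Hn; set k := n.+1.
have k0 : 0 < k%:R :> R by rewrite ltr0n.
set h := z / k%:R; have nh : normc h = normc z / k%:R.
  by rewrite /h normcM normcV -(rmorph_nat (real_complex R)) normc_real normr_nat.
have eh : cexp z = cexp h ^+ k.
  have cexpn j : cexp (h *+ j) = cexp h ^+ j.
    by elim: j => [|j IH]; rewrite ?mulr0n ?cexp0 ?expr0// mulrS cexpD IH exprS.
  by rewrite -cexpn -mulr_natr /h divfK// pnatr_eq0.
have bd : normc (1 + h) <= expR (normc h) /\ normc (cexp h) <= expR (normc h).
  split; last by rewrite normc_cexp ler_expR; apply: le_trans (ler_norm _) (le_normc_Re h).
  by apply: le_trans (le_normcD _ _) _; rewrite normc1; exact: expR_ge1Dx.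
rewrite eh subrXX normcM; have [b1 b2] := bd.
have {}H := H h; rewrite nh in H; have {}H := H Hn.
have -> : normc (1 + h - cexp h) = normc (cexp h - 1 - h).
  by rewrite normcBC opprD addrA.
have hS : normc (\sum_(i < k) (1 + h) ^+ (k.-1 - i) * cexp h ^+ i) <= k%:R * M.
  apply: le_trans (le_normc_sum _ _ _) _.
  apply: le_trans (_ : \sum_(i < k) M <= _); last by rewrite sumr_const card_ord mulr_natl.
  apply: ler_sum => i _; rewrite normcM !normcX.
  apply: le_trans (_ : expR (normc h) ^+ (k.-1 - i) * expR (normc h) ^+ i <= _).
    by apply: ler_pM; rewrite ?exprn_ge0 ?normc_ge0// lerXn2r ?nnegrE ?normc_ge0 ?expR_ge0.
  rewrite -exprD -expRM_natl ler_expR nh -/k subnK; last by rewrite -ltnS.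
  by rewrite mulrCA -[leRHS]mulr1 ler_wpM2l// ler_pdivrMr// mul1r ler_nat.
apply: le_trans (ler_pM (normc_ge0 _) (normc_ge0 _) H hS) _.
have -> : e / (M * (normc z + 1)) * (normc z / k%:R) * (k%:R * M) = e * (normc z / (normc z + 1)).
  by field; rewrite !gt_eqF//; lra.
rewrite -[leRHS]mulr1 ler_wpM2l ?(ltW e0)// ler_pdivrMr ?mul1r; lra.
Qed.

End ExpPolynomials.

Section Siegel.

(** The box principle. With H = 2 n A + 1 and W = n A H, each of the |I| forms takes at most 2 W + 1
    = (H - 1) H + 1 < H^2 values on the H^(2 |I|) vectors with entries below H; two of these
    collide, and their difference is the solution. *)
Lemma siegel (I J : finType) (a : I -> J -> int) (A : nat) :
  #|J| = (2 * #|I|)%N -> (0 < #|I|)%N -> (0 < A)%N -> (forall i j, (`|a i j| <= A)%N) ->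
  exists x : J -> int, [/\ exists j, x j != 0, forall j, (`|x j| <= 2 * #|J| * A)%N &
    forall i, \sum_j a i j * x j = 0].
Proof.
move=> JI I0 A0 aA; set n := #|J| in JI *; pose H := (2 * n * A).+1; pose W := (n * A * H)%N.
have n0 : (0 < n)%N by rewrite JI; lia.
have sum_le (y : {ffun J -> 'I_H}) i : `|\sum_j a i j * (y j : nat)%:Z| <= W%:Z.
  apply: le_trans (ler_norm_sum _ _ _) _.
  apply: le_trans (_ : \sum_(j : J) (A * H)%N%:Z <= _).
    apply: ler_sum => j _; rewrite normrM PoszM.
    by apply: ler_pM => //; rewrite ?abszE ?lez_nat ?aA// ltnW// ltn_ord.
  by rewrite sumr_const -/n -mulr_natl natz -PoszM /W mulnA.
pose phi (y : {ffun J -> 'I_H}) : {ffun I -> 'I_(2 * W).+1} :=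
  [ffun i => inord (absz (\sum_j a i j * (y j : nat)%:Z + W%:Z))].
have : ~~ injectiveb phi.
  apply/negP => /injectiveP/leq_card; rewrite !card_ffun !card_ord -/n leqNgt => /negP; apply.
  have WH : ((2 * W).+1 < H ^ 2)%N.
    have -> : (2 * W = (2 * n * A) * H)%N by rewrite /W; lia.
    by rewrite -mulnn /H; nia.
  by rewrite [X in (_ < H ^ X)%N]JI expnM ltn_exp2r.
case/injectivePn => y [y' yy' /ffunP eyy].
exists (fun j => (y j : nat)%:Z - (y' j : nat)%:Z); split.
- apply/existsP; apply: contraNT yy' => /existsPn h; apply/eqP/ffunP => j; apply/val_inj/eqP.
  by have := h j; rewrite negbK subr_eq0 eqz_nat.
- by move=> j; have := ltn_ord (y j); have := ltn_ord (y' j); rewrite !ltnS; lia.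
- move=> i; have := eyy i; rewrite !ffunE => /(congr1 val).
  have b1 := sum_le y i; have b2 := sum_le y' i.
  have bd (w : nat) (z : int) : `|z| <= w%:Z -> (absz (z + w%:Z)%R < (2 * w).+1)%N by lia.
  have absE (w : nat) (z z' : int) : `|z| <= w%:Z -> `|z'| <= w%:Z ->
    absz (z + w%:Z)%R = absz (z' + w%:Z)%R -> z - z' = 0 by lia.
  rewrite /= !inordK ?bd// => e1.
  have -> : \sum_j a i j * ((y j : nat)%:Z - (y' j : nat)%:Z) =
     \sum_j a i j * (y j : nat)%:Z - \sum_j a i j * (y' j : nat)%:Z.
    by rewrite -sumrB; apply: eq_bigr => j _; rewrite mulrBr.
  exact: absE b1 b2 e1.
Qed.

End Siegel.

Section GaussianIntegers.
Variable R : realType.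
Local Notation C := R[i].

Definition gauss (u v : nat) : C := (u%:R +i* v%:R)%C.

Fixpoint gauss_pow (u v k : nat) : int * int :=
  if k is k'.+1 then let p := gauss_pow u v k' in
    (u%:Z * p.1 - v%:Z * p.2, u%:Z * p.2 + v%:Z * p.1) else (1, 0).

Lemma gauss_powE u v k : gauss u v ^+ k =
  ((gauss_pow u v k).1%:~R +i* (gauss_pow u v k).2%:~R)%C.
Proof.
elim: k => [|k IH]; first by rewrite expr0 /=.
rewrite exprS IH /gauss /=; simpc.
by rewrite !(rmorphB, rmorphD, rmorphM) /=.
Qed.

Lemma gauss_pow_le u v k :
  (`|(gauss_pow u v k).1| <= (u + v) ^ k)%N && (`|(gauss_pow u v k).2| <= (u + v) ^ k)%N.
Proof.
elim: k => [|k /andP[]] //=; rewrite expnS; move: (gauss_pow u v k) => [x y] /= hx hy.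
have h1 : (absz (u%:Z * x - v%:Z * y)%R <= u * `|x| + v * `|y|)%N.
  by have := abszM u x; have := abszM v y; rewrite !absz_nat; lia.
have h2 : (absz (u%:Z * y + v%:Z * x)%R <= u * `|y| + v * `|x|)%N.
  by have := abszM u y; have := abszM v x; rewrite !absz_nat; lia.
apply/andP; split; [apply: leq_trans h1 _|apply: leq_trans h2 _];
  by rewrite mulnDl leq_add// leq_mul2l ?hx ?hy orbT.
Qed.

Lemma normc_gauss_sub u v u' v' t : (u <= t)%N -> (v <= t)%N -> (u' <= t)%N -> (v' <= t)%N ->
  normc (gauss u v - gauss u' v') <= (2 * t)%:R.
Proof.
have d m n : (m <= t)%N -> (n <= t)%N -> `|m%:R - n%:R| <= t%:R :> R.
  move=> mt nt; rewrite ler_distl; move: mt nt; rewrite -!(ler_nat R).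
  have := ler0n R m; have := ler0n R n; move=> ? ? ? ?; apply/andP; split; lra.
move=> ut vt ut' vt'; apply: le_trans (normc_le_ReIm _) _; rewrite /gauss /=.
by rewrite mul2n -addnn natrD lerD// d.
Qed.

Lemma normc_gauss u v t : (u <= t)%N -> (v <= t)%N -> normc (gauss u v) <= (2 * t)%:R.
Proof.
move=> ut vt; have := normc_gauss_sub ut vt (leq0n t) (leq0n t).
by rewrite (_ : gauss 0 0 = 0)// subr0.
Qed.

Lemma gauss_inj u v u' v' : gauss u v = gauss u' v' -> (u, v) = (u', v').
Proof. by case=> /eqP; rewrite eqr_nat => /eqP -> /eqP; rewrite eqr_nat => /eqP ->. Qed.

Lemma cis_pi_nat n : cos (pi * n%:R : R) = (-1) ^+ n /\ sin (pi * n%:R : R) = 0.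
Proof.
elim: n => [|n [IH1 IH2]]; first by rewrite mulr0 cos0 sin0.
rewrite -natr1 mulrDr mulr1 cosDpi sinDpi IH1 IH2 oppr0.
by rewrite exprS mulN1r.
Qed.

Lemma cexp_gauss l u v : cexp ((pi * l%:R)%:C%C * gauss u v) =
  (expR pi ^+ (l * u) * (-1) ^+ (l * v))%:C%C :> C.
Proof.
have -> : (pi * l%:R)%:C%C * gauss u v = (pi * (l * u)%:R +i* (pi * (l * v)%:R))%C.
  by rewrite /gauss; simpc; rewrite !natrM !mulrA.
have [ec es] := cis_pi_nat (l * v).
by rewrite /cexp ec es mulr0 [pi * (l * u)%:R]mulrC expRM_natl.
Qed.

End GaussianIntegers.

Section ComplexApproximation.
Variable R : realType.
Local Notation C := R[i].

Definition capprox (f : nat -> C) (l : C) := forall e : R, 0 < e ->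
  exists n0 : nat, forall n, (n0 <= n)%N -> normc (f n - l) <= e.

Lemma capproxZ c f l : capprox f l -> capprox (fun n => c * f n) (c * l).
Proof.
move=> h e e0; have c0 : 0 < normc c + 1 by have := normc_ge0 c; lra.
have [n0 H] := h _ (divr_gt0 e0 c0); exists n0 => n /H{}H.
rewrite -mulrBr normcM; apply: le_trans (ler_wpM2l (normc_ge0 c) H) _.
by rewrite mulrCA -[leRHS]mulr1 ler_wpM2l ?(ltW e0)// ler_pdivrMr// mul1r lerDl.
Qed.

Lemma capprox_sum I (s : seq I) (F : I -> nat -> C) (l : I -> C) :
  (forall i, capprox (F i) (l i)) -> capprox (fun n => \sum_(i <- s) F i n) (\sum_(i <- s) l i).
Proof.
move=> h; elim: s => [|i s IH] e e0.
  by exists 0%N => n _; rewrite !big_nil subrr normc0 ltW.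
have e2 : 0 < e / 2 by rewrite divr_gt0.
have [n1 H1] := h i _ e2; have [n2 H2] := IH _ e2.
exists (maxn n1 n2) => n; rewrite geq_max => /andP[/H1 h1 /H2 h2].
rewrite !big_cons opprD addrACA (splitr e); exact: le_trans (le_normcD _ _) (lerD h1 h2).
Qed.

Lemma capprox0_sum I (s : seq I) (F : I -> nat -> C) (e : R) : 0 < e ->
  (forall i, List.In i s -> capprox (F i) 0) ->
  exists n0 : nat, forall n, (n0 <= n)%N -> \sum_(i <- s) normc (F i n) <= e.
Proof.
elim: s e => [|i s IH] e e0 h; first by exists 0%N => n _; rewrite big_nil ltW.
have e2 : 0 < e / 2 by rewrite divr_gt0.
have [n1 H1] := h i (or_introl erefl) _ e2.
have [n2 H2] := IH _ e2 (fun j hj => h j (or_intror hj)).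
exists (maxn n1 n2) => n; rewrite geq_max => /andP[/H1 h1 /H2 h2].
by rewrite big_cons (splitr e) lerD// -[F i n]subr0.
Qed.

End ComplexApproximation.

(** The left side collects a bound a^(15 t) for the denominator, the number 16 S^2 of terms, the
    bound on the unknowns, and powers and exponentials at radius 2 t + 2 t^2. All of it is at most
    E^(t^2) t^(3 S^2). Since 4 S^2 <= t^2, the exponent t^2 - 3 S^2 left on the right is at least
    t^2 / 4, so t > E^4 is enough. *)
Lemma gelfond_size (a S t : nat) : (0 < a)%N -> (0 < S)%N -> ((2 ^ 12 * a ^ 90) ^ 4 < t)%N -> (2 * S <= t)%N ->
  (a ^ (15 * t) * (16 * S ^ 2) * (2 * (16 * S ^ 2) * ((4 * S) ^ (S ^ 2) * a ^ (30 * S))) *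
    (2 * t + 2 * t ^ 2) ^ (S ^ 2) * a ^ (15 * (2 * t + 2 * t ^ 2)) < t ^ (t ^ 2))%N.
Proof.
move=> a0 S0; set E := (_ * _)%N => Et St.
have t0 : (0 < t)%N by exact: leq_ltn_trans Et.
set T := (S ^ 2)%N.
have T4 : (4 * T <= t ^ 2)%N by rewrite /T -(expnMn 2 S 2) leq_exp2r.
have tt : (t <= t ^ 2)%N by rewrite -mulnn leq_pmulr.
have h1 : (512 * S ^ 4 <= 2 ^ (9 + 2 * t))%N.
  rewrite expnD leq_mul//; apply: leq_trans (_ : (2 ^ S) ^ 4 <= _)%N.
    by rewrite leq_exp2r// ltnW// ltn_expl.
  by rewrite -expnM leq_exp2l//; lia.
have h2 : ((4 * S) ^ T * (2 * t + 2 * t ^ 2) ^ T <= 2 ^ (3 * T) * t ^ (3 * T))%N.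
  rewrite (expnM 2 3) (expnM t 3) -!expnMn leq_exp2r; last by rewrite expn_gt0 S0.
  apply: leq_trans (_ : (2 * t) * (4 * t ^ 2) <= _)%N; last by rewrite expnMn; lia.
  by apply: leq_mul; lia.
have -> : (a ^ (15 * t) * (16 * T) * (2 * (16 * T) * ((4 * S) ^ T * a ^ (30 * S))) *
    (2 * t + 2 * t ^ 2) ^ T * a ^ (15 * (2 * t + 2 * t ^ 2)) =
   (512 * S ^ 4) * ((4 * S) ^ T * (2 * t + 2 * t ^ 2) ^ T) *
   a ^ (15 * t + 30 * S + 15 * (2 * t + 2 * t ^ 2)))%N.
  by rewrite !expnD /T; ring.
apply: leq_ltn_trans (_ : E ^ (t ^ 2) * t ^ (3 * T) < _)%N.
  apply: leq_trans (leq_mul (leq_mul h1 h2) (leqnn _)) _.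
  have ha : (a ^ (15 * t + 30 * S + 15 * (2 * t + 2 * t ^ 2)) <= a ^ (90 * t ^ 2))%N.
    by apply: leq_pexp2l => //; lia.
  apply: leq_trans (leq_mul (leqnn _) ha) _.
  have h2' : (2 ^ (9 + 2 * t) * 2 ^ (3 * T) <= 2 ^ (12 * t ^ 2))%N.
    by rewrite -expnD leq_exp2l//; lia.
  rewrite /E expnMn -!expnM mulnA; set x := (a ^ _)%N; set y := (t ^ (_ * _))%N.
  by rewrite [leqRHS]mulnAC leq_mul2r; apply/orP; right; rewrite leq_mul2r h2' orbT.
have E0 : (0 < E)%N by rewrite /E muln_gt0 !expn_gt0 a0.
have -> : (t ^ (t ^ 2) = t ^ (t ^ 2 - 3 * T) * t ^ (3 * T))%N by rewrite -expnD subnK//; lia.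
rewrite ltn_pmul2r ?expn_gt0 ?t0//.
apply: leq_ltn_trans (_ : (E ^ 4) ^ (t ^ 2 - 3 * T) < _)%N.
  by rewrite -expnM leq_pexp2l//; lia.
rewrite ltn_exp2r//; have : (0 < T)%N by rewrite /T expn_gt0 S0.
lia.
Qed.

Lemma prod_le_expr (R : realType) (I : eqType) (s : seq I) (F : I -> R) (c : R) :
  (forall i, i \in s -> 0 <= F i <= c) -> \prod_(i <- s) F i <= c ^+ size s.
Proof.
elim: s => [|i s IH] h; first by rewrite big_nil expr0.
rewrite big_cons exprS; have /andP[h1 h2] : 0 <= F i <= c by apply: h; rewrite inE eqxx.
have hs j : j \in s -> 0 <= F j <= c by move=> js; apply: h; rewrite inE js orbT.
apply: ler_pM => //; last exact: IH.
by rewrite big_seq; apply: prodr_ge0 => j /hs/andP[].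
Qed.

Lemma intr_lt1_eq0 (R : realType) (z : int) : `|z%:~R : R| < 1 -> z = 0.
Proof. by rewrite -intr_norm -[1]/(1%:~R) ltr_int; lia. Qed.

Lemma intr_term (F : numFieldType) (g m : int) (M e : nat) (n : F) : n != 0 ->
  n * (m%:~R * (g%:~R * (M%:R / n * (-1) ^+ e))) = (g * (M%:Z * (-1) ^+ e) * m)%:~R.
Proof.
move=> n0; rewrite !rmorphM /= rmorphXn /= mulrN1z -[M%:~R]pmulrn; field.
exact: n0.
Qed.

(** * The auxiliary function under the assumption e^pi = a / b *)

Section Gelfond.
Variables (R : realType) (a b : nat).
Local Notation C := R[i].
Hypotheses (b0 : (0 < b)%N) (hab : expR pi = a%:R / b%:R :> R).

Let b0R : 0 < b%:R :> R. Proof. by rewrite ltr0n. Qed.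

Let ba : (b < a)%N.
Proof.
rewrite -(ltr_nat R) -[b%:R]mul1r -ltr_pdivlMr// -hab -expR0 ltr_expR; exact: pi_gt0.
Qed.

Let a0 : (0 < a)%N. Proof. exact: leq_ltn_trans ba. Qed.

Variable S : nat.
Hypotheses (S0 : (0 < S)%N) (S_large : ((2 ^ 12 * a ^ 90) ^ 4 <= S)%N).
(* There are 16 T unknowns and 8 T equations: the real and imaginary parts of the
   values at the X^2 = 4 T Gaussian integers u + i v with u, v < X. *)
Let T := (S ^ 2)%N.
Let X := (2 * S)%N.
Let J : finType := ('I_T * 'I_16)%type.
Let A := ((4 * S) ^ T * a ^ (30 * S))%N.
Let B := (2 * (16 * T) * A)%N.

(* Integrality comes from e^(pi (u + i v)) = (-1)^v (a / b)^u. *)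
Let coef (u v : nat) (im : bool) (j : J) : int :=
  (if im then (gauss_pow u v j.1).2 else (gauss_pow u v j.1).1) *
  ((a ^ (j.2 * u) * b ^ ((15 - j.2) * u))%:Z * (-1) ^+ (j.2 * v)).

Let F (x : J -> int) (z : C) : C := \sum_(j : J) (x j)%:~R * (z ^+ j.1 * cexp ((pi * (j.2 : nat)%:R)%:C%C * z)).

Let F_gauss x u v : (b ^ (15 * u))%:R * F x (gauss R u v) =
  ((\sum_j coef u v false j * x j)%:~R +i* (\sum_j coef u v true j * x j)%:~R)%C.
Proof.
have termE (j : J) : (b ^ (15 * u))%:R * ((x j)%:~R * (gauss R u v ^+ j.1 * cexp ((pi * (j.2 : nat)%:R)%:C%C * gauss R u v)))
   = ((coef u v false j * x j)%:~R +i* (coef u v true j * x j)%:~R)%C.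
  rewrite cexp_gauss gauss_powE hab /coef.
  have -> : (a%:R / b%:R) ^+ (j.2 * u) = (a ^ (j.2 * u) * b ^ ((15 - j.2) * u))%:R / (b ^ (15 * u))%:R :> R.
    have -> : (15 * u = j.2 * u + (15 - j.2) * u)%N by rewrite -mulnDl subnKC// -ltnS ltn_ord.
    rewrite expnD !natrM !natrX expr_div_n; field.
    by rewrite !expf_neq0// gt_eqF.
  have bu : (b ^ (15 * u))%:R != 0 :> R by rewrite pnatr_eq0 expn_eq0 negb_and -lt0n b0.
  have toR n : n%:R = (n%:R)%:C%C :> C by rewrite rmorph_nat.
  have toRz n : n%:~R = (n%:~R)%:C%C :> C by rewrite rmorph_int.
  rewrite toR toRz; set M := (a ^ _ * _)%N; simpc.
  by congr (_ +i* _)%C; exact: intr_term.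
rewrite /F mulr_sumr (eq_bigr _ (fun j _ => termE j)).
elim/big_rec3: _ => [//|j y1 y2 y3 _ ->]; simpc; by rewrite !rmorphD.
Qed.

Let coef_le u v im j : (u < X)%N -> (v < X)%N -> (`|coef u v im j| <= A)%N.
Proof.
move=> uX vX; rewrite /coef !abszM abszX abszN absz1 exp1n muln1 absz_nat.
have uv : (u + v <= 4 * S)%N by move: uX vX; rewrite /X; lia.
have S4 : (0 < 4 * S)%N by rewrite muln_gt0 S0.
apply: leq_mul.
  have le : ((u + v) ^ j.1 <= (4 * S) ^ T)%N.
    apply: leq_trans (_ : (4 * S) ^ j.1 <= _)%N; last by rewrite leq_pexp2l// ltnW.
    by case: (nat_of_ord j.1) => // k; rewrite leq_exp2r.
  by have /andP[h1 h2] := gauss_pow_le u v j.1; case: im; exact: leq_trans le.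
have j15 : (j.2 <= 15)%N by rewrite -ltnS.
apply: leq_trans (_ : a ^ (j.2 * u) * a ^ ((15 - j.2) * u) <= _)%N.
  rewrite leq_mul2l; apply/orP; right; case: ((15 - j.2) * u)%N => // k.
  by rewrite leq_exp2r// ltnW.
rewrite -expnD leq_pexp2l// -mulnDl subnKC//.
by move: uX; rewrite /X; lia.
Qed.

Let solution : exists x : J -> int, [/\ exists j, x j != 0, forall j, (`|x j| <= B)%N &
  forall u v, (u < X)%N -> (v < X)%N -> F x (gauss R u v) = 0].
Proof.
have cJ : #|J| = (16 * T)%N by rewrite card_prod !card_ord mulnC.
pose I : finType := ('I_X * 'I_X * bool)%type.
have cI : #|I| = (8 * T)%N by rewrite !card_prod !card_ord card_bool /X /T; lia.
have T0 : (0 < T)%N by rewrite expn_gt0 S0.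
have [||||x [x0 xB hx]] := @siegel I J (fun i j => coef i.1.1 i.1.2 i.2 j) A.
- by rewrite cJ cI; lia.
- by rewrite cI; lia.
- by rewrite muln_gt0 !expn_gt0 a0 muln_gt0 S0.
- by move=> i j; apply: coef_le.
exists x; split=> //; first by rewrite /B -cJ.
move=> u v uX vX; have := F_gauss x u v.
rewrite (hx (Ordinal uX, Ordinal vX, false)) (hx (Ordinal uX, Ordinal vX, true)) => /eqP.
by rewrite mulf_eq0 pnatr_eq0 expn_eq0 eqn0Ngt b0 /= => /eqP.
Qed.

(** Each exponential e^(pi l z) is replaced by (1 + pi l z / (n+1))^(n+1), which turns [F] into
    polynomials accessible to Newton interpolation. *)
Let P x n : {poly C} := \sum_(j : J) (x j)%:~R *:
  ((1 + ((pi * (j.2 : nat)%:R) / n.+1%:R)%:C%C *: 'X) ^+ n.+1 * 'X ^+ j.1).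

Let P_cvg x z : capprox (fun n => (P x n).[z]) (F x z).
Proof.
rewrite (_ : (fun n => _) = fun n => \sum_(j : J) (x j)%:~R * (z ^+ j.1 *
   (1 + (pi * (j.2 : nat)%:R)%:C%C * z / n.+1%:R) ^+ n.+1)).
  apply: capprox_sum => j; apply: capproxZ; apply: capproxZ.
  by move=> e /affine_exp_cvg; apply.
apply/funext => n; rewrite /P horner_sum; apply: eq_bigr => j _.
rewrite hornerZ hornerM horner_exp hornerD hornerZ hornerXn hornerX hornerC [(1 + _) ^+ _ * _]mulrC.
congr (_ * (_ * (_ + _) ^+ _)).
by rewrite rmorphM fmorphV rmorph_nat mulrAC.
Qed.

(** The bound is uniform in [n] because (1 + y/(n+1))^(n+1) <= e^y for y >= 0, and e^pi = a / b <= a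
    turns the exponential into an integer power. *)
Let P_norm x n (r : nat) : (forall j, (`|x j| <= B)%N) -> (0 < r)%N ->
  pnorm r%:R (P x n) <= ((16 * T) * B * r ^ T * a ^ (15 * r))%:R.
Proof.
move=> xB r0; have r1 : 1 <= r%:R :> R by rewrite ler1n.
have rp : 0 <= r%:R :> R by rewrite ler0n.
apply: le_trans (pnorm_sum _ _ rp) _.
apply: le_trans (_ : \sum_(j : J) (B * (r ^ T * a ^ (15 * r)))%:R <= _); last first.
  by rewrite -natr_sum ler_nat sum_nat_const card_prod !card_ord; lia.
apply: ler_sum => j _; rewrite pnormZ pnorm_Xn (natrM _ B) (natrM _ (r ^ T)).
have nx : normc ((x j)%:~R : C) <= B%:R.
  rewrite -(rmorph_int (real_complex R)) normc_real -intr_norm -[B%:R]/(B%:Z%:~R) ler_int.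
  by rewrite -abszE lez_nat.
apply: ler_pM; rewrite ?normc_ge0 ?mulr_ge0 ?exprn_ge0 ?pnorm_ge0//.
apply: ler_pM; rewrite ?exprn_ge0 ?pnorm_ge0//.
  by rewrite natrX ler_weXn2l// ltnW// ltn_ord.
apply: le_trans (pnorm_affine_exp _ _ rp) _.
have c0 : 0 <= pi * (j.2 : nat)%:R / n.+1%:R :> R by rewrite divr_ge0 ?mulr_ge0 ?ler0n// ltW// pi_gt0.
rewrite normc_real ger0_norm//.
apply: le_trans (_ : expR (pi * (j.2 : nat)%:R / n.+1%:R * r%:R) ^+ n.+1 <= _).
  have cr := mulr_ge0 c0 rp.
  by apply: lerXn2r; rewrite ?nnegrE ?expR_ge0 ?(addr_ge0 ler01 cr)//; exact: expR_ge1Dx.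
rewrite -expRM_natl.
have -> : n.+1%:R * (pi * (j.2 : nat)%:R / n.+1%:R * r%:R) = (j.2 * r)%:R * pi :> R.
  by rewrite mulrA [n.+1%:R * _]mulrC divfK ?pnatr_eq0// natrM; ring.
rewrite expRM_natl hab natrX.
apply: le_trans (_ : a%:R ^+ (j.2 * r) <= _).
  rewrite lerXn2r ?nnegrE ?divr_ge0 ?ler0n// ler_pdivrMr// -natrM ler_nat; exact: leq_pmulr.
by rewrite ler_weXn2l ?ler1n// leq_mul2r; have := ltn_ord j.2; lia.
Qed.

Let grid t : seq C := [seq gauss R p.1 p.2 | p <- [seq (u, v) | u <- iota 0 t, v <- iota 0 t]].

Let grid_uniq t : uniq (grid t).
Proof.
rewrite map_inj_uniq; last by move=> [? ?] [? ?] /gauss_inj.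
by apply: allpairs_uniq; rewrite ?iota_uniq// => -[? ?] [? ?].
Qed.

Let gridP t z : reflect (exists u v, [/\ (u < t)%N, (v < t)%N & z = gauss R u v]) (z \in grid t).
Proof.
apply: (iffP mapP) => [[_ /allpairsP[[u v] /= [hu hv ->]] ->]|[u [v [hu hv ->]]]].
  by exists u, v; move: hu hv; rewrite !mem_iota.
by exists (u, v) => //; apply/allpairsP; exists (u, v); rewrite !mem_iota.
Qed.

(* b^(15 u) F(u + i v) is a Gaussian integer, and the t^2 zeros already known make
   it smaller than 1. *)
Let extrapolation x t : (forall j, (`|x j| <= B)%N) -> (X <= t)%N ->
  (forall u v, (u < t)%N -> (v < t)%N -> F x (gauss R u v) = 0) ->
  forall u v, (u <= t)%N -> (v <= t)%N -> F x (gauss R u v) = 0.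
Proof.
move=> xB Xt hF u v ut vt.
have t0 : (0 < t)%N by apply: leq_trans Xt; rewrite /X; lia.
(* Grid points satisfy |z| <= 2 t and |w - z| <= 2 t, so this radius gives r - |z| >= 2 t^2: a
   factor 1 / t for each of the t^2 zeros. *)
pose r := (2 * t + 2 * t ^ 2)%N; pose w := gauss R u v.
have r0 : (0 < r)%N by rewrite /r; lia.
have tR : 0 < t%:R :> R by rewrite ltr0n.
have r2t : r%:R - (2 * t)%:R = 2 * t%:R ^+ 2 :> R by rewrite /r natrD !natrM; ring.
have zr z : z \in grid t -> normc z <= (2 * t)%:R.
  by move=> /gridP[u' [v' [hu hv ->]]]; apply: normc_gauss; exact: ltnW.
have rt : (2 * t)%:R < r%:R :> R by rewrite ltr_nat /r; lia.
have [||c c0 H] := @interpolation_bound R r%:R w (grid t) (grid_uniq t).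
- by move=> z /zr/le_lt_trans; apply.
- exact: le_trans (normc_gauss R ut vt) (ltW rt).
pose K := ((16 * T) * B * r ^ T * a ^ (15 * r))%N.
have prod_le : \prod_(z <- grid t) (normc (w - z) / (r%:R - normc z)) <= (t%:R ^+ (t ^ 2))^-1.
  rewrite -exprVn.
  have <- : size (grid t) = (t ^ 2)%N by rewrite size_map size_allpairs !size_iota mulnn.
  apply: prod_le_expr => z zg; have zz := zr z zg.
  have dz : 0 < r%:R - normc z by rewrite subr_gt0; exact: le_lt_trans rt.
  rewrite divr_ge0 ?normc_ge0 ?(ltW dz)//= ler_pdivrMr//.
  move: zg => /gridP[u' [v' [hu hv ez]]].
  have : normc (w - z) <= (2 * t)%:R by rewrite ez; apply: normc_gauss_sub; rewrite // ltnW.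
  move=> /le_trans; apply; rewrite mulrC ler_pdivlMr//.
  by apply: le_trans (lerB (lexx _) zz); rewrite r2t natrM expr2 mulrA.
have prod_ge : 0 <= \prod_(z <- grid t) (normc (w - z) / (r%:R - normc z)).
  rewrite big_seq; apply: prodr_ge0 => z /zr zz; rewrite divr_ge0 ?normc_ge0// subr_ge0.
  exact: le_trans zz (ltW rt).
have Fw : normc (F x w) <= K%:R / t%:R ^+ (t ^ 2).
  apply/ler_addgt0Pr => e e0.
  have e2 : 0 < e / 2 by rewrite divr_gt0.
  have c1 : 0 < c + 1 by lra.
  have [n1 H1] := P_cvg x w e2.
  (* [F] vanishes on the grid, so its polynomial approximations tend to 0 there and the first term
     of the interpolation bound disappears in the limit. *)
  have [|n2 H2] := @capprox0_sum R C (grid t) (fun z n => (P x n).[z]) _ (divr_gt0 e2 c1).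
    move=> z hz; have /gridP[u' [v' [hu hv ->]]] : z \in grid t.
      by elim: (grid t) hz => //= y s IH [->|/IH]; rewrite inE ?eqxx// => ->; rewrite orbT.
    by rewrite -(hF _ _ hu hv); exact: P_cvg.
  pose n := maxn n1 n2.
  have {}H1 := H1 n (leq_maxl _ _); have {}H2 := H2 n (leq_maxr _ _).
  rewrite -[F x w](subrK (P x n).[w]); apply: le_trans (le_normcD _ _) _.
  rewrite normcBC; have {}H := H (P x n).
  have h1 : c * (\sum_(z <- grid t) normc (P x n).[z]) <= e / 2.
    apply: le_trans (ler_wpM2l c0 H2) _.
    by rewrite mulrCA -[leRHS]mulr1 ler_wpM2l ?(ltW e2)// ler_pdivrMr// mul1r lerDl.
  have h2 : pnorm r%:R (P x n) * \prod_(z <- grid t) (normc (w - z) / (r%:R - normc z)) <= K%:R / t%:R ^+ (t ^ 2).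
    by apply: ler_pM; rewrite ?pnorm_ge0 ?ler0n//; exact: P_norm.
  rewrite (splitr e); move: (le_trans H (lerD h1 h2)) H1.
  by set y1 := normc _; set y2 := normc _; lra.
have small : normc ((b ^ (15 * u))%:R * F x w) < 1.
  rewrite normcM -(rmorph_nat (real_complex R)) normc_real normr_nat.
  apply: le_lt_trans (ler_wpM2l (ler0n _ _) Fw) _.
  rewrite mulrA ltr_pdivrMr ?exprn_gt0// mul1r -natrM -natrX ltr_nat.
  have St : ((2 ^ 12 * a ^ 90) ^ 4 < t)%N.
    apply: leq_ltn_trans S_large _; apply: leq_trans Xt; rewrite /X; lia.
  apply: leq_ltn_trans (gelfond_size a0 S0 St Xt).
  rewrite /K /B /A -/T -/r.
  have hb : (b ^ (15 * u) <= a ^ (15 * t))%N.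
    apply: leq_trans (_ : a ^ (15 * u) <= _)%N; first by case: (15 * u)%N => // k; rewrite leq_exp2r// ltnW.
    by rewrite leq_pexp2l// leq_mul2l ut orbT.
  by rewrite !mulnA !leq_mul2r hb !orbT.
have := F_gauss x u v; rewrite -/w => eF.
rewrite eF in small.
have hRe := intr_lt1_eq0 (le_lt_trans (le_normc_Re _) small).
have hIm := intr_lt1_eq0 (le_lt_trans (le_normc_Im _) small).
rewrite hRe hIm in eF; move/eqP: eF.
by rewrite mulf_eq0 pnatr_eq0 expn_eq0 eqn0Ngt b0 /= => /eqP.
Qed.

(* For fixed u the exponentials are constant on the points u + 2 i v, where F is
   thus a polynomial with infinitely many zeros; its coefficients are polynomials
   in (e^pi)^u, again with infinitely many zeros. *)
Lemma gelfond_false : False.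
Proof.
have [x [[[k0 l0] xj] xB xF]] := solution.
have Fall u v : F x (gauss R u v) = 0.
  have all t u' v' : (u' < X + t)%N -> (v' < X + t)%N -> F x (gauss R u' v') = 0.
    elim: t u' v' => [|t IH] u' v'; first by rewrite addn0; exact: xF.
    rewrite addnS !ltnS; apply: extrapolation => //; exact: leq_addr.
  have lt m n : (m < X + (m + n).+1)%N by rewrite addnS ltnS addnCA leq_addr.
  by apply: (all (u + v).+1); rewrite ?lt// [(u + v)%N]addnC lt.
pose q : R := a%:R / b%:R.
have q1 : 1 < q by rewrite ltr_pdivlMr// mul1r ltr_nat.
(* [F] as a polynomial in z, with e^(pi l z) frozen at its value q^(u l); [insub] turns the natural
   exponent back into an ordinal. *)
pose Q u : {poly C} := \poly_(k < T) \sum_(l < 16) (if insub k is Some k' then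
   (x (k', l))%:~R else 0) * ((q ^+ u) ^+ l)%:C%C.
have Q0 u : Q u = 0.
  apply: (@roots_geq_poly_eq0 _ _ [seq gauss R u (2 * v) | v <- iota 0 T]); last 2 first.
  - rewrite map_inj_uniq ?iota_uniq// => v v' /gauss_inj[]; clear; lia.
  - by rewrite size_map size_iota size_poly.
  apply/allP => _ /mapP[v _ ->]; rewrite rootE horner_poly; apply/eqP.
  have F0 : \sum_(k < T) \sum_(l < 16) (x (k, l))%:~R *
    (gauss R u (2 * v) ^+ k * cexp ((pi * (l : nat)%:R)%:C%C * gauss R u (2 * v))) = 0.
    by rewrite pair_bigA -[RHS](Fall u (2 * v)%N); apply: eq_bigr => -[k l] _.
  rewrite -[RHS]F0.
  apply: eq_bigr => k _; rewrite mulr_suml; apply: eq_bigr => l _.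
  rewrite valK cexp_gauss hab -/q -exprM [(u * l)%N]mulnC.
  have -> : (-1) ^+ (l * (2 * v)) = 1 :> R by rewrite mulnCA exprM sqrrN expr1n expr1n.
  by rewrite mulr1 -mulrA [gauss R u _ ^+ _ * _]mulrC.
have Qc u : \sum_(l < 16) (x (k0, l))%:~R * (q ^+ u) ^+ l = 0 :> R.
  have := congr1 (fun p : {poly C} => p`_k0) (Q0 u); rewrite coef_poly ltn_ord coef0 valK => h.
  apply: (@complexI R); rewrite [RHS]rmorph0 -[RHS]h rmorph_sum /=; apply: eq_bigr => l _.
  by rewrite rmorphM /= rmorph_int.
have p0 : \poly_(l < 16) (x (k0, inord l))%:~R = 0 :> {poly R}.
  apply: (@roots_geq_poly_eq0 _ _ [seq q ^+ u | u <- iota 0 16]); last 2 first.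
  - rewrite map_inj_uniq ?iota_uniq// ; apply: ieexprIn; last by rewrite gt_eqF.
    exact: lt_trans q1.
  - by rewrite size_map size_iota size_poly.
  apply/allP => _ /mapP[u _ ->]; rewrite rootE horner_poly; apply/eqP; rewrite -[RHS](Qc u).
  by apply: eq_bigr => l _; rewrite inord_val.
have := congr1 (fun p : {poly R} => p`_l0) p0; rewrite coef_poly ltn_ord coef0 inord_val => /eqP.
by rewrite intr_eq0 (negbTE xj).
Qed.

End Gelfond.

Theorem expR_pi_irrational (R : realType) (a b : nat) : (0 < b)%N -> expR pi <> a%:R / b%:R :> R.
Proof.
move=> b0 hab; have a0 : (0 < a)%N.
  by rewrite lt0n; apply/eqP => a0; have := expR_gt0 (pi : R); rewrite hab a0 mul0r ltxx.
(* The parameter [S] is set to the threshold of the size estimate; every later t satisfies t >= 2 S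
   and lies strictly above it. *)
apply: (@gelfond_false R a b b0 hab ((2 ^ 12 * a ^ 90) ^ 4)%N) => //.
by rewrite expn_gt0 muln_gt0 !expn_gt0 a0.
Qed.

(** * Counting ideals *)

Section MultiplicativeFunctions.

Lemma dvdn_coprime_mul m n d : coprime m n -> (d %| m * n)%N ->
  d = (gcdn d m * gcdn d n)%N.
Proof.
move=> cmn dmn; apply/eqP; rewrite eqn_dvd; apply/andP; split.
  rewrite muln_gcdl dvdn_gcd dvdn_mulr//= muln_gcdr dvdn_gcd dmn andbT.
  by rewrite dvdn_mull.
rewrite Gauss_dvd ?dvdn_gcdl//.
by apply: coprime_dvdl (dvdn_gcdr _ _) (coprime_dvdr (dvdn_gcdr _ _) cmn).
Qed.

Lemma perm_divisors_mul m n : (0 < m)%N -> (0 < n)%N -> coprime m n ->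
  perm_eq (divisors (m * n)) [seq (d1 * d2)%N | d1 <- divisors m, d2 <- divisors n].
Proof.
move=> m0 n0 cmn; apply: uniq_perm; first exact: divisors_uniq.
- apply: allpairs_uniq; rewrite ?divisors_uniq// => -[a b] [a' b'].
  move=> /allpairsP[[x y] /= [xm yn [-> ->]]] /allpairsP[[x' y'] /= [xm' yn' [-> ->]]].
  rewrite -!dvdn_divisors// in xm yn xm' yn' => e.
  have g u v : (u %| m)%N -> (v %| n)%N -> gcdn (u * v) m = u.
    move=> um vn; rewrite gcdnC Gauss_gcdl; first by rewrite gcdnC; exact/gcdn_idPl.
    exact: coprime_dvdr vn cmn.
  have h u v : (u %| m)%N -> (v %| n)%N -> gcdn (u * v) n = v.
    move=> um vn; rewrite gcdnC mulnC Gauss_gcdl; first by rewrite gcdnC; exact/gcdn_idPl.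
    by rewrite coprime_sym; exact: coprime_dvdl um cmn.
  have -> : x = x' by rewrite -(g x y)// e g.
  by have -> : y = y' by rewrite -(h x y)// e h.
- move=> d; rewrite -dvdn_divisors ?muln_gt0 ?m0//.
  apply/idP/allpairsP => [dmn|[[x y] /= [xm yn ->]]]; last first.
    by rewrite -!dvdn_divisors// in xm yn; exact: dvdn_mul.
  exists (gcdn d m, gcdn d n); rewrite -!dvdn_divisors// !dvdn_gcdr; split=> //.
  exact: dvdn_coprime_mul.
Qed.

(** The summand may depend on the number as well as on its divisor, as the condition d^2 | n in the
    ideal count does. *)
Lemma divisor_sum_mul (R : pzRingType) (H : nat -> nat -> R) m n :
  (0 < m)%N -> (0 < n)%N -> coprime m n ->
  (forall d1 d2, (d1 %| m)%N -> (d2 %| n)%N -> H (d1 * d2)%N (m * n)%N = H d1 m * H d2 n) ->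
  \sum_(d <- divisors (m * n)) H d (m * n)%N =
  (\sum_(d <- divisors m) H d m) * (\sum_(d <- divisors n) H d n).
Proof.
move=> m0 n0 cmn HM; rewrite (perm_big _ (perm_divisors_mul m0 n0 cmn)) big_allpairs_dep /=.
rewrite mulr_suml big_seq [RHS]big_seq; apply: eq_bigr => d1 d1m.
rewrite mulr_sumr big_seq [RHS]big_seq; apply: eq_bigr => d2 d2n.
by apply: HM; rewrite dvdn_divisors.
Qed.

Lemma multiplicative_ext (R : pzRingType) (f g : nat -> R) : f 1%N = g 1%N ->
  (forall m n, (0 < m)%N -> (0 < n)%N -> coprime m n -> f (m * n)%N = f m * f n) ->
  (forall m n, (0 < m)%N -> (0 < n)%N -> coprime m n -> g (m * n)%N = g m * g n) ->
  (forall p e, prime p -> f (p ^ e)%N = g (p ^ e)%N) ->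
  forall n, (0 < n)%N -> f n = g n.
Proof.
move=> fg1 fM gM fgp n; have [k] := ubnP n; elim: k n => // k IH n nk n0.
have [n1|n1] := leqP n 1; first by have -> : n = 1%N by lia.
have pp := pdiv_prime n1; set p := pdiv n in pp.
have [m cpm e] := pfactor_coprime pp n0.
have m0 : (0 < m)%N by move: n0; rewrite {1}e muln_gt0 => /andP[].
have l0 : (0 < logn p n)%N by rewrite logn_gt0 mem_primes pp n0 pdiv_dvd.
have pe0 : (0 < p ^ logn p n)%N by rewrite expn_gt0 prime_gt0.
have mn : (m < k)%N.
  rewrite ltnS in nk; apply: leq_trans nk; rewrite [ltnRHS]e -[ltnLHS]muln1 ltn_pmul2l//.
  by rewrite -(expn0 p) ltn_exp2l ?prime_gt1.
have c : coprime m (p ^ logn p n) by rewrite coprime_sym coprimeXl.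
by rewrite e fM// gM// fgp// IH.
Qed.

Lemma perm_divisors_pfactor p e : prime p ->
  perm_eq (divisors (p ^ e)) [seq (p ^ i)%N | i <- iota 0 e.+1].
Proof.
move=> pp; apply: uniq_perm; first exact: divisors_uniq.
  rewrite map_inj_uniq ?iota_uniq// => i j /eqP.
  by rewrite eqn_exp2l ?prime_gt1// => /eqP.
move=> d; rewrite -dvdn_divisors ?expn_gt0 ?prime_gt0//.
apply/idP/mapP; first move=> /(dvdn_pfactor _ _ pp) [i ie ->].
  by exists i; rewrite // mem_iota.
by case=> i; rewrite mem_iota /= add0n ltnS => ie ->; rewrite dvdn_exp2l.
Qed.

Lemma divisor_sum_pfactor (R : pzRingType) (H : nat -> R) p e : prime p ->
  \sum_(d <- divisors (p ^ e)) H d = \sum_(i < e.+1) H (p ^ i)%N.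
Proof.
move=> pp; rewrite (perm_big _ (perm_divisors_pfactor e pp)) big_map -/(index_iota 0 e.+1).
by rewrite big_mkord.
Qed.

End MultiplicativeFunctions.

Section QuadraticCongruences.
Variables (t n0 : int).

Definition qpol (b : int) : int := b ^+ 2 + t * b + n0.

(* The number of b modulo a such that a divides N(b + om) = b^2 + t b + n0. *)
Definition rho (a : nat) : nat := \sum_(b < a) ((a%:Z %| qpol (b : nat)%:Z)%Z : nat).

Lemma qpolB x y : qpol x - qpol y = (x - y) * (x + y + t).
Proof. by rewrite /qpol; ring. Qed.

Lemma qpol_disc b : (2 * b + t) ^+ 2 = (t ^+ 2 - 4 * n0) + 4 * qpol b.
Proof. by rewrite /qpol; ring. Qed.

Lemma dvdz_qpol (d x y : int) : (d %| x - y)%Z -> (d %| qpol x)%Z = (d %| qpol y)%Z.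
Proof.
move=> dxy; have e : qpol x = (x - y) * (x + y + t) + qpol y by rewrite -qpolB subrK.
by rewrite e rpredDl// dvdz_mulr.
Qed.

Lemma qpol_period (d : nat) (r : nat) : (d%:Z %| qpol (r + d)%N%:Z)%Z = (d%:Z %| qpol r%:Z)%Z.
Proof. by apply: dvdz_qpol; rewrite PoszD addrC addKr dvdzz. Qed.

Lemma rhoM m n : (0 < m)%N -> (0 < n)%N -> coprime m n -> rho (m * n) = (rho m * rho n)%N.
Proof.
move=> m0 n0' cmn; rewrite /rho.
have cz : coprimez m n by rewrite coprimezE.
rewrite (@sum_residues_crt nat (fun r => ((m * n)%N%:Z %| qpol r%:Z)%Z : nat) m n m0 n0' cmn); last first.
  by move=> r; rewrite qpol_period.
have split_term r1 r2 : (((m * n)%N%:Z %| qpol (r1 * n + r2 * m)%N%:Z)%Z : nat) =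
   ((m%:Z %| qpol (r1 * n)%N%:Z)%Z * (n%:Z %| qpol (r2 * m)%N%:Z)%Z)%N.
  rewrite PoszM Gauss_dvdz// -mulnb; congr (_ * _)%N; congr nat_of_bool; apply: dvdz_qpol.
    by rewrite PoszD addrC addKr PoszM dvdz_mull.
  by rewrite PoszD addrK PoszM dvdz_mull.
under eq_bigr => r1 _ do under eq_bigr => r2 _ do rewrite split_term.
under eq_bigr => r1 _ do rewrite -big_distrr /=.
rewrite -big_distrl /=; congr (_ * _)%N.
  by apply: (@sum_residues_mul nat (fun r => (m%:Z %| qpol r%:Z)%Z : nat) m n) => // [|r];
    rewrite ?qpol_period// coprime_sym.
by apply: (@sum_residues_mul nat (fun r => (n%:Z %| qpol r%:Z)%Z : nat) n m) => // r; rewrite qpol_period.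
Qed.

Lemma rho1 : rho 1 = 1%N.
Proof. by rewrite /rho big_ord1 dvd1z. Qed.

Lemma count_translate (p : nat) (e : int) : (0 < p)%N ->
  (\sum_(c < p) ((p%:Z %| (e + (c : nat)%:Z)%R)%Z : nat) = 1)%N.
Proof.
move=> p0; pose r := ((- e) %% p%:Z)%Z.
have r0 : 0 <= r by rewrite modz_ge0// eqz_nat -lt0n.
have rp : r < p%:Z by rewrite ltz_pmod// ltz_nat.
have rn : (absz r < p)%N by lia.
rewrite (bigD1 (Ordinal rn)) //= gez0_abs// big1 => [|c cr].
  have -> : e + r = - ((- e - r)) by ring.
  by rewrite addn0 rpredN -eqz_mod_dvd modz_mod eqxx.
apply/eqP; rewrite eqb0; apply: contra cr => h.
apply/eqP/val_inj => /=.
have : (p%:Z %| ((c : nat)%:Z - - e)%R)%Z by rewrite opprK addrC.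
rewrite -eqz_mod_dvd => /eqP; rewrite modz_small; last by rewrite lez_nat leq0n ltz_nat ltn_ord.
by rewrite -/r => <-.
Qed.

Lemma count_linear (p : nat) (e u : int) : prime p -> ~~ (p%:Z %| u)%Z ->
  (\sum_(c < p) ((p%:Z %| (e + (c : nat)%:Z * u)%R)%Z : nat) = 1)%N.
Proof.
move=> pp pu; have p0 := prime_gt0 pp; pose v := absz (u %% p%:Z)%Z.
have ev : v%:Z = (u %% p%:Z)%Z by rewrite gez0_abs// modz_ge0// eqz_nat -lt0n.
have uv : (p%:Z %| (u - v%:Z)%R)%Z by rewrite -eqz_mod_dvd ev modz_mod.
have cv : coprime v p.
  rewrite coprime_sym prime_coprime//; apply: contra pu => pv.
  have : (p%:Z %| v%:Z)%Z by [].
  by move=> h; rewrite -(subrK v%:Z u) rpredD.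
rewrite -(count_translate e p0) -(@sum_residues_mul nat (fun c => (p%:Z %| (e + c%:Z)%R)%Z : nat) p v p0 cv).
  apply: eq_bigr => c _; congr nat_of_bool.
  have -> : e + (c : nat)%:Z * u = (e + (c * v)%N%:Z) + (c : nat)%:Z * (u - v%:Z) by rewrite PoszM; ring.
  by rewrite rpredDr// dvdz_mull.
by move=> c; rewrite PoszD addrA rpredDr// dvdzz.
Qed.

Section PrimePower.
Variable p : nat.
Hypothesis pp : prime p.

Let p0 : (0 < p)%N. Proof. exact: prime_gt0. Qed.

(** Hensel lifting: qpol(b + p^k c) = qpol(b) + p^k c (2 b + t) + p^(2k) c^2, and at a root 2 b + t
    is invertible because its square is the discriminant modulo p. The condition on c is thus linear
    and each root lifts in exactly one way. *)
Lemma rho_hensel k : (0 < k)%N -> ~~ (p%:Z %| (t ^+ 2 - 4 * n0)%R)%Z -> rho (p ^ k.+1) = rho (p ^ k).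
Proof.
move=> k0 pD; rewrite /rho expnSr.
rewrite (sum_mul_ord (fun b => ((p ^ k * p)%N%:Z %| qpol b%:Z)%Z : nat)) exchange_big /=.
apply: eq_bigr => b _.
have [/dvdzP[e eb]|nb] := boolP ((p ^ k)%N%:Z %| qpol (b : nat)%:Z)%Z; last first.
  rewrite big1// => c _; apply/eqP; rewrite eqb0; apply: contra nb => h.
  have : ((p ^ k)%N%:Z %| qpol (p ^ k * c + b)%N%:Z)%Z.
    by apply: dvdz_trans h; rewrite PoszM dvdz_mulr.
  by rewrite (@dvdz_qpol _ _ (b : nat)%:Z)// PoszD addrK PoszM dvdz_mulr.
have pu : ~~ (p%:Z %| (2 * (b : nat)%:Z + t)%R)%Z.
  apply: contra pD => h.
  have -> : t ^+ 2 - 4 * n0 = (2 * (b : nat)%:Z + t) ^+ 2 - 4 * qpol (b : nat)%:Z by rewrite qpol_disc addrK.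
  rewrite rpredB//; first by rewrite expr2 dvdz_mulr.
  rewrite dvdz_mull// eb dvdz_mull// -(prednK k0) expnS PoszM dvdz_mulr//.
rewrite -[RHS](@count_linear p e _ pp pu); apply: eq_bigr => c _; congr nat_of_bool.
have -> : qpol (p ^ k * c + b)%N%:Z = (p ^ k)%N%:Z *
   (e + (c : nat)%:Z * (2 * (b : nat)%:Z + t) + (p ^ k)%N%:Z * (c : nat)%:Z ^+ 2).
  have -> : qpol (p ^ k * c + b)%N%:Z = qpol (b : nat)%:Z + (p ^ k)%N%:Z *
    ((c : nat)%:Z * (2 * (b : nat)%:Z + t) + (p ^ k)%N%:Z * (c : nat)%:Z ^+ 2).
    by rewrite /qpol PoszD PoszM; ring.
  by rewrite eb; ring.
rewrite PoszM dvdz_mul2l ?eqz_nat ?expn_eq0 -?lt0n ?gtn_eqF ?p0// rpredDr// dvdz_mulr// -(prednK k0) expnS PoszM dvdz_mulr//.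
Qed.

Lemma rho_hensel_iter k : ~~ (p%:Z %| (t ^+ 2 - 4 * n0)%R)%Z -> rho (p ^ k.+1) = rho p.
Proof. by move=> pD; elim: k => [|k IH]; rewrite ?expn1// rho_hensel. Qed.

(** A root b0 comes with the root - t - b0, and the two are distinct since their difference is 2 b0
    + t up to sign, a unit modulo p. *)
Lemma rho_unramified : ~~ (p%:Z %| (t ^+ 2 - 4 * n0)%R)%Z ->
  rho p = if [exists b : 'I_p, (p%:Z %| qpol (b : nat)%:Z)%Z] then 2 else 0%N.
Proof.
move=> pD; case: existsP => [[b0 hb]|nb]; last first.
  rewrite /rho big1// => b _; apply/eqP; rewrite eqb0; apply/negP => h; apply: nb; by exists b.
have pu : ~~ (p%:Z %| (2 * (b0 : nat)%:Z + t)%R)%Z.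
  apply: contra pD => h.
  have -> : t ^+ 2 - 4 * n0 = (2 * (b0 : nat)%:Z + t) ^+ 2 - 4 * qpol (b0 : nat)%:Z by rewrite qpol_disc addrK.
  by rewrite rpredB//; [rewrite expr2 dvdz_mulr|rewrite dvdz_mull].
rewrite /rho -[RHS]/(1 + 1)%N -{1}(count_translate (- (b0 : nat)%:Z) p0).
rewrite -(count_translate ((b0 : nat)%:Z + t) p0) -big_split /=; apply: eq_bigr => b _.
set x := (b : nat)%:Z; set y := (b0 : nat)%:Z.
have -> : (p%:Z %| qpol x)%Z = (p%:Z %| (- y + x)%R)%Z || (p%:Z %| (y + t + x)%R)%Z.
  have -> : qpol x = (- y + x) * (y + t + x) + qpol y.
    by rewrite -[qpol x](subrK (qpol y)) qpolB; ring.
  rewrite rpredDr//.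
  by rewrite !dvdzE abszM Euclid_dvdM.
have : ~~ ((p%:Z %| (- y + x)%R)%Z && (p%:Z %| (y + t + x)%R)%Z).
  apply: contra pu => /andP[h1 h2].
  have -> : 2 * y + t = (y + t + x) - (- y + x) by ring.
  by rewrite rpredB.
by case: (_ \in _); case: (_ \in _).
Qed.

(** Completing the square reduces the congruence to the linear one 2 b + t = 0 modulo p. *)
Lemma rho_ramified_odd : odd p -> (p%:Z %| (t ^+ 2 - 4 * n0)%R)%Z -> rho p = 1%N.
Proof.
move=> op pD.
have p2 : ~~ (p%:Z %| 2)%Z by rewrite dvdzE /= gtnNdvd//; case: (p) pp op => [|[|[|]]].
rewrite -(@count_linear p t 2 pp p2); apply: eq_bigr => b _; congr nat_of_bool.
have p4 : coprimez p%:Z 4.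
  by rewrite coprimezE absz_nat; apply: (@coprimeXr 2 p 2); rewrite coprimen2.
have -> : t + (b : nat)%:Z * 2 = 2 * (b : nat)%:Z + t by ring.
rewrite -(Gauss_dvdzr _ p4).
have -> : 4 * qpol (b : nat)%:Z = (2 * (b : nat)%:Z + t) ^+ 2 - (t ^+ 2 - 4 * n0) by rewrite qpol_disc; ring.
by rewrite rpredBr// expr2 !dvdzE abszM Euclid_dvdM// orbb.
Qed.

Lemma rho_ramified_power k : (forall b, ~~ ((p ^ 2)%N%:Z %| qpol b)%Z) -> rho (p ^ k.+2) = 0%N.
Proof.
move=> h; rewrite /rho big1// => b _; apply/eqP; rewrite eqb0.
apply: contra (h (b : nat)%:Z); apply: dvdz_trans.
by rewrite dvdzE /= dvdn_exp2l.
Qed.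

End PrimePower.

End QuadraticCongruences.

(* Trace and norm of (1 + sqrt m) / 2, respectively sqrt m. *)
Definition om_tr (m : int) : int := if (m == 1 %[mod 4])%Z then 1 else 0.
Definition om_nm (m : int) : int := if (m == 1 %[mod 4])%Z then ((1 - m) %/ 4)%Z else - m.

Lemma om_disc m : om_tr m ^+ 2 - 4 * om_nm m = disc m.
Proof.
rewrite /om_tr /om_nm /disc; case: ifP => h; last by ring.
by have := divz_eq (1 - m) 4; lia.
Qed.

Section CountingIdeals.
Variables (m : int) (q : nat) (chi : nat -> int).
Hypotheses (sqm : squarefree m) (h : gauss_char q chi) (hq : chi q.-1 * q%:Z = disc m).
Hypothesis h2 : odd q -> chi 2 = chi8 q.

Let t := om_tr m.
Let n0 := om_nm m.
Let r := rho t n0.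

Let absD : absz (disc m) = q.
Proof. by rewrite -hq abszM; have [->|->] := gauss_char_N1 h; rewrite ?abszN absz1 mul1n absz_nat. Qed.

Let dvdD p : (p%:Z %| (t ^+ 2 - 4 * n0)%R)%Z = (p %| q)%N.
Proof. by rewrite om_disc dvdzE absD absz_nat. Qed.

Let rho2 : rho t n0 2 = (((2 %| n0)%Z : nat) + ((2 %| (1 + t + n0)%R)%Z : nat))%N.
Proof.
rewrite /rho !big_ord_recl big_ord0 /= /qpol addn0 expr0n /= mulr0 !add0r /bump /= expr1n mulr1.
by [].
Qed.

(** The square cannot be completed modulo 2. For odd [q] the parities of n0 and 1 + t + n0 are
    decided by [m] modulo 8, and this is where the recorded value of chi at 2 enters. *)
Let rho_prime_2 : rho t n0 2 = 1 + chi 2 :> int.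
Proof.
rewrite rho2; have := absD; rewrite /t /n0 /om_tr /om_nm /disc; case: ifP => hm eq; last first.
  have -> : chi 2 = 0 by apply: (gauss_char_eq0 h); rewrite -eq prime_coprime// negbK abszM dvdn_mulr.
  lia.
have oq : odd q by move: eq hm; lia.
rewrite h2//.
have hq' := hq; rewrite /disc hm in hq'.
have r8 : (q %% 8 = 1 \/ q %% 8 = 3 \/ q %% 8 = 5 \/ q %% 8 = 7)%N.
  by move: oq; have := ltn_pmod q (isT : 0 < 8)%N; lia.
have {}hq' : m = q%:Z \/ m = - q%:Z.
  by rewrite -hq'; have [->|->] := gauss_char_N1 h; rewrite ?mul1r ?mulN1r; [left|right].
by rewrite /chi8; case: r8 => [|[|[|]]] e8; rewrite e8 /=; case: hq' => hq'; clear -hm hq' e8; lia.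
Qed.

(** For odd p a root b amounts to a square root 2 b + t of the discriminant in F_p, and the Euler
    power of the discriminant is chi(p). *)
Let rho_prime p : prime p -> ~~ (p %| q)%N -> rho t n0 p = 1 + chi p :> int.
Proof.
move=> pp pq; have [->|op] := even_prime pp; first exact: rho_prime_2.
have cpq : coprime p q by rewrite prime_coprime.
have pD : ~~ (p%:Z %| (t ^+ 2 - 4 * n0)%R)%Z by rewrite dvdD.
have eul := gauss_char_euler h pp op cpq; rewrite hq -om_disc in eul.
have p4 : coprimez p%:Z 4 by rewrite coprimezE absz_nat; apply: (@coprimeXr 2 p 2); rewrite coprimen2.
have p2F : (2 : 'F_p) != 0 by rewrite (natF_eq0 pp 2) gtnNdvd//; case: (p) pp op => [|[|[|]]].
have intF (x : int) : ((x%:~R : 'F_p) == 0) = (p%:Z %| x)%Z.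
  by case: x => x; rewrite ?NegzE ?mulrNz ?oppr_eq0 ?rpredN natF_eq0.
have qF (b : 'I_p) : (p%:Z %| qpol t n0 (b : nat)%:Z)%Z = ((2 * (b : nat)%:R + t%:~R : 'F_p) ^+ 2 == (t ^+ 2 - 4 * n0)%:~R).
  rewrite -(Gauss_dvdzr _ p4) -intF -[RHS]subr_eq0; congr (_ == 0).
  have -> : (2 * (b : nat)%:R + t%:~R : 'F_p) ^+ 2 = ((2 * (b : nat)%:Z + t) ^+ 2)%:~R.
    by rewrite rmorphXn rmorphD rmorphM.
  by rewrite (qpol_disc t n0) -rmorphB /= addrAC subrr add0r.
rewrite rho_unramified//; case: existsP => [[b hb]|nb].
  move: hb; rewrite qF => /eqP e.
  rewrite -e -exprM in eul.
  have ek : (2 * p.-1./2 = p.-1)%N by have := prime_gt0 pp; clear -op; lia.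
  rewrite ek fermat_F// in eul.
    have [->//|c1] := gauss_char_cases h cpq.
    have := @legendre_inj p pp op 1 (chi p); rewrite -eul c1 mulr1z.
    by move=> /(_ isT isT erefl).
  apply: contraNneq pD => e0; rewrite -intF -e e0 expr0n.
  by [].
have [c1|->//] := gauss_char_cases h cpq.
exfalso; apply: nb.
pose n := absz ((t ^+ 2 - 4 * n0) %% p%:Z)%Z.
have nF : (n%:R : 'F_p) = (t ^+ 2 - 4 * n0)%:~R.
  apply/eqP; rewrite -subr_eq0 pmulrn -intrB intF /n gez0_abs; last first.
    by rewrite modz_ge0// eqz_nat -lt0n prime_gt0.
  by rewrite -eqz_mod_dvd modz_mod.
have /(euler_criterion pp op)[x hx] : legendre p n = 1.
  by rewrite /legendre nF eul c1 mulr1z oner_eq0 eqxx.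
pose y : 'F_p := (x%:R - t%:~R) / 2.
have yp : (y < p)%N by rewrite -[X in (_ < X)%N](Fp_cast pp) ltn_ord.
have ey : ((y : nat)%:R : 'F_p) = y := natr_Zp y.
exists (Ordinal yp); rewrite qF /= ey /y [2 * _]mulrC divfK// subrK -nF -natrX.
by apply/eqP; rewrite -(Fp_nat_mod pp) hx (Fp_nat_mod pp).
Qed.

(** One formula for all cases: chi(p) = 1 gives 2 and chi(p) = -1 gives 0 at every power, while
    chi(p) = 0 gives 1 at [k = 0] and 0 afterwards, because squarefreeness of [m] excludes roots
    modulo p^2 at ramified primes. *)
Let rho_prime_power p k : prime p -> rho t n0 (p ^ k.+1) = chi p ^+ k + chi p ^+ k.+1 :> int.
Proof.
move=> pp; have [pq|pq] := boolP (p %| q)%N; last first.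
  have pD : ~~ (p%:Z %| (t ^+ 2 - 4 * n0)%R)%Z by rewrite dvdD.
  rewrite rho_hensel_iter// rho_prime// exprS.
  have cpq : coprime p q by rewrite prime_coprime.
  have [->|->] := gauss_char_cases h cpq; first by rewrite expr1n mulr1.
  by rewrite mulN1r !subrr.
have cp : chi p = 0 by apply: (gauss_char_eq0 h); rewrite prime_coprime// negbK.
have pD : (p%:Z %| (t ^+ 2 - 4 * n0)%R)%Z by rewrite dvdD.
rewrite cp exprS mul0r addr0; case: k => [|k].
  rewrite expn1 expr0; have [p2|op] := even_prime pp; last by rewrite rho_ramified_odd.
  by rewrite p2 rho_prime_2 -p2 cp.
rewrite expr0n /= rho_ramified_power// => b; apply/negP => hb.
have [p2|op] := even_prime pp.
  move: hb pD; rewrite om_disc p2 /t /n0 /om_tr /om_nm /disc /qpol.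
  have := sqm (isT : prime 2); case: ifP => hm; first by lia.
  rewrite mul0r addr0 => m4 hb _.
  have : (b %% 2 = 0)%Z \/ (b %% 2 = 1)%Z by lia.
  have eb := divz_eq b 2; set c := (b %/ 2)%Z in eb *.
  case=> b2; rewrite b2 in eb; move: hb; rewrite eb.
    have -> : (c * 2 + 0) ^+ 2 - m = 4 * (c * c) - m :> int by ring.
    by set x := c * c; lia.
  have -> : (c * 2 + 1) ^+ 2 - m = 4 * (c * c + c) + 1 - m :> int by ring.
  by set x := c * c + c; lia.
have p4 : coprime (p ^ 2) 4 by rewrite (coprimeXl 2)// (@coprimeXr 2 p 2)// coprimen2.
have h1 : (p%:Z %| (2 * b + t)%R)%Z.
  have : (p%:Z %| ((2 * b + t) ^+ 2)%R)%Z.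
    rewrite (qpol_disc t n0) rpredD// dvdz_mull//; apply: dvdz_trans hb.
    by rewrite dvdzE /= dvdn_exp.
  by rewrite expr2 !dvdzE abszM Euclid_dvdM// orbb.
have : ((p ^ 2)%N%:Z %| disc m)%Z.
  rewrite -om_disc -/t -/n0.
  have -> : t ^+ 2 - 4 * n0 = (2 * b + t) ^+ 2 - 4 * qpol t n0 b by rewrite (qpol_disc t n0) addrK.
  by rewrite rpredB ?(dvdz_mull _ hb)// -mulnn PoszM expr2 dvdz_mul.
rewrite dvdzE absz_nat /disc; case: ifP => _; first by rewrite (negbTE (sqm pp)).
by rewrite abszM Gauss_dvdr// (negbTE (sqm pp)).
Qed.

(** Both sides are multiplicative, so prime powers suffice. There both grow by the same amount from
    p^e to p^(e+2): on the left the term d = 1 adds rho(p^(e+2)) = chi(p)^(e+1) + chi(p)^(e+2), and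
    the terms with p | d reproduce those of p^e. *)
Theorem ideal_count_identity n : (0 < n)%N ->
  \sum_(d <- divisors n | (d ^ 2 %| n)%N) (rho t n0 (n %/ d ^ 2) : int) = \sum_(k <- divisors n) chi k.
Proof.
move=> npos.
pose H d n : int := if (d ^ 2 %| n)%N then (rho t n0 (n %/ d ^ 2) : int) else 0.
have -> : \sum_(d <- divisors n | (d ^ 2 %| n)%N) (rho t n0 (n %/ d ^ 2) : int) = \sum_(d <- divisors n) H d n.
  by rewrite big_mkcond.
pose f n := \sum_(d <- divisors n) H d n; pose g n := \sum_(k <- divisors n) chi k.
apply: (@multiplicative_ext _ f g) => //.
- by rewrite /f /g !big_cons !big_nil /H /= divn1 rho1 (gauss_char1 h).
- move=> k l k0 l0 ckl; apply: divisor_sum_mul => // d1 d2 d1k d2l; rewrite /H expnMn.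
  have c1 : coprime (d1 ^ 2) l by apply: coprimeXl; exact: coprime_dvdl d1k ckl.
  have c2 : coprime (d2 ^ 2) k by apply: coprimeXl; apply: coprime_dvdl d2l _; rewrite coprime_sym.
  have c3 : coprime (d1 ^ 2) (d2 ^ 2) by apply: coprimeXr; exact: coprime_dvdr d2l c1.
  rewrite Gauss_dvd// Gauss_dvdl// Gauss_dvdr//.
  case: (boolP (d1 ^ 2 %| k)%N) => h3; case: (boolP (d2 ^ 2 %| l)%N) => h4 /=; rewrite ?mul0r ?mulr0//.
  have d10 : (0 < d1 ^ 2)%N by exact: dvdn_gt0 h3.
  have d20 : (0 < d2 ^ 2)%N by exact: dvdn_gt0 h4.
  have k1 : (0 < k %/ d1 ^ 2)%N by rewrite divn_gt0// dvdn_leq.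
  have l1 : (0 < l %/ d2 ^ 2)%N by rewrite divn_gt0// dvdn_leq.
  have ckl' : coprime (k %/ d1 ^ 2) (l %/ d2 ^ 2).
    exact: coprime_dvdl (dvdn_div h3) (coprime_dvdr (dvdn_div h4) ckl).
  have -> : ((k * l) %/ (d1 ^ 2 * d2 ^ 2) = (k %/ d1 ^ 2) * (l %/ d2 ^ 2))%N.
    by rewrite -{1}(divnK h3) -{1}(divnK h4) mulnACA mulnK// muln_gt0 d10.
  by rewrite (rhoM t n0 k1 l1 ckl').
- move=> k l k0 l0 ckl; apply: (@divisor_sum_mul _ (fun d _ => chi d)) => // d1 d2 _ _.
  exact: gauss_charM h _ _.
move=> p e pp; rewrite /f /g !divisor_sum_pfactor//.
have [k] := ubnP e; elim: k e => // k IH e ek.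
case: e ek => [|[|e]] ek.
- by rewrite !big_ord1 /H expn0 /= divn1 rho1 (gauss_char1 h).
- rewrite !big_ord_recl !big_ord0 /H /= !expn0 expn1 /= divn1 dvd1n !addr0 (gauss_char1 h).
  rewrite ifF; last by rewrite gtnNdvd ?prime_gt0// -[X in (X < _)%N]expn1 ltn_exp2l// prime_gt1.
  by have := rho_prime_power 0 pp; rewrite expn1 addr0 => ->; rewrite expr0 expr1.
have p0 := prime_gt0 pp; have p1 := prime_gt1 pp.
have HS i : H (p ^ i.+1)%N (p ^ e.+2)%N = H (p ^ i)%N (p ^ e)%N.
  rewrite /H; have -> : ((p ^ i.+1) ^ 2 = p ^ 2 * (p ^ i) ^ 2)%N by rewrite (expnS p i) expnMn.
  have -> : (p ^ e.+2 = p ^ 2 * p ^ e)%N by rewrite -expnD.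
  by rewrite dvdn_pmul2l ?divnMl ?expn_gt0 ?p0.
rewrite big_ord_recl (eq_bigr (fun i : 'I_e.+2 => H (p ^ i)%N (p ^ e)%N)) => [|i _]; last by rewrite lift0 HS.
rewrite big_ord_recr /= IH; last by lia.
have -> : H (p ^ e.+1)%N (p ^ e)%N = 0.
  rewrite /H ifF// gtnNdvd ?expn_gt0 ?p0// -expnM ltn_exp2l//; lia.
rewrite addr0 /H expn0 exp1n dvd1n divn1 (rho_prime_power e.+1 pp).
rewrite [RHS]big_ord_recr [X in _ = X + _]big_ord_recr /= addrC -addrA.
have chiX i : chi (p ^ i)%N = chi p ^+ i.
  by elim: i => [|i IHi]; rewrite ?expn0 ?expr0 ?(gauss_char1 h)// expnS (gauss_charM h) IHi exprS.
by rewrite -addrA [X in _ = _ + X]addrC -!chiX.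
Qed.

End CountingIdeals.

Lemma int_subgroup (S : int -> Prop) : (exists2 x, S x & x != 0) ->
  (forall x y, S x -> S y -> S (x + y)) -> (forall k x, S x -> S (k * x)) ->
  exists g : nat, (0 < g)%N /\ forall x, S x <-> (g%:Z %| x)%Z.
Proof.
move=> [x0 Sx0 x00] SD SM.
have ex : exists n, (0 < n)%N && `[< S n%:Z >].
  exists (absz x0); rewrite absz_gt0 x00 /=; apply/asboolP.
  by rewrite abszE normrEsg; exact: SM.
have [g /andP[g0 /asboolP Sg] gmin] := ex_minnP ex.
exists g; split=> // x; split=> [Sx|/dvdzP[k ->]]; last exact: SM.
have gz : g%:Z != 0 by rewrite eqz_nat -lt0n.
have Sr : S (x %% g%:Z)%Z.
  have -> : (x %% g%:Z)%Z = x + (- (x %/ g%:Z)%Z) * g%:Z by rewrite /modz mulNr.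
  by apply: SD => //; exact: SM.
have r0 : 0 <= (x %% g%:Z)%Z by rewrite modz_ge0.
have rg : (x %% g%:Z)%Z < g%:Z by rewrite ltz_pmod// ltz_nat.
have [e|e] := eqVneq (x %% g%:Z)%Z 0; first by apply/dvdz_mod0P.
have := gmin (absz (x %% g%:Z)%Z); rewrite absz_gt0 e /= gez0_abs// => /(_ _)/=.
have h : `[< S (x %% g%:Z)%Z >] by apply/asboolP.
by move=> /(_ h); lia.
Qed.

(** * Ideals of a quadratic order *)

Section QuadraticOrder.
Variables (R : realType) (K : set R[i]) (t n0 : int) (om : R[i]).
Local Notation C := R[i].

Definition quad (x y : int) : C := x%:~R + y%:~R * om.

Hypothesis hom : om ^+ 2 = t%:~R * om - n0%:~R.
Hypothesis hO : forall z, ring_of_integers K z <-> exists x y, z = quad x y.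
Hypothesis hfree : forall x y, quad x y = 0 -> x = 0 /\ y = 0.

Lemma quadD x y x' y' : quad x y + quad x' y' = quad (x + x') (y + y').
Proof. by rewrite /quad !rmorphD /= mulrDl addrACA. Qed.

Lemma quadZ k x y : k%:~R * quad x y = quad (k * x) (k * y).
Proof. by rewrite /quad !rmorphM /= mulrDr mulrA. Qed.

Lemma quadB x y x' y' : quad x y - quad x' y' = quad (x - x') (y - y').
Proof. by rewrite /quad !rmorphB /= mulrBl opprD addrACA. Qed.

Lemma quad_om x y : om * quad x y = quad (- n0 * y) (x + t * y).
Proof.
rewrite /quad mulrDr mulrCA -expr2 hom !rmorphD !rmorphM /= rmorphN /=; ring.
Qed.

Lemma quadM p r x y : quad p r * quad x y = quad (p * x - n0 * (r * y)) (p * y + r * x + t * (r * y)).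
Proof.
rewrite {1}/quad mulrDl -mulrA quad_om !quadZ quadD; congr quad; ring.
Qed.

Lemma quad_inj x y x' y' : quad x y = quad x' y' -> x = x' /\ y = y'.
Proof.
move=> e; have /hfree[] : quad (x - x') (y - y') = 0 by rewrite -quadB e subrr.
by move=> /eqP; rewrite subr_eq0 => /eqP -> /eqP; rewrite subr_eq0 => /eqP ->.
Qed.

Lemma quad0 : quad 0 0 = 0. Proof. by rewrite /quad mul0r addr0. Qed.

(* The nonzero ideals are the d (a Z + (b + om) Z) with 0 <= b < a and a dividing
   N(b + om); the norm is then d^2 a. *)
Definition ideal_of (d a b : nat) : set C :=
  [set z | exists x y : int, z = quad (d%:Z * (a%:Z * x + b%:Z * y)) (d%:Z * y)].

Lemma ideal_ofP d a b u v : ideal_of d a b (quad u v) <->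
  exists x y : int, u = d%:Z * (a%:Z * x + b%:Z * y) /\ v = d%:Z * y.
Proof.
split=> -[x [y]]; first by move=> /quad_inj[-> ->]; exists x, y.
by move=> [-> ->]; exists x, y.
Qed.

Lemma ideal_of_ideal d a b : (a%:Z %| qpol t n0 b%:Z)%Z -> is_ideal K (ideal_of d a b).
Proof.
move=> /dvdzP[e eb]; split.
- by move=> z [x [y ->]]; apply/hO; eexists; eexists.
- by exists 0, 0; rewrite !mulr0 ?addr0 ?mulr0 quad0.
- move=> _ _ [x [y ->]] [x' [y' ->]]; exists (x + x'), (y + y'); rewrite quadD; congr quad; ring.
- move=> _ _ /hO[p [r ->]] [x [y ->]].
  exists (p * x + r * (- b%:Z * x - e * y)), (p * y + r * (a%:Z * x + (b%:Z + t) * y)).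
  rewrite quadM; congr quad; last by ring.
  have en : n0 = e * a%:Z - b%:Z ^+ 2 - t * b%:Z by rewrite -eb /qpol; ring.
  rewrite en; ring.
Qed.

Lemma ideal_of_neq0 d a b : (0 < d)%N -> (0 < a)%N -> ideal_of d a b <> [set 0].
Proof.
move=> d0 a0 e; have : ideal_of d a b (quad (d%:Z * a%:Z) 0).
  by apply/ideal_ofP; exists 1, 0; rewrite !(mulr1, mulr0, addr0).
rewrite e => /hfree[/eqP + _].
by rewrite mulf_eq0 !eqz_nat !eqn0Ngt d0 a0.
Qed.

(** Hermite normal form: [d] generates the group of second coordinates of elements of [I], and [a']
    the integers contained in [I]. Multiplication by [om] moves first coordinates into the second
    place, which makes [d] divide [a'] and [b'] too. *)
Lemma ideal_of_surj I : is_ideal K I -> I <> [set 0] ->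
  exists d a b : nat, [/\ (0 < d)%N, (b < a)%N, (a%:Z %| qpol t n0 b%:Z)%Z & I = ideal_of d a b].
Proof.
move=> [IO I0 ID IM] Inz.
have Oint p r : ring_of_integers K (quad p r) by apply/hO; eexists; eexists.
have IZ k x y : I (quad x y) -> I (quad (k * x) (k * y)).
  move=> h; have := IM _ _ (Oint k 0) h; rewrite quadM !mul0r !mulr0 subr0 !addr0.
  by [].
have Iom x y : I (quad x y) -> I (quad (- n0 * y) (x + t * y)).
  by move=> h; have := IM _ _ (Oint 0 1) h; rewrite quadM !mul0r !mul1r sub0r add0r mulNr.
have [z Iz z0] : exists2 z, I z & z <> 0.
  apply: contrapT => h; apply: Inz; apply/seteqP; split=> z /=; last by move=> ->.
  by move=> Iz; apply: contrapT => z0; apply: h; exists z.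
have [x0 [y0 ez]] : exists x y, z = quad x y by apply/hO/IO.
rewrite {z}ez in Iz z0.
have [d [d0 hd]] : exists d : nat, (0 < d)%N /\ forall y, (exists x, I (quad x y)) <-> (d%:Z %| y)%Z.
  apply: int_subgroup.
  - have [y00|y00] := eqVneq y0 0; last by exists y0 => //; exists x0.
    exists x0; first by exists (- n0 * y0); have := Iom _ _ Iz; rewrite y00 !mulr0 addr0.
    by apply: contra_notN z0 => /eqP ->; rewrite y00 quad0.
  - by move=> y y' [x h] [x' h']; exists (x + x'); rewrite -quadD; exact: ID.
  - by move=> k y [x h]; exists (k * x); exact: IZ.
have [a' [a'0 ha]] : exists a : nat, (0 < a)%N /\ forall x, I (quad x 0) <-> (a%:Z %| x)%Z.
  apply: int_subgroup.
  (* The norm of x0 + y0 om, obtained by multiplying with the conjugate (x0 + t y0) - y0 om, is a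
     nonzero integer in [I]. *)
  - exists (x0 ^+ 2 + t * (x0 * y0) + n0 * y0 ^+ 2).
      have := IM _ _ (Oint (x0 + t * y0) (- y0)) Iz; rewrite quadM.
      have -> : (x0 + t * y0) * x0 - n0 * (- y0 * y0) = x0 ^+ 2 + t * (x0 * y0) + n0 * y0 ^+ 2 by ring.
      by have -> : (x0 + t * y0) * y0 + - y0 * x0 + t * (- y0 * y0) = 0 by ring.
    apply: contra_notN z0 => /eqP e.
    have : quad (x0 + t * y0) (- y0) * quad x0 y0 = 0.
      by rewrite quadM -quad0; congr quad; [rewrite -[RHS]e; ring|ring].
    move=> /eqP; rewrite mulf_eq0 => /orP[|/eqP//] /eqP/hfree[e1 /eqP].
    rewrite oppr_eq0 => /eqP y00; rewrite y00 mulr0 addr0 in e1.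
    by rewrite e1 y00 quad0.
  - by move=> x x' h h'; have := ID _ _ h h'; rewrite quadD addr0.
  - by move=> k x h; have := IZ k _ _ h; rewrite mulr0.
have dz : d%:Z != 0 by rewrite eqz_nat -lt0n.
have da : (d%:Z %| a'%:Z)%Z.
  apply/hd; exists (- n0 * 0); have := Iom a'%:Z 0; rewrite !mulr0 addr0; apply.
  by apply/ha; rewrite dvdzz.
have [b' hb'] : exists x, I (quad x d%:Z) by apply/hd; rewrite dvdzz.
have db : (d%:Z %| b')%Z.
  have : (d%:Z %| (b' + t * d%:Z)%R)%Z by apply/hd; eexists; exact: Iom hb'.
  by rewrite rpredDr// dvdz_mull// dvdzz.
have [a ea] : exists a : nat, a' = (d * a)%N by exists (a' %/ d)%N; rewrite mulnC divnK.
have a0 : (0 < a)%N by move: a'0; rewrite ea muln_gt0 => /andP[].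
have /dvdzP[b1 eb1] := db.
pose b := absz (b1 %% a%:Z)%Z.
have ebz : b%:Z = (b1 %% a%:Z)%Z by rewrite gez0_abs// modz_ge0// eqz_nat -lt0n.
have hb : I (quad (d%:Z * b%:Z) d%:Z).
  have h : I (quad (- (b1 %/ a%:Z)%Z * a'%:Z) 0) by apply/ha; rewrite dvdz_mull// dvdzz.
  have := ID _ _ hb' h; rewrite quadD addr0 ebz eb1 ea PoszM.
  by have -> : b1 * d%:Z + - (b1 %/ a%:Z)%Z * (d%:Z * a%:Z) = d%:Z * (b1 %% a%:Z)%Z by rewrite /modz; ring.
exists d, a, b; split=> //.
- by rewrite -ltz_nat ebz ltz_pmod// ltz_nat.
(* Since (b + t - om) (b + om) = qpol(b), the integer d qpol(b) lies in [I] and is a multiple of d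
   a. *)
- have : I (quad (d%:Z * qpol t n0 b%:Z) 0).
    have := IM _ _ (Oint (b%:Z + t) (-1)) hb; rewrite quadM.
    have -> : (b%:Z + t) * (d%:Z * b%:Z) - n0 * (-1 * d%:Z) = d%:Z * qpol t n0 b%:Z by rewrite /qpol; ring.
    by have -> : (b%:Z + t) * d%:Z + -1 * (d%:Z * b%:Z) + t * (-1 * d%:Z) = 0 by ring.
  by move=> /ha; rewrite ea PoszM dvdz_mul2l.
apply/seteqP; split=> z.
  move=> Iz'; have [u [v ez]] : exists x y, z = quad x y by apply/hO/IO.
  rewrite ez in Iz' *; have /dvdzP[y ey] : (d%:Z %| v)%Z by apply/hd; exists u.
  have h : I (quad (- y * (d%:Z * b%:Z)) (- y * d%:Z)) by exact: IZ.
  have := ID _ _ Iz' h; rewrite quadD ey mulNr mulNr subrr => /ha/dvdzP[x ex].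
  apply/ideal_ofP; exists x, y; split; last by rewrite mulrC.
  rewrite -[u](subrK (y * (d%:Z * b%:Z))) ex ea PoszM; ring.
move=> [x [y ->]].
have h1 : I (quad (x * (d * a)%N%:Z) 0) by apply/ha; rewrite ea dvdz_mull// dvdzz.
have := ID _ _ h1 (IZ y _ _ hb); rewrite quadD add0r PoszM.
have -> : x * (d%:Z * a%:Z) + y * (d%:Z * b%:Z) = d%:Z * (a%:Z * x + b%:Z * y) by ring.
by rewrite [y * _]mulrC.
Qed.

Lemma ideal_of_inj d a b d' a' b' : (0 < d)%N -> (b < a)%N -> (0 < d')%N -> (b' < a')%N ->
  ideal_of d a b = ideal_of d' a' b' -> [/\ d = d', a = a' & b = b'].
Proof.
have half d1 a1 b1 d2 a2 b2 : (0 < d1)%N -> (0 < d2)%N -> (ideal_of d1 a1 b1 `<=` ideal_of d2 a2 b2) ->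
   (d2 %| d1)%N /\ (d1 = d2 -> (a2 %| a1)%N /\ (a2%:Z %| (b1%:Z - b2%:Z)%R)%Z).
  move=> d10 d20 sub.
  have /sub/ideal_ofP[x [y [ex ey]]] : ideal_of d1 a1 b1 (quad (d1%:Z * b1%:Z) d1%:Z).
    by apply/ideal_ofP; exists 0, 1; rewrite !(mulr1, mulr0, add0r).
  split; first by have : (d2%:Z %| d1%:Z)%Z by rewrite ey dvdz_mulr// dvdzz.
  move=> e; rewrite -e in ex ey sub *.
  have dz : d1%:Z != 0 by rewrite eqz_nat -lt0n.
  have y1 : y = 1 by apply: (mulfI dz); rewrite -ey mulr1.
  split.
    have /sub/ideal_ofP[x' [y' [ex' /esym/eqP]]] : ideal_of d1 a1 b1 (quad (d1%:Z * a1%:Z) 0).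
      by apply/ideal_ofP; exists 1, 0; rewrite !(mulr1, mulr0, addr0).
    rewrite mulf_eq0 (negbTE dz) /= => /eqP y0; move: ex'; rewrite y0 mulr0 addr0 => /(mulfI dz) e1.
    by have : (a2%:Z %| a1%:Z)%Z by rewrite e1 dvdz_mulr// dvdzz.
  by move: ex; rewrite y1 mulr1 => /(mulfI dz) ->; rewrite addrK dvdz_mulr// dvdzz.
move=> d0 ba d0' ba' e.
have [|h1 h2] := @half d a b d' a' b' d0 d0'; first by rewrite e.
have [|h3 h4] := @half d' a' b' d a b d0' d0; first by rewrite e.
have ed : d = d' by apply/eqP; rewrite eqn_dvd h1 h3.
have [h5 h6] := h2 ed; have [h7 _] := h4 (esym ed).
have ea : a = a' by apply/eqP; rewrite eqn_dvd h5 h7.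
split=> //; have : b%:Z = b'%:Z; last by case.
rewrite -[LHS](@modz_small _ a'%:Z) ?lez_nat ?ltz_nat -?ea//.
rewrite -[RHS](@modz_small _ a'%:Z) ?lez_nat ?ltz_nat//.
by rewrite ea; apply/eqP; rewrite eqz_mod_dvd.
Qed.

(** The numbers x + y om with 0 <= x < d a and 0 <= y < d represent the cosets: the second
    coordinate is reduced modulo d first, then the first one, shifted accordingly by a multiple of d
    b, modulo d a. *)
Lemma ideal_norm_of d a b : (0 < d)%N -> (0 < a)%N -> (a%:Z %| qpol t n0 b%:Z)%Z ->
  ideal_norm K (ideal_of d a b) = (d ^ 2 * a)%N.
Proof.
move=> d0 a0 hb; have [_ J0 JD JM] := ideal_of_ideal d hb.
set J := ideal_of d a b in J0 JD JM *.
have dz : d%:Z != 0 by rewrite eqz_nat -lt0n.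
have JN z : J z -> J (- z).
  move=> Jz; rewrite -mulN1r; apply: JM => //; apply/hO; exists (-1), 0.
  by rewrite /quad mul0r addr0 mulrNz mulr1z.
pose coset (p : 'I_(d * a) * 'I_d) : set C :=
  [set quad (p.1 : nat)%:Z (p.2 : nat)%:Z + y | y in J].
have cosetE u v : [set u + y | y in J] = [set v + y | y in J] <-> J (u - v).
  split=> [e|Juv].
    have : [set u + y | y in J] u by exists 0 => //; rewrite addr0.
    by rewrite e => -[y Jy <-]; rewrite addrC addKr.
  apply/seteqP; split=> _ [y Jy <-].
    by exists (u - v + y); [exact: JD|rewrite addrCA addrA subrK addrC].
  exists (- (u - v) + y); first by apply: JD => //; exact: JN.
  by rewrite opprB addrA [u + _]addrC subrK.
have coset_inj : injective coset.
  move=> [x y] [x' y'] /cosetE; rewrite quadB => /ideal_ofP[u [v /= [eu ev]]].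
  have ey : (y : nat)%:Z = (y' : nat)%:Z.
    apply/eqP; rewrite -[X in X == _](@modz_small _ d%:Z) ?lez_nat ?ltz_nat ?ltn_ord//.
    rewrite -[X in _ == X](@modz_small _ d%:Z) ?lez_nat ?ltz_nat ?ltn_ord//.
    by rewrite eqz_mod_dvd ev dvdz_mulr// dvdzz.
  have v0 : v = 0 by apply: (mulfI dz); rewrite -ev ey subrr mulr0.
  have ex : (x : nat)%:Z = (x' : nat)%:Z.
    apply/eqP; rewrite -[X in X == _](@modz_small _ (d * a)%N%:Z) ?lez_nat ?ltz_nat ?ltn_ord//.
    rewrite -[X in _ == X](@modz_small _ (d * a)%N%:Z) ?lez_nat ?ltz_nat ?ltn_ord//.
    by rewrite eqz_mod_dvd eu v0 mulr0 addr0 PoszM mulrA dvdz_mulr// dvdzz.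
  by congr pair; apply: val_inj; [case: ex|case: ey].
rewrite /ideal_norm.
have -> : [set [set x + y | y in J] | x in ring_of_integers K] =
    [set` [fset coset p | p in {: 'I_(d * a) * 'I_d}]%fset].
  apply/seteqP; split=> [_ [_ /hO[u [v ->]] <-]|_ /imfsetP[[x y] _ ->]]; last first.
    by exists (quad (x : nat)%:Z (y : nat)%:Z) => //; apply/hO; eexists; eexists.
  pose y := (v %% d%:Z)%Z; pose k := (v %/ d%:Z)%Z.
  pose x := ((u - d%:Z * (b%:Z * k)) %% (d * a)%N%:Z)%Z.
  pose l := ((u - d%:Z * (b%:Z * k)) %/ (d * a)%N%:Z)%Z.
  have y0 : 0 <= y by rewrite modz_ge0.
  have dad : (d * a)%N%:Z != 0 by rewrite eqz_nat muln_eq0 negb_or -!lt0n d0.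
  have x0 : 0 <= x by rewrite modz_ge0.
  have yd : (absz y < d)%N by rewrite -ltz_nat gez0_abs// ltz_pmod// ltz_nat.
  have xd : (absz x < d * a)%N by rewrite -ltz_nat gez0_abs// ltz_pmod// ltz_nat muln_gt0 d0.
  apply/imfsetP; exists (Ordinal xd, Ordinal yd) => //; apply/cosetE => /=.
  rewrite !gez0_abs// quadB; apply/ideal_ofP; exists l, k; split.
    have := divz_eq (u - d%:Z * (b%:Z * k)) (d * a)%N%:Z; rewrite -/x -/l PoszM => e.
    have -> : u = u - d%:Z * (b%:Z * k) + d%:Z * (b%:Z * k) by rewrite subrK.
    by rewrite e; ring.
  by have := divz_eq v d%:Z; rewrite -/y -/k => ->; ring.
rewrite set_fsetK card_imfset// -cardE card_prod !card_ord -mulnn; lia.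
Qed.

Definition triples (N : nat) : seq (nat * nat * nat) :=
  [seq p <- [seq (da, b) | da <- [seq (d, a) | d <- iota 1 N, a <- iota 1 N], b <- iota 0 N] |
    [&& (p.2 < p.1.2)%N, (p.1.2%:Z %| qpol t n0 p.2%:Z)%Z & (p.1.1 ^ 2 * p.1.2 <= N)%N]].

Lemma triples_uniq N : uniq (triples N).
Proof.
apply/filter_uniq/allpairs_uniq; rewrite ?iota_uniq//; last by move=> [? ?] [? ?].
by apply: allpairs_uniq; rewrite ?iota_uniq// => -[? ?] [? ?].
Qed.

Lemma mem_triples N d a b : ((d, a, b) \in triples N) =
  [&& (0 < d)%N, (b < a)%N, (a%:Z %| qpol t n0 b%:Z)%Z & (d ^ 2 * a <= N)%N].
Proof.
rewrite mem_filter /=; apply/andP/and4P.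
  move=> [/and3P[ba hb hN] /allpairsP[[[d' a'] b'] /= [/allpairsP[[d'' a''] /= [hd ha [e1 e2]]] _ [e3 e4 _]]]].
  by split=> //; rewrite e3 e1; move: hd; rewrite mem_iota => /andP[].
move=> [d0 ba hb hN]; split; first exact/and3P.
have a0 : (0 < a)%N by exact: leq_ltn_trans ba.
have aN : (a <= N)%N by apply: leq_trans hN; rewrite leq_pmull// expn_gt0 d0.
have dN : (d <= N)%N.
  by apply: leq_trans hN; apply: leq_trans (leq_pmulr _ a0); rewrite -mulnn leq_pmulr.
apply/allpairsP; exists ((d, a), b); split=> //=; last by rewrite mem_iota /= (leq_trans ba).
by apply/allpairsP; exists (d, a); rewrite !mem_iota /= d0 a0 !add1n !ltnS.
Qed.

Lemma sum_triples (V : pzRingType) (F : nat -> V) N :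
  \sum_(p <- triples N) F (p.1.1 ^ 2 * p.1.2)%N =
  \sum_(n < N) F n.+1 * (\sum_(d <- divisors n.+1 | (d ^ 2 %| n.+1)%N) rho t n0 (n.+1 %/ d ^ 2))%N%:R.
Proof.
have divs n : (n < N)%N -> (\sum_(d <- divisors n.+1 | (d ^ 2 %| n.+1)%N) rho t n0 (n.+1 %/ d ^ 2) =
   \sum_(d <- iota 1 N | (d ^ 2 %| n.+1)%N) rho t n0 (n.+1 %/ d ^ 2))%N.
  move=> nN; rewrite -[LHS]big_filter -[RHS]big_filter; apply: perm_big; apply: uniq_perm.
  - by rewrite filter_uniq ?divisors_uniq.
  - by rewrite filter_uniq ?iota_uniq.
  move=> d; rewrite !mem_filter -dvdn_divisors// mem_iota; case: (boolP (d ^ 2 %| n.+1)%N) => //= h.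
  have dn : (d %| n.+1)%N by apply: dvdn_trans h; rewrite -mulnn dvdn_mulr.
  by rewrite dn (dvdn_gt0 _ dn)// add1n ltnS (leq_trans (dvdn_leq _ dn)).
rewrite /triples big_filter big_mkcond big_allpairs_dep /= big_allpairs_dep /=.
transitivity (\sum_(d <- iota 1 N) \sum_(a <- iota 1 N) \sum_(n < N)
   if (n.+1 == d ^ 2 * a)%N then F n.+1 * (rho t n0 a)%:R else 0).
  rewrite big_seq [RHS]big_seq; apply: eq_bigr => d; rewrite mem_iota => /andP[d0 dN].
  rewrite big_seq [RHS]big_seq; apply: eq_bigr => a; rewrite mem_iota => /andP[a0 aN].
  rewrite -big_mkcond /=.
  have [hN|hN] := leqP (d ^ 2 * a) N; last first.
    rewrite big_pred0 => [|b]; last by rewrite !andbF.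
    rewrite big1// => n _; rewrite ifF//; apply/eqP => e.
    by move: hN; rewrite -e ltnNge ltn_ord.
  have p0 : (0 < d ^ 2 * a)%N by rewrite muln_gt0 expn_gt0 d0 a0.
  have pN : ((d ^ 2 * a).-1 < N)%N by rewrite prednK.
  rewrite [RHS](bigD1 (Ordinal pN))//= prednK// eqxx [X in _ = _ + X]big1 ?addr0 => [|n nE]; last first.
    by rewrite ifF//; apply: contra_neqF nE => /eqP e; apply: val_inj; rewrite /= -e.
  have -> : iota 0 N = index_iota 0 N by rewrite /index_iota subn0.
  rewrite big_mkord.
  rewrite (eq_bigl (fun b : 'I_N => (a%:Z %| qpol t n0 (b : nat)%:Z)%Z && (b < a)%N)); last first.
    by move=> b /=; rewrite andbT andbC.
  rewrite -(big_ord_widen_cond N (fun b => (a%:Z %| qpol t n0 b%:Z)%Z) (fun=> F (d ^ 2 * a)%N)); last first.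
    by rewrite -ltnS -add1n.
  rewrite big_mkcond /rho natr_sum mulr_sumr; apply: eq_bigr => b _.
  by case: (_ \in _); rewrite ?mulr1 ?mulr0.
transitivity (\sum_(d <- iota 1 N) \sum_(n < N) \sum_(a <- iota 1 N)
   if (n.+1 == d ^ 2 * a)%N then F n.+1 * (rho t n0 a)%:R else 0).
  by apply: eq_bigr => d _; rewrite exchange_big.
rewrite exchange_big /=; apply: eq_bigr => n _.
rewrite divs// natr_sum mulr_sumr [RHS]big_mkcond big_seq [RHS]big_seq.
apply: eq_bigr => d; rewrite mem_iota => /andP[d0 _].
have dd : (0 < d ^ 2)%N by rewrite expn_gt0 d0.
case: ifP => h; last first.
  by rewrite big1_seq// => a _; rewrite ifF//; apply: contraFF h => /eqP ->; rewrite dvdn_mulr.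
rewrite (bigD1_seq (n.+1 %/ d ^ 2)%N) ?iota_uniq //=; last first.
  rewrite mem_iota divn_gt0// dvdn_leq//= add1n ltnS.
  by apply: leq_trans (leq_div _ _) _.
rewrite mulnC divnK// eqxx big1 ?addr0// => a ha; rewrite ifF//.
by apply: contra_neqF ha => /eqP ->; rewrite mulKn.
Qed.

(** The first clause makes these sets cofinal among the finite sets of ideals as N grows, which is
    how the unordered sum gets evaluated; the second regroups the sum by the norm n = d^2 a. *)
Definition ideals_up_to (N : nat) (A : {fset nonzero_ideals K}) :=
  (forall I : nonzero_ideals K, (ideal_norm K (val I) <= N)%N -> I \in A) /\
  forall (V : pzRingType) (F : nat -> V),
    \sum_(I <- A) F (ideal_norm K (val I)) =
    \sum_(n < N) F n.+1 * (\sum_(d <- divisors n.+1 | (d ^ 2 %| n.+1)%N) rho t n0 (n.+1 %/ d ^ 2))%N%:R.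

Lemma ideals_up_to_ex N : exists A, ideals_up_to N A.
Proof.
have nz d a b : (0 < d)%N -> (b < a)%N -> (a%:Z %| qpol t n0 b%:Z)%Z -> nonzero_ideals K (ideal_of d a b).
  move=> d0 ba hb; split; first exact: ideal_of_ideal.
  by apply: ideal_of_neq0 => //; exact: leq_ltn_trans ba.
have nz1 : nonzero_ideals K (ideal_of 1 1 0) by apply: nz => //; rewrite dvd1z.
pose I0 : nonzero_ideals K := exist (fun I => I \in nonzero_ideals K) _ (mem_set nz1).
pose phi (p : nat * nat * nat) : nonzero_ideals K := insubd I0 (ideal_of p.1.1 p.1.2 p.2).
have phiE p : p \in triples N -> val (phi p) = ideal_of p.1.1 p.1.2 p.2.
  case: p => [[d a] b]; rewrite mem_triples => /and4P[d0 ba hb _].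
  by rewrite /phi insubdK//; apply/mem_set/nz.
have normE p : p \in triples N -> ideal_norm K (val (phi p)) = (p.1.1 ^ 2 * p.1.2)%N.
  move=> pN; rewrite phiE//; case: p pN => [[d a] b]; rewrite mem_triples => /and4P[d0 ba hb _].
  by apply: ideal_norm_of => //; exact: leq_ltn_trans ba.
have phi_inj : {in triples N &, injective phi}.
  move=> p p' pN pN' /(congr1 val); rewrite !phiE//.
  case: p p' pN pN' => [[d a] b] [[d' a'] b']; rewrite !mem_triples /=.
  by move=> /and4P[d0 ba _ _] /and4P[d0' ba' _ _] /(ideal_of_inj d0 ba d0' ba')[-> -> ->].
exists [fset phi p | p in triples N]%fset; split.
  move=> I hI; have /set_mem[iI nI] := valP I.
  have [d [a [b [d0 ba hb eI]]]] := ideal_of_surj iI nI.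
  have a0 : (0 < a)%N by exact: leq_ltn_trans ba.
  have pN : (d, a, b) \in triples N.
    by rewrite mem_triples d0 ba hb /= -(ideal_norm_of d0 a0 hb) -eI.
  by apply/imfsetP; exists (d, a, b) => //; apply: val_inj; rewrite phiE.
move=> V F; rewrite -sum_triples.
rewrite (perm_big [seq phi p | p <- triples N]) /=; last first.
  apply: uniq_perm; first exact: fset_uniq.
    by rewrite map_inj_in_uniq ?triples_uniq.
  by move=> I; apply/imfsetP/mapP => -[p pN ->]; exists p.
by rewrite big_map big_seq [RHS]big_seq; apply: eq_bigr => p pN; rewrite normE.
Qed.

End QuadraticOrder.

Lemma squarefree_decomp (M : int) : M != 0 ->
  exists (m : int) (s : nat), [/\ (0 < s)%N, squarefree m & M = m * s%:Z ^+ 2].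
Proof.
have [n] := ubnP (absz M); elim: n M => // n IH M Mn M0.
have [sqM|nsq] := pselect (squarefree M).
  by exists M, 1%N; split; rewrite // expr1n mulr1.
have [p pp pM] : exists2 p : nat, prime p & (p ^ 2 %| `|M|)%N.
  apply: contrapT => h; apply: nsq => p pp; apply/negP => pM; apply: h; by exists p.
have /dvdzP[M' eM] : ((p ^ 2)%N%:Z %| M)%Z by [].
have M'0 : M' != 0 by apply: contraNneq M0 => e; rewrite eM e mul0r.
have p1 := prime_gt1 pp.
have lt : (absz M' < n)%N.
  rewrite ltnS in Mn; apply: leq_trans Mn; rewrite eM abszM absz_nat.
  rewrite -[ltnLHS]muln1 ltn_pmul2l ?absz_gt0//.
  by rewrite -[X in (X < _)%N](expn0 p) ltn_exp2l.
have [m [s [s0 sqm e]]] := IH M' lt M'0.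
exists m, (s * p)%N; split=> //; first by rewrite muln_gt0 s0 ltnW.
by rewrite eM e -mulnn !PoszM; ring.
Qed.

(** The square of a prime dividing the denominator of [y] would have to divide [m]. *)
Lemma squarefree_sqr_int (m k : int) (y : rat) : squarefree m -> m%:~R * y ^+ 2 = k%:~R ->
  exists l : int, y = l%:~R.
Proof.
move=> sqm ey.
have d0 : (denq y)%:~R != 0 :> rat by rewrite intr_eq0 denq_neq0.
have e : m * numq y ^+ 2 = k * denq y ^+ 2.
  apply: (@intr_inj rat); rewrite !intrM numqE -ey; ring.
have d1 : (`|denq y| = 1)%N.
  apply/eqP; apply: contraT => d1.
  have d2 : (1 < `|denq y|)%N by rewrite ltn_neqAle eq_sym d1 absz_gt0 denq_neq0.
  have pp := pdiv_prime d2; have pd := pdiv_dvd `|denq y|; set p := pdiv _ in pp pd.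
  have cpn : coprime (p ^ 2) (`|numq y| ^ 2).
    by rewrite coprimeXl// coprimeXr// (coprime_dvdl pd)// coprime_sym coprime_num_den.
  have : (p ^ 2 %| `|m| * `|numq y| ^ 2)%N.
    by rewrite -abszX -abszM e abszM abszX dvdn_mull// dvdn_exp2r.
  by rewrite Gauss_dvdl// (negbTE (sqm _ pp)).
exists (numq y); rewrite -[LHS]divq_num_den.
have -> : denq y = 1 by have := denq_gt0 y; move: d1; lia.
by rewrite mulr1z divr1.
Qed.

Lemma squarefree_not_square (m : int) (x : rat) : squarefree m -> x ^+ 2 = m%:~R -> m = 1.
Proof.
move=> sqm ex.
have sq1 : squarefree 1 by move=> p pp; rewrite absz1 dvdn1 -(expn0 p) eqn_exp2l ?prime_gt1.
have [|l el] := @squarefree_sqr_int 1 m x sq1; first by rewrite mulr1z mul1r.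
have em : m = l ^+ 2 by apply: (@intr_inj rat); rewrite -ex el rmorphXn.
have l1 : (`|l| <= 1)%N.
  rewrite leqNgt; apply/negP => l2.
  have pl := pdiv_dvd `|l|; have := sqm _ (pdiv_prime l2).
  by rewrite em abszX dvdn_exp2r.
have [e|e] : absz l = 0%N \/ absz l = 1%N by lia.
  by have := sqm _ (isT : prime 2); rewrite em abszX e.
have [el'|el'] : l = 1 \/ l = -1 by lia.
  by rewrite em el' expr1n.
by rewrite em el' sqrrN expr1n.
Qed.

(** The integral equation has rational data, so it can be moved from [R[i]] to [algC], where
    rational algebraic integers are known to be integers. *)
Lemma rat_integral (R : realType) (x : rat) :
  integralOver (intr : int -> R[i]) (ratr x) -> exists k : int, x = k%:~R.
Proof.
move=> [p pm].
have mapP (F : numFieldType) : map_poly intr p = map_poly (ratr : rat -> F) (map_poly intr p) :> {poly F}.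
  by rewrite -map_poly_comp; apply: eq_map_poly => k /=; rewrite ratr_int.
rewrite mapP fmorph_root => rx.
have : (ratr x : algC) \in Num.int.
  apply: Cint_rat_Aint; first exact: Crat_rat.
  apply: (@root_monic_Aint (map_poly intr p)).
  - by rewrite mapP fmorph_root.
  - exact: monic_map.
  - by apply/polyOverP => i; rewrite coef_map intr_int.
move=> /intrP[k ek]; exists k; apply: (fmorph_inj (ratr : {rmorphism rat -> algC})).
by rewrite /= ek ratr_int.
Qed.

Section QuadraticField.
Variables (R : realType).
Local Notation C := R[i].

(** An element outside Q satisfies a quadratic equation. Completing the square makes the square of
    the shifted generator rational, multiplying by its denominator makes it an integer, and dividing
    by the square part makes it squarefree. *)
Lemma quadratic_generator (K : set C) : quadratic_number_field K ->
  exists (m : int) (th : C), [/\ squarefree m, m != 1, th ^+ 2 = m%:~R &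
    K = [set z | exists a b : rat, z = ratr a + ratr b * th]].
Proof.
move=> [F [f [Kf dF]]].
have fA (a : rat) : f a%:A = ratr a by rewrite -(fmorph_eq_rat (f \o in_alg F)).
have [y y1] : exists y : F, y \notin 1%VS.
  have /subvPn[y _ hy] : ~~ ({:F} <= 1%VS)%VS by apply/negP => /dimvS; rewrite dF dimv1.
  by exists y.
have full : (1%VS + <[y]> = {:F})%VS.
  apply/eqP; rewrite eqEdim subvf dF /=.
  have s1 : (1%VS <= 1%VS + <[y]>)%VS by exact: addvSl.
  rewrite ltnNge; apply/negP => h.
  have /eqP e : 1%VS == (1 + <[y]>)%VS by rewrite eqEdim s1 dimv1 h.
  case/negP: y1; rewrite e; apply: (subvP (addvSr _ _)); exact: memv_line.
have decomp (z : F) : exists a b : rat, z = a%:A + b *: y.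
  have : z \in (1%VS + <[y]>)%VS by rewrite full memvf.
  by case/memv_addP => _ /vlineP[a ->] [_ /vlineP[b ->] ->]; exists a, b.
pose Y := f y.
have fZ (b : rat) (z : F) : f (b *: z) = ratr b * f z by rewrite -mulr_algl rmorphM fA.
have KY : K = [set z | exists a b : rat, z = ratr a + ratr b * Y].
  rewrite -Kf; apply/seteqP; split=> [_ [z _ <-]|_ [a [b ->]]].
    by have [a [b ->]] := decomp z; exists a, b; rewrite rmorphD fA fZ.
  by exists (a%:A + b *: y) => //; rewrite rmorphD fA fZ.
have Yirr (a : rat) : Y <> ratr a.
  rewrite -fA => /fmorph_inj e; move: y1; rewrite e; apply/negP; rewrite negbK.
  by apply/vlineP; exists a.
have [v [u eu]] := decomp (y ^+ 2).
have EY : Y ^+ 2 = ratr v + ratr u * Y by rewrite -rmorphXn eu rmorphD fA fZ.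
pose r := v + u ^+ 2 / 4.
have er : (Y - ratr (u / 2)) ^+ 2 = ratr r.
  rewrite sqrrB EY /r !(rmorphD, rmorphM, fmorphV, rmorphXn, rmorph_nat) /=.
  by field.
(* [M] is r times the square of its denominator, so it stays in the same square class. *)
pose M := numq r * denq r.
have d0 : ratr (denq r)%:~R != 0 :> C by rewrite fmorph_eq0 intr_eq0 denq_neq0.
have eM : ((Y - ratr (u / 2)) * ratr (denq r)%:~R) ^+ 2 = ratr M%:~R :> C.
  rewrite exprMn er -rmorphXn -rmorphM; congr ratr.
  by rewrite /M rmorphM /= -{1}[r]divq_num_den expr2 mulrA divfK// intr_eq0 denq_neq0.
have Y0 : Y - ratr (u / 2) != 0 by rewrite subr_eq0; apply/eqP; exact: Yirr.
have M0 : M != 0.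
  apply: contraNneq Y0 => e; move/eqP: eM; rewrite e (ratr_int C 0) mulr0z expf_eq0 /=.
  by rewrite mulf_eq0 (negbTE d0) orbF.
have [m [s [s0 sqm em]]] := squarefree_decomp M0.
have s0C : s%:R != 0 :> C by rewrite pnatr_eq0 -lt0n.
pose th := (Y - ratr (u / 2)) * ratr (denq r)%:~R / s%:R.
have eth : th ^+ 2 = m%:~R.
  rewrite /th expr_div_n eM ratr_int em rmorphM rmorphXn /= -pmulrn mulfK//.
  by rewrite expf_neq0.
have eY : Y = ratr (u / 2) + ratr (s%:R / (denq r)%:~R) * th.
  rewrite /th !rmorphM !fmorphV !rmorph_nat /=.
  move: d0; move: (ratr (denq r)%:~R : C) => dd d0; field.
  by rewrite s0C d0.
have eth2 : th = ratr ((denq r)%:~R / s%:R) * Y - ratr (u / 2 * ((denq r)%:~R / s%:R)).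
  rewrite /th !rmorphM !fmorphV rmorph_nat; field.
  exact: s0C.
exists m, th; split=> //.
  apply/eqP => m1; move/eqP: eth; rewrite m1 mulr1z sqrf_eq1 => /orP[] /eqP e.
    by apply: (Yirr (u / 2 + s%:R / (denq r)%:~R)); rewrite eY e mulr1 -rmorphD.
  by apply: (Yirr (u / 2 - s%:R / (denq r)%:~R)); rewrite eY e mulrN1 -rmorphB.
rewrite KY; apply/seteqP; split=> _ [a [b ->]].
  exists (a + b * (u / 2)), (b * (s%:R / (denq r)%:~R)).
  by rewrite {1}eY !(rmorphD, rmorphM) /=; ring.
exists (a - b * (u / 2 * ((denq r)%:~R / s%:R))), (b * ((denq r)%:~R / s%:R)).
by rewrite {1}eth2 !(rmorphB, rmorphM) /=; ring.
Qed.

Section Integers.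
Variables (K : set C) (m : int) (th : C).
Hypotheses (sqm : squarefree m) (m1 : m != 1) (eth : th ^+ 2 = m%:~R).
Hypothesis hK : K = [set z | exists a b : rat, z = ratr a + ratr b * th].

Let th_irr (x : rat) : th <> ratr x.
Proof.
move=> e; move/eqP: m1; apply; apply: (@squarefree_not_square m x) => //.
by apply: (fmorph_inj (ratr : {rmorphism rat -> C})); rewrite rmorphXn /= -e eth ratr_int.
Qed.

Let free_rat (a b : rat) : ratr a + ratr b * th = 0 -> a = 0 /\ b = 0.
Proof.
move=> e; have [b0|b0] := eqVneq b 0.
  by move: e; rewrite b0 rmorph0 mul0r addr0 => /eqP; rewrite fmorph_eq0 => /eqP.
exfalso; apply: (@th_irr (- a / b)).
have bC : ratr b != 0 :> C by rewrite fmorph_eq0.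
rewrite fmorph_div rmorphN /=; apply: (mulfI bC); rewrite mulrCA divff// mulr1.
by apply/eqP; rewrite -addr_eq0 addrC e.
Qed.

Definition quad_gen : C := if (m == 1 %[mod 4])%Z then (1 + th) / 2 else th.

Let om := quad_gen.
Let t := om_tr m.
Let n0 := om_nm m.

Lemma quad_gen_eq : om ^+ 2 = t%:~R * om - n0%:~R.
Proof.
rewrite /om /t /n0 /quad_gen /om_tr /om_nm; case: ifP => hm; last first.
  by rewrite mulr0z mul0r add0r mulrNz opprK.
have e : (4 * ((1 - m) %/ 4)%Z)%:~R = (1 - m)%:~R :> C by congr (_%:~R); lia.
rewrite rmorphM rmorphB /= in e.
have -> : ((1 + th) / 2) ^+ 2 = (1 + 2 * th + th ^+ 2) / 4 :> C by field.
have -> : (((1 - m) %/ 4)%Z)%:~R = (1 - m%:~R) / 4 :> C by rewrite -e mulrC mulKf.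
by rewrite eth; field.
Qed.

Lemma quad_gen_free x y : quad om x y = 0 -> x = 0 /\ y = 0.
Proof.
rewrite /quad /om /quad_gen; case: ifP => hm e.
  have [e1 /eqP] : x%:~R + y%:~R / 2 = 0 :> rat /\ y%:~R / 2 = 0 :> rat.
    by apply: free_rat; rewrite -[RHS]e rmorphD rmorphM fmorphV /= !ratr_int rmorph_nat; field.
  rewrite mulf_eq0 invr_eq0 pnatr_eq0 orbF intr_eq0 => /eqP y0.
  by move/eqP: e1; rewrite y0 mul0r addr0 intr_eq0 => /eqP.
have [/eqP + /eqP] : x%:~R = 0 :> rat /\ y%:~R = 0 :> rat.
  by apply: free_rat; rewrite !ratr_int.
by rewrite !intr_eq0 => /eqP -> /eqP ->.
Qed.

(** The coordinates [A] and [B] serve both square roots of [m] at once, which transfers integrality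
    from a + b th to a - b th. *)
Let eval_conj (a b : rat) (p : {poly int}) : exists A B : rat, forall w : C, w ^+ 2 = m%:~R ->
  (map_poly intr p).[ratr a + ratr b * w] = ratr A + ratr B * w.
Proof.
elim/poly_ind: p => [|p c [A [B IH]]].
  by exists 0, 0 => w _; rewrite rmorph0 horner0 !rmorph0 mul0r addr0.
exists (A * a + B * b * m%:~R + c%:~R), (A * b + B * a) => w ew.
rewrite rmorphD rmorphM /= map_polyX map_polyC /= hornerMXaddC IH//.
rewrite !(rmorphD, rmorphM) /= !ratr_int -ew; ring.
Qed.

Let integral_conj (a b : rat) : integralOver (intr : int -> C) (ratr a + ratr b * th) ->
  integralOver (intr : int -> C) (ratr a - ratr b * th).
Proof.
move=> [p pm rp]; exists p => //; have [A [B h]] := eval_conj a b p.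
move: rp; rewrite !rootE h// => /eqP/free_rat[A0 B0].
have -> : ratr a - ratr b * th = ratr a + ratr b * (- th) by rewrite mulrN.
by rewrite h ?sqrrN// A0 B0 !rmorph0 mul0r addr0.
Qed.

(** Trace 2 a and norm a^2 - m b^2 of an integral element are rational and integral, hence integers.
    Then m (2 b)^2 is an integer, so 2 b is one because [m] is squarefree, and a congruence modulo 4
    decides which half-integers occur. *)
Lemma ring_of_integersP z : ring_of_integers K z <-> exists x y, z = quad om x y.
Proof.
split=> [[] + /= iz|[x [y ->]]]; last first.
  split; last first.
    have iI (k : int) : integralOver (intr : int -> C) k%:~R.
      by have := integral_id (intr : {rmorphism int -> C}) k.
    pose g : {poly int} := 'X ^+ 2 + (- t *: 'X + n0%:P).
    have gl : (size (- t *: 'X + n0%:P : {poly int})%R < size ('X ^+ 2 : {poly int})%R)%N.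
      rewrite size_polyXn; apply: leq_ltn_trans (size_polyD _ _) _; rewrite gtn_max.
      by rewrite (leq_ltn_trans (size_scale_leq _ _)) ?size_polyX//= size_polyC; case: (n0 != 0).
    have iom : integralOver (intr : int -> C) om.
      exists g; first by rewrite monicE lead_coefDl// lead_coefXn.
      rewrite rootE /g !rmorphD /= map_polyXn map_polyZ map_polyX map_polyC /= !hornerE.
      by rewrite quad_gen_eq rmorphN /= mulNr; apply/eqP; ring.
    have := @integral_add _ _ (intr : {rmorphism int -> C}) _ _ (iI x)
      (@integral_mul _ _ (intr : {rmorphism int -> C}) _ _ (iI y) iom).
    by [].
  rewrite hK /quad /om /quad_gen; case: ifP => _.
    exists (x%:~R + y%:~R / 2), (y%:~R / 2).
    by rewrite rmorphD !rmorphM fmorphV /= !ratr_int ?rmorph_nat; field.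
  by exists x%:~R, y%:~R; rewrite !ratr_int.
rewrite hK => -[a [b ez]]; rewrite ez in iz *.
have iz' := integral_conj iz.
have [k ek] : exists k : int, 2 * a = k%:~R.
  apply: (@rat_integral R).
  have -> : ratr (2 * a) = (ratr a + ratr b * th) + (ratr a - ratr b * th) :> C.
    by rewrite rmorphM rmorph_nat; ring.
  exact: (@integral_add _ _ (intr : {rmorphism int -> C})).
have [n en] : exists n : int, a ^+ 2 - m%:~R * b ^+ 2 = n%:~R.
  apply: (@rat_integral R).
  have -> : ratr (a ^+ 2 - m%:~R * b ^+ 2) = (ratr a + ratr b * th) * (ratr a - ratr b * th) :> C.
    rewrite rmorphB rmorphM !rmorphXn /= ratr_int -eth; ring.
  exact: (@integral_mul _ _ (intr : {rmorphism int -> C})).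
have e4 : m%:~R * (2 * b) ^+ 2 = (k ^+ 2 - 4 * n)%:~R.
  by rewrite intrB !intrM -ek -en; ring.
have [l el] := squarefree_sqr_int sqm e4.
have e4' : m * l ^+ 2 = k ^+ 2 - 4 * n.
  by apply: (@intr_inj rat); rewrite rmorphM rmorphXn /= -el e4.
have ea : a = k%:~R / 2 by rewrite -ek mulrC mulKf.
have eb : b = l%:~R / 2 by rewrite -el mulrC mulKf.
have sq2 := @sqm 2%N isT.
have par (x : int) : exists y, x = 2 * y \/ x = 2 * y + 1.
  by exists (x %/ 2)%Z; have := divz_eq x 2; have := ltz_pmod x (isT : 0 < 2 :> int); have := modz_ge0 x (isT : 2 != 0 :> int); lia.
have [k' ek'] := par k; have [l' el'] := par l.
rewrite /om /quad_gen; case: ifP => hm.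
  exists ((k - l) %/ 2)%Z, l.
  have kl : (((k - l) %/ 2)%Z)%:~R = (k - l)%:~R / 2 :> C.
    have e2 : k - l = ((k - l) %/ 2)%Z * 2.
      suff : ((k - l) %% 2)%Z = 0 by have := divz_eq (k - l) 2; lia.
      pose c := (m %/ 4)%Z; have em : m = 4 * c + 1 by rewrite /c; lia.
      case: ek' => ek'; case: el' => el'; rewrite ek' el' ?em in e4' *; lia.
    by rewrite e2 mulzK// rmorphM /= mulfK.
  by rewrite /quad kl ea eb !rmorphM !fmorphV /= !rmorph_nat !ratr_int rmorphB /=; field.
have [ek2 el2] : k = 2 * k' /\ l = 2 * l'.
  have hA : (2 * k') ^+ 2 = 4 * k' ^+ 2 :> int by ring.
  have hA1 : (2 * k' + 1) ^+ 2 = 4 * (k' ^+ 2 + k') + 1 :> int by ring.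
  have hB : m * (2 * l') ^+ 2 = 4 * (m * l' ^+ 2) :> int by ring.
  have hB1 : m * (2 * l' + 1) ^+ 2 = 4 * (m * (l' ^+ 2 + l')) + m :> int by ring.
  have h1 (u v : int) : 4 * u + m <> 4 * v - 4 * n by move: sq2; clear; lia.
  have h2 (u v : int) : 4 * u + m <> 4 * v + 1 - 4 * n by move: hm; clear; lia.
  have h3 (u v : int) : 4 * u <> 4 * v + 1 - 4 * n by clear; lia.
  case: ek' => ek'; case: el' => el'; rewrite ek' el' in e4' *; split=> //; exfalso; move: e4'.
  - by rewrite hA hB1; exact: h1.
  - by rewrite hA1 hB; exact: h3.
  - by rewrite hA1 hB1; exact: h2.
  - by rewrite hA1 hB1; exact: h2.
by exists k', l'; rewrite /quad ea eb ek2 el2 !rmorphM !fmorphV /= !ratr_int !rmorph_nat; field.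
Qed.

End Integers.

End QuadraticField.

(** * Continuation into the critical strip *)

Section DirichletPolynomials.
Variable R : realType.
Local Notation C := R[i].

(** Both G + F and G - F have nonnegative derivatives. *)
Lemma derive_norm_le (F G f g : R -> R) (a b : R) : a <= b ->
  (forall x : R, is_derive x 1 F (f x)) -> (forall x : R, is_derive x 1 G (g x)) ->
  (forall x, `|f x| <= g x) -> `|F b - F a| <= G b - G a.
Proof.
move=> ab dF dG fg.
have incr (H h : R -> R) : (forall x : R, is_derive x 1 H (h x)) -> (forall x, 0 <= h x) -> H a <= H b.
  move=> dH h0; have cH : {within `[a, b], continuous H}.
    exact: (is_derive_continuous (fun x _ => dH x)).
  have [c _ e] := @MVT_segment R H h a b ab (fun x _ => dH x) cH.
  by rewrite -subr_ge0 e mulr_ge0// subr_ge0.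
have h1 : G a + F a <= G b + F b.
  apply: (incr (fun x => G x + F x) (fun x => g x + f x) (fun x => is_deriveD (dG x) (dF x))) => x.
  by have := fg x; rewrite ler_norml; lra.
have h2 : G a - F a <= G b - F b.
  apply: (incr (fun x => G x - F x) (fun x => g x - f x) (fun x => is_deriveB (dG x) (dF x))) => x.
  by have := fg x; rewrite ler_norml; lra.
by rewrite ler_norml; apply/andP; split; lra.
Qed.

(** The derivative of e^(-z t) has modulus |z| e^(-x t) with x = Re z, which has the primitive -
    (|z| / x) e^(-x t). Taken between consecutive values ln i the bounds telescope; the factor 2
    again comes from the two coordinates. *)
Lemma cexp_dist_le (z : C) (a b : R) : 0 < complex.Re z -> a <= b ->
  normc (cexp (- z * b%:C%C) - cexp (- z * a%:C%C)) <=
  2 * (normc z / complex.Re z) * (expR (- complex.Re z * a) - expR (- complex.Re z * b)).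
Proof.
case: z => x y; rewrite -[complex.Re _]/x => x0 ab; set M := normc (x +i* y)%C.
pose f (t : R) : C := cexp ((- x * t) +i* (- y * t))%C.
pose d (t : R) : C := ((- x) +i* (- y))%C * f t.
have fd t : path_diff f (d t) t.
  by apply: path_diff_cexp; [have := @is_deriveZ _ _ _ id (- x) t 1 1 (is_derive_id t 1)|
    have := @is_deriveZ _ _ _ id (- y) t 1 1 (is_derive_id t 1)]; rewrite /GRing.scale /= mulr1.
pose G (t : R) : R := - (M / x) * expR (- x * t).
have dG (t : R) : is_derive t 1 G (M * expR (- x * t)).
  have dl : is_derive t 1 (fun u => - x * u) (- x).
    by have := @is_deriveZ _ _ _ id (- x) t 1 1 (is_derive_id t 1); rewrite /GRing.scale /= mulr1.
  have de : is_derive t 1 (@expR R \o (fun u => - x * u)) (expR (- x * t) * - x) by exact: is_derive1_comp.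
  have := @is_deriveZ _ _ _ _ (- (M / x)) t 1 _ de; rewrite /GRing.scale /=.
  by have -> : - (M / x) * (expR (- x * t) * - x) = M * expR (- x * t) by field; rewrite gt_eqF.
have nd t : normc (d t) = M * expR (- x * t).
  rewrite /d normcM /f normc_cexp; congr (_ * _).
  by rewrite -[((- x) +i* (- y))%C]/(- (x +i* y)%C) normcN.
have toC (u : R) : cexp (- (x +i* y)%C * u%:C%C) = f u by congr cexp; simpc.
rewrite !toC; apply: le_trans (normc_le_ReIm _) _.
have h1 : `|complex.Re (f b) - complex.Re (f a)| <= G b - G a.
  apply: derive_norm_le ab (fun t => (fd t).1) dG _ => t.
  by rewrite -nd; exact: le_normc_Re.
have h2 : `|complex.Im (f b) - complex.Im (f a)| <= G b - G a.
  apply: derive_norm_le ab (fun t => (fd t).2) dG _ => t.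
  by rewrite -nd; exact: le_normc_Im.
have -> : 2 * (M / x) * (expR (- x * a) - expR (- x * b)) = (G b - G a) + (G b - G a).
  by rewrite /G; ring.
by apply: lerD; [move: h1|move: h2]; case: (f b) => ? ?; case: (f a).
Qed.

Lemma natpow_normc n (z : C) : normc (natpow n (- z)) = expR (- complex.Re z * ln n%:R).
Proof. by rewrite /natpow normc_cexp; case: z => x y; simpc. Qed.

Lemma natpowM m n (z : C) : (0 < m)%N -> (0 < n)%N ->
  natpow (m * n) z = natpow m z * natpow n z.
Proof.
move=> m0 n0; rewrite /natpow -cexpD -mulrDr -rmorphD /= natrM lnM ?posrE ?ltr0n//.
Qed.

Lemma cdiff_natpow n (z : C) : cdiff (fun w => natpow n (- w)) z.
Proof.
apply: (cdiff_comp (G := fun w => - w * (ln n%:R)%:C%C)); last exact: cdiff_cexp.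
by apply: cdiffM; [apply: cdiffN; exact: cdiff_id|exact: cdiff_cst].
Qed.

Definition dirp (a : nat -> C) (N : nat) (z : C) : C := \sum_(i < N) a i * natpow i.+1 (- z).

Lemma cdiff_dirp a N z : cdiff (dirp a N) z.
Proof.
apply: (@cdiff_sum R _ _ (fun (i : 'I_N) w => a i * natpow i.+1 (- w))) => i.
by apply: cdiffM; [exact: cdiff_cst|exact: cdiff_natpow].
Qed.

(** Summation by parts, with the differences telescoping through [cexp_dist_le]. The bound is
    uniform in [N] and valid to the left of the line of absolute convergence. *)
Lemma dirp_bound (a : nat -> C) N (z : C) K : 0 < complex.Re z -> (forall j, normc (\sum_(i < j) a i) <= K) ->
  normc (dirp a N z) <= K * (1 + 2 * (normc z / complex.Re z)).
Proof.
move=> x0 aK; set D := 2 * _.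
have K0 : 0 <= K by apply: le_trans (aK 0%N); exact: normc_ge0.
have D0 : 0 <= D by rewrite mulr_ge0// divr_ge0 ?normc_ge0 ?ltW.
pose w i := natpow i.+1 (- z); pose v i := expR (- complex.Re z * ln i.+1%:R).
case: N => [|N]; first by rewrite /dirp big_ord0 normc0 mulr_ge0// addr_ge0.
have abel n : dirp a n.+1 z = (\sum_(i < n.+1) a i) * w n + \sum_(i < n) (\sum_(j < i.+1) a j) * (w i - w i.+1).
  elim: n => [|n IH]; first by rewrite /dirp !big_ord1 big_ord0 addr0.
  rewrite /dirp big_ord_recr /= -/(dirp a n.+1 z) IH [in RHS]big_ord_recr [X in _ = _ + X]big_ord_recr /= -/(w n.+1).
  ring.
have wv i : normc (w i - w i.+1) <= D * (v i - v i.+1).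
  rewrite normcBC; apply: cexp_dist_le => //.
  by rewrite ler_ln ?posrE ?ltr0n// ler_nat.
rewrite abel; apply: le_trans (le_normcD _ _) _; rewrite mulrDr mulr1 lerD//.
  rewrite normcM -[leRHS]mulr1; apply: ler_pM; rewrite ?normc_ge0//.
  rewrite /w natpow_normc -[leRHS]expR0 ler_expR mulNr oppr_le0 mulr_ge0 ?(ltW x0) ?ln_ge0 ?ler1n//.
apply: le_trans (le_normc_sum _ _ _) _.
apply: le_trans (_ : \sum_(i < N) K * (D * (v i - v i.+1)) <= _).
  by apply: ler_sum => i _; rewrite normcM; apply: ler_pM; rewrite ?normc_ge0.
rewrite -mulr_sumr ler_wpM2l// -mulr_sumr -[leRHS]mulr1 ler_wpM2l//.
have -> : \sum_(i < N) (v i - v i.+1) = v 0%N - v N.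
  elim: N => [|n IH]; first by rewrite big_ord0 subrr.
  by rewrite big_ord_recr /= IH addrA subrK.
by rewrite /v ln1 mulr0 expR0 gerBl expR_ge0.
Qed.

Definition vsq (i : nat) : R := (i.+1%:R ^+ 2)^-1.

Lemma vsq_ge0 i : 0 <= vsq i. Proof. by rewrite invr_ge0 exprn_ge0. Qed.

Lemma vsq_tail N J : (0 < N)%N -> (N <= J)%N ->
  \sum_(i < J) vsq i - \sum_(i < N) vsq i <= N%:R^-1.
Proof.
move=> N0 NJ; suff : \sum_(i < J) vsq i - \sum_(i < N) vsq i <= N%:R^-1 - J%:R^-1.
  by move=> /le_trans; apply; rewrite gerBl invr_ge0.
rewrite -(subnKC NJ); elim: (J - N)%N => [|k IH]; first by rewrite addn0 !subrr.
rewrite addnS big_ord_recr /= addrAC; set n := (N + k)%N in IH *.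
have n0 : 0 < n%:R :> R by rewrite ltr0n /n addn_gt0 N0.
suff hv : vsq n <= n%:R^-1 - n.+1%:R^-1 by apply: le_trans (lerD IH hv) _; rewrite addrA subrK.
rewrite /vsq -natr1; set y := n%:R in n0 *.
have -> : y^-1 - (y + 1)^-1 = (y * (y + 1))^-1 by field; rewrite !gt_eqF//; lra.
rewrite lef_pV2 ?posrE; [|nra|nra]. nra.
Qed.

Lemma vsq_sum_le N : \sum_(i < N) vsq i <= 2.
Proof.
case: N => [|N]; first by rewrite big_ord0.
have := @vsq_tail 1 N.+1 isT isT; rewrite big_ord1 /vsq expr1n invr1; lra.
Qed.

Lemma natpow_le_vsq (z : C) i : 2 <= complex.Re z -> normc (natpow i.+1 (- z)) <= vsq i.
Proof.
move=> z2; rewrite natpow_normc /vsq -[X in _ <= X^-1]lnK ?posrE ?exprn_gt0//.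
rewrite -expRN ler_expR lnXn ?ltr0n// -[ln _ *+ 2]mulr_natr mulNr lerN2 [leLHS]mulrC ler_wpM2r//.
by rewrite ln_ge0// ler1n.
Qed.

Lemma dirp_tail a N J (z : C) : (forall i, normc (a i) <= 1) -> 2 <= complex.Re z ->
  (0 < N)%N -> (N <= J)%N -> normc (dirp a J z - dirp a N z) <= N%:R^-1.
Proof.
move=> a1 z2 N0 NJ; apply: le_trans (vsq_tail N0 NJ).
rewrite /dirp (sum_ord_tail (fun i => a i * natpow i.+1 (- z)) NJ) (sum_ord_tail vsq NJ).
apply: le_trans (le_normc_sum _ _ _) _; apply: ler_sum => i _.
by rewrite normcM -[leRHS]mul1r; apply: ler_pM; rewrite ?normc_ge0 ?natpow_le_vsq.
Qed.

Lemma dirp_le2 a N (z : C) : (forall i, normc (a i) <= 1) -> 2 <= complex.Re z ->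
  normc (dirp a N z) <= 2.
Proof.
move=> a1 z2; apply: le_trans (vsq_sum_le N).
apply: le_trans (le_normc_sum _ _ _) _; apply: ler_sum => i _.
by rewrite normcM -[leRHS]mul1r; apply: ler_pM; rewrite ?normc_ge0 ?natpow_le_vsq.
Qed.

(** The truncated Dirichlet series of the product of zeta with the series of [a]. The coefficients
    [a] are indexed from 0, hence [k.-1]. *)
Definition divisor_dirp (a : nat -> C) (N : nat) (z : C) : C :=
  \sum_(n < N) natpow n.+1 (- z) * \sum_(k <- divisors n.+1) a k.-1.

Lemma divisor_dirpE a N z : divisor_dirp a N z =
  \sum_(k < N) \sum_(l < N) if (k.+1 * l.+1 <= N)%N then a k * natpow k.+1 (- z) * natpow l.+1 (- z) else 0.
Proof.
transitivity (\sum_(n < N) \sum_(k < N) \sum_(l < N)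
   if n.+1 == (k.+1 * l.+1)%N then natpow n.+1 (- z) * a k else 0).
  apply: eq_bigr => n _.
  have -> : \sum_(k <- divisors n.+1) a k.-1 = \sum_(k < N | (k.+1 %| n.+1)%N) a k.
    have -> : \sum_(k < N | (k.+1 %| n.+1)%N) a k = \sum_(k <- iota 1 N | (k %| n.+1)%N) a k.-1.
      rewrite -[1%N]/(1 + 0)%N iotaDl big_map -[iota 0 N]/(iota 0 N).
      have -> : iota 0 N = index_iota 0 N by rewrite /index_iota subn0.
      by rewrite big_mkord; apply: eq_bigl => k; rewrite add1n.
    rewrite -[RHS]big_filter; apply: perm_big; apply: uniq_perm.
    - exact: divisors_uniq.
    - by rewrite filter_uniq ?iota_uniq.
    move=> d; rewrite mem_filter -dvdn_divisors// mem_iota.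
    have [dn|//] := boolP (d %| n.+1)%N.
    by rewrite (dvdn_gt0 _ dn)// add1n ltnS (leq_trans (dvdn_leq _ dn)).
  rewrite mulr_sumr [LHS]big_mkcond; apply: eq_bigr => k _.
  case: ifP => h; last first.
    by rewrite big1// => l _; rewrite ifF//; apply: contraFF h => /eqP ->; rewrite dvdn_mulr.
  have /dvdnP[l el] := h.
  have l0 : (0 < l)%N by move: (isT : (0 < n.+1)%N); rewrite el muln_gt0 => /andP[].
  have lN : (l.-1 < N)%N.
    rewrite prednK//; apply: leq_trans (ltn_ord n); rewrite el; exact: leq_pmulr.
  rewrite (bigD1 (Ordinal lN))//= prednK// el mulnC eqxx big1 ?addr0// => j jl.
  rewrite ifF//; apply: contra_neqF jl; rewrite eqn_pmul2l// => /eqP e.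
  by apply: val_inj; rewrite /= e.
rewrite exchange_big /=; apply: eq_bigr => k _; rewrite exchange_big /=; apply: eq_bigr => l _.
have kl0 : (0 < k.+1 * l.+1)%N by [].
rewrite -mulrA -natpowM//; move: (k.+1 * l.+1)%N kl0 => p p0.
have [h|h] := leqP p N; last first.
  rewrite big1// => n _; rewrite ifF//; apply/eqP => e.
  by move: h; rewrite -e ltnNge ltn_ord.
have nN : (p.-1 < N)%N by rewrite prednK.
rewrite (bigD1 (Ordinal nN))//= prednK// eqxx big1 ?addr0 => [|n ne]; last first.
  by rewrite ifF//; apply: contra_neqF ne => /eqP e; apply: val_inj; rewrite /= -e.
by rewrite mulrC.
Qed.

(** The difference consists of the pairs with (k+1) (l+1) > N >= M^2, for which one index is at
    least M. That tail of [vsq] is at most 1 / M, and the other sum is at most 2. *)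
Lemma hyperbola_le a N M (z : C) : (forall i, normc (a i) <= 1) -> 2 <= complex.Re z ->
  (0 < M)%N -> (M * M <= N)%N ->
  normc (divisor_dirp a N z - dirp (fun=> 1) N z * dirp a N z) <= 4 / M%:R.
Proof.
move=> a1 z2 M0 MN.
have MN' : (M <= N)%N by apply: leq_trans MN; exact: leq_pmulr.
have -> : dirp (fun=> 1) N z * dirp a N z = \sum_(k < N) \sum_(l < N) a k * natpow k.+1 (- z) * natpow l.+1 (- z).
  rewrite mulrC /dirp mulr_suml; apply: eq_bigr => k _; rewrite mulr_sumr.
  by apply: eq_bigr => l _; rewrite mul1r.
rewrite divisor_dirpE -sumrB; apply: le_trans (le_normc_sum _ _ _) _.
have V2 := vsq_sum_le N; have VT := vsq_tail M0 MN'.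
have Vw : \sum_(i < N) (if (M <= i)%N then vsq i else 0) = \sum_(i < N) vsq i - \sum_(i < M) vsq i.
  rewrite (big_ord_widen N vsq MN') [X in _ = _ - X]big_mkcond -sumrB; apply: eq_bigr => i _.
  by rewrite ltnNge; case: leqP => _ /=; rewrite ?subr0 ?subrr.
have V0 n : 0 <= \sum_(i < n) vsq i by apply: sumr_ge0 => i _; exact: vsq_ge0.
apply: le_trans (_ : \sum_(k < N) \sum_(l < N)
   ((if (M <= k)%N then vsq k else 0) * vsq l + vsq k * (if (M <= l)%N then vsq l else 0)) <= _).
  apply: ler_sum => k _; rewrite -sumrB; apply: le_trans (le_normc_sum _ _ _) _.
  apply: ler_sum => l _; have vk := vsq_ge0 k; have vl := vsq_ge0 l.
  have hk : 0 <= (if (M <= k)%N then vsq k else 0) by case: ifP.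
  have hl : 0 <= (if (M <= l)%N then vsq l else 0) by case: ifP.
  case: ifP => h; first by rewrite subrr normc0 addr_ge0// mulr_ge0.
  rewrite sub0r normcN !normcM.
  apply: le_trans (_ : vsq k * vsq l <= _).
    apply: ler_pM; rewrite ?mulr_ge0 ?normc_ge0 ?natpow_le_vsq//.
    by rewrite -[leRHS]mul1r; apply: ler_pM; rewrite ?normc_ge0 ?natpow_le_vsq.
  have [kM|kM] := leqP M k; first by rewrite lerDl mulr_ge0.
  have [lM|lM] := leqP M l; first by rewrite lerDr mulr_ge0.
  by move: h; rewrite (leq_trans _ MN)// leq_mul.
under eq_bigr => k _ do rewrite big_split /= -!mulr_sumr.
rewrite big_split /= -!mulr_suml Vw.
apply: le_trans (_ : M%:R^-1 * 2 + 2 * M%:R^-1 <= _); last by lra.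
have T0 : 0 <= \sum_(i < N) vsq i - \sum_(i < M) vsq i.
  by rewrite -Vw; apply: sumr_ge0 => i _; case: ifP => // _; exact: vsq_ge0.
by apply: lerD; apply: ler_pM => //; exact: V0.
Qed.

End DirichletPolynomials.

Section Continuation.
Variable R : realType.
Local Notation C := R[i].

Lemma nbhs_normc (P : set C^o) (a : C^o) : nbhs a P ->
  exists2 d : R, 0 < d & forall w : C, normc (w - a) < d -> P w.
Proof.
move=> /nbhs_normP[[e e'] /= e0 hP].
move: (e0); rewrite ltcE /= => /andP[/eqP e'0 e00]; exists e => // w we.
apply: hP; rewrite /= normcE_norm normcBC.
have -> : (e +i* e')%C = e%:C%C by rewrite e'0.
by rewrite ltcR.
Qed.

Lemma cdiff_local (G H : C -> C) z (d : R) : 0 < d ->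
  (forall w, normc (w - z) < d -> G w = H w) -> cdiff H z -> cdiff G z.
Proof.
move=> d0 GH [D hD]; exists D => e e0; have [dl dl0 hd] := hD e e0.
exists (Num.min d dl); first by rewrite lt_min d0.
move=> h; rewrite lt_min => /andP[h1 h2].
rewrite !GH ?subrr ?normc0//; first exact: hd.
by rewrite addrC addKr.
Qed.

Definition alt (i : nat) : C := (-1) ^+ i.

Lemma alt_partial_sum j : normc (\sum_(i < j) alt i) <= 1.
Proof.
have e k : \sum_(i < k) alt i = (odd k)%:R.
  elim: k => [|k IH]; first by rewrite big_ord0.
  rewrite big_ord_recr /= IH /alt -signr_odd; case: (odd k); rewrite /= ?expr0 ?expr1 ?subrr ?add0r//.
by rewrite e; case: (odd j); rewrite ?normc0 ?normc1.
Qed.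

Lemma normc_nat n : normc (n%:R : C) = n%:R.
Proof. by rewrite -(rmorph_nat (real_complex R)) normc_real normr_nat. Qed.

Lemma dirpS (a : nat -> C) N z : dirp a N.+1 z = dirp a N z + a N * natpow N.+1 (- z).
Proof. by rewrite /dirp big_ord_recr. Qed.

(** Subtracting the even terms twice produces the signs, and the even terms up to 2 N are 2^(-z)
    times the terms up to N. *)
Lemma dirp_alt N (z : C) : dirp alt (2 * N) z =
  dirp (fun=> 1) (2 * N) z - 2 * natpow 2 (- z) * dirp (fun=> 1) N z.
Proof.
elim: N => [|N IH]; first by rewrite /dirp muln0 !big_ord0 mulr0 subr0.
have -> : (2 * N.+1 = (2 * N).+2)%N by lia.
rewrite !dirpS IH.
have -> : alt (2 * N) = 1 by rewrite /alt exprM sqrrN expr1n expr1n.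
have -> : alt (2 * N).+1 = -1 by rewrite /alt exprS exprM sqrrN expr1n expr1n mulr1.
have -> : ((2 * N).+2 = 2 * N.+1)%N by lia.
by rewrite (@natpowM R 2 N.+1)//; ring.
Qed.

Section Field.
Variables (K : set C) (f : C^o -> C^o) (q : nat) (chi : nat -> int).
Hypotheses (hf : is_dedekind_zeta K f) (h : gauss_char q chi) (q1 : (1 < q)%N).
Hypothesis hK : forall N, exists A : {fset nonzero_ideals K},
  (forall I : nonzero_ideals K, (ideal_norm K (val I) <= N)%N -> I \in A) /\
  forall F : nat -> C, \sum_(I <- A) F (ideal_norm K (val I)) =
    \sum_(n < N) F n.+1 * (\sum_(k <- divisors n.+1) chi k)%:~R.

Let a (k : nat) : C := (chi k.+1)%:~R.

Let a1 k : normc (a k) <= 1.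
Proof.
rewrite /a -(rmorph_int (real_complex R)) normc_real -intr_norm -[1]/(1%:~R) ler_int.
exact: gauss_char_norm h _.
Qed.

Let one1 (k : nat) : normc (1 : C) <= 1. Proof. by rewrite normc1. Qed.

(** Once N exceeds all norms occurring in the finite set [A0] given by unordered convergence, the
    set supplied by [hK] contains [A0], and its sum is a truncated Dirichlet series. *)
Let zeta_lim (z : C) : 1 < complex.Re z -> forall e : R, 0 < e ->
  exists N0 : nat, forall N, (N0 <= N)%N -> normc (divisor_dirp a N z - f z) <= e.
Proof.
move=> z1 e e0; have [_ _ /(_ z z1) hlim] := hf.
have eC : 0 < e%:C%C :> C by rewrite ltcR.
have : nbhs (f z : C^o) ([set w : C^o | normc (w - f z) <= e] : set C^o).
  by apply/(@nbhs_normP C C^o); exists e%:C%C => // w /=; rewrite normcE_norm ltcR normcBC; exact: ltW.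
move=> /hlim[A0 _ hA0].
pose N0 := (\max_(I <- A0) ideal_norm K (val I))%N.
exists N0 => N NN; have [A [hA sA]] := hK N.
have sub : (A0 `<=` A)%fset.
  apply/fsubsetP => I IA0; apply: hA; apply: leq_trans NN.
  rewrite /N0 (big_rem I)//=; exact: leq_maxl.
have := hA0 A sub; rewrite /= /summability.partial_sum -(big_seq_fsetE _ _ xpredT (fun I : nonzero_ideals K => natpow (ideal_norm K (val I)) (- z))) /=.
rewrite (sA (fun n => natpow n (- z))) /divisor_dirp => H.
apply: le_trans H; rewrite le_eqVlt; apply/orP; left; apply/eqP; congr (normc (_ - _)).
apply: eq_bigr => n _; congr (_ * _); rewrite rmorph_sum big_seq [RHS]big_seq.
apply: eq_bigr => k; rewrite -dvdn_divisors// => kn.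
by rewrite /a prednK// (dvdn_gt0 _ kn).
Qed.

Let zeta_dist (z : C) J : 2 <= complex.Re z -> (0 < J)%N ->
  normc (f z - dirp (fun=> 1) J z * dirp a J z) <= 4 / J%:R.
Proof.
move=> z2 J0; apply/ler_addgt0Pr => e e0.
have z1 : 1 < complex.Re z by apply: lt_le_trans z2; rewrite ltr1n.
have e2 : 0 < e / 2 by rewrite divr_gt0.
have [N0 HN] := zeta_lim z1 e2.
have [M M0 hM] : exists2 M, (0 < M)%N & 4 / M%:R <= e / 2.
  exists (Num.bound (4 / (e / 2))).+1 => //; rewrite ler_pdivrMr ?ltr0n// mulrC -ler_pdivrMr//.
  apply: ltW; apply: lt_le_trans (archi_boundP _) _; first by rewrite divr_ge0// ltW.
  by rewrite ler_nat.
pose N := maxn N0 (maxn (M * M) J).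
have hN0 : (N0 <= N)%N by exact: leq_maxl.
have hNM : (M * M <= N)%N by rewrite /N !leq_max leqnn orbT.
have hNJ : (J <= N)%N by rewrite /N !leq_max leqnn !orbT.
have d1 := HN N hN0; have d2 := le_trans (hyperbola_le a1 z2 M0 hNM) hM.
set S := divisor_dirp a N z in d1 d2; set ZN := dirp _ N z in d2; set LN := dirp a N z in d2.
set ZJ := dirp _ J z; set LJ := dirp a J z.
have J0R : 0 <= J%:R^-1 :> R by rewrite invr_ge0 ler0n.
have d3 : normc (ZN * LN - ZJ * LJ) <= 4 / J%:R.
  have -> : ZN * LN - ZJ * LJ = ZN * (LN - LJ) + (ZN - ZJ) * LJ by ring.
  apply: le_trans (le_normcD _ _) _; rewrite !normcM.
  have t1 : normc ZN * normc (LN - LJ) <= 2 * J%:R^-1.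
    by apply: ler_pM; rewrite ?normc_ge0 ?(dirp_le2 _ one1)// dirp_tail.
  have t2 : normc (ZN - ZJ) * normc LJ <= J%:R^-1 * 2.
    apply: ler_pM; rewrite ?normc_ge0 ?dirp_le2//; exact: (dirp_tail one1).
  by apply: le_trans (lerD t1 t2) _; lra.
have -> : f z - ZJ * LJ = - (S - f z) + ((S - ZN * LN) + (ZN * LN - ZJ * LJ)) by ring.
apply: le_trans (le_normcD _ _) _; rewrite normcN.
apply: le_trans (lerD (lexx _) (le_normcD _ _)) _.
by move: d1 d2 d3; lra.
Qed.

(* Entire, since 1 - 2^(1 - z) cancels the pole of f at 1. *)
Let hfun (z : C) : C := if z == 1 then 0 else (z - 1) * (1 - 2 * natpow 2 (- z)) * f z.

Let cdiff_factor z : cdiff (fun w : C => 1 - 2 * natpow 2 (- w)) z.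
Proof.
apply: cdiffB; first exact: cdiff_cst.
by apply: cdiffM; [exact: cdiff_cst|exact: cdiff_natpow].
Qed.

Let factor1 : 1 - 2 * natpow 2 (- 1) = 0 :> C.
Proof.
have -> : natpow 2 (- 1) = 2^-1 :> C.
  rewrite /natpow mulN1r -rmorphN /= /cexp /= cos0 sin0 mulr0 mulr1 expRN lnK ?posrE//.
  by transitivity ((2^-1 : R)%:C%C) => //; rewrite fmorphV rmorph_nat.
by rewrite mulfV ?subrr// pnatr_eq0.
Qed.

Let cdiff_hfun z : cdiff hfun z.
Proof.
have [fd [g [gd g1 fg]] _] := hf.
have [->|z1] := eqVneq z 1; last first.
  have d0 : 0 < normc (z - 1) by rewrite normc_gt0 subr_eq0.
  apply: (@cdiff_local hfun (fun w => (w - 1) * (1 - 2 * natpow 2 (- w)) * f w) z _ d0).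
    move=> w hw; rewrite /hfun ifF//; apply/eqP => w1.
    by move: hw; rewrite w1 normcBC ltxx.
  apply: cdiffM; last by apply: derivable_cdiff; exact: fd.
  apply: cdiffM; last exact: cdiff_factor.
  by apply: cdiffB; [exact: cdiff_id|exact: cdiff_cst].
have gd1 : derivable g 1 1 := nbhs_singleton gd.
have [d d0 hd] : exists2 d : R, 0 < d & forall w : C, normc (w - 1) < d -> w != 1 -> f w = g w / (w - 1).
  by apply: nbhs_normc.
(* Near 1 the factor w - 1 cancels the pole, and the value 0 given to [hfun] at 1 agrees with the
   zero of 1 - 2^(1 - w). *)
apply: (@cdiff_local hfun (fun w => (1 - 2 * natpow 2 (- w)) * g w) 1 _ d0).
  move=> w hw; rewrite /hfun; have [->|w1] := eqVneq w 1; first by rewrite factor1 mul0r.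
  rewrite hd// mulrAC mulrC; congr (_ * _); rewrite mulrCA mulfV ?mulr1// subr_eq0//.
apply: cdiffM; first exact: cdiff_factor.
exact: derivable_cdiff.
Qed.

(* Summation by parts bounds both factors for Re z >= 1/10, although the Dirichlet
   series of f only converges for Re z > 1. *)
Let E (N : nat) (z : C) : C := (z - 1) * (dirp alt (2 * N.+1) z * dirp a (2 * N.+1) z).

(** On this circle Re z >= 1/10 and |z| <= 6, so |z| / Re z <= 60 and [dirp_bound] gives 1 + 2 * 60
    = 121 for each factor; the remaining 5 bounds |z - 1|. *)
Let E_bound N (z : C) : normc (z - 3) = 29 / 10 -> normc (E N z) <= 5 * (121 * (q%:R * 121)).
Proof.
move=> hz; have hx : 1 / 10 <= complex.Re z.
  have := le_normc_Re (z - 3); rewrite hz ler_norml; case: (z) => x y /=; lra.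
have hz6 : normc z <= 6.
  rewrite -[z](subrK 3); apply: le_trans (le_normcD _ _) _.
  rewrite hz normc_nat; lra.
have x0 : 0 < complex.Re z by lra.
have r0 : 0 <= normc z / complex.Re z by rewrite divr_ge0 ?normc_ge0 ?ltW.
have r60 : normc z / complex.Re z <= 60 by rewrite ler_pdivrMr//; lra.
rewrite /E !normcM; apply: ler_pM; rewrite ?mulr_ge0 ?normc_ge0//.
  have -> : z - 1 = (z - 3) + 2 by ring.
  apply: le_trans (le_normcD _ _) _; rewrite hz normc_nat; lra.
apply: ler_pM; rewrite ?normc_ge0//.
  apply: le_trans (dirp_bound _ x0 alt_partial_sum) _; lra.
apply: le_trans (dirp_bound (K := q%:R) _ x0 _) _.
  move=> j; have := @gauss_char_partial_sum R _ _ h q1 1 j.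
  rewrite -(normc_real (\sum_(i < j) _)) rmorph_sum /=; congr (normc _ <= _).
  by apply: eq_bigr => i _; rewrite rmorph_int add1n.
by rewrite ler_wpM2l ?ler0n//; lra.
Qed.

(** On this circle Re z >= 2, where everything converges absolutely; the bounds 3 for |z - 1| and 16
    / (N + 1) for the rest multiply to 48 / (N + 1). *)
Let E_cvg (e : R) : 0 < e -> exists N0 : nat, forall N z, (N0 <= N)%N ->
  normc (z - 3) = 1 -> normc (hfun z - E N z) <= e.
Proof.
move=> e0; exists (Num.bound (48 / e)) => N z NN hz.
have z2 : 2 <= complex.Re z.
  have := le_normc_Re (z - 3); rewrite hz ler_norml; case: (z) => x y /=; lra.
have z1 : z != 1.
  by apply: contraTneq z2 => ->; rewrite /= -ltNge ltr1n.
have n0 : 0 < N.+1%:R :> R by rewrite ltr0n.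
rewrite /hfun (negbTE z1) /E dirp_alt.
set Z2 := dirp _ (2 * N.+1) z; set Z1 := dirp _ N.+1 z; set L := dirp a _ z; set u := natpow 2 _.
have -> : (z - 1) * (1 - 2 * u) * f z - (z - 1) * ((Z2 - 2 * u * Z1) * L) =
  (z - 1) * ((1 - 2 * u) * (f z - Z2 * L) - 2 * u * (Z2 - Z1) * L) by ring.
have nu : normc u <= 1.
  by apply: le_trans (natpow_le_vsq 1 z2) _; rewrite /vsq invf_le1// exprn_ege1// ler1n.
have n2 : normc (2 : C) = 2 := normc_nat 2.
have t1 : normc (f z - Z2 * L) <= 4 / N.+1%:R.
  apply: le_trans (zeta_dist z2 (isT : 0 < 2 * N.+1)%N) _.
  rewrite ler_pM2l// lef_pV2 ?posrE ?ltr0n// ler_nat; lia.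
have t2 : normc (Z2 - Z1) <= N.+1%:R^-1 by apply: (dirp_tail one1) => //; lia.
have t3 : normc L <= 2 by apply: dirp_le2.
have t4 : normc (z - 1) <= 3.
  have -> : z - 1 = (z - 3) + 2 by ring.
  by apply: le_trans (le_normcD _ _) _; rewrite hz n2; lra.
have t5 : normc (1 - 2 * u) <= 3.
  by apply: le_trans (le_normcB _ _) _; rewrite normc1 normcM n2; lra.
have t6 : normc ((1 - 2 * u) * (f z - Z2 * L) - 2 * u * (Z2 - Z1) * L) <= 16 / N.+1%:R.
  apply: le_trans (le_normcB _ _) _; rewrite !normcM n2.
  have s1 : normc (1 - 2 * u) * normc (f z - Z2 * L) <= 3 * (4 / N.+1%:R) by apply: ler_pM; rewrite ?normc_ge0.
  have s2 : 2 * normc u * normc (Z2 - Z1) * normc L <= 2 * 1 * N.+1%:R^-1 * 2.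
    by rewrite !ler_pM ?mulr_ge0 ?normc_ge0.
  by apply: le_trans (lerD s1 s2) _; set y := N.+1%:R^-1; lra.
rewrite normcM; apply: le_trans (ler_pM (normc_ge0 _) (normc_ge0 _) t4 t6) _.
rewrite mulrA ler_pdivrMr// -ler_pdivrMl//.
have -> : e^-1 * (3 * 16) = 48 / e by lra.
apply: ltW; apply: lt_le_trans (archi_boundP _) _; first by rewrite divr_ge0// ltW.
by rewrite ler_nat (leq_trans NN).
Qed.

Definition alt_series (s : R) (N : nat) : R := \sum_(i < N) (-1) ^+ i * i.+1%:R `^ (- s).

Definition alt_value (s : R) : R := limn (alt_series s).

Lemma alt_series_cvg (s : R) : 0 < s -> alt_series s @ \oo --> alt_value s.
Proof.
move=> s0.
have tail L J : (L <= J)%N -> `|alt_series s J - alt_series s L| <= 1 * L.+1%:R `^ (- s).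
  move=> LJ; rewrite /alt_series (sum_ord_tail (fun i => (-1) ^+ i * i.+1%:R `^ (- s)) LJ).
  have [->|J0] := posnP (J - L)%N; first by rewrite big_ord0 normr0 mulr_ge0 ?powR_ge0.
  have := @abel_le R (fun i => (-1) ^+ (L + i)) (fun i => (L + i).+1%:R `^ (- s)) 1 (J - L)%N.
  rewrite addn0; apply => //.
  - move=> j; have -> : \sum_(i < j) (-1) ^+ (L + i) = (-1) ^+ L * (odd j)%:R :> R.
      elim: j => [|j IH]; first by rewrite big_ord0 mulr0.
      rewrite big_ord_recr /= IH exprD -mulrDr -[X in _ + X]signr_odd; congr (_ * _).
      by case: (odd j); rewrite /= ?expr1 ?subrr ?expr0 ?add0r.
    by rewrite normrM normrX normrN normr1 expr1n mul1r normr_nat; case: (odd j).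
  - move=> i _; apply: powRN_nincr; [exact: ltW|by rewrite ltr0n|by rewrite ler_nat addnS].
have [cx _] := dirichlet_cvg tail (powRN_cvg0 1 s0).
exact: cx.
Qed.

(** Three circles of centre 3 and radii 1, 3 - s and 29/10 give [hfun] at s as the limit of [E N];
    the same limit is computed from the alternating series and from L. The common factor s - 1 is
    nonzero and cancels. *)
Theorem zeta_factorization (s : R) : 1 / 10 < s < 1 ->
  (1 - 2 * 2 `^ (- s))%:C%C * f s%:C%C = (alt_value s * Lvalue chi s)%:C%C.
Proof.
move=> /andP[s0 s1].
have sp : 0 < s by lra.
have real_dirp (c : nat -> R) N : dirp (fun i => (c i)%:C%C) N s%:C%C = (\sum_(i < N) c i * i.+1%:R `^ (- s))%:C%C.
  rewrite rmorph_sum; apply: eq_bigr => i _; rewrite rmorphM; congr (_ * _).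
  by rewrite /natpow -rmorphN -rmorphM /cexp /= cos0 sin0 mulr0 mulr1 /powR gt_eqF.
have eE N : E N s%:C%C = ((s - 1) * (alt_series s (2 * N.+1) * Lseries chi s (2 * N.+1)))%:C%C.
  rewrite /E !rmorphM rmorphB rmorph1; congr (_ * (_ * _)).
    rewrite -[RHS](real_dirp (fun i => (-1) ^+ i)).
    by apply: eq_bigr => i _; rewrite rmorphXn rmorphN1.
  rewrite -[RHS](real_dirp (fun i => (chi i.+1)%:~R)).
  by apply: eq_bigr => i _; rewrite rmorph_int.
have lim : forall e : R, 0 < e -> exists N0 : nat, forall N, (N0 <= N)%N -> normc (hfun s%:C%C - E N s%:C%C) <= e.
  have r12 : 1 < 3 - s by lra.
  have r23 : 3 - s < 29 / 10 by lra.
  have := middle_circle_cvg cdiff_hfun (fun N z => _) ltr01 r12 r23 E_bound E_cvg.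
  move=> H e e0; have [|N0 HN] := H _ e e0.
    move=> N z; apply: cdiffM; last by apply: cdiffM; exact: cdiff_dirp.
    by apply: cdiffB; [exact: cdiff_id|exact: cdiff_cst].
  have e3 : 3 - (3 - s)%:C%C = s%:C%C :> C by rewrite rmorphB rmorph_nat opprB addrC subrK.
  by exists N0 => N /HN; rewrite e3.
have cE : (fun N => (s - 1) * (alt_series s (2 * N.+1) * Lseries chi s (2 * N.+1))) @ \oo -->
    (s - 1) * (alt_value s * Lvalue chi s).
  have sub u (l : R) : u @ \oo --> l -> (fun N : nat => u (2 * N.+1)%N) @ \oo --> l.
    move=> /cvg_seqP hu; apply/cvg_seqP => e /hu[n0 H]; exists n0 => n nn; apply: H; lia.
  apply: cvgM; first exact: cvg_cst.
  by apply: cvgM; [exact: sub (alt_series_cvg sp)|exact: sub (Lseries_cvg h q1 sp)].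
have hval : hfun s%:C%C = ((s - 1) * (alt_value s * Lvalue chi s))%:C%C.
  apply/eqP; rewrite -subr_eq0 -normc_eq0; apply/eqP/le_anti/andP; split; last exact: normc_ge0.
  apply/ler_addgt0Pr => e e0; rewrite add0r.
  have e2 : 0 < e / 2 by rewrite divr_gt0.
  have [n1 H1] := lim _ e2; move/cvg_seqP: cE => /(_ _ e2)[n2 H2].
  have := H1 (maxn n1 n2) (leq_maxl _ _); have := H2 (maxn n1 n2) (leq_maxr _ _).
  set N := maxn n1 n2; rewrite eE => h2 h1.
  apply: le_trans (normc_distD _ _ _) _; rewrite (splitr e); apply: lerD; first exact: h1.
  by rewrite -rmorphB normc_real.
have s1C : s%:C%C != 1 :> C by rewrite -(rmorph1 (real_complex R)) (inj_eq (@complexI R)) lt_eqF.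
have s10 : s%:C%C - 1 != 0 :> C by rewrite subr_eq0.
move: hval; rewrite /hfun (negbTE s1C) rmorphM rmorphB rmorph1 -mulrA => /(mulfI s10) <-.
congr (_ * _); rewrite rmorphB rmorph1 rmorphM rmorph_nat; congr (_ - _ * _).
by rewrite /natpow -rmorphN -rmorphM /cexp /= cos0 sin0 mulr0 mulr1 /powR gt_eqF.
Qed.

End Field.

End Continuation.

(** * Logarithmic derivatives at 1/2 *)

Lemma disc_inj (m m' : int) : squarefree m -> squarefree m' -> disc m = disc m' -> m = m'.
Proof.
have no k k' : squarefree k -> k = 4 * k' -> False.
  by move=> /(_ 2%N isT) + ek; rewrite ek abszM dvdn_mulr.
move=> sm sm'; rewrite /disc; case: ifP => _; case: ifP => _ => // e.
- by case: (no _ _ sm e).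
- by case: (no _ _ sm' (esym e)).
- by apply: (@mulfI _ 4).
Qed.

Section LogarithmicDerivative.
Variable R : realType.
Local Notation C := R[i].

Lemma is_derive_Re (f : C^o -> C^o) (s : R) : derivable f s%:C%C 1 ->
  is_derive s 1 (fun u : R => complex.Re (f u%:C%C)) (complex.Re (derive1 f s%:C%C)).
Proof.
move=> /derivable_estimate est; rewrite derive1E; set d := 'D_1 f s%:C%C in est *.
pose F (u : R) : R := complex.Re (f u%:C%C).
have lim : h^-1 *: ((F \o shift s) (h *: (1 : R)) - F s) @[h --> (0 : R)^'] --> complex.Re d.
  apply/cvgrPdist_le => e e0; have [dl dl0 hdl] := est e e0.
  near=> h.
  have h0 : h != 0 by near: h; exact: nbhs_dnbhs_neq.
  have hlt : `|h| < dl by near: h; exact: dnbhs0_lt.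
  have := hdl h%:C%C; rewrite normc_real => /(_ hlt) H.
  have Hre := le_trans (le_normc_Re _) H.
  have -> : complex.Re d - h^-1 *: ((F \o shift s) (h *: 1) - F s) =
      - (h^-1 * complex.Re (f (s%:C%C + h%:C%C) - f s%:C%C - d * h%:C%C)).
    rewrite /F /= -rmorphD [h *: 1]mulr1 [s + h]addrC /(_ *: _).
    case: (f (h + s)%:C%C) => a1 a2; case: (f s%:C%C) => b1 b2; case: (d) => d1 d2 /=.
    by rewrite mulr0 subr0; field.
  rewrite normrN normrM normfV ler_pdivrMl ?normr_gt0// [X in _ <= X]mulrC; exact: Hre.
apply: DeriveDef; first exact: cvgP lim.
exact: cvg_lim lim.
Unshelve. all: by end_near.
Qed.

(** At s = 1/2 the trigonometric argument is pi/4, where sine and cosine agree, so only a sign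
    recording the parity remains in front of pi/2. *)
Lemma is_derive_gamma_factor (b : bool) (x : R) : 0 < x ->
  is_derive (2^-1 : R) 1 (fun s => 2 * trig b ((1 - s) * (pi / 2)) * x `^ (s - 1))
    ((ln x + (if b then -1 else 1) * (pi / 2)) *
     (2 * trig b ((1 - 2^-1) * (pi / 2)) * x `^ (2^-1 - 1))).
Proof.
move=> x0.
have dl : is_derive (2^-1 : R) 1 (fun u : R => (1 - u) * (pi / 2)) (- (pi / 2)).
  apply: is_derive_eq; rewrite /GRing.scale /=; ring.
have de : is_derive (2^-1 : R) 1 (fun u : R => (u - 1) * ln x) (ln x).
  apply: is_derive_eq; rewrite /GRing.scale /=; ring.
have sc : sin (pi / 4) = cos (pi / 4) :> R.
  by rewrite -cosBpihalf -cosN opprB; congr cos; lra.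
have e4 : (1 - 2^-1) * (pi / 2) = pi / 4 :> R by lra.
have dt : is_derive (2^-1 : R) 1 (trig b \o (fun u => (1 - u) * (pi / 2)))
   (((if b then -1 else 1) * (pi / 2)) * trig b (pi / 4)).
  case: b => /=.
    apply: is_derive_eq (is_derive1_comp (is_derive_sin _) dl) _.
    by rewrite e4 sc; ring.
  apply: is_derive_eq (is_derive1_comp (is_derive_cos _) dl) _.
  by rewrite e4 sc; ring.
have dE := is_derive1_comp (is_derive_expR _) de.
have -> : (fun s => 2 * trig b ((1 - s) * (pi / 2)) * x `^ (s - 1)) =
   (2 *: (trig b \o (fun u => (1 - u) * (pi / 2)))) * (@expR R \o (fun u => (u - 1) * ln x)).
  by apply/funext => s; rewrite /powR gt_eqF.
apply: is_derive_eq (is_deriveM (is_deriveZ 2 dt) dE) _.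
transitivity (2 * trig b ((1 - 2^-1) * (pi / 2)) * (expR ((2^-1 - 1) * ln x) * ln x) +
  expR ((2^-1 - 1) * ln x) * (2 * ((if b then -1 else 1) * (pi / 2) * trig b (pi / 4)))).
  by [].
rewrite e4 /powR gt_eqF//; ring.
Qed.

(** This is zeta(s) on (0, 1), the factor that the two fields share. *)
Definition zeta_weight (s : R) : R := alt_value s / (1 - 2 * 2 `^ (- s)).

Lemma quadratic_zeta (K : set C) (f : C^o -> C^o) :
  quadratic_number_field K -> is_dedekind_zeta K f ->
  exists (m : int) (th : C) (q : nat) (chi : nat -> int),
  [/\ [/\ squarefree m, th ^+ 2 = m%:~R & K = [set z | exists a b : rat, z = ratr a + ratr b * th]],
      [/\ gauss_char q chi, (1 < q)%N & chi q.-1 * q%:Z = disc m]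
    & forall s : R, 1 / 10 < s < 1 -> f s%:C%C = (zeta_weight s * Lvalue chi s)%:C%C].
Proof.
move=> /quadratic_generator[m [th [sqm m1 eth eK]]] hf.
have [q [chi [h hq h2]]] := quadratic_char sqm.
exists m, th, q, chi.
(* Modulus 1 would make [disc m] equal to 1 or -1, which leaves only the excluded m = 1. *)
have q1 : (1 < q)%N.
  rewrite ltn_neqAle (gauss_char_gt0 h) andbT; apply/eqP => q1.
  have := @gauss_char_cases _ _ h 0; rewrite -q1 => c0.
  move: hq; rewrite -q1 /= mulr1 /disc; case: ifP => m4 e; last by case: (c0 isT); lia.
  by case: (c0 isT) => c; move: m1 m4; rewrite -e c.
split => // s hs.
have hK N : exists A : {fset nonzero_ideals K},
  (forall I : nonzero_ideals K, (ideal_norm K (val I) <= N)%N -> I \in A) /\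
  forall F : nat -> C, \sum_(I <- A) F (ideal_norm K (val I)) =
    \sum_(n < N) F n.+1 * (\sum_(k <- divisors n.+1) chi k)%:~R.
  have [A [hA sA]] := ideals_up_to_ex (quad_gen_eq m1 eth) (ring_of_integersP sqm m1 eth eK)
    (quad_gen_free sqm m1 eth) N.
  exists A; split => // F; rewrite sA; apply: eq_bigr => n _; congr (_ * _).
  rewrite -(ideal_count_identity sqm h hq h2)// [RHS]rmorph_sum natr_sum.
  exact: eq_bigr.
have fac := zeta_factorization hf h q1 hK hs.
have w0 : 1 - 2 * 2 `^ (- s) != 0 :> R.
  have ln2 : 0 < ln 2 :> R by rewrite ln_gt0// ltr1n.
  have : expR (- ln 2) < 2 `^ (- s) :> R.
    by rewrite /powR gt_eqF// ltr_expR -[X in X < _]mulN1r ltr_pM2r// ltrN2; case/andP: hs.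
  rewrite expRN lnK ?posrE// => lt; clear -lt; lra.
have w0C : (1 - 2 * 2 `^ (- s))%:C%C != 0 :> C.
  by rewrite -(rmorph0 (real_complex R)) (inj_eq (@complexI R)).
apply: (mulfI w0C); rewrite fac -rmorphM /zeta_weight; congr (_%:C)%C.
by field.
Qed.


(* 1/2 is fixed by s |-> 1 - s, so the contributions of g1 and g2 to the logarithmic
   derivative cancel. *)
Lemma reflection_derive (g1 g2 B1 B2 : R -> R) (k1 k2 l1 l2 c1 c2 : R) :
  (forall s, 1 / 10 < s < 9 / 10 -> g1 (1 - s) * g2 s * B1 s * c2 = g2 (1 - s) * g1 s * B2 s * c1) ->
  is_derive (2^-1 : R) 1 g1 k1 -> is_derive (2^-1 : R) 1 g2 k2 ->
  is_derive (2^-1 : R) 1 B1 (l1 * B1 2^-1) -> is_derive (2^-1 : R) 1 B2 (l2 * B2 2^-1) ->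
  g1 2^-1 != 0 -> g2 2^-1 != 0 -> B1 2^-1 != 0 -> c2 != 0 ->
  k1 / g1 2^-1 = k2 / g2 2^-1 -> l1 = l2.
Proof.
move=> key; have := key (2^-1); set hf : R := 2^-1 => keyh G1 G2 Bd1 Bd2 n1 n2 nB nc eL.
have hE : 1 - hf = hf by rewrite /hf; lra.
pose r (u : R) : R := 1 - u.
have dr : is_derive hf 1 r (-1).
  by apply: is_derive_eq (is_deriveB (is_derive_cst (1 : R) hf 1) (is_derive_id hf 1)) _; rewrite sub0r.
have G1' : is_derive (r hf) 1 g1 k1 by rewrite /r hE.
have G2' : is_derive (r hf) 1 g2 k2 by rewrite /r hE.
have H1 := is_derive1_comp G1' dr; have H2 := is_derive1_comp G2' dr.
have D1 := is_deriveM (is_deriveM (is_deriveM H1 G2) Bd1) (is_derive_cst c2 hf 1).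
have D2 := is_deriveM (is_deriveM (is_deriveM H2 G1) Bd2) (is_derive_cst c1 hf 1).
have nearE : \forall u \near hf, ((g1 \o r) * g2 * B1 * (fun=> c2)) u =
    ((g2 \o r) * g1 * B2 * (fun=> c1)) u.
  near=> u; apply: key; apply/andP; split; near: u; [apply: lt_nbhsr|apply: lt_nbhsl]; rewrite /hf; lra.
have D1' := near_eq_is_derive nearE D1.
have := @derive_val _ _ _ _ _ _ _ D2; rewrite (@derive_val _ _ _ _ _ _ _ D1').
move=> e.
have {}e : (g1 (1 - hf) * g2 hf * B1 hf) * 0 + c2 * ((g1 (1 - hf) * g2 hf) * (l1 * B1 hf) +
     B1 hf * (g1 (1 - hf) * k2 + g2 hf * (k1 * -1))) =
    (g2 (1 - hf) * g1 hf * B2 hf) * 0 + c1 * ((g2 (1 - hf) * g1 hf) * (l2 * B2 hf) +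
     B2 hf * (g2 (1 - hf) * k1 + g1 hf * (k2 * -1))) by exact: esym.
rewrite hE in e keyh.
have {}keyh : g1 hf * g2 hf * B1 hf * c2 = g2 hf * g1 hf * B2 hf * c1.
  by apply: keyh; apply/andP; split; rewrite /hf; lra.
have eq12 : k1 * g2 hf = k2 * g1 hf by apply/eqP; rewrite -eqr_div//; exact/eqP.
have nz : g1 hf * g2 hf * B1 hf * c2 != 0 by rewrite !mulf_neq0.
apply: (mulfI nz); rewrite [in RHS]keyh.
transitivity (c2 * (g1 hf * g2 hf * (l1 * B1 hf) + B1 hf * (k2 * g1 hf - k1 * g2 hf))).
  by rewrite eq12; ring.
transitivity (c1 * (g2 hf * g1 hf * (l2 * B2 hf) + B2 hf * (k1 * g2 hf - k2 * g1 hf))).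
  by transitivity (g1 hf * g2 hf * B1 hf * 0 + c2 * (g1 hf * g2 hf * (l1 * B1 hf) +
     B1 hf * (g1 hf * k2 + g2 hf * (k1 * -1)))); [ring|rewrite e; ring].
by rewrite eq12; ring.
Unshelve. all: by end_near.
Qed.

(** Inserting the functional equation of each character, both sides of [key] become tau1 tau2
    kappa(s) L(s, chi1) L(s, chi2) times the zeta weights at s and 1 - s; [reflection_derive] then
    isolates the logarithmic derivatives of the elementary factors. *)
Lemma gamma_factor_comparison (q1 q2 : nat) (chi1 chi2 : nat -> int) (f1 f2 : C^o -> C^o) :
  gauss_char q1 chi1 -> (1 < q1)%N -> gauss_char q2 chi2 -> (1 < q2)%N ->
  derivable f1 (2^-1 : R)%:C%C 1 -> derivable f2 (2^-1 : R)%:C%C 1 ->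
  (forall s : R, 1 / 10 < s < 1 -> f1 s%:C%C = (zeta_weight s * Lvalue chi1 s)%:C%C) ->
  (forall s : R, 1 / 10 < s < 1 -> f2 s%:C%C = (zeta_weight s * Lvalue chi2 s)%:C%C) ->
  f1 (2^-1 : R)%:C%C != 0 -> f2 (2^-1 : R)%:C%C != 0 ->
  derive1 f1 (2^-1 : R)%:C%C / f1 (2^-1 : R)%:C%C = derive1 f2 (2^-1 : R)%:C%C / f2 (2^-1 : R)%:C%C ->
  ln (2 * pi / q1%:R) + (if chi1 q1.-1 == -1 then -1 else 1) * (pi / 2) =
  ln (2 * pi / q2%:R) + (if chi2 q2.-1 == -1 then -1 else 1) * (pi / 2) :> R.
Proof.
move=> h1 q11 h2 q21 d1 d2 e1 e2 n1 n2 eL.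
have [tau1 t1 ht1] := gauss_trig R h1; have [tau2 t2 ht2] := gauss_trig R h2.
set b1 := chi1 q1.-1 == -1 in ht1 *; set b2 := chi2 q2.-1 == -1 in ht2 *.
pose B b (x : R) s := 2 * trig b ((1 - s) * (pi / 2)) * x `^ (s - 1).
pose x1 : R := 2 * pi / q1%:R; pose x2 : R := 2 * pi / q2%:R.
pose g1 (u : R) : R := complex.Re (f1 u%:C%C); pose g2 (u : R) : R := complex.Re (f2 u%:C%C).
have x10 : 0 < x1 by rewrite /x1 !mulr_gt0 ?pi_gt0// invr_gt0 ltr0n ltnW.
have x20 : 0 < x2 by rewrite /x2 !mulr_gt0 ?pi_gt0// invr_gt0 ltr0n ltnW.
have tau10 : tau1 != 0 by rewrite -sqrf_eq0 t1 pnatr_eq0 -lt0n ltnW.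
have tau20 : tau2 != 0 by rewrite -sqrf_eq0 t2 pnatr_eq0 -lt0n ltnW.
have key s : 1 / 10 < s < 9 / 10 ->
  g1 (1 - s) * g2 s * B b1 x1 s * tau2 = g2 (1 - s) * g1 s * B b2 x2 s * tau1.
  move=> /andP[s1 s2].
  have sa : 1 / 10 < s < 1 by rewrite s1 /=; lra.
  have sb : 1 / 10 < 1 - s < 1 by apply/andP; split; lra.
  have sc : 0 < s < 1 by apply/andP; split; lra.
  have F1 := functional_equation h1 q11 sc ht1.
  have F2 := functional_equation h2 q21 sc ht2.
  rewrite /g1 /g2 !(e1 _ sa, e1 _ sb, e2 _ sa, e2 _ sb) /=.
  transitivity (zeta_weight (1 - s) * zeta_weight s * Lvalue chi2 s * tau2 * (B b1 x1 s * Lvalue chi1 (1 - s))); first by ring.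
  rewrite [B _ _ _ * _]F1.
  transitivity (zeta_weight (1 - s) * zeta_weight s * Lvalue chi1 s * tau1 * (B b2 x2 s * Lvalue chi2 (1 - s))); last by ring.
  by rewrite [B _ _ _ * _]F2; ring.
have hh : 1 / 10 < (2^-1 : R) < 1 by apply/andP; split; lra.
have E1 : f1 (2^-1 : R)%:C%C = (g1 2^-1)%:C%C by rewrite /g1 (e1 _ hh).
have E2 : f2 (2^-1 : R)%:C%C = (g2 2^-1)%:C%C by rewrite /g2 (e2 _ hh).
have neq0 (x : R) : x%:C%C != 0 :> C -> x != 0 by apply: contraNneq => ->.
have Rdiv (z : C) (x : R) : complex.Re (z / x%:C%C) = complex.Re z / x.
  by rewrite -fmorphV; case: z => u v /=; rewrite mulr0 subr0.
apply: (reflection_derive key (is_derive_Re d1) (is_derive_Re d2)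
  (is_derive_gamma_factor b1 x10) (is_derive_gamma_factor b2 x20)) => //.
- by apply: neq0; rewrite -E1.
- by apply: neq0; rewrite -E2.
- rewrite /B !mulf_neq0 ?pnatr_eq0//; last by rewrite gt_eqF// powR_gt0.
  have -> : (1 - 2^-1) * (pi / 2) = pi / 4 :> R by lra.
  have p0 := pi_gt0 R; rewrite /trig; case: (b1); rewrite gt_eqF//.
    by apply: sin_gt0_pi; apply/andP; split; lra.
  by apply: cos_gt0_pihalf; apply/andP; split; lra.
(* Both values at 1/2 are real, so the equality of complex quotients passes to real parts. *)
- rewrite E1 E2 in eL.
  exact: etrans (esym (Rdiv _ _)) (etrans (congr1 (@complex.Re R) eL) (Rdiv _ _)).
Qed.

(** Different parities would exhibit e^pi as the quotient of the two conductors; equal parities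
    leave the injectivity of ln. *)
Lemma conductor_comparison (q1 q2 : nat) (b1 b2 : bool) : (0 < q1)%N -> (0 < q2)%N ->
  ln (2 * pi / q1%:R) + (if b1 then -1 else 1) * (pi / 2) =
  ln (2 * pi / q2%:R) + (if b2 then -1 else 1) * (pi / 2) :> R ->
  q1 = q2 /\ b1 = b2.
Proof.
move=> q10 q20.
have pos q : (0 < q)%N -> 0 < 2 * pi / q%:R :> R.
  by move=> q0; rewrite !mulr_gt0 ?pi_gt0// invr_gt0 ltr0n.
have irr q q' : (0 < q)%N -> (0 < q')%N -> ln (2 * pi / q'%:R) = ln (2 * pi / q%:R) + pi :> R -> False.
  move=> q0 q'0 e; apply: (@expR_pi_irrational R q q' q'0).
  have : expR (ln (2 * pi / q'%:R)) = expR (ln (2 * pi / q%:R) + pi) :> R by rewrite e.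
  rewrite expRD !lnK ?posrE ?pos// => {}e.
  have qn0 : q%:R != 0 :> R by rewrite pnatr_eq0 -lt0n.
  have qn0' : q'%:R != 0 :> R by rewrite pnatr_eq0 -lt0n.
  have pn0 : pi != 0 :> R by rewrite gt_eqF// pi_gt0.
  have solve (p x y z : R) : p != 0 -> x != 0 -> y != 0 -> 2 * p / y = 2 * p / x * z -> z = x / y.
    move=> p0 x0 y0 h; transitivity (2 * p / x * z * (x / (2 * p))).
      by field; rewrite p0 x0.
    by rewrite -h; field; rewrite ?p0 ?y0.
  exact: solve e.
have inj q q' : (0 < q)%N -> (0 < q')%N -> ln (2 * pi / q%:R) = ln (2 * pi / q'%:R) :> R -> q = q'.
  move=> q0 q'0 /ln_inj; rewrite !posrE => /(_ (pos _ q0) (pos _ q'0)).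
  have p2 : 2 * pi != 0 :> R by rewrite mulf_neq0 ?pnatr_eq0// gt_eqF// pi_gt0.
  by move=> /(mulfI p2)/invr_inj/eqP; rewrite eqr_nat => /eqP.
case: b1; case: b2 => e.
- by split=> //; apply: inj => //; apply: addIr e.
- by case: (irr q2 q1) => //; move: e; lra.
- by case: (irr q1 q2) => //; move: e; lra.
- by split=> //; apply: inj => //; apply: addIr e.
Qed.

(** Two square roots of [m] differ at most by a sign, which the coefficient b absorbs. *)
Lemma quadratic_set_eq (m : int) (th th' : C) : th ^+ 2 = m%:~R -> th' ^+ 2 = m%:~R ->
  [set z : C | exists a b : rat, z = ratr a + ratr b * th] `<=`
  [set z : C | exists a b : rat, z = ratr a + ratr b * th'].
Proof.
move=> e e' z /= [a [b ->]]; exists a.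
move: e; rewrite -e' => /eqP; rewrite eqf_sqr => /orP[] /eqP ->; first by exists b.
by exists (- b); rewrite rmorphN mulrN mulNr.
Qed.

(** The default of [xget] is the zero function, so a nonzero value shows that the chosen function
    meets its specification. *)
Lemma dedekind_zetaP (K : set C) (s : C) : dedekind_zeta K s <> 0 ->
  is_dedekind_zeta K (dedekind_zeta K).
Proof. by rewrite /dedekind_zeta; case: xgetP. Qed.

End LogarithmicDerivative.

Theorem theorem1 (R : realType) (K L : set R[i])
  (hK : quadratic_number_field K) (hL : quadratic_number_field L)
  (hKL : K <> L)
  (h0 : dedekind_zeta K 2^-1 * dedekind_zeta L 2^-1 <> 0) :
  derive1 (dedekind_zeta K) 2^-1 / dedekind_zeta K 2^-1
    <> derive1 (dedekind_zeta L) 2^-1 / dedekind_zeta L 2^-1.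
Proof.
have half : 2^-1 = (2^-1 : R)%:C%C :> R[i] by rewrite fmorphV rmorph_nat.
have half1 : (2^-1 : R)%:C%C != 1 :> R[i].
  by rewrite -half invr_eq1 (eqr_nat _ 2 1).
have nK : dedekind_zeta K (2^-1 : R)%:C%C != 0.
  by apply/eqP => e; apply: h0; rewrite half e mul0r.
have nL : dedekind_zeta L (2^-1 : R)%:C%C != 0.
  by apply/eqP => e; apply: h0; rewrite half e mulr0.
have zK := dedekind_zetaP (elimN eqP nK); have zL := dedekind_zetaP (elimN eqP nL).
have [m1 [th1 [q1 [chi1 [[s1 t1 eK] [g1 q11 c1] f1]]]]] := quadratic_zeta hK zK.
have [m2 [th2 [q2 [chi2 [[s2 t2 eL] [g2 q21 c2] f2]]]]] := quadratic_zeta hL zL.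
have [[dK _ _] [dL _ _]] := (zK, zL).
rewrite half => e.
have [eq eb] := conductor_comparison (ltnW q11) (ltnW q21)
  (gamma_factor_comparison g1 q11 g2 q21 (dK _ half1) (dL _ half1) f1 f2 nK nL e).
(* The parity flag determines the value at -1, so equal conductors and flags give equal
   discriminants chi(-1) q. *)
have sgn q chi : gauss_char q chi -> (1 < q)%N -> chi q.-1 = if chi q.-1 == -1 then -1 else 1.
  move=> g qg; have [|->|->] := gauss_char_cases (n := q.-1) g; rewrite ?eqxx//.
  by rewrite coprimePn// ltnW.
have em : m1 = m2.
  by apply: disc_inj => //; rewrite -c1 -c2 (sgn _ _ g1)// (sgn _ _ g2)// eb eq.
apply: hKL; rewrite eK eL; apply/seteqP; split; apply: (@quadratic_set_eq R m1) => //; by rewrite em.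
Qed.
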